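(* Let $g\in VMOA$ and consider $I_g$ acting on $H^2$. Let $\alpha\in[0,1)$ and $\beta\geq0$ be such that $\alpha>0$ or $\beta>0$. Then $$s_n(I_g)\asymp\frac{1}{n^\alpha\log^\beta(n+1)}\iff\tau_n(\nu_g)\asymp\frac{1}{n^{2\alpha}\log^{2\beta}(n+1)}.$$
   Context: For sequences, $A_n\asymp B_n$ means that there are constants $c,C>0$ independent of $n$ with $cB_n\leq A_n\leq CB_n$ for all $n\geq1$. $\mathbb{D}$ is the open unit disc, $\mathbb{T}$ the unit circle, and $m$ is normalized Lebesgue (area) measure on $\mathbb{D}$. $H^2$ is the Hardy space of analytic functions $f$ on $\mathbb{D}$ with $\|f\|_{H^2}^2=\sup_{0<r<1}\int_0^{2\pi}|f(re^{i\theta})|^2\frac{d\theta}{2\pi}<\infty$. For $g$ analytic on $\mathbb{D}$, the integration operator is $I_gf(z)=\int_0^zf(\zeta)g'(\zeta)\,d\zeta$. $VMOA$ is the set of $g\in H^2$ with $\lim_{|w|\to1^-}\|g\circ\varphi_w-g(w)\|_{H^2}=0$, where $\varphi_w(z)=\frac{w-z}{1-\bar wz}$; for such $g$ the operator $I_g$ is compact on $H^2$. The singular values of a compact operator $T$ are $s_n(T)=\inf\{\|T-R\|:\operatorname{rank}R<n\}$, $n\geq1$. For an arc $I\subset\mathbb{T}$ of length $|I|$, the Carleson window is $W(I)=\{z\in\mathbb{D}:1-|z|\leq|I|/2\pi,\ z/|z|\in I\}$. The dyadic arcs are $I_{n,k}=\{e^{i\theta}:2\pi k/2^n\leq\theta<2\pi(k+1)/2^n\}$,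 $n\geq1$, $1\leq k\leq2^n$. Let $d\nu_g(z)=|g'(z)|^2(1-|z|^2)dm(z)$. One has $g\in VMOA$ iff $\lim_{n\to\infty}\sup_{1\leq k\leq2^n}\nu_g(W(I_{n,k}))/|I_{n,k}|=0$, and for such $g$, $(\tau_n(\nu_g))_{n\geq1}$ denotes the nonincreasing rearrangement of the family $\left(\nu_g(W(I_{n,k}))/|I_{n,k}|\right)_{n,k}$ (the $n$-th largest value, counted with multiplicity). *)

(* Defs.v *)
From HB Require Import structures.
From mathcomp Require Import all_boot all_order all_algebra.
From mathcomp Require Import complex ring lra.
From mathcomp Require Import all_classical all_reals all_analysis.
From mathcomp Require Import measurable_realfun.

Set Implicit Arguments.
Unset Strict Implicit.
Unset Printing Implicit Defensive.

Import Order.TTheory GRing.Theory Num.Theory.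
Import numFieldNormedType.Exports.
Import ComplexField.Normc.

Local Open Scope classical_set_scope.
Local Open Scope ring_scope.
Local Open Scope complex_scope.

Section HardyNorm.
Variable R : realType.
Local Notation C := R[i].
Implicit Types (f g : C -> C) (z w : C).

Definition disc : set C := [set z | normc z < 1].

(* Differentiability over the field R[i], i.e. complex differentiability; the
   regular module [C^o] carries the topology of R[i]. *)
Definition holomorphic_disc f :=
  forall z, disc z -> derivable (f : C^o -> C^o) z 1.

Definition circle (r t : R) : C := (r * cos t) +i* (r * sin t).

Definition circle_mean2 f (r : R) : \bar R :=
  ((2 * pi)^-1)%:E *
  (\int[lebesgue_measure]_(t in `[0%R, (2 * pi)%R])
     (normc (f (circle r t)) ^+ 2)%:E).

Definition h2norm f : \bar R :=
  sqrte (ereal_sup [set circle_mean2 f r | r in `]0, 1[]).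

Definition hardy2 f := holomorphic_disc f /\ (h2norm f < +oo)%E.

(* A function on the disc is represented by its extension by zero, so that
   Leibniz equality on the subtype is equality on the disc. *)
Definition hardy2_pred : {pred C -> C} :=
  fun f => `[< hardy2 f /\ forall z, ~ disc z -> f z = 0 >].

Lemma normc_cts (z : C^o) : {for z, continuous (@normc R : C^o -> R)}.
Proof.
apply/(@cvgrPdist_lt _ _ _ _ (nbhs_filter z)) => e e0.
have zE : \forall w \near (z : C^o), `|(z : C^o) - w| < e%:C.
  have eC : 0 < e%:C by rewrite ltcR.
  exact: (proj1 (@cvgrPdist_lt _ _ _ _ (nbhs_filter z) id z) cvg_id _ eC).
apply: (@filterS _ _ (nbhs_filter (z : C^o)) _ _ _ zE) => w; rewrite normc_def ltcR => zw.
apply: le_lt_trans zw; rewrite ler_norml; apply/andP; split.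
  rewrite lerNl opprB lerBlDr.
  have := @le_normcD R (w - z) z; rewrite subrK => /le_trans; apply.
  by rewrite -(normcN (w - z)) opprB; case: (z - w).
rewrite lerBlDr.
have := @le_normcD R (z - w) w; rewrite subrK => /le_trans; apply.
by case: (z - w).
Qed.

Lemma normc_le_Re_Im (a b : R) : normc (a +i* b) <= `|a| + `|b|.
Proof.
rewrite /normc -[leRHS]ger0_norm ?addr_ge0// -sqrtr_sqr ler_wsqrtr//.
rewrite sqrrD !real_normK ?num_real// lerD2r lerDl.
by rewrite mulrn_wge0// mulr_ge0.
Qed.

Lemma circle_cts (r t : R) : {for t, continuous (circle r : R -> C^o)}.
Proof.
apply/cvgrPdist_lt => e; rewrite ltcE/= => /andP[/eqP Ime Ree].
have -> : e = (complex.Re e)%:C by apply/eqP; rewrite eq_complex /= Ime !eqxx.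
set d := complex.Re e in Ree *.
have cc : {for t, continuous (fun x => r * cos x)}.
  by apply: cvgMr => //; exact: continuous_cos.
have cs : {for t, continuous (fun x => r * sin x)}.
  by apply: cvgMr => //; exact: continuous_sin.
have d2 : 0 < d / 2 by rewrite divr_gt0.
move/cvgrPdist_lt/(_ _ d2) : cc => cc; move/cvgrPdist_lt/(_ _ d2) : cs => cs.
near=> x.
rewrite normc_def ltcR; apply: le_lt_trans (normc_le_Re_Im _ _) _.
by rewrite [d]splitr ltrD//; near: x.
Unshelve. all: by end_near. Qed.

Lemma normc_circle (r t : R) : 0 <= r -> normc (circle r t) = r.
Proof.
by move=> r0; rewrite /= !exprMn -mulrDr cos2Dsin2 mulr1 sqrtr_sqr ger0_norm.
Qed.


Lemma measurable_circle_mean2 f (r : R) : holomorphic_disc f -> 0 < r < 1 ->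
  measurable_fun [set` `[0%R, 2 * pi]]
    (fun t => (normc (f (circle r t)) ^+ 2)%:E : \bar R).
Proof.
move=> hf /andP[r0 r1].
have fc : continuous (fun t => normc (f (circle r t))).
  move=> t; apply: (@continuous_comp _ C^o _ (f \o circle r) (@normc R)).
    apply: (@continuous_comp _ C^o C^o (circle r) f).
      exact: circle_cts.
    apply: (@differentiable_continuous C C^o C^o).
    by apply/derivable1_diffP; apply: hf; rewrite /disc /mkset normc_circle// ltW.
  exact: normc_cts.
apply/measurable_EFinP/measurable_funX; apply: measurable_funTS.
exact: measurable_realfun.continuous_measurable_fun.
Qed.

Lemma circle_mean2_ge0 f r : (0 <= circle_mean2 f r)%E.
Proof.
apply: mule_ge0; first by rewrite lee_fin invr_ge0 mulr_ge0// pi_ge0.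
by apply: integral_ge0 => t _; rewrite lee_fin sqr_ge0.
Qed.

Lemma circle_mean2_linear f g (c : C) (r : R) :
  holomorphic_disc f -> holomorphic_disc g -> holomorphic_disc (c *: f + g) ->
  0 < r < 1 ->
  (circle_mean2 (c *: f + g)%R r <=
   (2 * normc c ^+ 2)%:E * circle_mean2 f r + 2%:E * circle_mean2 g r)%E.
Proof.
move=> hf hg hfg r01; rewrite /circle_mean2.
have p0 : 0 <= (2 * pi)^-1 :> R by rewrite invr_ge0 mulr_ge0// pi_ge0.
have mf := measurable_circle_mean2 hf r01.
have mg := measurable_circle_mean2 hg r01.
have mfg := measurable_circle_mean2 hfg r01.
have k0 : 0 <= 2 * normc c ^+ 2 by rewrite mulr_ge0// sqr_ge0.
rewrite (muleCA (2 * normc c ^+ 2)%:E) (muleCA 2%:E) -muleDr//; last first.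
  by rewrite ge0_adde_def// inE mule_ge0 ?lee_fin//; apply: integral_ge0 => t _;
     rewrite lee_fin sqr_ge0.
apply: lee_wpmul2l; rewrite ?lee_fin//.
rewrite -!ge0_integralZl_EFin//; do ?by move=> t _; rewrite lee_fin sqr_ge0.
rewrite -ge0_integralD//.
- apply: ge0_le_integral => //.
  + by move=> t _; rewrite lee_fin sqr_ge0.
  + by apply: emeasurable_funD; apply: measurable_funeM.
  + move=> t _; rewrite -!EFinM -EFinD lee_fin.
    set z := circle r t; rewrite [(_ + _) z]/=.
    have : normc (c * f z + g z) <= normc c * normc (f z) + normc (g z).
      by rewrite -normcM; exact: le_normcD.
    have n0 w : 0 <= normc w by case: w => a b; exact: sqrtr_ge0.
    set u := normc (c * f z + g z) => uvw.
    have u2 : u ^+ 2 <= (normc c * normc (f z) + normc (g z)) ^+ 2.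
      by rewrite lerXn2r// nnegrE ?addr_ge0 ?mulr_ge0 ?n0.
    apply: le_trans u2 _; rewrite -mulrA -exprMn.
    set a := (normc c * normc (f z)); set b := normc (g z).
    by have := sqr_ge0 (a - b); rewrite sqrrB sqrrD; lra.
- by move=> t _; rewrite mule_ge0 ?lee_fin// sqr_ge0.
- exact: measurable_funeM.
- by move=> t _; rewrite mule_ge0 ?lee_fin// sqr_ge0.
- exact: measurable_funeM.
Qed.

Lemma h2norm_lty f :
  (h2norm f < +oo)%E = (ereal_sup [set circle_mean2 f r | r in `]0%R, 1%R[] < +oo)%E.
Proof.
have h0 : (0 <= ereal_sup [set circle_mean2 f r | r in `]0%R, 1%R[])%E.
  apply: le_trans (circle_mean2_ge0 f 2^-1) _; apply: ereal_sup_ubound.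
  by exists 2^-1 => //=; rewrite in_itv/= invr_gt0 ltr0n invf_lt1 ?ltr1n.
have := sqrte_fin_num h0.
by rewrite !ge0_fin_numE// sqrte_ge0.
Qed.

Lemma hardy2_submod : GRing.submod_closed hardy2_pred.
Proof.
split.
  apply/asboolP; split=> //; split.
    by move=> z _; exact: (@derivable_cst C C^o C^o).
  rewrite h2norm_lty; apply: (@le_lt_trans _ _ 0%E); last exact: ltry.
  apply: ge_ereal_sup => _ [r _ <-]; rewrite /circle_mean2.
  rewrite integral0_eq ?mule0// => t _.
  by rewrite -[LHS]/((normc (0 : C) ^+ 2)%:E) normc0 expr0n.
move=> c f g /asboolP[[hf nf] f0] /asboolP[[hg ng] g0]; apply/asboolP.
have hfg : holomorphic_disc (c *: f + g).
  move=> z Dz; apply: (@derivableD C C^o C^o (c *: (f : C^o -> C^o)) g).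
    by apply: derivableZ; exact: hf.
  exact: hg.
split; last first.
  by move=> z Dz; rewrite [LHS]/= -[LHS]/(c * f z + g z) f0// g0// mulr0 addr0.
split=> //; rewrite !h2norm_lty in nf ng *.
have k0 : 0 <= 2 * normc c ^+ 2 by rewrite mulr_ge0// sqr_ge0.
set Sf := ereal_sup _ in nf; set Sg := ereal_sup _ in ng.
apply: (@le_lt_trans _ _ ((2 * normc c ^+ 2)%:E * Sf + 2%:E * Sg)%E).
  apply: ge_ereal_sup => _ [r r01 <-].
  have r01' : 0 < r < 1 by move: r01; rewrite /= in_itv.
  apply: (le_trans (circle_mean2_linear hf hg hfg r01')).
  have fS : (circle_mean2 f r <= Sf)%E by apply: ereal_sup_ubound; exists r.
  have gS : (circle_mean2 g r <= Sg)%E by apply: ereal_sup_ubound; exists r.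
  by apply: leeD; apply: lee_wpmul2l => //; rewrite lee_fin.
apply: lte_add_pinfty.
  by apply: lte_mul_pinfty => //; rewrite lee_fin.
by apply: lte_mul_pinfty => //; rewrite lee_fin.
Qed.

HB.instance Definition _ :=
  GRing.isSubmodClosed.Build C (C -> C) hardy2_pred hardy2_submod.

Record H2 := MkH2 { h2fun :> C -> C; h2funP : h2fun \in hardy2_pred }.

HB.instance Definition _ := [isSub for h2fun].
HB.instance Definition _ := [Choice of H2 by <:].
HB.instance Definition _ := [SubChoice_isSubLmodule of H2 by <:].

End HardyNorm.

Section Operators.
Variable R : realType.
Local Notation C := R[i].

Definition opnorm (T : H2 R -> (C -> C)) : \bar R :=
  ereal_sup [set h2norm (T f) | f in [set f : H2 R | (h2norm f <= 1)%E]].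

Definition rank_lt (S : H2 R -> H2 R) (n : nat) : Prop :=
  exists2 v : seq (H2 R), (size v < n)%N &
    forall f, exists c : nat -> C, S f = \sum_(i < size v) c i *: v`_i.

Definition bounded_rank_lt (n : nat) : set {linear H2 R -> H2 R} :=
  [set S : {linear H2 R -> H2 R} | (opnorm (fun f => S f) < +oo)%E /\ rank_lt S n].

(* [T] is allowed to take values in arbitrary functions: [h2norm] is
   [+oo]-valued, so no proof that [T] maps H^2 to itself is needed here. *)
Definition singular_value (T : H2 R -> (C -> C)) (n : nat) : \bar R :=
  ereal_inf [set opnorm (fun f z => T f z - S f z)%R | S in bounded_rank_lt n].

(* Integral of [h] along the straight segment from 0 to [z]. *)
Definition segment_integral (h : C -> C) (z : C) : C :=
  (\int[lebesgue_measure]_(t in `[0%R, 1%R]) complex.Re (h (t%:C * z) * z)) +i*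
  (\int[lebesgue_measure]_(t in `[0%R, 1%R]) complex.Im (h (t%:C * z) * z)).

Definition cderiv (g : C -> C) : C -> C := derive1 (g : C -> C^o).

Definition integration_op (g : C -> C) (f : H2 R) : C -> C :=
  segment_integral (fun u => f u * cderiv g u).

Definition disc_aut (w z : C) : C := (w - z) / (1 - conjc w * z).

Definition vmoa (g : C -> C) : Prop :=
  hardy2 g /\
  forall e : R, 0 < e -> \forall r \near 1^'-, forall w : C, normc w = r ->
    (h2norm (fun z => g (disc_aut w z) - g w)%R < e%:E)%E.

End Operators.

Section CarlesonWindows.
Variable R : realType.
Local Notation C := R[i].

Definition arc_length (I : set C) : R :=
  fine (lebesgue_measure [set t : R | 0 <= t < 2 * pi /\ I (circle 1 t)]).

Definition carleson_window (I : set C) : set C :=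
  [set z | [/\ disc z, 1 - normc z <= arc_length I / (2 * pi)
             & I (z / (normc z)%:C)]].

Definition dyadic_arc (n k : nat) : set C :=
  [set circle 1 t | t in
     [set t : R | 2 * pi * k%:R / 2 ^+ n <= t < 2 * pi * k.+1%:R / 2 ^+ n]].

(* The factor 1/pi normalizes planar Lebesgue measure on the disc. *)
Definition nu (g : C -> C) (A : set C) : \bar R :=
  (pi^-1)%:E *
  (\int[(@lebesgue_measure R \x @lebesgue_measure R)%E]_(p in
       [set p : R * R | disc (p.1 +i* p.2) /\ A (p.1 +i* p.2)])
     (normc (cderiv g (p.1 +i* p.2)) ^+ 2
      * (1 - normc (p.1 +i* p.2) ^+ 2))%:E).

(* Nonincreasing rearrangement of the nonnegative family (a i)_{i in D}: the
   n-th largest value, counted with multiplicity, for n >= 1. *)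
Definition rearrangement (I : Type) (D : set I) (a : I -> \bar R) (n : nat) :
    \bar R :=
  ereal_inf [set s : \bar R | (0 <= s)%E /\
                              ([set i | D i /\ (s < a i)%E] #<= `I_n.-1)%card].

Definition dyadic_index : set (nat * nat) :=
  [set p | (1 <= p.1)%N /\ (1 <= p.2 <= 2 ^ p.1)%N].

Definition tau (g : C -> C) (n : nat) : \bar R :=
  rearrangement dyadic_index
    (fun p => nu g (carleson_window (dyadic_arc p.1 p.2)) *
              ((arc_length (dyadic_arc p.1 p.2))^-1)%:E)%E n.

End CarlesonWindows.

Definition asymp (R : realType) (A B : nat -> \bar R) : Prop :=
  exists c K : R, [/\ 0 < c, 0 < K &
    forall n : nat, (1 <= n)%N ->
      (c%:E * B n <= A n)%E /\ (A n <= K%:E * B n)%E].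

(* Main.v *)
(* For a dyadic arc I let a_I = nu_g(W(I)) / |I| and s_j = s_j(I_g). By the
   Littlewood-Paley identity |I_g f|^2 is comparable to the integral of |f|^2
   against nu_g.

   Upper bound. Let B_j be the set of arcs with a_I > tau_(2^j). Ask f to vanish,
   at a fixed number of points of the upper half of W(I), to an order equal to
   the number of j <= k with I in B_j. These are O(2^k) linear conditions and, by
   the Schwarz lemma and the Carleson embedding theorem,
     s_(C 2^k)^2 <= C sum_(j <= k) 16^(j-k) tau_(2^j).

   Lower bound. Normalized kernels concentrated on the windows W(I) form an
   orthonormal system. Telescoping operators of rank less than 2^j that are
   s_(2^j)-close to I_g, a Hilbert-Schmidt estimate gives
     tau_(2^k)^(1/2) <= C sum_(j <= k) 2^((j-k)/2) s_(2^j),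
   enough for alpha < 1/2. For larger alpha a trace estimate for the masses of
   the upper halves of the W(I) has the kernel 2^(j-k), and W(I) is recovered by
   summing over the descendants of I with the subadditive power t^r, where
   r = 1 / (2 alpha + 1/2).

   The profiles n^(-alpha) log^(-beta)(n+1) decay more slowly along n = 2^k than
   these kernels. Hence upper bounds pass through the inequalities, and lower
   bounds pass back: the terms with j far from k are negligible by the upper
   bound, and the rest is controlled by monotonicity. *)
Require Import Defs.
From HB Require Import structures.
From mathcomp Require Import finmap.
From mathcomp Require Import all_boot all_order all_algebra.
From mathcomp Require Import complex ring lra zify.
From mathcomp Require Import all_classical all_reals all_analysis.
From mathcomp Require Import measurable_realfun.

Set Implicit Arguments.
Unset Strict Implicit.
Unset Printing Implicit Defensive.

Import Order.TTheory GRing.Theory Num.Theory.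
Import numFieldNormedType.Exports.
Import ComplexField.Normc.

Local Open Scope classical_set_scope.
Local Open Scope ring_scope.
Local Open Scope complex_scope.

Arguments normc : simpl never.

(** The trace estimate is confined to the upper halves, called boxes below, because it needs
    seminorms whose squares sum to O(|f|^2). Energies over disjoint boxes have this property;
    energies over nested windows do not. The way back to windows costs 2^t descendants in generation
    t. The scale of the descendants gains 2^(-r t) and the profile, raised to the power 2 r, gains
    2^(-2 alpha r t), so the sum converges when r (1 + 2 alpha) > 1. The kernel 2^(j-k) preserves
    the same power of the profile when 2 alpha r < 1. The value of r lies between these two
    constraints. The number 16 in the upper bound is the square of 4 = (1/2) / (1/8): boxes are
    covered by small discs on which f is controlled at relative radius 1/2 and estimated at relative
    radius 1/8. An arc heavy enough to occur in many of the lists B_j needs correspondingly more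
    damping, whence the varying order of vanishing. Approximants of I_g exist only strictly above
    the singular values, so every inequality is applied to strict majorants. The constants of the
    transfer lemmas are therefore fixed before the sequences. *)

Ltac nonneg := repeat first
  [ done | exact: pi_ge0 | exact: normr_ge0 | exact: sqr_ge0 | exact: sqrtr_ge0
  | apply: ltW; done | apply: mulr_ge0 | apply: addr_ge0 | apply: divr_ge0
  | apply: exprn_ge0 | rewrite invr_ge0 ].

Lemma le_of_eq d (T : porderType d) (x y : T) : x = y -> (x <= y)%O.
Proof. by move=> ->. Qed.

(** * Contour integrals and Goursat's lemma *)

Section ComplexIntegral.
Variable R : realType.
Local Notation C := R[i].
Local Notation mu := (@lebesgue_measure R).
Implicit Types (f g h : C -> C) (z w c : C) (p q : R -> C) (u v : R -> R).

Lemma normc_ge0 z : 0 <= normc z.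
Proof. by case: z => a b; exact: sqrtr_ge0. Qed.

Lemma normcD_le z w (x : R) : normc z + normc w <= x -> normc (z + w) <= x.
Proof. exact: le_trans (le_normcD _ _). Qed.

Lemma normcB z w : normc (z - w) = normc (w - z).
Proof. by rewrite -normcN opprB. Qed.

Lemma ler_normcB z w : normc z - normc w <= normc (z - w).
Proof. by rewrite lerBlDr; have := le_normcD (z - w) w; rewrite subrK. Qed.

Lemma normc_gt0 z : z != 0 -> 0 < normc z.
Proof.
by move=> z0; rewrite lt_def normc_ge0 andbT; apply: contraNneq z0 => /eq0_normc->.
Qed.

Lemma normcX z n : normc (z ^+ n) = normc z ^+ n.
Proof. by elim: n => [|n IH]; rewrite ?expr0 ?normc1// !exprS normcM IH. Qed.

Lemma normcR (x : R) : normc x%:C = `|x|.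
Proof. by rewrite /normc/= expr0n/= addr0 sqrtr_sqr. Qed.

Lemma normc_sum I (r : seq I) (P : pred I) (F : I -> C) :
  normc (\sum_(i <- r | P i) F i) <= \sum_(i <- r | P i) normc (F i).
Proof.
elim/big_ind2 : _ => [|x1 x2 y1 y2 h1 h2|//]; first by rewrite normc0.
by apply: normcD_le; exact: lerD.
Qed.

Lemma Re_le_normc z : `|complex.Re z| <= normc z.
Proof.
case: z => a b; rewrite /normc/= -sqrtr_sqr ler_wsqrtr// lerDl; exact: sqr_ge0.
Qed.

Lemma Im_le_normc z : `|complex.Im z| <= normc z.
Proof.
case: z => a b; rewrite /normc/= -sqrtr_sqr ler_wsqrtr// lerDr; exact: sqr_ge0.
Qed.

Lemma normc_le_ReIm z : normc z <= `|complex.Re z| + `|complex.Im z|.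
Proof. by case: z => a b; exact: normc_le_Re_Im. Qed.

Lemma normc2 z : normc z ^+ 2 = complex.Re z ^+ 2 + complex.Im z ^+ 2.
Proof. by case: z => a b; rewrite /normc/= sqr_sqrtr// addr_ge0// sqr_ge0. Qed.

Lemma mulcJ z : z * conjc z = (normc z ^+ 2)%:C.
Proof.
case: z => a b; rewrite normc2; apply/eqP; rewrite eq_complex/=.
by apply/andP; split; apply/eqP; ring.
Qed.

Lemma normc_conj z : normc (conjc z) = normc z.
Proof. by case: z => a b; rewrite /normc/= sqrrN. Qed.

Lemma ReM z w : complex.Re (z * w) =
  complex.Re z * complex.Re w - complex.Im z * complex.Im w.
Proof. by case: z w => a b [c d]. Qed.

Lemma ImM z w : complex.Im (z * w) =
  complex.Re z * complex.Im w + complex.Im z * complex.Re w.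
Proof. by case: z w => a b [c d]. Qed.

Lemma ReD z w : complex.Re (z + w) = complex.Re z + complex.Re w.
Proof. by case: z w => a b [c d]. Qed.

Lemma ImD z w : complex.Im (z + w) = complex.Im z + complex.Im w.
Proof. by case: z w => a b [c d]. Qed.

Lemma ReN z : complex.Re (- z) = - complex.Re z.
Proof. by case: z. Qed.

Lemma ImN z : complex.Im (- z) = - complex.Im z.
Proof. by case: z. Qed.

Lemma Re_sum I (r : seq I) (P : pred I) (F : I -> C) :
  complex.Re (\sum_(i <- r | P i) F i) = \sum_(i <- r | P i) complex.Re (F i).
Proof. by elim/big_rec2 : _ => // i x y _ <-; rewrite ReD. Qed.

Lemma Im_sum I (r : seq I) (P : pred I) (F : I -> C) :
  complex.Im (\sum_(i <- r | P i) F i) = \sum_(i <- r | P i) complex.Im (F i).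
Proof. by elim/big_rec2 : _ => // i x y _ <-; rewrite ImD. Qed.

Lemma complex_eq z w : complex.Re z = complex.Re w ->
  complex.Im z = complex.Im w -> z = w.
Proof. by case: z w => a b [c d] /= -> ->. Qed.

(** Continuity and differentiability are restated with real tolerances and the real modulus [normc],
    so that estimates stay in R. The derivative is a first-order expansion, without a quotient. *)
Definition ccont f z := forall e : R, 0 < e -> exists2 d : R, 0 < d &
  forall w, normc (w - z) < d -> normc (f w - f z) < e.

Definition rcont p (x : R) := forall e : R, 0 < e -> exists2 d : R, 0 < d &
  forall y, `|y - x| < d -> normc (p y - p x) < e.

Definition rconti p (a b : R) := forall x, a <= x <= b -> rcont p x.

Definition cderive f z (D : C) := forall e : R, 0 < e -> exists2 d : R, 0 < d &
  forall w, normc (w - z) < d ->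
    normc (f w - f z - D * (w - z)) <= e * normc (w - z).

Lemma rcont_continuous p x : rcont p x ->
  [/\ {for x, continuous (fun t => complex.Re (p t))},
      {for x, continuous (fun t => complex.Im (p t))} &
      {for x, continuous (fun t => normc (p t))}].
Proof.
have H u : (forall y, `|u y - u x| <= normc (p y - p x)) ->
    rcont p x -> {for x, continuous u}.
  move=> hu px; apply/cvgrPdist_lt => e /px[d d0 hd].
  near=> y; rewrite distrC; apply: le_lt_trans (hu y) _; apply: hd.
  near: y; exists d => //= y; rewrite /ball_ /=; by rewrite distrC.
move=> px; split; apply: H => // y.
- by have := Re_le_normc (p y - p x); rewrite ReD ReN.
- by have := Im_le_normc (p y - p x); rewrite ImD ImN.
- rewrite ler_norml ler_normcB andbT lerNl opprB normcB.
  exact: ler_normcB.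
Unshelve. all: by end_near. Qed.

Lemma continuous_rcont p x : {for x, continuous (fun t => complex.Re (p t))} ->
  {for x, continuous (fun t => complex.Im (p t))} -> rcont p x.
Proof.
move=> /cvgrPdist_lt pr /cvgrPdist_lt pim e e0.
have e2 : 0 < e / 2 by rewrite divr_gt0.
have [d /= d0 hd] : \forall y \near x, normc (p y - p x) < e.
  near=> y; apply: le_lt_trans (normc_le_ReIm _) _.
  rewrite [e]splitr ltrD// ?ReD ?ReN ?ImD ?ImN distrC.
    by near: y; exact: pr.
  by near: y; exact: pim.
exists d => // y yx; apply: hd; by rewrite /ball_ /= distrC.
Unshelve. all: by end_near. Qed.

Lemma rcont_comp f p x : ccont f (p x) -> rcont p x -> rcont (fun t => f (p t)) x.
Proof.
move=> hf hp e /hf[d /hp[d' d'0 H] h]; exists d' => // y /H; exact: h.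
Qed.

Lemma ccont_comp f g z : ccont f (g z) -> ccont g z -> ccont (fun t => f (g t)) z.
Proof.
move=> hf hp e /hf[d /hp[d' d'0 H] h]; exists d' => // y /H; exact: h.
Qed.

Lemma cderive_ccont f z D : cderive f z D -> ccont f z.
Proof.
move=> hf e e0; have [d d0 hd] := hf 1 ltr01.
have D1 : 0 < 1 + normc D by rewrite ltr_wpDr// normc_ge0.
exists (Num.min d (e / (1 + normc D))).
  by rewrite lt_min d0 divr_gt0.
move=> w; rewrite lt_min => /andP[/hd]; rewrite mul1r => h1 h2.
have -> : f w - f z = (f w - f z - D * (w - z)) + D * (w - z) by ring.
apply: le_lt_trans (le_normcD _ _) _; rewrite normcM.
by move: h2; rewrite ltr_pdivlMr// mulrDr mulr1 mulrC; apply: le_lt_trans; lra.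
Qed.

Lemma rcont_cst c x : rcont (fun=> c) x.
Proof. by move=> e e0; exists 1 => // y _; rewrite subrr normc0. Qed.

Lemma rcontD p q x : rcont p x -> rcont q x -> rcont (fun t => p t + q t) x.
Proof.
move=> hp hq e e0; have e2 : 0 < e / 2 by rewrite divr_gt0.
have [d1 d10 h1] := hp _ e2; have [d2 d20 h2] := hq _ e2.
exists (Num.min d1 d2); first by rewrite lt_min d10.
move=> y; rewrite lt_min => /andP[/h1 ? /h2 ?].
have -> : p y + q y - (p x + q x) = (p y - p x) + (q y - q x) by ring.
by apply: le_lt_trans (le_normcD _ _) _; rewrite [e]splitr ltrD.
Qed.

Lemma ccont_id z : ccont id z.
Proof. by move=> e e0; exists e. Qed.

Lemma ccont_cst c z : ccont (fun=> c) z.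
Proof. by move=> e e0; exists 1 => // y _; rewrite subrr normc0. Qed.

Lemma ccontD f g z : ccont f z -> ccont g z -> ccont (fun t => f t + g t) z.
Proof.
move=> hp hq e e0; have e2 : 0 < e / 2 by rewrite divr_gt0.
have [d1 d10 h1] := hp _ e2; have [d2 d20 h2] := hq _ e2.
exists (Num.min d1 d2); first by rewrite lt_min d10.
move=> y; rewrite lt_min => /andP[/h1 ? /h2 ?].
have -> : f y + g y - (f z + g z) = (f y - f z) + (g y - g z) by ring.
by apply: le_lt_trans (le_normcD _ _) _; rewrite [e]splitr ltrD.
Qed.

(** The modulus depends only on bounds for the two factors, so one estimate serves [rcontM] and
    [ccontM]. *)
Lemma mulc_cont_bound (e A B : R) : 0 < e -> 0 <= A -> 0 <= B ->
  exists2 d : R, 0 < d & forall a b a' b' : C, normc a <= A -> normc b <= B ->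
    normc (a' - a) < d -> normc (b' - b) < d -> normc (a' * b' - a * b) < e.
Proof.
move=> e0 A0 B0; exists (Num.min 1 (e / (A + B + 1))).
  by rewrite lt_min ltr01 divr_gt0// ltr_wpDl ?addr_ge0.
move=> a b a' b' aA bB; rewrite !lt_min => /andP[a1 ae] /andP[b1 be].
have -> : a' * b' - a * b = a * (b' - b) + (a' - a) * b + (a' - a) * (b' - b).
  by ring.
have hd : 0 < A + B + 1 by rewrite ltr_wpDl ?addr_ge0.
move: ae be; set x := normc (a' - a); set y := normc (b' - b).
rewrite !ltr_pdivlMr// => ae be.
apply: le_lt_trans (le_normcD _ _) _.
apply: (@le_lt_trans _ _ (A * y + x * B + x * y)).
  apply: lerD; last by rewrite normcM.
  apply: normcD_le; rewrite !normcM.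
  by apply: lerD; [apply: ler_wpM2r|apply: ler_wpM2l] => //; exact: normc_ge0.
have x0 : 0 <= x by exact: normc_ge0.
have y0 : 0 <= y by exact: normc_ge0.
pose m := Num.max x y.
have xm : x <= m by rewrite le_max lexx.
have ym : y <= m by rewrite le_max lexx orbT.
have y1 : y <= 1 by exact: ltW.
have me : m * (A + B + 1) < e by rewrite /m; case: (ltP x y).
apply: le_lt_trans me.
have : A * y <= A * m by exact: ler_wpM2l.
have : x * B <= m * B by exact: ler_wpM2r.
have : x * y <= m * 1 by apply: ler_pM.
lra.
Qed.

Lemma rcontM p q x : rcont p x -> rcont q x -> rcont (fun t => p t * q t) x.
Proof.
move=> hp hq e e0.
have [d d0 H] := mulc_cont_bound e0 (normc_ge0 (p x)) (normc_ge0 (q x)).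
have [d1 d10 h1] := hp _ d0; have [d2 d20 h2] := hq _ d0.
exists (Num.min d1 d2); first by rewrite lt_min d10.
by move=> y; rewrite lt_min => /andP[/h1 ? /h2 ?]; apply: H.
Qed.

Lemma ccontM f g z : ccont f z -> ccont g z -> ccont (fun t => f t * g t) z.
Proof.
move=> hp hq e e0.
have [d d0 H] := mulc_cont_bound e0 (normc_ge0 (f z)) (normc_ge0 (g z)).
have [d1 d10 h1] := hp _ d0; have [d2 d20 h2] := hq _ d0.
exists (Num.min d1 d2); first by rewrite lt_min d10.
by move=> y; rewrite lt_min => /andP[/h1 ? /h2 ?]; apply: H.
Qed.

Lemma ccontX f z n : ccont f z -> ccont (fun t => f t ^+ n) z.
Proof.
move=> hf; elim: n => [|n IH].
  by move=> e e0; exists 1 => // w _; rewrite !expr0 subrr normc0.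
move=> e e0; have [d d0 H] := ccontM hf IH e0.
by exists d => // w /H; rewrite !exprS.
Qed.

Lemma ccontV z : z != 0 -> ccont (fun t => t^-1) z.
Proof.
move=> z0 e e0; have n0 := normc_gt0 z0.
exists (Num.min (normc z / 2) (e * (normc z ^+ 2 / 2))).
  by rewrite lt_min divr_gt0//= mulr_gt0// divr_gt0// exprn_gt0.
move=> w; rewrite lt_min => /andP[w1 w2].
have wz : normc z / 2 < normc w.
  have := ler_normcB z (z - w); have -> : z - (z - w) = w by ring.
  by rewrite normcB; lra.
have w0 : w != 0.
  by apply: contraTneq wz => ->; rewrite normc0 -leNgt divr_ge0// ltW.
have -> : w^-1 - z^-1 = (z - w) / (w * z).
  by field; rewrite z0 w0.
rewrite normcM normcV normcM normcB ltr_pdivrMr; last first.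
  by rewrite mulr_gt0// (lt_trans _ wz)// divr_gt0.
apply: lt_le_trans w2 _; rewrite ler_pM2l// expr2 mulrAC ler_pM2r//.
exact: ltW.
Qed.

Lemma rcontX p x n : rcont p x -> rcont (fun t => p t ^+ n) x.
Proof.
by move=> hp; apply: (@rcont_comp (fun t => t ^+ n)) => //; exact/ccontX/ccont_id.
Qed.

Lemma rconti_conj p x : rcont p x -> rcont (fun t => conjc (p t)) x.
Proof.
move=> hp e /hp[d d0 H]; exists d => // y /H.
by case: (p y) (p x) => a b [c d']; rewrite /normc/= -opprD sqrrN.
Qed.

Definition cint (a b : R) p : C :=
  (\int[mu]_(t in `[a, b]) complex.Re (p t)) +i*
  (\int[mu]_(t in `[a, b]) complex.Im (p t)).

Lemma cont_integrable (a b : R) u :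
  (forall x, a <= x <= b -> {for x, continuous u}) ->
  mu.-integrable `[a, b] (EFin \o u).
Proof.
move=> hu; apply: continuous_compact_integrable; first exact: segment_compact.
by apply: continuous_in_subspaceT => x; rewrite inE/= in_itv/=; exact: hu.
Qed.

Lemma rconti_integrable p a b : rconti p a b ->
  [/\ mu.-integrable `[a, b] (EFin \o (fun t => complex.Re (p t))),
      mu.-integrable `[a, b] (EFin \o (fun t => complex.Im (p t))) &
      mu.-integrable `[a, b] (EFin \o (fun t => normc (p t)))].
Proof.
by move=> hp; split; apply: cont_integrable => x /hp/rcont_continuous[].
Qed.

Lemma eq_cint p q a b : (forall t, a <= t <= b -> p t = q t) ->
  cint a b p = cint a b q.
Proof.
move=> pq; congr (_ +i* _); apply: eq_Rintegral => t;
  by rewrite inE/= in_itv/= => /pq ->.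
Qed.

Lemma cintD p q a b : rconti p a b -> rconti q a b ->
  cint a b (fun t => p t + q t) = cint a b p + cint a b q.
Proof.
move=> /rconti_integrable[p1 p2 _] /rconti_integrable[q1 q2 _].
rewrite /cint; apply: complex_eq => /=; rewrite -RintegralD//;
  by apply: eq_Rintegral => t _; rewrite ?ReD ?ImD.
Qed.

Lemma cintZ c p a b : rconti p a b ->
  cint a b (fun t => c * p t) = c * cint a b p.
Proof.
move=> /rconti_integrable[p1 p2 _]; rewrite /cint.
have iz r u : mu.-integrable `[a, b] (EFin \o u) ->
    mu.-integrable `[a, b] (EFin \o (fun t => r * u t)).
  move=> iu; rewrite (_ : EFin \o _ = (fun t => r%:E * (EFin \o u) t)%E)//.
  exact: integrableZl.
apply: complex_eq; rewrite ?ReM ?ImM/= -!RintegralZl//.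
- rewrite -RintegralB//; do ?exact: iz.
  by apply: eq_Rintegral => t _; rewrite ReM.
- rewrite -RintegralD//; do ?exact: iz.
  by apply: eq_Rintegral => t _; rewrite ImM.
Qed.

Lemma rconti_cst c a b : rconti (fun=> c) a b.
Proof. by move=> x _; exact: rcont_cst. Qed.

Lemma rcontiZ c p a b : rconti p a b -> rconti (fun t => c * p t) a b.
Proof. by move=> hp x hx; apply: rcontM (hp _ hx); exact: rcont_cst. Qed.

Lemma rconti_sum n (F : nat -> R -> C) a b : (forall i, rconti (F i) a b) ->
  rconti (fun t => \sum_(i < n) F i t) a b.
Proof.
move=> hF; elim: n => [|n IH] x hx.
  move=> e e0; exists 1 => // y _; by rewrite !big_ord0 subrr normc0.
move=> e e0; have [d d0 H] := rcontD (IH _ hx) (hF n _ hx) e0.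
by exists d => // y /H; rewrite !big_ord_recr.
Qed.

Lemma cint0 a b : cint a b (fun=> 0) = 0.
Proof.
by rewrite /cint /Rintegral integral0_eq// integral0_eq.
Qed.

Lemma cint_sum n (F : nat -> R -> C) a b : (forall i, rconti (F i) a b) ->
  cint a b (fun t => \sum_(i < n) F i t) = \sum_(i < n) cint a b (F i).
Proof.
move=> hF; elim: n => [|n IH].
  by rewrite big_ord0 -[RHS](cint0 a b); apply: eq_cint => t _; rewrite big_ord0.
rewrite [RHS]big_ord_recr/= -IH -cintD//; last exact: rconti_sum.
by apply: eq_cint => t _; rewrite big_ord_recr.
Qed.

Lemma cintN p a b : rconti p a b -> cint a b (fun t => - p t) = - cint a b p.
Proof.
move=> hp; rewrite -mulN1r -cintZ//; apply: eq_cint => t _; by rewrite mulN1r.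
Qed.

Lemma cintB p q a b : rconti p a b -> rconti q a b ->
  cint a b (fun t => p t - q t) = cint a b p - cint a b q.
Proof.
move=> hp hq; rewrite -(cintN hq) -cintD// => x hx.
move=> e /(hq x hx)[d d0 H]; exists d => // y /H.
by rewrite -opprD normcN.
Qed.

Lemma cint_cst c a b : a <= b -> cint a b (fun=> c) = (b - a)%:C * c.
Proof.
move=> ab; rewrite /cint !Rintegral_cst//= lebesgue_measure_itv/=.
have [ab'|ba] := ltP a b; rewrite lte_fin.
  rewrite ab'/=; apply: complex_eq => /=; rewrite ?ReM ?ImM/=; ring.
have -> : a = b by apply/eqP; rewrite eq_le ab.
by rewrite ltxx/= subrr !mulr0 mul0r.
Qed.

Lemma Rint_cat u (a b c : R) : a <= b -> b <= c ->
  mu.-integrable `[a, c] (EFin \o u) ->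
  \int[mu]_(t in `[a, c]) u t =
  \int[mu]_(t in `[a, b]) u t + \int[mu]_(t in `[b, c]) u t.
Proof.
move=> ab bc iu; apply/eqP; rewrite addrC -subr_eq; apply/eqP.
rewrite (Rintegral_itvB iu); last 2 first.
  by rewrite bnd_simp.
  by rewrite bnd_simp.
apply: Rintegral_itv_obnd_cbnd.
apply: integrableS iu => //; apply: subset_itvr; by rewrite bnd_simp.
Qed.

Lemma cint_cat p (a b c : R) : a <= b -> b <= c -> rconti p a c ->
  cint a c p = cint a b p + cint b c p.
Proof.
move=> ab bc /rconti_integrable[p1 p2 _].
by apply: complex_eq => /=; exact: Rint_cat.
Qed.

(** Real and imaginary parts are bounded separately, whence the factor 2. *)
Lemma normc_cint p a b : rconti p a b ->
  normc (cint a b p) <= 2 * \int[mu]_(t in `[a, b]) normc (p t).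
Proof.
move=> /rconti_integrable[p1 p2 p3].
apply: le_trans (normc_le_ReIm _) _; rewrite mulr_natl mulr2n.
apply: lerD; apply: le_trans (le_normr_Rintegral _ _) _ => //.
  apply: le_Rintegral => //; last by move=> x _; exact: Re_le_normc.
  exact: integrable_norm p1.
apply: le_Rintegral => //; last by move=> x _; exact: Im_le_normc.
exact: integrable_norm p2.
Qed.

Lemma cint_bound p a b (M : R) : a <= b -> rconti p a b ->
  (forall t, a <= t <= b -> normc (p t) <= M) ->
  normc (cint a b p) <= 2 * (M * (b - a)).
Proof.
move=> ab hp hM; apply: le_trans (normc_cint hp) _.
rewrite ler_pM2l//; have [_ _ p3] := rconti_integrable hp.
have -> : M * (b - a) = \int[mu]_(t in `[a, b]) M.
  rewrite Rintegral_cst//=.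
  rewrite lebesgue_measure_itv/= lte_fin.
  move: ab; rewrite le_eqVlt => /predU1P[->|->]//.
  by rewrite ltxx subrr mulr0.
apply: le_Rintegral => //.
  by apply: cont_integrable => x _; exact: cvg_cst.
Qed.

End ComplexIntegral.

Section Goursat.
Variable R : realType.
Local Notation C := R[i].
Implicit Types (h : C -> C).

Lemma rcont_hline h (x y : R) : ccont h (x +i* y) -> rcont (fun t => h (t +i* y)) x.
Proof.
move=> hc e /hc[d d0 H]; exists d => // t tx; apply: H.
by rewrite /normc/= subrr expr0n/= addr0 sqrtr_sqr.
Qed.

Lemma rcont_vline h (x y : R) : ccont h (x +i* y) -> rcont (fun t => h (x +i* t)) y.
Proof.
move=> hc e /hc[d d0 H]; exists d => // t tx; apply: H.
by rewrite /normc/= subrr expr0n/= add0r sqrtr_sqr.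
Qed.

Lemma rcontB (p q : R -> C) x : rcont p x -> rcont q x -> rcont (fun t => p t - q t) x.
Proof.
move=> hp hq e e0; have e2 : 0 < e / 2 by rewrite divr_gt0.
have [d1 d10 h1] := hp _ e2; have [d2 d20 h2] := hq _ e2.
exists (Num.min d1 d2); first by rewrite lt_min d10.
move=> y; rewrite lt_min => /andP[/h1 ? /h2 ?].
have -> : p y - q y - (p x - q x) = (p y - p x) - (q y - q x) by ring.
by apply: le_lt_trans (le_normcD _ _) _; rewrite normcN [e]splitr ltrD.
Qed.

(* The integral of [h] along the boundary of [a, b] x [c, d], opposite sides
   being paired so that linear functions need no antiderivative. *)
Definition rect_int h (a b c d : R) : C :=
  cint a b (fun x => h (x +i* c) - h (x +i* d)) +
  'i * cint c d (fun y => h (b +i* y) - h (a +i* y)).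

Definition rect_cont h (a b c d : R) := forall x y, a <= x <= b -> c <= y <= d ->
  ccont h (x +i* y).

Lemma rect_cont_sub h (a b c d a' b' c' d' : R) : a <= a' -> b' <= b -> c <= c' ->
  d' <= d -> rect_cont h a b c d -> rect_cont h a' b' c' d'.
Proof.
move=> aa bb cc dd H x y /andP[x1 x2] /andP[y1 y2]; apply: H.
  by rewrite (le_trans aa)// (le_trans x2).
by rewrite (le_trans cc)// (le_trans y2).
Qed.

Lemma rect_rconti h (a b c d : R) : a <= b -> c <= d -> rect_cont h a b c d ->
  rconti (fun x => h (x +i* c) - h (x +i* d)) a b /\
  rconti (fun y => h (b +i* y) - h (a +i* y)) c d.
Proof.
move=> ab cd H; split=> [x hx|y hy]; apply: rcontB.
- by apply: rcont_hline; apply: H; rewrite ?lexx.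
- by apply: rcont_hline; apply: H; rewrite ?lexx ?cd.
- by apply: rcont_vline; apply: H; rewrite ?lexx ?ab.
- by apply: rcont_vline; apply: H; rewrite ?lexx ?ab.
Qed.

Lemma rect_int_vsplit h (a m b c d : R) : a <= m -> m <= b -> c <= d ->
  rect_cont h a b c d -> rect_int h a b c d = rect_int h a m c d + rect_int h m b c d.
Proof.
move=> am mb cd H; have ab := le_trans am mb.
have [h1 h2] := rect_rconti ab cd H.
have [k1 k2] := rect_rconti am cd (rect_cont_sub (lexx _) mb (lexx _) (lexx _) H).
have [l1 l2] := rect_rconti mb cd (rect_cont_sub am (lexx _) (lexx _) (lexx _) H).
rewrite /rect_int (cint_cat am mb h1).
rewrite (_ : cint c d (fun y => h (b +i* y) - h (a +i* y)) =
  cint c d (fun y => (h (b +i* y) - h (m +i* y)) + (h (m +i* y) - h (a +i* y)))).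
  rewrite (cintD l2 k2); ring.
by apply: eq_cint => t _; ring.
Qed.

Lemma rect_int_hsplit h (a b c m d : R) : a <= b -> c <= m -> m <= d ->
  rect_cont h a b c d -> rect_int h a b c d = rect_int h a b c m + rect_int h a b m d.
Proof.
move=> ab cm md H; have cd := le_trans cm md.
have [h1 h2] := rect_rconti ab cd H.
have [k1 k2] := rect_rconti ab cm (rect_cont_sub (lexx _) (lexx _) (lexx _) md H).
have [l1 l2] := rect_rconti ab md (rect_cont_sub (lexx _) (lexx _) cm (lexx _) H).
rewrite /rect_int (cint_cat cm md h2).
rewrite (_ : cint a b (fun x => h (x +i* c) - h (x +i* d)) =
  cint a b (fun y => (h (y +i* c) - h (y +i* m)) + (h (y +i* m) - h (y +i* d)))).
  rewrite (cintD k1 l1); ring.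
by apply: eq_cint => t _; ring.
Qed.

Lemma normc_i : normc 'i = 1 :> R.
Proof. by rewrite /normc/= expr0n/= add0r expr1n sqrtr1. Qed.

Lemma rect_int_bound h (a b c d M : R) : a <= b -> c <= d -> rect_cont h a b c d ->
  (forall x y, a <= x <= b -> c <= y <= d -> normc (h (x +i* y)) <= M) ->
  normc (rect_int h a b c d) <= 4 * (M * ((b - a) + (d - c))).
Proof.
move=> ab cd H hM; have [h1 h2] := rect_rconti ab cd H.
apply: normcD_le; rewrite normcM normc_i mul1r.
have B1 : normc (cint a b (fun x => h (x +i* c) - h (x +i* d))) <= 2 * ((2 * M) * (b - a)).
  apply: cint_bound => // t ht; apply: normcD_le.
  rewrite normcN; have := hM t c ht; have := hM t d ht; rewrite !lexx cd/= => /(_ isT) ? /(_ isT) ?.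
  lra.
have B2 : normc (cint c d (fun y => h (b +i* y) - h (a +i* y))) <= 2 * ((2 * M) * (d - c)).
  apply: cint_bound => // t ht; apply: normcD_le.
  rewrite normcN; have := hM a t; have := hM b t; rewrite !lexx ab/= ht => /(_ isT isT) ? /(_ isT isT) ?.
  lra.
apply: le_trans (lerD B1 B2) _; lra.
Qed.

(** For an affine function the differences across opposite sides are constant, and the contributions
    of the two pairs of sides cancel. *)
Lemma rect_int_linear h (al be : C) (a b c d : R) : a <= b -> c <= d ->
  rect_cont h a b c d ->
  rect_int h a b c d = rect_int (fun w => h w - (al + be * w)) a b c d.
Proof.
move=> ab cd H; have [h1 h2] := rect_rconti ab cd H.
rewrite /rect_int.
have -> : (fun x : R => h (x +i* c) - (al + be * (x +i* c)) -
    (h (x +i* d) - (al + be * (x +i* d)))) =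
  (fun x => h (x +i* c) - h (x +i* d) + - (be * (0 +i* (c - d)))).
  apply/funext => x.
  have -> : 0 +i* (c - d) = (x +i* c) - (x +i* d) by apply: complex_eq => /=; ring.
  ring.
have -> : (fun y : R => h (b +i* y) - (al + be * (b +i* y)) -
    (h (a +i* y) - (al + be * (a +i* y)))) =
  (fun y => h (b +i* y) - h (a +i* y) + - (be * ((b - a) +i* 0))).
  apply/funext => y.
  have -> : (b - a) +i* 0 = (b +i* y) - (a +i* y) by apply: complex_eq => /=; ring.
  ring.
rewrite (cintD h1 (@rconti_cst R _ a b)) (cintD h2 (@rconti_cst R _ c d)) !cint_cst//.
set A := cint _ _ _; set B := cint _ _ _.
have -> : 0 +i* (c - d) = - 'i * (d - c)%:C by apply: complex_eq; rewrite ?ReM ?ImM/=; ring.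
have -> : (b - a) +i* 0 = (b - a)%:C by [].
ring.
Qed.

Definition rect_hol h (a b c d : R) := forall x y, a <= x <= b -> c <= y <= d ->
  exists D, cderive h (x +i* y) D.

Lemma rect_hol_cont h a b c d : rect_hol h a b c d -> rect_cont h a b c d.
Proof. by move=> H x y hx hy; have [D] := H x y hx hy; exact: cderive_ccont. Qed.

(** If three quarters each carry less than a fourth of the integral, the triangle inequality leaves
    at least a fourth for the last one. *)
Lemma rect_int_quarter h (a b c d : R) : a <= b -> c <= d -> rect_cont h a b c d ->
  exists r : (R * R) * (R * R),
  [/\ a <= r.1.1, r.1.2 <= b, c <= r.2.1, r.2.2 <= d &
  [/\ r.1.2 - r.1.1 = (b - a) / 2, r.2.2 - r.2.1 = (d - c) / 2 &
   normc (rect_int h a b c d) <= 4 * normc (rect_int h r.1.1 r.1.2 r.2.1 r.2.2)]].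
Proof.
move=> ab cd H; pose m := (a + b) / 2; pose n := (c + d) / 2.
have am : a <= m by rewrite /m; lra.
have mb : m <= b by rewrite /m; lra.
have cn : c <= n by rewrite /n; lra.
have nd : n <= d by rewrite /n; lra.
have hm1 : m - a = (b - a) / 2 by rewrite /m; lra.
have hm2 : b - m = (b - a) / 2 by rewrite /m; lra.
have hn1 : n - c = (d - c) / 2 by rewrite /n; lra.
have hn2 : d - n = (d - c) / 2 by rewrite /n; lra.
have E := rect_int_vsplit am mb cd H.
have E1 := rect_int_hsplit am cn nd (rect_cont_sub (lexx _) mb (lexx _) (lexx _) H).
have E2 := rect_int_hsplit mb cn nd (rect_cont_sub am (lexx _) (lexx _) (lexx _) H).
rewrite E1 E2 in E; move: E.
set x1 := rect_int h a m c n; set x2 := rect_int h a m n d.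
set x3 := rect_int h m b c n; set x4 := rect_int h m b n d => E.
have T : normc (rect_int h a b c d) <= normc x1 + normc x2 + normc x3 + normc x4.
  rewrite E -(addrA (normc x1 + normc x2)).
  by apply: normcD_le; apply: lerD; exact: le_normcD.
have [h1|h1] := leP (normc (rect_int h a b c d)) (4 * normc x1).
  by exists ((a, m), (c, n)); split => //; split.
have [h2|h2] := leP (normc (rect_int h a b c d)) (4 * normc x2).
  by exists ((a, m), (n, d)); split => //; split.
have [h3|h3] := leP (normc (rect_int h a b c d)) (4 * normc x3).
  by exists ((m, b), (c, n)); split => //; split.
exists ((m, b), (n, d)); split => //; split; [exact: hm2|exact: hn2|].
change (normc (rect_int h a b c d) <= 4 * normc x4); move: T h1 h2 h3; clear.
move: (normc (rect_int h a b c d)) (normc x1) (normc x2) (normc x3) (normc x4) => {x1 x2 x3 x4}.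
by move=> *; lra.
Qed.

Lemma nested_point (u v : nat -> R) : (forall n, u n <= u n.+1) ->
  (forall n, v n.+1 <= v n) -> (forall n, u n <= v n) ->
  exists x, forall n, u n <= x <= v n.
Proof.
move=> hu hv huv.
have um : {homo u : m n / (m <= n)%N >-> m <= n} by exact: homo_leq le_trans hu.
have vm : {homo v : m n / (m <= n)%N >-> n <= m}.
  by apply: (homo_leq lexx) => // y x z xy yz; exact: le_trans yz xy.
have uv m n : u m <= v n.
  apply: le_trans (um _ _ (leq_maxl m n)) _.
  by apply: le_trans (huv _) _; apply: vm; exact: leq_maxr.
exists (sup (range u)) => n; apply/andP; split.
  apply: ub_le_sup; last by exists n.
  by exists (v 0%N) => _ [m _ <-]; exact: uv.
by apply: ge_sup; [exists (u 0%N), 0%N|move=> _ [m _ <-]; exact: uv].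
Qed.

Lemma goursat h (a b c d : R) : a <= b -> c <= d -> rect_hol h a b c d ->
  rect_int h a b c d = 0.
Proof.
move=> ab cd H.
pose ok (r : (R * R) * (R * R)) :=
  [/\ a <= r.1.1, r.1.2 <= b, c <= r.2.1, r.2.2 <= d & r.1.1 <= r.1.2 /\ r.2.1 <= r.2.2].
pose E (r : (R * R) * (R * R)) := normc (rect_int h r.1.1 r.1.2 r.2.1 r.2.2).
pose good (r r' : (R * R) * (R * R)) := [/\ r.1.1 <= r'.1.1, r'.1.2 <= r.1.2, r.2.1 <= r'.2.1, r'.2.2 <= r.2.2 &
  [/\ r'.1.2 - r'.1.1 = (r.1.2 - r.1.1) / 2, r'.2.2 - r'.2.1 = (r.2.2 - r.2.1) / 2 &
   E r <= 4 * E r']].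
have okc r : ok r -> rect_cont h r.1.1 r.1.2 r.2.1 r.2.2.
  case=> ? ? ? ? _; apply: rect_cont_sub (rect_hol_cont H) => //.
have step r : exists r', ok r -> good r r'.
  have [okr|nok] := pselect (ok r); last by exists r => /nok.
  have [_ _ _ _ [r1 r2]] := okr.
  by have [r' P] := rect_int_quarter r1 r2 (okc _ okr); exists r'.
have [nx hnx] := choice step.
pose s n := iter n nx ((a, b), (c, d)).
have s_ok n : ok (s n).
  elim: n => [|n IH]; first by split.
  have := hnx _ IH; rewrite -/(s n) -[nx (s n)]/(s n.+1).
  case: IH => i1 i2 i3 i4 [i5 i6] [j1 j2 j3 j4 [j5 j6 _]].
  split; [exact: le_trans j1|exact: le_trans i2|exact: le_trans j3|exact: le_trans i4|].
  by split; [rewrite -subr_ge0 j5 divr_ge0// subr_ge0|rewrite -subr_ge0 j6 divr_ge0// subr_ge0].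
have s_good n : good (s n) (s n.+1) by exact: hnx.
have sdim n : (s n).1.2 - (s n).1.1 = (b - a) / 2 ^+ n /\
    (s n).2.2 - (s n).2.1 = (d - c) / 2 ^+ n.
  elim: n => [|n [IH1 IH2]]; first by rewrite expr0 !divr1.
  have [_ _ _ _ [-> -> _]] := s_good n.
  by rewrite IH1 IH2 exprSr !invfM !mulrA.
have sE n : E (s 0%N) <= 4 ^+ n * E (s n).
  elim: n => [|n IH]; first by rewrite expr0 mul1r.
  apply: le_trans IH _; have [_ _ _ _ [_ _ e]] := s_good n.
  by rewrite exprSr -mulrA ler_pM2l// exprn_gt0.
have [x0 hx0] : exists x, forall n, (s n).1.1 <= x <= (s n).1.2.
  by apply: nested_point => n; [case: (s_good n)|case: (s_good n)|case: (s_ok n) => _ _ _ _ []].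
have [y0 hy0] : exists x, forall n, (s n).2.1 <= x <= (s n).2.2.
  by apply: nested_point => n; [case: (s_good n)|case: (s_good n)|case: (s_ok n) => _ _ _ _ []].
have [D hD] := H x0 y0 (hx0 0%N) (hy0 0%N).
pose L := (b - a) + (d - c).
have L0 : 0 <= L by rewrite addr_ge0// subr_ge0.
have key e : 0 < e -> E (s 0%N) <= e.
  (* After n bisections at most a factor 4^n is lost, while the bound on a rectangle of
     half-perimeter L / 2^n is 4 e' (L / 2^n)^2. The product is 4 e' L^2, which this choice keeps
     below e. *)
  move=> e0; have e' : 0 < e / (4 * (L ^+ 2 + 1)).
    by rewrite divr_gt0// mulr_gt0// ltr_wpDl// sqr_ge0.
  have [dl dl0 hdl] := hD _ e'.
  have [n hn] : exists n, L / 2 ^+ n < dl.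
    exists (Num.Def.archi_bound (L / dl)).
    rewrite ltr_pdivrMr ?exprn_gt0// mulrC -ltr_pdivrMr//.
    apply: lt_le_trans (archi_boundP (divr_ge0 L0 (ltW dl0))) _.
    by rewrite -natrX ler_nat ltnW// ltn_expl.
  apply: le_trans (sE n) _.
  have [ok1 ok2 ok3 ok4 [ok5 ok6]] := s_ok n.
  have cn := okc _ (s_ok n).
  have [d1 d2] := sdim n.
  rewrite {1}/E (rect_int_linear (h (x0 +i* y0) - D * (x0 +i* y0)) D ok5 ok6 cn).
  have hM x y : (s n).1.1 <= x <= (s n).1.2 -> (s n).2.1 <= y <= (s n).2.2 ->
    normc ((h (x +i* y) - (h (x0 +i* y0) - D * (x0 +i* y0) + D * (x +i* y)))) <=
      e / (4 * (L ^+ 2 + 1)) * (L / 2 ^+ n).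
    move=> hx hy.
    have nb : normc ((x +i* y) - (x0 +i* y0)) <= L / 2 ^+ n.
      apply: le_trans (normc_le_ReIm _) _ => /=.
      rewrite /L mulrDl -d1 -d2; apply: lerD; rewrite ler_norml;
      move: (hx0 n) (hy0 n) hx hy => /andP[? ?] /andP[? ?] /andP[? ?] /andP[? ?];
      by apply/andP; split; lra.
    have := hdl _ (le_lt_trans nb hn).
    have -> : h (x +i* y) - h (x0 +i* y0) - D * ((x +i* y) - (x0 +i* y0)) =
      h (x +i* y) - (h (x0 +i* y0) - D * (x0 +i* y0) + D * (x +i* y)) by ring.
    by move=> /le_trans; apply; rewrite ler_pM2l.
  have rc : rect_cont (fun w => h w - (h (x0 +i* y0) - D * (x0 +i* y0) + D * w))
     (s n).1.1 (s n).1.2 (s n).2.1 (s n).2.2.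
    move=> x y hx hy.
    have -> : (fun w => h w - (h (x0 +i* y0) - D * (x0 +i* y0) + D * w)) =
      (fun w => h w + ((- (h (x0 +i* y0) - D * (x0 +i* y0))) + (- D) * w)).
      by apply/funext => w; ring.
    apply: ccontD; first exact: cn.
    apply: ccontD; first exact: ccont_cst.
    by apply: ccontM; [exact: ccont_cst|exact: ccont_id].
  have := rect_int_bound ok5 ok6 rc hM.
  rewrite d1 d2 -mulrDl -/L => B.
  apply: le_trans (ler_wpM2l (exprn_ge0 n (ler0n _ 4)) B) _.
  have -> : (4 : R) ^+ n = 2 ^+ n * 2 ^+ n by rewrite -exprMn; congr (_ ^+ _); ring.
  have -> : 2 ^+ n * 2 ^+ n * (4 * (e / (4 * (L ^+ 2 + 1)) * (L / 2 ^+ n) * (L / 2 ^+ n))) =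
    e * (L ^+ 2 / (L ^+ 2 + 1)).
    field; rewrite expf_neq0 ?andbT//=.
    by rewrite gt_eqF// ltr_wpDl// sqr_ge0.
  rewrite ler_piMr ?(ltW e0)// ler_pdivrMr ?mul1r ?lerDl//.
  by rewrite ltr_wpDl// sqr_ge0.
apply: eq0_normc; apply/eqP; rewrite eq_le normc_ge0 andbT.
by apply/ler_addgt0Pr => e e0; rewrite add0r; exact: key.
Qed.

End Goursat.

(** * Complex derivatives, polar coordinates and the exponential *)

Section ComplexDerivative.
Variable R : realType.
Local Notation C := R[i].

(** Stated over any [numFieldType] because it is applied both to R[i] and, for [expR], [sin], [cos]
    and functions along segments, to R. *)
Lemma derivable_eps (K : numFieldType) (f : K^o -> K^o) (z D : K) :
  is_derive z 1 f D <->
  (forall e : K, 0 < e -> exists2 d : K, 0 < d &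
    forall w : K, `|w - z| < d -> `|f w - f z - D * (w - z)| <= e * `|w - z|).
Proof.
split.
  case=> df Df e e0.
  have := df; rewrite /derivable => cf.
  have : h^-1 *: (f (h *: (1 : K^o) + z) - f z) @[h --> (0 : K)^'] --> (D : K^o).
    by rewrite -Df; exact: cf.
  move=> /cvgrPdist_lt/(_ _ e0) [d /= d0 hd]; exists d => // w wz.
  have [->|wz0] := eqVneq w z; first by rewrite !subrr mulr0 subr0 normr0 mulr0.
  have w0 : w - z != 0 by rewrite subr_eq0.
  have := hd (w - z); rewrite /ball_/= sub0r normrN => /(_ wz w0).
  rewrite -[_ *: 1]/((w - z) * 1) mulr1 subrK -[_ *: _]/((w - z)^-1 * (f w - f z)) => /ltW H.
  have -> : f w - f z - D * (w - z) = - ((D - (w - z)^-1 * (f w - f z)) * (w - z)).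
    by field.
  by rewrite normrN normrM ler_wpM2r.
move=> H.
have cf : h^-1 *: (f (h *: (1 : K^o) + z) - f z) @[h --> (0 : K)^'] --> (D : K^o).
  apply/cvgrPdist_le => e /H[d d0 hd]; exists d => //= h; rewrite /ball_/= sub0r normrN => hd0 h0.
  have := hd (h + z); rewrite addrK => /(_ hd0).
  rewrite -[_ *: 1]/(h * 1) mulr1 -[_ *: _]/(h^-1 * (f (h + z) - f z)).
  have -> : f (h + z) - f z - D * h = - ((D - h^-1 * (f (h + z) - f z)) * h) by field.
  by rewrite normrN normrM ler_pM2r// normr_gt0.
split; first by apply/cvg_ex; exists D.
exact/cvg_lim.
Qed.

Lemma normCE (z : C) : `|z| = (normc z)%:C.
Proof. by rewrite normc_def; case: z. Qed.

Lemma cderiveP (f : C -> C) z D :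
  is_derive (z : C^o) 1 (f : C^o -> C^o) D <-> cderive f z D.
Proof.
apply: (iff_trans (derivable_eps f z D)); split=> H e e0.
  have eC : 0 < e%:C by rewrite ltcR.
  have [d d0 hd] := H _ eC; move: d0; rewrite ltcE/= => /andP[/eqP imd red].
  exists (complex.Re d) => // w wz.
  have dE : d = (complex.Re d)%:C by apply: complex_eq.
  by have := hd w; rewrite !normCE {1}dE ltcR -rmorphM lecR => /(_ wz).
move: e0; rewrite ltcE/= => /andP[/eqP ime ree].
have [d d0 hd] := H _ ree; exists d%:C; first by rewrite ltcR.
have eE : e = (complex.Re e)%:C by apply: complex_eq.
by move=> w; rewrite !normCE ltcR => /hd; rewrite eE -rmorphM lecR.
Qed.

Lemma derivable_cderive (f : C -> C) z : derivable (f : C^o -> C^o) z 1 ->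
  cderive f z (cderiv f z).
Proof.
move=> fz; apply: (cderiveP f z (cderiv f z)).1.
rewrite /cderiv (@derive1E C C^o (f : C^o -> C^o)).
by apply: DeriveDef.
Qed.

Lemma cderive_derivable (f : C -> C) z D : cderive f z D ->
  derivable (f : C^o -> C^o) z 1 /\ cderiv f z = D.
Proof.
by move=> /cderiveP fz; split; [exact: ex_derive|rewrite /cderiv derive1E derive_val].
Qed.

Lemma cderive_near (f g : C -> C) z D (r : R) : 0 < r ->
  (forall w, normc (w - z) < r -> f w = g w) -> cderive g z D -> cderive f z D.
Proof.
move=> r0 fg hg e /hg[d d0 hd]; exists (Num.min d r); first by rewrite lt_min d0.
move=> w; rewrite lt_min => /andP[wd wr]; rewrite !fg ?subrr ?normc0//; exact: hd.
Qed.

Lemma cderive_cst (c z : C) : cderive (fun=> c) z 0.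
Proof.
by move=> e e0; exists 1 => // w _; rewrite subrr mul0r subrr normc0; exact: mulr_ge0 (ltW e0) (normc_ge0 _).
Qed.

Lemma cderive_id (z : C) : cderive id z 1.
Proof.
by move=> e e0; exists 1 => // w _; rewrite mul1r subrr normc0; exact: mulr_ge0 (ltW e0) (normc_ge0 _).
Qed.

Lemma cderiveD (f g : C -> C) z D E : cderive f z D -> cderive g z E ->
  cderive (fun w => f w + g w) z (D + E).
Proof. by move=> /cderiveP hf /cderiveP hg; apply/cderiveP; exact: is_deriveD. Qed.

Lemma cderiveM (f g : C -> C) z D E : cderive f z D -> cderive g z E ->
  cderive (fun w => f w * g w) z (f z * E + g z * D).
Proof. by move=> /cderiveP hf /cderiveP hg; apply/cderiveP; exact: is_deriveM. Qed.

Lemma cderiveV (f : C -> C) z D : f z != 0 -> cderive f z D ->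
  cderive (fun w => (f w)^-1) z (- (f z) ^- 2 * D).
Proof.
move=> fz0 /cderiveP [hf Df]; apply: (cderiveP _ z _).1; split.
  exact: (@derivableV C C^o (f : C^o -> C^o) z 1 fz0 hf).
by rewrite (@deriveV C C^o (f : C^o -> C^o) z 1 fz0 hf) Df.
Qed.

Lemma cderiveX (f : C -> C) z D n : cderive f z D ->
  exists E, cderive (fun w => f w ^+ n) z E.
Proof.
move=> hf; elim: n => [|n [E IH]]; first by exists 0; exact: cderive_cst.
exists (f z * E + f z ^+ n * D); have := cderiveM hf IH.
by under eq_fun do rewrite -exprS.
Qed.

Lemma cderive_comp (f g : C -> C) z D E : cderive g z E -> cderive f (g z) D ->
  cderive (fun w => f (g w)) z (D * E).
Proof.
move=> hg hf e e0.
have n1 : 0 < 1 + normc E by rewrite ltr_wpDr// normc_ge0.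
have n2 : 0 < 1 + normc D by rewrite ltr_wpDr// normc_ge0.
have e1 : 0 < e / (2 * (1 + normc E)) by rewrite divr_gt0// mulr_gt0.
have e2 : 0 < Num.min 1 (e / (2 * (1 + normc D))).
  by rewrite lt_min ltr01 divr_gt0// mulr_gt0.
have [d1 d10 h1] := hf _ e1; have [d2 d20 h2] := hg _ e2.
have [d3 d30 h3] := cderive_ccont hg d10.
exists (Num.min d2 d3); first by rewrite lt_min d20.
move=> w; rewrite lt_min => /andP[/h2 w2 /h3 /h1 w1].
set u := normc (w - z) in w2 *; have u0 : 0 <= u by exact: normc_ge0.
have g1 : normc (g w - g z) <= (1 + normc E) * u.
  have -> : g w - g z = (g w - g z - E * (w - z)) + E * (w - z) by ring.
  apply: normcD_le; rewrite normcM -/u mulrDl mul1r lerD//.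
  by apply: le_trans w2 _; rewrite ler_piMl// ge_min lexx.
have g2 : normc (g w - g z - E * (w - z)) <= e / (2 * (1 + normc D)) * u.
  by apply: le_trans w2 _; rewrite ler_wpM2r// ge_min lexx orbT.
have -> : f (g w) - f (g z) - D * E * (w - z) =
  (f (g w) - f (g z) - D * (g w - g z)) + D * (g w - g z - E * (w - z)) by ring.
apply: normcD_le; rewrite normcM.
have -> : e * u = e / (2 * (1 + normc E)) * ((1 + normc E) * u) +
   (1 + normc D) * (e / (2 * (1 + normc D)) * u).
  by field; rewrite !gt_eqF.
apply: lerD; first by apply: le_trans w1 _; rewrite ler_pM2l.
by apply: ler_pM => //; rewrite ?normc_ge0// lerDr.
Qed.

Lemma circleM (r s t u : R) : circle r t * circle s u = circle (r * s) (t + u).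
Proof. by apply: complex_eq; rewrite ?ReM ?ImM/= ?cosD ?sinD; ring. Qed.

Lemma circle_r0 (r : R) : circle r 0 = r%:C.
Proof. by apply: complex_eq; rewrite /= ?cos0 ?sin0 ?mulr1 ?mulr0. Qed.

Lemma circleX (r t : R) n : circle r t ^+ n = circle (r ^+ n) (n%:R * t).
Proof.
elim: n => [|n IH]; first by rewrite !expr0 mul0r circle_r0.
by rewrite !exprS IH circleM; congr circle; rewrite -natr1; ring.
Qed.

Lemma conj_circle (r t : R) : conjc (circle r t) = circle r (- t).
Proof. by rewrite /circle/= cosN sinN mulrN. Qed.

Lemma circleD2pi (r t : R) : circle r (t + 2 * pi) = circle r t.
Proof.
by rewrite /circle mulr_natl cosD2pi sinD2pi.
Qed.

Lemma normc_circ (r t : R) : normc (circle r t) = `|r|.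
Proof.
by rewrite /normc/= !exprMn -mulrDr cos2Dsin2 mulr1 sqrtr_sqr.
Qed.

Lemma circleV (r t : R) : r != 0 -> (circle r t)^-1 = circle r^-1 (- t).
Proof.
move=> r0; apply: (mulfI (x := circle r t)).
  by apply: contraNneq r0 => H; rewrite -normr_eq0 -(normc_circ r t) H normc0.
rewrite divff ?circleM ?divff// ?subrr ?circle_r0//.
by apply: contraNneq r0 => H; rewrite -normr_eq0 -(normc_circ r t) H normc0.
Qed.

Lemma circle_inj_pi (r r' t t' : R) : 0 < r -> 0 < r' -> `|t - t'| <= pi ->
  circle r t = circle r' t' -> r = r' /\ t = t'.
Proof.
move=> r0 r'0 tt H.
have E : r = r'.
  have := congr1 (@normc R) H; by rewrite !normc_circ !gtr0_norm.
split=> //; rewrite -E in H.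
have : circle r t / circle r t' = 1.
  rewrite H divff//; apply: contraNneq (lt0r_neq0 r0) => H'.
  by rewrite -normr_eq0 -(normc_circ r t') H' normc0.
rewrite circleV ?lt0r_neq0// circleM divff ?lt0r_neq0// => /(congr1 (@complex.Re R))/=.
rewrite mul1r -cos_norm -cos0 => /cos_inj; rewrite !in_itv/= lexx pi_ge0 normr_ge0 tt.
by move=> /(_ isT isT)/eqP; rewrite normr_eq0 subr_eq0 => /eqP.
Qed.

(** The complex exponential in polar form: it carries vertical segments to circular arcs, which
    turns annuli into rectangles. *)
Definition cexp (w : C) : C := circle (expR (complex.Re w)) (complex.Im w).

Lemma cexpD z w : cexp (z + w) = cexp z * cexp w.
Proof. by rewrite /cexp circleM ReD ImD expRD. Qed.

Lemma real_deriv_eps (f : R -> R) (x D : R) : is_derive x 1 f D ->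
  forall e, 0 < e -> exists2 d, 0 < d &
    forall y, `|y - x| < d -> `|f y - f x - D * (y - x)| <= e * `|y - x|.
Proof. by move=> /derivable_eps. Qed.

Lemma cexp_derive0 : cderive cexp 0 1.
Proof.
move=> e e0.
have [e' [e'0 e'8 e'1]] : exists e' : R, [/\ 0 < e', e' <= e / 8 & e' <= 1].
  by exists (Num.min (e / 8) (1 : R)); rewrite lt_min divr_gt0// ltr01 !ge_min !lexx orbT.
have [d1 d10 h1] := real_deriv_eps (@is_derive_expR R 0) e'0.
have [d2 d20 h2] := real_deriv_eps (is_derive_cos (0 : R)) e'0.
have [d3 d30 h3] := real_deriv_eps (is_derive_sin (0 : R)) e'0.
exists (Num.min (Num.min d1 d2) (Num.min d3 e')).
  by do ![rewrite lt_min; apply/andP; split].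
move=> w; rewrite subr0 !lt_min mul1r => /andP[/andP[w1 w2] /andP[w3 w4]].
have := h1 (complex.Re w); have := h2 (complex.Im w); have := h3 (complex.Im w).
rewrite !subr0 expR0 cos0 sin0 oppr0 mul0r !subr0 !mul1r.
have r1 := Re_le_normc w; have r2 := Im_le_normc w.
move=> /(_ (le_lt_trans r2 w3)) H3 /(_ (le_lt_trans r2 w2)) H2 /(_ (le_lt_trans r1 w1)) H1.
set x := complex.Re w in r1 H1 *; set y := complex.Im w in r2 H2 H3 *.
set u := normc w in r1 r2 w1 w2 w3 w4 *.
have u0 : 0 <= u by exact: normc_ge0.
(* The first three terms contain a first-order remainder of [expR], [cos] or [sin], with a factor of
   modulus at most 1, 2 and 2; the last is at most e' u because |x| <= e'. The total 6 e' u explains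
   the choice e' <= e / 8. *)
have -> : cexp w - cexp 0 - w =
  (expR x - 1 - x)%:C * circle 1 y + ((1 + x) * (cos y - 1))%:C
   + (0 +i* ((1 + x) * (sin y - y))) + (0 +i* (x * y)).
  apply: complex_eq; rewrite /cexp !(ReD, ReN, ImD, ImN, ReM, ImM)/= expR0 ?cos0 ?sin0 -/x -/y; ring.
have nI (a : R) : normc (0 +i* a) = `|a| by rewrite /normc/= expr0n/= add0r sqrtr_sqr.
apply: normcD_le; rewrite nI.
apply: (@le_trans _ _ (e' * u + 2 * (e' * u) + 2 * (e' * u) + e' * u)); last first.
  by move: e'8 (mulr_ge0 (ltW e0) u0) => /(ler_wpM2r u0); lra.
have x1 : `|1 + x| <= 2 by apply: le_trans (ler_normD _ _) _; rewrite normr1; lra.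
have eu := ler_wpM2l (ltW e'0) r1; have ev := ler_wpM2l (ltW e'0) r2.
rewrite addr0 in H3; have K3 := le_trans H3 ev; have K2 := le_trans H2 ev; have K1 := le_trans H1 eu.
apply: lerD; last by rewrite normrM; apply: ler_pM => //; apply: le_trans r1 (ltW w4).
apply: normcD_le; rewrite nI; apply: lerD; last first.
  by rewrite normrM; apply: ler_pM.
apply: normcD_le; rewrite normcR normcM normcR; apply: lerD.
  by rewrite normc_circ normr1 mulr1.
by rewrite normrM; apply: ler_pM.
Qed.

Lemma cexp_derive z : cderive cexp z (cexp z).
Proof.
have H : cderive (fun w => cexp z * cexp (w - z)) z (cexp z * (1 * 1)).
  have h2 : cderive (fun w => cexp (w - z)) z (1 * 1).
    apply: (@cderive_comp cexp (fun w => w - z)).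
      by have := cderiveD (cderive_id z) (cderive_cst (- z) z); rewrite addr0.
    by rewrite subrr; exact: cexp_derive0.
  have := cderiveM (cderive_cst (cexp z) z) h2.
  by rewrite mulr0 addr0.
rewrite !mulr1 in H; apply: cderive_near H => // w _.
by rewrite -cexpD addrC subrK.
Qed.

End ComplexDerivative.

(** * Integrals over circles of holomorphic functions *)

Section Cauchy.
Variable R : realType.
Local Notation C := R[i].
Implicit Types (f h phi : C -> C) (z w : C) (r t c : R).

Lemma small_pow2_bound (A e : R) : 0 <= A -> 0 < e -> exists2 d : R, 0 < d & A * d <= e.
Proof.
move=> A0 e0; exists (e / (A + 1)); first by rewrite divr_gt0// ltr_wpDl.
rewrite mulrA ler_pdivrMr ?ltr_wpDl// [A * e]mulrC ler_pM2l// lerDl//.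
Qed.

(* The exceptional point is cut out by a square of side 2 d whose boundary
   integral is O(d). *)
Lemma goursat_except h (a b c d x0 y0 : R) : a < x0 < b -> c < y0 < d ->
  ccont h (x0 +i* y0) ->
  (forall x y, a <= x <= b -> c <= y <= d -> (x, y) != (x0, y0) ->
     exists D, cderive h (x +i* y) D) ->
  rect_int h a b c d = 0.
Proof.
move=> /andP[ax xb] /andP[cy yd] h0 H.
have hc : rect_cont h a b c d.
  move=> x y hx hy; have [[-> ->]//|ne] := eqVneq (x, y) (x0, y0).
  by have [D] := H x y hx hy ne; exact: cderive_ccont.
have [dl dl0 hdl] := h0 1 ltr01.
apply: eq0_normc; apply/eqP; rewrite eq_le normc_ge0 andbT.
apply/ler_addgt0Pr => e e0; rewrite add0r.
pose M := normc (h (x0 +i* y0)) + 1.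
have M0 : 0 <= 16 * M by rewrite mulr_ge0// addr_ge0// normc_ge0.
have [s' s'0 hs'] := small_pow2_bound M0 e0.
have [s [s0 [sdl [ss [sa sb]] [sc sd]]]] : exists s : R, [/\ 0 < s, [/\ s < dl / 2, s <= s' &
   a <= x0 - s /\ x0 + s <= b] & c <= y0 - s /\ y0 + s <= d].
  exists (Num.min (Num.min (dl / 3) s') (Num.min (Num.min (x0 - a) (b - x0)) (Num.min (y0 - c) (d - y0)))).
  set s := Num.min _ _.
  have h1 : s <= dl / 3 by rewrite !ge_min lexx.
  have h2 : s <= s' by rewrite !ge_min lexx orbT.
  have h3 : s <= x0 - a by rewrite !ge_min lexx !orbT.
  have h4 : s <= b - x0 by rewrite !ge_min lexx !orbT.
  have h5 : s <= y0 - c by rewrite !ge_min lexx !orbT.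
  have h6 : s <= d - y0 by rewrite !ge_min lexx !orbT.
  split; first by rewrite !lt_min !subr_gt0 ax xb cy yd s'0 divr_gt0.
    by split=> //; [lra|split; lra].
  by split; lra.
have z1 x y : a <= x <= b -> c <= y <= d -> ((x < x0) || (x0 < x)) || ((y < y0) || (y0 < y)) ->
    exists D, cderive h (x +i* y) D.
  move=> hx hy ne; apply: H => //; apply: contraTneq ne => -[-> ->].
  by rewrite !ltxx.
have cd : c <= d by lra.
have xsm : x0 - s <= x0 + s by lra.
have ysm : y0 - s <= y0 + s by lra.
rewrite (@rect_int_vsplit _ h a (x0 - s) b c d)//; last by lra.
rewrite (@goursat _ h a (x0 - s) c d)//; last first.
  move=> x y /andP[x1 x2] hy; apply: z1 => //; first by apply/andP; split; lra.
  by rewrite (_ : x < x0)//; lra.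
have hc1 := rect_cont_sub (a' := x0 - s) sa (lexx b) (lexx c) (lexx d) hc.
rewrite add0r (@rect_int_vsplit _ h (x0 - s) (x0 + s) b c d)//.
rewrite (@goursat _ h (x0 + s) b c d)//; last first.
  move=> x y /andP[x1 x2] hy; apply: z1 => //; first by apply/andP; split; lra.
  by rewrite (_ : x0 < x) ?orbT//; lra.
have hc2 := rect_cont_sub (lexx (x0 - s)) sb (lexx c) (lexx d) hc1.
rewrite addr0 (@rect_int_hsplit _ h (x0 - s) (x0 + s) c (y0 - s) d)//; last by lra.
rewrite (@goursat _ h (x0 - s) (x0 + s) c (y0 - s))//; last first.
  move=> x y /andP[x1 x2] /andP[y1 y2]; apply: z1.
  - by apply/andP; split; lra.
  - by apply/andP; split; lra.
  - by rewrite (_ : y < y0) ?orbT//; lra.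
have hc3 := rect_cont_sub (lexx (x0 - s)) (lexx _) sc (lexx d) hc2.
rewrite add0r (@rect_int_hsplit _ h (x0 - s) (x0 + s) (y0 - s) (y0 + s) d)//.
rewrite (@goursat _ h (x0 - s) (x0 + s) (y0 + s) d)//; last first.
  move=> x y /andP[x1 x2] /andP[y1 y2]; apply: z1.
  - by apply/andP; split; lra.
  - by apply/andP; split; lra.
  - by rewrite (_ : y0 < y) ?orbT//; lra.
have hc4 := rect_cont_sub (lexx (x0 - s)) (lexx _) (lexx _) sd hc3.
rewrite addr0; apply: le_trans (rect_int_bound xsm ysm hc4 (M := M) _) _.
  move=> x y /andP[x1 x2] /andP[y1 y2].
  have nb : normc ((x +i* y) - (x0 +i* y0)) < dl.
    apply: le_lt_trans (normc_le_ReIm _) _ => /=.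
    have : `|x - x0| <= s by rewrite ler_norml; apply/andP; split; lra.
    have : `|y - y0| <= s by rewrite ler_norml; apply/andP; split; lra.
    lra.
  have := hdl _ nb; have := ler_normcB (h (x +i* y)) (h (x0 +i* y0)); rewrite /M; lra.
apply: le_trans hs'.
have -> : 4 * (M * (x0 + s - (x0 - s) + (y0 + s - (y0 - s)))) = 16 * M * s by ring.
exact: ler_wpM2l.
Qed.

(** Since dt = dw / (i w), the contour integral of h appears, up to the factor i, as [circ_int] of w
    h(w). *)
Definition circ_int phi r c : C := cint c (c + 2 * pi) (fun t => phi (circle r t)).

Lemma expR_lnK r : 0 < r -> expR (ln r) = r.
Proof. by move=> r0; apply: lnK; rewrite posrE. Qed.

Lemma pi2_gt0 : 0 < 2 * pi :> R.
Proof. by rewrite mulr_gt0// pi_gt0. Qed.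

(** The exponential maps the rectangle onto the annulus, and its two horizontal sides have the same
    image by periodicity. *)
Lemma circ_int_rect phi r1 r2 c : 0 < r1 -> 0 < r2 ->
  rect_int (fun w => phi (cexp w)) (ln r1) (ln r2) c (c + 2 * pi) =
  'i * cint c (c + 2 * pi) (fun t => phi (circle r2 t) - phi (circle r1 t)).
Proof.
move=> r10 r20; rewrite /rect_int.
rewrite (_ : cint (ln r1) _ _ = 0); last first.
  rewrite -(cint0 (ln r1) (ln r2)); apply: eq_cint => t _.
  by rewrite /cexp/= circleD2pi subrr.
by rewrite add0r; congr (_ * _); apply: eq_cint => t _; rewrite /cexp/= !expR_lnK.
Qed.

Lemma circle_rcont r t : rcont (circle r) t.
Proof.
apply: continuous_rcont => /=; apply: cvgMr => //;
  [exact: continuous_cos|exact: continuous_sin].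
Qed.

Lemma circ_int_eq phi r1 r2 c : 0 < r1 -> 0 < r2 ->
  (forall t, ccont phi (circle r1 t)) -> (forall t, ccont phi (circle r2 t)) ->
  rect_int (fun w => phi (cexp w)) (ln r1) (ln r2) c (c + 2 * pi) = 0 ->
  circ_int phi r1 c = circ_int phi r2 c.
Proof.
move=> r10 r20 c1 c2; rewrite circ_int_rect// => /eqP; rewrite mulf_eq0.
have i0 : ('i : C) != 0 by rewrite eq_complex/= oner_eq0 andbF.
rewrite (negbTE i0)/= cintB; last 2 first.
  by move=> t _; apply: rcont_comp => //; exact: circle_rcont.
  by move=> t _; apply: rcont_comp => //; exact: circle_rcont.
by rewrite subr_eq0 => /eqP.
Qed.

Lemma ln_le r1 r2 : 0 < r1 -> r1 <= r2 -> ln r1 <= ln r2.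
Proof. by move=> r10 r12; rewrite ler_ln// posrE// (lt_le_trans r10). Qed.

Lemma circ_int_const phi r1 r2 c : 0 < r1 -> r1 <= r2 ->
  (forall r t, r1 <= r <= r2 -> exists D, cderive phi (circle r t) D) ->
  circ_int phi r1 c = circ_int phi r2 c.
Proof.
move=> r10 r12 H; have r20 := lt_le_trans r10 r12.
apply: circ_int_eq => //.
- by move=> t; have [|D] := H r1 t; [rewrite lexx|exact: cderive_ccont].
- by move=> t; have [|D] := H r2 t; [rewrite lexx r12|exact: cderive_ccont].
apply: goursat; first exact: ln_le.
  by rewrite lerDl ltW// pi2_gt0.
move=> x y /andP[x1 x2] _; have [|D HD] := H (expR x) y.
  by rewrite -(expR_lnK r10) -(expR_lnK r20) !ler_expR x1 x2.
exists (D * cexp (x +i* y)).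
by apply: cderive_comp => //; exact: cexp_derive.
Qed.

(** The annulus is slit at the angle t0 - pi opposite to the exceptional point, which puts that
    point in the interior of the rectangle. *)
Lemma circ_int_const_except phi r1 r2 (r0 t0 : R) : 0 < r1 -> r1 < r0 < r2 ->
  ccont phi (circle r0 t0) ->
  (forall z, r1 <= normc z <= r2 -> z != circle r0 t0 -> exists D, cderive phi z D) ->
  circ_int phi r1 (t0 - pi) = circ_int phi r2 (t0 - pi).
Proof.
move=> r10 /andP[r1r r2r] H0 H.
have r00 := lt_trans r10 r1r; have r20 := lt_trans r00 r2r.
have r12 := lt_trans r1r r2r.
have circH r t : r1 <= r <= r2 -> circle r t != circle r0 t0 -> exists D, cderive phi (circle r t) D.
  move=> hr ne; apply: H => //; rewrite normc_circ gtr0_norm//.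
  by case/andP: hr => hr _; exact: lt_le_trans hr.
have neq r t : 0 < r -> r != r0 -> circle r t != circle r0 t0.
  move=> rp; apply: contraNneq => /(congr1 (@normc R)).
  by rewrite !normc_circ !gtr0_norm// => ->.
apply: circ_int_eq => //.
- move=> t; have [||D] := circH r1 t; last exact: cderive_ccont.
    by rewrite lexx ltW.
  by apply: neq; rewrite // lt_eqF.
- move=> t; have [||D] := circH r2 t; last exact: cderive_ccont.
    by rewrite lexx ltW.
  by apply: neq; rewrite // gt_eqF.
have pig := pi_gt0 R.
apply: (@goursat_except _ _ _ _ _ (ln r0) t0).
- by rewrite !ltr_ln ?posrE// r1r r2r.
- by apply/andP; split; lra.
- apply: ccont_comp; first by rewrite /cexp/= expR_lnK.
  exact: cderive_ccont (@cexp_derive _ _).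
move=> x y /andP[x1 x2] /andP[y1 y2] ne; have [||D HD] := circH (expR x) y.
- by rewrite -(expR_lnK r10) -(expR_lnK r20) !ler_expR x1 x2.
- apply: contra_neq ne => /circle_inj_pi[]//; first exact: expR_gt0.
    by rewrite ler_norml; apply/andP; split; lra.
  by move=> <- ->; rewrite expRK.
exists (D * cexp (x +i* y)).
by apply: cderive_comp => //; exact: cexp_derive.
Qed.

Lemma circ_int_bound phi r c (M : R) : (forall t, ccont phi (circle r t)) ->
  (forall t, normc (phi (circle r t)) <= M) ->
  normc (circ_int phi r c) <= 2 * (M * (2 * pi)).
Proof.
move=> hc hM; have := @cint_bound R (fun t => phi (circle r t)) c (c + 2 * pi) M.
rewrite [c + _ - c]addrC addKr; apply.
- by rewrite lerDl ltW// pi2_gt0.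
- by move=> t _; apply: rcont_comp => //; exact: circle_rcont.
- by move=> t _.
Qed.

(** On small circles the integral is at most a constant times the maximum of |phi|, which tends to
    |phi 0| = 0. *)
Lemma circ_int_to0 phi (rho c : R) (I : C) : 0 < rho ->
  (forall r t, 0 < r < rho -> ccont phi (circle r t)) ->
  ccont phi 0 -> phi 0 = 0 ->
  (forall r, 0 < r < rho -> circ_int phi r c = I) -> I = 0.
Proof.
move=> rho0 hc h0 p0 H.
apply: eq0_normc; apply/eqP; rewrite eq_le normc_ge0 andbT.
apply/ler_addgt0Pr => e e0; rewrite add0r.
have e1 : 0 < e / (4 * pi) by rewrite divr_gt0// mulr_gt0// pi_gt0.
have [d d0 hd] := h0 _ e1.
pose r := Num.min (d / 2) (rho / 2).
have r0 : 0 < r by rewrite lt_min !divr_gt0.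
have rd : r <= d / 2 by rewrite ge_min lexx.
have rr : r <= rho / 2 by rewrite ge_min lexx orbT.
have hr : 0 < r < rho by rewrite r0; lra.
rewrite -(H r hr); apply: le_trans (circ_int_bound c (M := e / (4 * pi)) _ _) _.
- by move=> t; exact: hc.
- move=> t; rewrite ltW//; have := hd (circle r t); rewrite p0 !subr0; apply.
  by rewrite normc_circ gtr0_norm//; lra.
have p0' : pi != 0 :> R by rewrite gt_eqF// pi_gt0.
have -> : 2 * (e / (4 * pi) * (2 * pi)) = e.
  move: (pi : R) p0' => p p0'; field.
  by rewrite p0'.
by rewrite lexx.
Qed.

Lemma polar z : z != 0 -> exists t, [/\ 0 <= t, t < 2 * pi & z = circle (normc z) t].
Proof.
move=> z0; have n0 := normc_gt0 z0; set r := normc z in n0 *.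
case: z z0 @r n0 => x y z0 r n0.
have xy : (x / r) ^+ 2 + (y / r) ^+ 2 = 1.
  rewrite !expr_div_n -mulrDl -(normc2 (x +i* y)) divff//.
  by rewrite expf_eq0/= gt_eqF.
have x1 : -1 <= x / r <= 1.
  rewrite -ler_norml -sqrtr_sqr -sqrtr1 ler_wsqrtr// -xy lerDl; exact: sqr_ge0.
have yE : `|y / r| = sin (acos (x / r)).
  by rewrite sin_acos// -sqrtr_sqr -xy addrC addKr.
have cE := acosK x1.
have xr : x = r * (x / r) by rewrite mulrC divfK// gt_eqF.
have yr : y = r * (y / r) by rewrite mulrC divfK// gt_eqF.
have pig := pi_gt0 R.
have [y0|y0] := leP 0 (y / r).
  exists (acos (x / r)); split.
  - exact: acos_ge0.
  - by apply: le_lt_trans (acos_lepi x1) _; lra.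
  - by apply: complex_eq => /=; rewrite ?cE -?yE ?ger0_norm.
exists (2 * pi - acos (x / r)); split.
- by rewrite subr_ge0; apply: le_trans (acos_lepi x1) _; lra.
- rewrite ltrBlDr ltrDl lt_neqAle acos_ge0// andbT eq_sym.
  apply: contraTneq y0 => H; rewrite -leNgt.
  by move: yE; rewrite H sin0 => /eqP; rewrite normr_eq0 => /eqP ->.
- have -> : 2 * pi - acos (x / r) = - acos (x / r) + 2 * pi by ring.
  by rewrite circleD2pi; apply: complex_eq => /=; rewrite ?cosN ?cE// sinN -yE ltr0_norm// opprK.
Qed.

End Cauchy.

(** * Image measures and affine changes of variable *)

Section ImageMeasure.
Context d d' (T1 : measurableType d) (T2 : measurableType d') (R : realType).
Variables (m : {measure set T1 -> \bar R}) (f : T1 -> T2).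
Hypothesis mf : measurable_fun [set: T1] f.

Definition image_measure : {measure set T2 -> \bar R}.
Proof.
unshelve refine (pushforward m f : {measure set T2 -> \bar R}); exact: mf.
Defined.

Lemma ge0_integral_image (D : set T2) (h : T2 -> \bar R) : measurable D ->
  measurable_fun D h -> {in D, forall y, (0 <= h y)%E} ->
  (\int[image_measure]_(y in D) h y = \int[m]_(x in f @^-1` D) h (f x))%E.
Proof. by move=> mD mh h0; exact: (ge0_integral_pushforward mf). Qed.

Lemma integral_image (D : set T2) (h : T2 -> \bar R) :
  measurable_fun [set: T2] h -> m.-integrable (f @^-1` D) (h \o f) -> measurable D ->
  (\int[image_measure]_(y in D) h y = \int[m]_(x in f @^-1` D) h (f x))%E.
Proof. by move=> mh ih mD; exact: (integral_pushforward mf). Qed.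

End ImageMeasure.

Section AffineChange.
Variable R : realType.
Local Notation mu := (@lebesgue_measure R).

Definition affine_map (r s : R) : measurableTypeR R -> measurableTypeR R :=
  fun x : R => r * x + s.

Lemma measurable_affine_map r s : measurable_fun setT (affine_map r s).
Proof.
suff : measurable_fun setT (fun x : measurableTypeR R => r * x + s : R) by [].
by apply: measurable_funD => //; exact: measurable_funM.
Qed.

(** Both sides are measures in A that agree on half-open intervals, and these determine Lebesgue
    measure. *)
Lemma lebesgue_affine (r s : R) (A : set (measurableTypeR R)) : 0 < r -> measurable A ->
  mu A = (r%:E * mu (affine_map r s @^-1` A))%E.
Proof.
move=> r0 mA.
pose m' : {measure set (measurableTypeR R) -> \bar R} :=
  mscale (NngNum (ltW r0)) (image_measure mu (measurable_affine_map r s)).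
apply: (@lebesgue_measure_unique R m') => // X [[a b] _ <-].
change (mu `]a, b] = (r%:E * mu (affine_map r s @^-1` `]a, b]))%E).
have -> : affine_map r s @^-1` `]a, b] = `](a - s) / r, (b - s) / r]%classic.
  apply/seteqP; split => x /=; rewrite !in_itv/= /affine_map ltr_pdivrMr// ler_pdivlMr//;
  by rewrite ltrBlDr lerBrDr mulrC.
rewrite !lebesgue_measure_itv/= !lte_fin.
rewrite ltr_pM2r ?invr_gt0// ltrD2r.
case: ifPn => // ab; last by rewrite mule0.
rewrite -EFinM -EFinB; congr EFin; field; exact: lt0r_neq0.
Qed.

Lemma Rint_shift (u : R -> R) (a b s : R) : continuous u ->
  \int[mu]_(t in `[a + s, b + s]) u t = \int[mu]_(t in `[a, b]) u (t + s).
Proof.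
move=> cu; rewrite /Rintegral; congr fine.
have E : affine_map 1 s @^-1` `[a + s, b + s] = `[a, b]%classic.
  by apply/seteqP; split => x /=; rewrite !in_itv/= /affine_map mul1r !lerD2r.
have mu' : measurable_fun setT (EFin \o u : measurableTypeR R -> \bar R).
  by apply/measurable_EFinP; exact: continuous_measurable_fun.
have cus : continuous (u \o affine_map 1 s).
  move=> x; apply: continuous_comp; last exact: cu.
  by apply: cvgD; [apply: cvgMr; exact: cvg_id|exact: cvg_cst].
have iu : mu.-integrable (affine_map 1 s @^-1` `[a + s, b + s]) ((EFin \o u) \o affine_map 1 s).
  by rewrite E; apply: cont_integrable => x _; exact: cus.
transitivity (\int[image_measure mu (measurable_affine_map 1 s)]_(t in `[(a + s)%R, (b + s)%R]) (EFin \o u) t)%E.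
  apply: eq_measure_integral => A mA _.
  by have := lebesgue_affine s ltr01 mA; rewrite mul1e.
rewrite integral_image// E.
by apply: eq_integral => x _ /=; rewrite /affine_map mul1r.
Qed.

End AffineChange.

(** * Periodicity of integrals over a full turn *)

Section Periodic.
Variable R : realType.
Local Notation C := R[i].
Implicit Types (p : R -> C) (c s : R).

Lemma cint_shift p (a b s : R) : (forall t, rcont p t) ->
  cint (a + s) (b + s) p = cint a b (fun t => p (t + s)).
Proof.
by move=> hp; apply: complex_eq => /=; apply: Rint_shift => x;
  have [] := rcont_continuous (hp x).
Qed.

Lemma rconti_all p a b : (forall t, rcont p t) -> rconti p a b.
Proof. by move=> hp x _; exact: hp. Qed.

(** A starting point in [0, 2 pi] is treated by cutting at 2 pi and translating one piece; any other
    is moved there by whole periods, by induction on their number. *)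
Lemma cint_period p c : (forall t, rcont p t) -> (forall t, p (t + 2 * pi) = p t) ->
  cint c (c + 2 * pi) p = cint 0 (2 * pi) p.
Proof.
move=> hp pp; have p0 := pi2_gt0 R.
have S k : cint (k + 2 * pi) (k + 2 * pi + 2 * pi) p = cint k (k + 2 * pi) p.
  by rewrite cint_shift//; apply: eq_cint => t _.
have B k : 0 <= k <= 2 * pi -> cint k (k + 2 * pi) p = cint 0 (2 * pi) p.
  move=> /andP[k0 k1].
  have hpi a b : rconti p a b by exact: rconti_all.
  have k2 : 2 * pi <= k + 2 * pi by rewrite lerDr.
  rewrite (cint_cat k1 k2 (hpi _ _)).
  rewrite (cint_cat k0 k1 (hpi _ _)).
  rewrite addrC; congr (_ + _); rewrite -{1}[2 * pi]add0r cint_shift//.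
  by apply: eq_cint => t _.
have N (m : nat) : forall k, `|k| <= m%:R * (2 * pi) -> cint k (k + 2 * pi) p = cint 0 (2 * pi) p.
  elim: m => [|m IH] k.
    by rewrite mul0r normr_le0 => /eqP ->; rewrite add0r.
  rewrite -natr1 mulrDl mul1r => hk.
  have [k0|k0] := leP 0 k.
    rewrite ger0_norm// in hk.
    have [k1|k1] := leP k (2 * pi); first by apply: B; rewrite k0.
    have <- : k - 2 * pi + 2 * pi = k by rewrite subrK.
    by rewrite S; apply: IH; rewrite ger0_norm ?subr_ge0 ?(ltW k1)// lerBlDr.
  rewrite -S; rewrite ltr0_norm// in hk.
  have [k1|k1] := leP 0 (k + 2 * pi); first by apply: B; rewrite k1/=; lra.
  by apply: IH; rewrite ltr0_norm//; lra.
have [m hm] : exists m : nat, `|c| <= m%:R * (2 * pi).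
  exists (Num.Def.archi_bound (`|c| / (2 * pi))).
  rewrite -ler_pdivrMr//; apply/ltW/archi_boundP/divr_ge0 => //; exact: ltW.
exact: N hm.
Qed.

Lemma circ_int_shift (phi : C -> C) (r c : R) : (forall t, ccont phi (circle r t)) ->
  circ_int phi r c = circ_int phi r 0.
Proof.
move=> hc; rewrite /circ_int add0r; apply: cint_period.
  by move=> t; apply: rcont_comp => //; exact: circle_rcont.
by move=> t; rewrite circleD2pi.
Qed.

Lemma rcont_circleX (r : R) n t : rcont (fun t => circle r t ^+ n) t.
Proof. by apply: rcontX; exact: circle_rcont. Qed.

(* A rotation by [pi / n] changes the sign of the integrand. *)
Lemma cint_circle_pow (r : R) n c : (0 < n)%N ->
  cint c (c + 2 * pi) (fun t => circle r t ^+ n) = 0.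
Proof.
move=> n0; set p := fun t => _.
have hp t : rcont p t by exact: rcont_circleX.
have pp t : p (t + 2 * pi) = p t by rewrite /p circleD2pi.
have n0' : n%:R != 0 :> R by rewrite pnatr_eq0 -lt0n.
have ps t : p (t + pi / n%:R) = - p t.
  rewrite /p !circleX mulrDr [n%:R * (pi / _)]mulrC divfK//.
  by apply: complex_eq; rewrite /= ?cosDpi ?sinDpi mulrN.
have E : cint c (c + 2 * pi) p = - cint c (c + 2 * pi) p.
  rewrite -cintN; last exact: rconti_all.
  rewrite (@cint_period p c)// -(@cint_period p (c + pi / n%:R))//.
  rewrite (_ : c + pi / n%:R + 2 * pi = c + 2 * pi + pi / n%:R); last by ring.
  by rewrite cint_shift//; apply: eq_cint => t _.
by apply/eqP; have : cint c (c + 2 * pi) p *+ 2 == 0;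
  [rewrite mulr2n {2}E subrr|rewrite mulrn_eq0].
Qed.

End Periodic.

(** * Power series and Parseval's identity *)

Section PowerSeries.
Variable R : realType.
Local Notation C := R[i].
Implicit Types (f g : C -> C) (z w : C) (a b : nat -> C).

Definition psum a z (N : nat) : C := \sum_(n < N) a n * z ^+ n.

(** Only pointwise convergence on the disc is asked; the uniform geometric rate on smaller discs is
    recovered in [ps_tail]. *)
Definition is_ps f a := forall z, normc z < 1 -> forall e : R, 0 < e ->
  exists N0, forall N, (N0 <= N)%N -> normc (f z - psum a z N) <= e.

Lemma geo_small (q K e : R) : 0 <= q < 1 -> 0 <= K -> 0 < e ->
  exists N0, forall N, (N0 <= N)%N -> K * q ^+ N <= e.
Proof.
move=> /andP[q0 q1] K0 e0.
have K1 : 0 < K + 1 by rewrite ltr_wpDl.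
have /cvgrPdist_lt/(_ _ (divr_gt0 e0 K1)) [N0 _ H] : (fun n => q ^+ n) @ \oo --> (0 : R).
  by apply: cvg_expr; rewrite ger0_norm.
exists N0 => N /H; rewrite /= sub0r normrN ger0_norm ?exprn_ge0// ltr_pdivlMr// => h.
apply: le_trans (ltW h); rewrite mulrC ler_wpM2l ?exprn_ge0// lerDl//.
Qed.

Lemma normc_eq0_small (x : C) : (forall e : R, 0 < e -> normc x <= e) -> x = 0.
Proof.
move=> H; apply: eq0_normc; apply/eqP; rewrite eq_le normc_ge0 andbT.
by apply/ler_addgt0Pr => e e0; rewrite add0r; exact: H.
Qed.

Lemma normc_gtr (z w : C) : normc z < normc w -> w - z != 0 /\ w != 0.
Proof.
move=> zw; split; last by apply: contraTneq zw => ->; rewrite normc0 -leNgt normc_ge0.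
by rewrite subr_eq0; apply: contraTneq zw => ->; rewrite ltxx.
Qed.

Lemma geo_kernel z w N : w != 0 -> w - z != 0 ->
  w / (w - z) = \sum_(n < N) (z / w) ^+ n + (z / w) ^+ N * (w / (w - z)).
Proof.
move=> w0 wz; elim: N => [|N IH]; first by rewrite big_ord0 add0r mul1r.
rewrite big_ord_recr/= {1}IH -addrA; congr (_ + _).
by rewrite exprSr; field; rewrite w0 wz.
Qed.

Lemma circle_neq0 (r t : R) : r != 0 -> circle r t != 0.
Proof.
apply: contraNneq => H; rewrite -normr_eq0 -(normc_circ r t) H.
by rewrite normc0.
Qed.

(** On the circle, 1/w is the conjugate of a point of the circle of radius 1/r, which reduces
    negative powers to [cint_circle_pow]. *)
Lemma circ_int_invX (r : R) n c : 0 < r ->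
  circ_int (fun w => w^-1 ^+ n) r c = if n is 0 then (2 * pi)%:C else 0.
Proof.
move=> r0; have p0 := ltW (pi2_gt0 R).
have shift : c <= c + 2 * pi by rewrite lerDl.
case: n => [|n].
  rewrite /circ_int (eq_cint (q := fun=> 1)); last by move=> t _; rewrite expr0.
  by rewrite cint_cst// mulr1 addrC addKr.
rewrite circ_int_shift; last first.
  by move=> t; apply/ccontX/ccontV/circle_neq0; rewrite gt_eqF.
rewrite /circ_int add0r.
have E t : (circle r t)^-1 ^+ n.+1 = conjc (circle r^-1 t ^+ n.+1).
  by rewrite circleV ?lt0r_neq0// !circleX conj_circle mulrN.
have := @cint_circle_pow R r^-1 n.+1 0 isT; rewrite add0r /cint => -[h1 h2].
rewrite /cint; congr (_ +i* _).
  by rewrite -[RHS]h1; apply: eq_Rintegral => t _; rewrite E; case: (_ ^+ _).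
transitivity (- \int[lebesgue_measure]_(t in `[0, 2 * pi]) complex.Im (circle r^-1 t ^+ n.+1)).
  rewrite -mulN1r -RintegralZl//; last first.
    have [] := @rconti_integrable R (fun t => circle r^-1 t ^+ n.+1) 0 (2 * pi) => //.
    by move=> t _; exact: rcont_circleX.
  by apply: eq_Rintegral => t _; rewrite E mulN1r; case: (_ ^+ _).
by rewrite h2 oppr0.
Qed.

Lemma holo_cderive f z : holomorphic_disc f -> normc z < 1 -> cderive f z (cderiv f z).
Proof. by move=> hf hz; apply: derivable_cderive; exact: hf. Qed.

(** With the derivative as its value at z, the difference quotient is holomorphic off z and
    continuous at z, exactly what [goursat_except] accepts. *)
Definition dquot f z w : C :=
  if w == z then cderiv f z else (f w - f z) / (w - z).

Lemma dquot_cderive f z w : holomorphic_disc f -> normc w < 1 -> w != z ->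
  exists D, cderive (dquot f z) w D.
Proof.
move=> hf hw wz; have wz0 : w - z != 0 by rewrite subr_eq0.
have h1 : cderive (fun x => x - z) w 1.
  by have := cderiveD (cderive_id w) (cderive_cst (- z) w); rewrite addr0.
have h2 := cderiveD (holo_cderive hf hw) (cderive_cst (- f z) w).
have h3 := cderiveM h2 (cderiveV (f := fun x => x - z) wz0 h1).
eexists; apply: cderive_near (normc_gt0 wz0) _ h3 => x hx.
rewrite /dquot; case: eqP => // xz; move: hx.
by rewrite xz normcB ltxx.
Qed.

Lemma dquot_ccont f z : holomorphic_disc f -> normc z < 1 -> ccont (dquot f z) z.
Proof.
move=> hf hz e e0; have e2 : 0 < e / 2 by rewrite divr_gt0.
have [d d0 hd] := holo_cderive hf hz e2.
exists d => // w /hd; rewrite /dquot eqxx.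
case: eqVneq => [->|wz]; first by rewrite !subrr normc0.
have wz0 : w - z != 0 by rewrite subr_eq0.
rewrite -ler_pdivrMr ?normc_gt0// -normcV -normcM => h.
apply: le_lt_trans (_ : e / 2 < e); last by rewrite ltr_pdivrMr// ltr_pMr// ltr1n.
apply: le_trans h; apply: le_of_eq; congr normc; field => //.
Qed.

(** The integral does not depend on the radius, first across z and then down to 0, where the factor
    w makes it vanish. The starting angle is chosen opposite to z; for z = 0 there is nothing to
    cross. *)
Lemma cauchy_dquot f z (rho : R) : holomorphic_disc f -> normc z < rho -> rho < 1 ->
  circ_int (fun w => w * dquot f z w) rho 0 = 0.
Proof.
move=> hf zr r1; have rho0 : 0 < rho by exact: le_lt_trans (normc_ge0 z) zr.
have z1 := lt_trans zr r1.
have hd w : normc w < 1 -> w != z -> exists D, cderive (fun w => w * dquot f z w) w D.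
  move=> w1 wz; have [D HD] := dquot_cderive hf w1 wz.
  by eexists; apply: cderiveM (cderive_id w) HD.
have hc w : normc w < 1 -> ccont (fun w => w * dquot f z w) w.
  move=> w1; have [->|wz] := eqVneq w z.
    by apply: ccontM; [exact: ccont_id|exact: dquot_ccont].
  by have [D] := hd w w1 wz; exact: cderive_ccont.
have hcc r t : 0 < r -> r <= rho -> ccont (fun w => w * dquot f z w) (circle r t).
  by move=> r0 rr; apply: hc; rewrite normc_circ gtr0_norm// (le_lt_trans rr).
have [c [s [s0 sr Hc]]] : exists c s, [/\ 0 < s, s <= rho & forall r, 0 < r < s ->
    circ_int (fun w => w * dquot f z w) r c = circ_int (fun w => w * dquot f z w) rho c].
  have [z0|z0] := eqVneq z 0.
    exists 0, rho; split=> // r /andP[r0 rr]; apply: circ_int_const => //; first exact: ltW.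
    move=> s t /andP[s0 s1]; apply: hd.
      rewrite normc_circ ger0_norm; last by rewrite (le_trans _ s0)// ltW.
      exact: le_lt_trans s1 r1.
    by rewrite z0; apply: circle_neq0; rewrite gt_eqF// (lt_le_trans r0).
  have [t [_ _ zE]] := polar z0.
  exists (t - pi), (normc z); split; [exact: normc_gt0|exact: ltW|] => r /andP[r0 rr].
  apply: (@circ_int_const_except _ _ _ _ (normc z)) => //.
  - by rewrite zr andbT.
  - by rewrite -zE; exact: hc.
  - move=> w /andP[w1 w2]; rewrite -zE => wz; apply: hd => //.
    exact: le_lt_trans w2 r1.
rewrite -(@circ_int_shift _ _ _ c); last by move=> t; exact: hcc.
apply: (@circ_int_to0 _ (fun w => w * dquot f z w) s c) Hc => //.
- by move=> r t /andP[r0 rr]; apply: hcc => //; exact: ltW (lt_le_trans rr sr).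
- by apply: hc; rewrite normc0.
- by rewrite mul0r.
Qed.

Lemma holo_ccont f z : holomorphic_disc f -> normc z < 1 -> ccont f z.
Proof. by move=> hf hz; exact: cderive_ccont (holo_cderive hf hz). Qed.

Lemma holo_circ_rcont f (r t : R) : holomorphic_disc f -> 0 <= r < 1 ->
  rcont (fun t => f (circle r t)) t.
Proof.
move=> hf /andP[r0 r1]; apply: rcont_comp; last exact: circle_rcont.
by apply: holo_ccont => //; rewrite normc_circ ger0_norm.
Qed.

Lemma circ_bounded f (r : R) : (forall t, rcont (fun t => f (circle r t)) t) ->
  exists2 M, 0 <= M & forall t, normc (f (circle r t)) <= M.
Proof.
move=> hf.
have cf : {within `[0, 2 * pi], continuous (fun t => normc (f (circle r t)))}.
  apply: continuous_subspaceT => t; by have [] := rcont_continuous (hf t).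
have [|c _ hc] := EVT_max _ cf; first exact: ltW (pi2_gt0 R).
exists (normc (f (circle r c))); first exact: normc_ge0.
move=> t; have [t0 t1] : exists2 s, 0 <= s <= 2 * pi & circle r t = circle r s.
  have [r0|r0] := eqVneq r 0.
    exists 0; first by rewrite lexx ltW// pi2_gt0.
    by rewrite r0 /circle !mul0r.
  have [u [u0 u1 uE]] := polar (circle_neq0 t r0).
  have [rp|rn] := ltP 0 r.
    exists u; first by rewrite u0 ltW.
    by rewrite {1}uE normc_circ gtr0_norm.
  have rn' : r < 0 by rewrite lt_neqAle r0.
  exists (if u < pi then u + pi else u - pi); rewrite normc_circ ltr0_norm// in uE.
    have := pi_gt0 R; case: ifPn; first by move=> *; apply/andP; split; lra.
    by rewrite -leNgt => *; apply/andP; split; lra.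
  rewrite uE; case: ifPn => _; first by rewrite /circle cosDpi sinDpi; congr (_ +i* _); ring.
  have -> : u - pi = u + pi - 2 * pi by ring.
  by rewrite -[RHS]circleD2pi subrK /circle cosDpi sinDpi; congr (_ +i* _); ring.
by move=> ->; apply: hc; rewrite in_itv.
Qed.

Definition tcoef f (r : R) (n : nat) : C :=
  (2 * pi)^-1%:C * circ_int (fun w => f w * w^-1 ^+ n) r 0.

Lemma tcoef_const f (r s : R) n : holomorphic_disc f -> 0 < r < 1 -> 0 < s < 1 ->
  tcoef f r n = tcoef f s n.
Proof.
move=> hf; wlog rs : r s / r <= s.
  move=> H hr hs; have [?|/ltW ?] := leP r s; first exact: H.
  by apply/esym; exact: H.
move=> /andP[r0 _] /andP[_ s1]; rewrite /tcoef.
have -> // : circ_int (fun w => f w * w^-1 ^+ n) r 0 = circ_int (fun w => f w * w^-1 ^+ n) s 0.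
apply: (circ_int_const _ r0 rs) => x t /andP[rx xs].
have x0 : 0 < x by exact: lt_le_trans rx.
have w0 : circle x t != 0 by apply: circle_neq0; rewrite gt_eqF.
have [E HE] := cderiveX n (cderiveV w0 (cderive_id _)).
eexists; apply: cderiveM HE; apply: holo_cderive => //.
by rewrite normc_circ gtr0_norm// (le_lt_trans xs).
Qed.

(** In [cauchy_dquot] the kernel w / (w - z) is expanded into N geometric terms, which integrate to
    the partial sum minus f(z), and a remainder containing (z / w)^N. For 0 < N the sum includes the
    term n = 0, the only one to which f(z) contributes. *)
Lemma holo_psum_bound f z (rho : R) : holomorphic_disc f -> normc z < rho -> rho < 1 ->
  exists2 K, 0 <= K & forall N, (0 < N)%N ->
  normc (f z - psum (tcoef f rho) z N) <= K * (normc z / rho) ^+ N.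
Proof.
move=> hf zr r1; have rho0 : 0 < rho by exact: le_lt_trans (normc_ge0 z) zr.
have hr : 0 <= rho < 1 by rewrite ltW.
have pp := pi2_gt0 R.
have hfc t : rcont (fun t => f (circle rho t)) t by exact: holo_circ_rcont.
have [M M0 HM] := circ_bounded hfc.
have w0 t : circle rho t != 0 by apply: circle_neq0; rewrite gt_eqF.
have nw t : normc (circle rho t) = rho by rewrite normc_circ gtr0_norm.
have wz t : circle rho t - z != 0 by have [] := @normc_gtr z (circle rho t); rewrite ?nw.
have cV n t : rcont (fun t => (circle rho t)^-1 ^+ n) t.
  by apply/rcontX/(@rcont_comp _ (fun w => w^-1)); [exact: ccontV|exact: circle_rcont].
have cK t : rcont (fun t => circle rho t / (circle rho t - z)) t.
  apply: rcontM; first exact: circle_rcont.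
  apply: (@rcont_comp _ (fun w => w^-1) (fun t => circle rho t - z)); first exact: ccontV.
  by apply: rcontD; [exact: circle_rcont|exact: rcont_cst].
pose B := (M + normc (f z)) * (rho / (rho - normc z)).
have B0 : 0 <= B.
  by rewrite mulr_ge0// ?addr_ge0 ?normc_ge0// divr_ge0 ?(ltW rho0)// subr_ge0 ltW.
exists ((2 * pi)^-1 * (2 * (B * (2 * pi)))); first by apply: mulr_ge0; [rewrite invr_ge0 ltW|apply: mulr_ge0 => //; apply: mulr_ge0 => //; exact: ltW].
move=> N N0.
pose T n t := z ^+ n * (f (circle rho t) * (circle rho t)^-1 ^+ n) +
  - (f z * z ^+ n) * (circle rho t)^-1 ^+ n.
pose Rm t := (f (circle rho t) - f z) * (z * (circle rho t)^-1) ^+ N *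
   (circle rho t / (circle rho t - z)).
have cT1 n : rconti (fun t => z ^+ n * (f (circle rho t) * (circle rho t)^-1 ^+ n)) 0 (2 * pi).
  by move=> t _; apply: rcontM; [exact: rcont_cst|apply: rcontM].
have cT2 n : rconti (fun t => - (f z * z ^+ n) * (circle rho t)^-1 ^+ n) 0 (2 * pi).
  by move=> t _; apply: rcontM => //; exact: rcont_cst.
have cT n : rconti (T n) 0 (2 * pi) by move=> t ht; apply: rcontD; [exact: cT1|exact: cT2].
have cR : rconti Rm 0 (2 * pi).
  move=> t _; apply: rcontM => //; apply: rcontM.
    by apply: rcontD => //; exact: rcont_cst.
  apply/rcontX/rcontM; first exact: rcont_cst.
  by have := cV 1%N t; under eq_fun do rewrite expr1.
have E : cint 0 (2 * pi) (fun t => \sum_(n < N) T n t + Rm t) = 0.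
  have := cauchy_dquot hf zr r1; rewrite /circ_int add0r => H.
  rewrite -[RHS]H; apply: eq_cint => t _; rewrite /dquot.
  rewrite -subr_eq0 (negbTE (wz t)).
  have -> : circle rho t * ((f (circle rho t) - f z) / (circle rho t - z)) =
    (f (circle rho t) - f z) * (circle rho t / (circle rho t - z)).
    by field; exact: wz.
  rewrite (geo_kernel N (w0 t) (wz t)) mulrDr /Rm.
  rewrite -[in LHS](mulrA (f (circle rho t) - f z)); congr (_ + _).
  rewrite mulr_sumr; apply: eq_bigr => n _; rewrite /T exprMn; ring.
rewrite cintD in E; [|exact: rconti_sum|exact: cR].
rewrite cint_sum// in E.
have tE n : (2 * pi)%:C * tcoef f rho n =
    cint 0 (2 * pi) (fun t => f (circle rho t) * (circle rho t)^-1 ^+ n).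
  by rewrite /tcoef mulrA -rmorphM/= divff ?gt_eqF// mul1r /circ_int add0r.
have ET n : cint 0 (2 * pi) (T n) =
    z ^+ n * ((2 * pi)%:C * tcoef f rho n) - (if n == 0%N then (2 * pi)%:C * f z else 0).
  rewrite cintD; [|exact: cT1|exact: cT2].
  rewrite !cintZ; [|by move=> t _; exact: cV|by move=> t _; apply: rcontM].
  have := @circ_int_invX rho n 0 rho0; rewrite /circ_int add0r => ->.
  rewrite tE.
  congr (_ + _); case: n => [|n] /=; first by rewrite expr0; ring.
  by rewrite mulr0 oppr0.
have E2 : (2 * pi)%:C * (f z - psum (tcoef f rho) z N) = cint 0 (2 * pi) Rm.
  have S : \sum_(i < N) cint 0 (2 * pi) (T i) =
      (2 * pi)%:C * psum (tcoef f rho) z N - (2 * pi)%:C * f z.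
    under eq_bigr do rewrite ET; rewrite sumrB /psum mulr_sumr.
    have -> : \sum_(i < N) (if i == 0%N :> nat then (2 * pi)%:C * f z else 0) = (2 * pi)%:C * f z.
      by case: N N0 {Rm cR E} => // N' _; rewrite big_ord_recl/= big1 ?addr0.
    by congr (_ - _); apply: eq_bigr => n _; ring.
  by move: E; rewrite S => /eqP; rewrite addrC addr_eq0 => /eqP ->; ring.
have -> : f z - psum (tcoef f rho) z N = (2 * pi)^-1%:C * cint 0 (2 * pi) Rm.
  by rewrite -E2 mulrA -rmorphM/= mulVf ?gt_eqF// mul1r.
rewrite normcM normcR gtr0_norm ?invr_gt0// -(mulrA (2 * pi)^-1) ler_pM2l ?invr_gt0//.
have Rb t : 0 <= t <= 2 * pi -> normc (Rm t) <= B * (normc z / rho) ^+ N.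
  move=> _; rewrite /Rm !normcM normcX normcM !normcV nw /B mulrAC.
  apply: ler_wpM2r; first by rewrite exprn_ge0// divr_ge0 ?normc_ge0// ltW.
  have nz : 0 < rho - normc z by rewrite subr_gt0.
  have dz : rho - normc z <= normc (circle rho t - z) by have := ler_normcB (circle rho t) z; rewrite nw.
  apply: ler_pM; first exact: normc_ge0.
  - by rewrite divr_ge0 ?normc_ge0// ltW.
  - by apply: normcD_le; rewrite normcN lerD2r.
  by rewrite ler_pM2l// lef_pV2// posrE// (lt_le_trans nz).
apply: le_trans (cint_bound (ltW pp) cR Rb) _.
by rewrite subr0; apply: le_of_eq; ring.
Qed.

(** The coefficients are read at radius 1/2; [tcoef_const] moves them to a radius between |z| and 1,
    where the remainder estimate applies. *)
Lemma holo_ps f : holomorphic_disc f -> exists a, is_ps f a.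
Proof.
move=> hf; exists (tcoef f 2^-1) => z z1 e e0.
pose rho := (normc z + 1) / 2.
have zr : normc z < rho by rewrite /rho; lra.
have r1 : rho < 1 by rewrite /rho; lra.
have r0 : 0 < rho by exact: le_lt_trans (normc_ge0 z) zr.
have [K K0 HK] := holo_psum_bound hf zr r1.
have q01 : 0 <= normc z / rho < 1.
  by rewrite divr_ge0 ?normc_ge0 ?(ltW r0)//= ltr_pdivrMr// mul1r.
have [N0 HN0] := geo_small q01 K0 e0.
exists N0.+1 => N hN.
have -> : psum (tcoef f 2^-1) z N = psum (tcoef f rho) z N.
  apply: eq_bigr => n _; rewrite (@tcoef_const f 2^-1 rho)//.
    by rewrite invr_gt0 ltr0n invf_lt1 ?ltr1n.
  by rewrite r0.
apply: le_trans (HK N _) (HN0 N _); first exact: leq_ltn_trans hN.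
exact: ltnW.
Qed.

End PowerSeries.

(** * Convergence and termwise differentiation of power series *)

Section PowerSeriesTheory.
Variable R : realType.
Local Notation C := R[i].
Implicit Types (f g : C -> C) (z w : C) (a b u : nat -> C).

Lemma geo_sum_bound (M q : R) (m n : nat) : 0 <= M -> 0 <= q < 1 ->
  \sum_(m <= i < n) M * q ^+ i <= M * q ^+ m / (1 - q).
Proof.
move=> M0 /andP[q0 q1]; have q1' : 0 < 1 - q by rewrite subr_gt0.
have [mn|nm] := leqP m n; last first.
  by rewrite big_geq ?(ltnW nm)// divr_ge0 ?(ltW q1')// mulr_ge0// exprn_ge0.
rewrite ler_pdivlMr//.
have -> : (\sum_(m <= i < n) M * q ^+ i) * (1 - q) = M * (q ^+ m - q ^+ n).
  elim: n mn => [|n IH] mn.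
    by move: mn; rewrite leqn0 => /eqP ->; rewrite big_geq// subrr mulr0 mul0r.
  have [mn'|mn'] := leqP m n.
    by rewrite big_nat_recr//= mulrDl IH// exprS; ring.
  have -> : m = n.+1 by apply/eqP; rewrite eqn_leq mn mn'.
  by rewrite big_geq// subrr mulr0 mul0r.
by rewrite ler_wpM2l// gerBl exprn_ge0.
Qed.

Lemma sum_tail_bound u (M q : R) m n : 0 <= M -> 0 <= q < 1 -> (m <= n)%N ->
  (forall i, normc (u i) <= M * q ^+ i) ->
  normc (\sum_(i < n) u i - \sum_(i < m) u i) <= M * q ^+ m / (1 - q).
Proof.
move=> M0 q01 mn hu.
have -> : \sum_(i < n) u i - \sum_(i < m) u i = \sum_(m <= i < n) u i.
  by rewrite -!(big_mkord xpredT u) (big_cat_nat (leq0n m) mn)/=; ring.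
apply: le_trans (normc_sum _ _ _) _.
by apply: le_trans (geo_sum_bound m n M0 q01); apply: ler_sum => i _.
Qed.

Lemma csum_geo u (M q : R) : 0 <= M -> 0 <= q < 1 ->
  (forall i, normc (u i) <= M * q ^+ i) ->
  exists s, forall N, normc (s - \sum_(i < N) u i) <= M * q ^+ N / (1 - q).
Proof.
move=> M0 q01 hu; have [q0 q1] := andP q01.
have K (v : nat -> R) : (forall i, `|v i| <= normc (u i)) ->
    exists l : R, (fun N => \sum_(i < N) v i) @ \oo --> l.
  move=> hv; have H : cvgn [series `|v n|]_n.
    apply: (@series_le_cvg _ _ (fun n => M * q ^+ n)) => //.
    - by move=> n; exact: normr_ge0.
    - by move=> n; rewrite mulr_ge0// exprn_ge0.
    - by move=> n; exact: le_trans (hv n) (hu n).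
    - by apply: is_cvg_geometric_series; rewrite ger0_norm.
  have /cvg_ex[l hl] := normed_cvg H; exists l.
  rewrite (_ : (fun N => _) = [series v n]_n)//.
  by apply/funext => n; rewrite /series/= big_mkord.
have [x hx] := K (fun i => complex.Re (u i)) (fun i => Re_le_normc (u i)).
have [y hy] := K (fun i => complex.Im (u i)) (fun i => Im_le_normc (u i)).
exists (x +i* y) => N; apply/ler_addgt0Pr => e e0.
have e2 : 0 < e / 2 by rewrite divr_gt0.
move/cvgrPdist_lt : hx => /(_ _ e2)[N1 _ H1]; move/cvgrPdist_lt : hy => /(_ _ e2)[N2 _ H2].
pose K0 := maxn N (maxn N1 N2).
have -> : (x +i* y) - \sum_(i < N) u i = (\sum_(i < K0) u i - \sum_(i < N) u i) +
   ((x +i* y) - \sum_(i < K0) u i) by ring.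
apply: normcD_le; apply: lerD.
  by apply: sum_tail_bound => //; exact: leq_maxl.
apply: le_trans (normc_le_ReIm _) _; rewrite ReD ReN ImD ImN Re_sum Im_sum/= [e]splitr.
apply: lerD; apply: ltW; [apply: H1|apply: H2]; rewrite /= /K0 !leq_max leqnn ?orbT//.
Qed.

(** This says that the radius of convergence is at least 1; see [is_ps_cbd] and [pssumP]. *)
Definition cbd a := forall r : R, 0 <= r < 1 ->
  exists2 M, 0 <= M & forall n, normc (a n) * r ^+ n <= M.

Lemma is_ps_cbd f a : is_ps f a -> cbd a.
Proof.
move=> ha r /andP[r0 r1].
have rn : normc (r%:C : C) = r by rewrite normcR ger0_norm.
have [|N0 HN0] := ha r%:C _ 1 ltr01; first by rewrite rn.
have H n : (N0 <= n)%N -> normc (a n) * r ^+ n <= 2.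
  move=> hn; rewrite -[X in _ * X ^+ _]rn -normcX -normcM.
  have -> : a n * (r%:C) ^+ n = (f r%:C - psum a r%:C n) - (f r%:C - psum a r%:C n.+1).
    by rewrite /psum big_ord_recr/=; ring.
  apply: normcD_le; rewrite normcN.
  have := HN0 n hn; have := HN0 n.+1 (leqW hn); lra.
have S0 : 0 <= \sum_(i < N0) normc (a i) * r ^+ i.
  by apply: sumr_ge0 => i _; rewrite mulr_ge0 ?normc_ge0 ?exprn_ge0.
exists (2 + \sum_(i < N0) normc (a i) * r ^+ i); first by rewrite addr_ge0.
move=> n; have [hn|hn] := leqP N0 n.
  by apply: le_trans (H n hn) _; rewrite lerDl.
apply: le_trans (_ : \sum_(i < N0) normc (a i) * r ^+ i <= _); last by rewrite lerDr.
rewrite (bigD1 (Ordinal hn))//= lerDl; apply: sumr_ge0 => i _.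
by rewrite mulr_ge0 ?normc_ge0 ?exprn_ge0.
Qed.

Lemma cbd_geo a (r : R) : cbd a -> 0 <= r < 1 -> exists M q, [/\ 0 <= M, 0 <= q < 1 &
  forall n, normc (a n) * r ^+ n <= M * q ^+ n].
Proof.
move=> ha /andP[r0 r1]; pose s := (r + 1) / 2.
have s0 : 0 < s by rewrite /s; lra.
have rs : r < s by rewrite /s; lra.
have s1 : s < 1 by rewrite /s; lra.
have [|M M0 HM] := ha s; first by rewrite (ltW s0).
exists M, (r / s); split => //.
  by rewrite divr_ge0 ?(ltW s0)//= ltr_pdivrMr// mul1r.
move=> n; rewrite expr_div_n mulrA ler_pdivlMr ?exprn_gt0//.
by rewrite mulrAC ler_wpM2r ?exprn_ge0.
Qed.

(** Each of the n terms q^i with i < n is at least q^n. *)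
Lemma nat_geo_bound (q : R) n : 0 <= q < 1 -> n%:R * q ^+ n <= (1 - q)^-1.
Proof.
move=> /andP[q0 q1].
have H : \sum_(i < n) q ^+ i <= (1 - q)^-1.
  have := @geo_sum_bound 1 q 0 n ler01; rewrite q0 q1 expr0 mulr1 mul1r => /(_ isT).
  by rewrite big_mkord; under eq_bigr do rewrite mul1r.
apply: le_trans H; rewrite mulr_natl -[n in _ *+ n]card_ord -sumr_const.
by apply: ler_sum => i _; apply: ler_wiXn2l => //; [exact: ltW|exact: ltnW].
Qed.

Lemma cbd_natmul a : cbd a -> cbd (fun n => n%:R * a n).
Proof.
move=> ha r r01; have [M [q [M0 q01 H]]] := cbd_geo ha r01.
have [q0 q1] := andP q01; have q1' : 0 < 1 - q by rewrite subr_gt0.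
exists (M * (1 - q)^-1); first by rewrite mulr_ge0// invr_ge0 ltW.
move=> n; rewrite normcM.
have -> : normc (n%:R : C) = n%:R by rewrite -(rmorph_nat (real_complex R)) normcR ger0_norm.
rewrite -mulrA; apply: le_trans (ler_wpM2l (ler0n _ _) (H n)) _.
by rewrite mulrCA ler_wpM2l// nat_geo_bound.
Qed.

Lemma cbd_shift a : cbd a -> cbd (fun n => a n.+1).
Proof.
move=> ha r /andP[r0 r1]; pose s := Num.max r 2^-1.
have s0 : 0 < s by rewrite lt_max invr_gt0 ltr0n orbT.
have rs : r <= s by rewrite le_max lexx.
have s1 : s < 1 by rewrite gt_max r1 invf_lt1 ?ltr1n.
have [|M M0 HM] := ha s; first by rewrite (ltW s0).
exists (M / s); first by rewrite divr_ge0// ltW.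
move=> n; rewrite ler_pdivlMr//; apply: le_trans (HM n.+1).
rewrite exprSr mulrA ler_wpM2r ?(ltW s0)// ler_wpM2l ?normc_ge0//.
by apply: lerXn2r; rewrite ?nnegrE ?(ltW s0).
Qed.

Definition dcoef a n : C := n.+1%:R * a n.+1.

Lemma cbd_dcoef a : cbd a -> cbd (dcoef a).
Proof. by move=> /cbd_natmul/cbd_shift. Qed.

Lemma normcXle (z : C) (r : R) n : normc z <= r -> normc (z ^+ n) <= r ^+ n.
Proof.
move=> zr; rewrite normcX; apply: lerXn2r => //.
  by rewrite nnegrE normc_ge0.
by rewrite nnegrE (le_trans _ zr)// normc_ge0.
Qed.

Lemma ps_tail f a (r : R) : is_ps f a -> 0 <= r < 1 -> exists M q, [/\ 0 <= M, 0 <= q < 1 &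
  forall z N, normc z <= r -> normc (f z - psum a z N) <= M * q ^+ N].
Proof.
move=> ha r01; have [M [q [M0 q01 H]]] := cbd_geo (is_ps_cbd ha) r01.
have [q0 q1] := andP q01; have q1' : 0 < 1 - q by rewrite subr_gt0.
exists (M / (1 - q)), q; split => //; first by rewrite divr_ge0// ltW.
move=> z N zr; have z1 : normc z < 1 by case/andP: r01 => _; exact: le_lt_trans.
apply/ler_addgt0Pr => e e0; have [N0 HN0] := ha z z1 e e0.
have -> : f z - psum a z N = (psum a z (maxn N N0) - psum a z N) + (f z - psum a z (maxn N N0)).
  by ring.
apply: normcD_le; apply: lerD; last by apply: HN0; exact: leq_maxr.
rewrite mulrAC; apply: (@sum_tail_bound (fun n => a n * z ^+ n)) => //; first exact: leq_maxl.
move=> i; apply: le_trans (H i); rewrite normcM ler_wpM2l ?normc_ge0//.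
exact: normcXle.
Qed.

(** The sum is chosen by [xget], with default 0 at points of divergence. *)
Definition pssum a z : C := xget 0 [set s | forall e : R, 0 < e ->
  exists N0, forall N, (N0 <= N)%N -> normc (s - psum a z N) <= e].

Lemma pssumP a : cbd a -> is_ps (pssum a) a.
Proof.
move=> ha z z1; suff ex : exists s, [set s | forall e : R, 0 < e ->
    exists N0, forall N, (N0 <= N)%N -> normc (s - psum a z N) <= e] s.
  exact: (xgetPex 0 ex).
have z01 : 0 <= normc z < 1 by rewrite normc_ge0.
have [M [q [M0 q01 H]]] := cbd_geo ha z01.
have [|s Hs] := @csum_geo (fun n => a n * z ^+ n) M q M0 q01.
  by move=> i; rewrite normcM normcX.
exists s => e e0; have [q0 q1] := andP q01; have q1' : 0 < 1 - q by rewrite subr_gt0.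
have [N0 HN0] := geo_small q01 (divr_ge0 M0 (ltW q1')) e0.
exists N0 => N hN; apply: le_trans (Hs N) _; rewrite mulrAC; exact: HN0.
Qed.

(** Induction through w^(n+1) = w w^n. Writing r^n / r^2 avoids the exponent n - 2, which would be
    truncated for small n. *)
Lemma exprn_taylor1 (z w : C) (r : R) n : 0 < r -> normc z <= r -> normc w <= r ->
  normc (w ^+ n - z ^+ n - n%:R * z ^+ n.-1 * (w - z)) <=
    n%:R ^+ 2 * r ^+ n / r ^+ 2 * normc (w - z) ^+ 2.
Proof.
move=> r0 zr wr; elim: n => [|n IH].
  by rewrite !expr0 subrr !mul0r subrr normc0 expr0n/= !mul0r.
have -> : w ^+ n.+1 - z ^+ n.+1 - n.+1%:R * z ^+ n.+1.-1 * (w - z) =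
  w * (w ^+ n - z ^+ n - n%:R * z ^+ n.-1 * (w - z)) + n%:R * z ^+ n.-1 * (w - z) ^+ 2.
  rewrite !exprS /= -natr1; case: n {IH} => [|n] /=; first by rewrite !expr0; ring.
  by rewrite !exprS; ring.
apply: normcD_le; rewrite !normcM !normcX.
have nn : normc (n%:R : C) = n%:R by rewrite -(rmorph_nat (real_complex R)) normcR ger0_norm.
rewrite nn; set d := normc (w - z) in IH *.
have r2 : 0 < r ^+ 2 by rewrite exprn_gt0.
apply: le_trans (_ : r * (n%:R ^+ 2 * r ^+ n / r ^+ 2 * d ^+ 2) + n%:R * (r ^+ n.+1 / r ^+ 2) * d ^+ 2 <= _).
  apply: lerD; first by apply: ler_pM => //; exact: normc_ge0.
  rewrite ler_wpM2r ?sqr_ge0//; case: n {IH nn} => [|n]; first by rewrite !mul0r.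
  rewrite ler_wpM2l// ler_pdivlMr// -[n.+2]addn2 exprD ler_wpM2r ?exprn_ge0 ?(ltW r0)//=.
  by apply: lerXn2r; rewrite ?nnegrE ?normc_ge0 ?(ltW r0).
have -> : r * (n%:R ^+ 2 * r ^+ n / r ^+ 2 * d ^+ 2) + n%:R * (r ^+ n.+1 / r ^+ 2) * d ^+ 2 =
  (n%:R ^+ 2 + n%:R) * (r ^+ n.+1 / r ^+ 2 * d ^+ 2).
  by rewrite (exprS r n); field; rewrite gt_eqF.
rewrite -(mulrA (n.+1%:R ^+ 2)) -(mulrA (n.+1%:R ^+ 2)) ler_wpM2r//.
  by rewrite mulr_ge0 ?sqr_ge0// divr_ge0 ?exprn_ge0 ?(ltW r0)//.
by rewrite -natr1 sqrrD expr1n mulr1 -addrA lerD2l mulr2n -addrA lerDl addr_ge0.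
Qed.

Lemma psum_dcoef a z N : psum (dcoef a) z N = \sum_(n < N.+1) n%:R * a n * z ^+ n.-1.
Proof.
rewrite big_ord_recl/= mul0r mul0r add0r; apply: eq_bigr => n _.
by rewrite /dcoef /bump leq0n add1n add0n.
Qed.

(** The remainders of [exprn_taylor1] add up to at most K |w - z|^2, because n^2 |a_n| r^n is
    dominated by a geometric sequence. The tails of the three series involved are absorbed in an
    arbitrary e. *)
Lemma is_ps_cderive f a z : is_ps f a -> normc z < 1 ->
  cderive f z (pssum (dcoef a) z).
Proof.
move=> ha z1; have cb := is_ps_cbd ha; have hb := pssumP (cbd_dcoef cb).
pose r := (normc z + 1) / 2.
have zr : normc z < r by rewrite /r; lra.
have r1 : r < 1 by rewrite /r; lra.
have r0 : 0 < r by exact: le_lt_trans (normc_ge0 z) zr.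
have r01 : 0 <= r < 1 by rewrite (ltW r0).
have [M [q [M0 q01 H]]] := cbd_geo (cbd_natmul (cbd_natmul cb)) r01.
have [q0 q1] := andP q01; have q1' : 0 < 1 - q by rewrite subr_gt0.
pose K := M / (1 - q) / r ^+ 2.
have K0 : 0 <= K by rewrite !divr_ge0 ?exprn_ge0 ?(ltW r0) ?(ltW q1').
have key w : normc w <= r ->
    normc (f w - f z - pssum (dcoef a) z * (w - z)) <= K * normc (w - z) ^+ 2.
  move=> wr; have w1 : normc w < 1 by exact: le_lt_trans wr r1.
  apply/ler_addgt0Pr => e e0.
  pose e' := e / (2 + normc (w - z)).
  have d2 : 0 < 2 + normc (w - z) by rewrite ltr_wpDr ?normc_ge0.
  have e'0 : 0 < e' by rewrite divr_gt0.
  have [N1 H1] := ha w w1 e' e'0; have [N2 H2] := ha z z1 e' e'0.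
  have [N3 H3] := hb z z1 e' e'0.
  pose N := maxn N1 (maxn N2 N3).
  have -> : f w - f z - pssum (dcoef a) z * (w - z) =
    (psum a w N.+1 - psum a z N.+1 - psum (dcoef a) z N * (w - z)) +
    ((f w - psum a w N.+1) - (f z - psum a z N.+1) -
     (pssum (dcoef a) z - psum (dcoef a) z N) * (w - z)) by ring.
  apply: normcD_le; apply: lerD; last first.
    apply: normcD_le.
    apply: le_trans (lerD (le_normcD _ _) (lexx _)) _; rewrite !normcN normcM.
    have h1 := H1 N.+1 (leqW (leq_maxl _ _)).
    have h2 : normc (f z - psum a z N.+1) <= e'.
      by apply: H2; apply: leqW; rewrite /N !leq_max leqnn !orbT.
    have h3 : normc (pssum (dcoef a) z - psum (dcoef a) z N) <= e'.
      by apply: H3; rewrite /N !leq_max leqnn !orbT.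
    have -> : e = e' + e' + e' * normc (w - z) by rewrite /e'; field; rewrite gt_eqF.
    by apply: lerD; [apply: lerD|rewrite ler_wpM2r ?normc_ge0].
  have -> : psum a w N.+1 - psum a z N.+1 - psum (dcoef a) z N * (w - z) =
    \sum_(n < N.+1) a n * (w ^+ n - z ^+ n - n%:R * z ^+ n.-1 * (w - z)).
    rewrite psum_dcoef /psum mulr_suml -!sumrB; apply: eq_bigr => n _; ring.
  apply: le_trans (normc_sum _ _ _) _.
  apply: le_trans (_ : \sum_(n < N.+1) (M * q ^+ n) / r ^+ 2 * normc (w - z) ^+ 2 <= _).
    apply: ler_sum => n _; rewrite normcM.
    apply: le_trans (ler_wpM2l (normc_ge0 _) (exprn_taylor1 n r0 (ltW zr) wr)) _.
    rewrite (_ : normc (a n) * _ =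
      (normc (n%:R * (n%:R * a n)) * r ^+ n) / r ^+ 2 * normc (w - z) ^+ 2).
      rewrite ler_wpM2r ?sqr_ge0//.
      by rewrite ler_wpM2r ?invr_ge0 ?exprn_ge0 ?(ltW r0).
    rewrite !normcM (_ : normc (n%:R : C) = n%:R); first by ring.
    by rewrite -(rmorph_nat (real_complex R)) normcR ger0_norm.
  rewrite -mulr_suml -mulr_suml ler_wpM2r ?sqr_ge0// ler_wpM2r ?invr_ge0 ?exprn_ge0 ?(ltW r0)//.
  by have := geo_sum_bound 0 N.+1 M0 q01; rewrite big_mkord expr0 mulr1.
move=> e e0; exists (Num.min (r - normc z) (e / (K + 1))).
  by rewrite lt_min subr_gt0 zr divr_gt0// ltr_wpDl.
move=> w; rewrite lt_min => /andP[w1 w2].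
have wr : normc w <= r.
  have := le_normcD (w - z) z; rewrite subrK; lra.
apply: le_trans (key w wr) _; rewrite expr2 mulrA ler_wpM2r ?normc_ge0//.
move: w2; rewrite ltr_pdivlMr ?ltr_wpDl// => /ltW; apply: le_trans.
by rewrite mulrDr mulr1 mulrC lerDl normc_ge0.
Qed.

Lemma is_ps_holo f a : is_ps f a -> holomorphic_disc f.
Proof.
move=> ha z hz; have [] := cderive_derivable (is_ps_cderive ha hz) => //.
Qed.

Lemma is_ps_ext f g a : is_ps f a -> (forall z, normc z < 1 -> f z = g z) -> is_ps g a.
Proof. by move=> ha fg z z1; rewrite -fg//; exact: ha. Qed.

Lemma is_ps_cderiv f a : is_ps f a -> is_ps (cderiv f) (dcoef a).
Proof.
move=> ha; apply: is_ps_ext (pssumP (cbd_dcoef (is_ps_cbd ha))) _ => z z1.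
by have [_ ->] := cderive_derivable (is_ps_cderive ha z1).
Qed.

Lemma holo_cderiv f : holomorphic_disc f -> holomorphic_disc (cderiv f).
Proof. by move=> /holo_ps[a] /is_ps_cderiv/is_ps_holo. Qed.

End PowerSeriesTheory.

(** * Parseval's identity and the norm in terms of coefficients *)

Section Parseval.
Variable R : realType.
Local Notation C := R[i].
Local Notation mu := (@lebesgue_measure R).
Implicit Types (f g : C -> C) (z w : C) (a b : nat -> C) (p : R -> C).

Lemma cint_conj p (s t : R) : rconti p s t ->
  cint s t (fun x => conjc (p x)) = conjc (cint s t p).
Proof.
move=> hp; have [h1 h2 _] := rconti_integrable hp.
apply: complex_eq => /=; first by apply: eq_Rintegral => x _; case: (p x).
rewrite -mulN1r -RintegralZl//.
by apply: eq_Rintegral => x _; rewrite mulN1r; case: (p x).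
Qed.

Lemma conjM z w : conjc (z * w) = conjc z * conjc w.
Proof. exact: rmorphM. Qed.

Lemma conjX z n : conjc (z ^+ n) = conjc z ^+ n.
Proof. exact: rmorphXn. Qed.

Lemma conjI z : conjc (conjc z) = z.
Proof. by case: z => x y; rewrite /= opprK. Qed.

Lemma conj_circleM (r t : R) : circle r t * conjc (circle r t) = (r ^+ 2)%:C.
Proof. by rewrite mulcJ normc_circ real_normK ?num_real. Qed.

Lemma circle_orth (r : R) n m c :
  cint c (c + 2 * pi) (fun t => circle r t ^+ n * conjc (circle r t) ^+ m) =
  if n == m then (2 * pi * r ^+ (n + n))%:C else 0.
Proof.
have p0 := pi2_gt0 R.
have H k l : (k < l)%N ->
    cint c (c + 2 * pi) (fun t => circle r t ^+ l * conjc (circle r t) ^+ k) = 0.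
  move=> kl; rewrite (eq_cint (q := fun t => (r ^+ 2)%:C ^+ k * circle r t ^+ (l - k))).
    rewrite cintZ; last by move=> t _; exact: rcont_circleX.
    by rewrite cint_circle_pow ?mulr0// subn_gt0.
  by move=> t _; rewrite -(conj_circleM r t) exprMn mulrAC -exprD subnKC// ltnW.
have [<-|nm] := eqVneq n m.
  rewrite (eq_cint (q := fun=> (r ^+ (n + n))%:C)).
    rewrite cint_cst; last by rewrite lerDl ltW.
    by rewrite -rmorphM addrAC subrr add0r.
  by move=> t _; rewrite -exprMn conj_circleM -rmorphXn/= -exprM mul2n addnn.
have [nm'|mn'] := ltnP m n; first exact: H.
rewrite (eq_cint (q := fun t => conjc (circle r t ^+ m * conjc (circle r t) ^+ n))).
  rewrite cint_conj.
    by rewrite H ?conjc0// ltn_neqAle nm mn'.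
  by move=> t _; apply: rcontM; [exact: rcont_circleX|apply/rcontX/rconti_conj/circle_rcont].
by move=> t _; rewrite conjM !conjX conjI mulrC.
Qed.

Definition mean2 f (r c : R) : R :=
  \int[mu]_(t in `[c, c + 2 * pi]) (normc (f (circle r t)) ^+ 2).

Definition sq_coef a (r : R) N : R := \sum_(n < N) normc (a n) ^+ 2 * r ^+ (n + n).

Lemma psum_parseval a (r c : R) N :
  mean2 (fun z => psum a z N) r c = 2 * pi * sq_coef a r N.
Proof.
apply: complexI.
have E : cint c (c + 2 * pi) (fun t => (normc (psum a (circle r t) N) ^+ 2)%:C) =
    (mean2 (fun z => psum a z N) r c)%:C.
  by apply: complex_eq => //=; rewrite /Rintegral integral0.
rewrite -E.
pose G n m t := (a n * conjc (a m)) * (circle r t ^+ n * conjc (circle r t) ^+ m).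
have cG0 n m : rconti (fun t => circle r t ^+ n * conjc (circle r t) ^+ m) c (c + 2 * pi).
  by move=> t _; apply: rcontM; [exact: rcont_circleX|apply/rcontX/rconti_conj/circle_rcont].
have cG n m : rconti (G n m) c (c + 2 * pi) by apply: rcontiZ.
rewrite (eq_cint (q := fun t => \sum_(n < N) \sum_(m < N) G n m t)); last first.
  move=> t _; rewrite -mulcJ /psum rmorph_sum mulr_suml; apply: eq_bigr => n _.
  by rewrite mulr_sumr; apply: eq_bigr => m _; rewrite /G rmorphM rmorphXn/=; ring.
rewrite (@cint_sum R N (fun n t => \sum_(m < N) G n m t)); last by move=> n; exact: rconti_sum.
rewrite /sq_coef mulr_sumr rmorph_sum/=; apply: eq_bigr => n _.
rewrite cint_sum// (bigD1 n)//= cintZ// circle_orth eqxx big1 ?addr0.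
  by rewrite mulcJ -rmorphM; congr (_%:C); ring.
by move=> m mn; rewrite cintZ// circle_orth ifN ?mulr0// eq_sym; exact: mn.
Qed.

Lemma Rint_dist (u v : R -> R) (s t e : R) : s <= t ->
  (forall x, s <= x <= t -> {for x, continuous u}) ->
  (forall x, s <= x <= t -> {for x, continuous v}) ->
  (forall x, s <= x <= t -> `|u x - v x| <= e) ->
  `|\int[mu]_(x in `[s, t]) u x - \int[mu]_(x in `[s, t]) v x| <= e * (t - s).
Proof.
move=> st cu cv H; have iu := cont_integrable cu.
have iv := cont_integrable cv.
rewrite -RintegralB//.
have iuv : mu.-integrable `[s, t] (EFin \o (fun x => u x - v x)).
  by apply: cont_integrable => x hx; apply: cvgB; [exact: cu|exact: cv].
apply: le_trans (le_normr_Rintegral _ iuv) _ => //.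
have -> : e * (t - s) = \int[mu]_(x in `[s, t]) e.
  rewrite Rintegral_cst//= lebesgue_measure_itv/= lte_fin.
  move: st; rewrite le_eqVlt => /predU1P[->|->]//.
  by rewrite ltxx subrr mulr0.
apply: le_Rintegral => //; first exact: integrable_norm iuv.
  by apply: cont_integrable => x _; exact: cvg_cst.
Qed.

Lemma normc2_continuous p x : rcont p x -> {for x, continuous (fun t => normc (p t) ^+ 2)}.
Proof. by move=> /rcont_continuous[_ _ h]; exact: (cvgM h h). Qed.

Lemma psum_holo a N z : exists D, cderive (fun z => psum a z N) z D.
Proof.
elim: N => [|N [D IH]].
  exists 0; rewrite (_ : (fun z => _) = fun=> 0); first exact: cderive_cst.
  by apply/funext => w; rewrite /psum big_ord0.
have [E HE] := cderiveX N (cderive_id z).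
exists (D + (a N * E + z ^+ N * 0)).
rewrite (_ : (fun z => _) = fun z => psum a z N + a N * z ^+ N).
  exact: cderiveD IH (cderiveM (cderive_cst (a N) z) HE).
by apply/funext => w; rewrite /psum big_ord_recr.
Qed.

(** |f|^2 and |psum|^2 are compared by factoring the difference of squares; the uniform rate of
    [ps_tail] then gives a geometric error. *)
Lemma parseval f a (r c : R) : is_ps f a -> 0 <= r < 1 ->
  exists K q, [/\ 0 <= K, 0 <= q < 1 &
   forall N, `|mean2 f r c - 2 * pi * sq_coef a r N| <= K * q ^+ N].
Proof.
move=> ha r01; have [M [q [M0 q01 H]]] := ps_tail ha r01.
have [q0 q1] := andP q01; have p0 := pi2_gt0 R.
have hf t : rcont (fun t => f (circle r t)) t.
  exact: holo_circ_rcont (is_ps_holo ha) r01.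
have [B B0 HB] := circ_bounded hf.
exists ((M * (M + 2 * B)) * (2 * pi)), q; split => //.
  by nonneg.
move=> N; rewrite -(psum_parseval a r c N).
have -> : M * (M + 2 * B) * (2 * pi) * q ^+ N =
  (M * (M + 2 * B) * q ^+ N) * (c + 2 * pi - c) by ring.
apply: Rint_dist.
- by rewrite lerDl ltW.
- by move=> x _; exact: normc2_continuous.
- move=> x _; apply: normc2_continuous.
  apply: (@rcont_comp _ (fun z => psum a z N)); last exact: circle_rcont.
  by have [D] := psum_holo a N (circle r x); exact: cderive_ccont.
move=> x _; set F := f _; set P := psum _ _ _.
have FP : normc (F - P) <= M * q ^+ N.
  by apply: H; rewrite normc_circ ger0_norm//; case/andP: r01.
have qN1 : q ^+ N <= 1 by exact: exprn_ile1 (ltW q1).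
have MqM : M * q ^+ N <= M by rewrite ler_piMr.
have FB : normc F <= B by exact: HB.
rewrite subr_sqr normrM [M * _ * _]mulrAC; apply: ler_pM => //.
  apply: le_trans FP; rewrite ler_norml ler_normcB andbT lerNl opprB normcB.
  exact: ler_normcB.
rewrite ger0_norm ?addr_ge0 ?normc_ge0//.
have : normc P <= normc F + normc (F - P).
  by rewrite -{1}(subrK F P) addrC; apply: normcD_le; rewrite (normcB P).
lra.
Qed.

Lemma sq_coef_ge0 a (r : R) N : 0 <= r -> 0 <= sq_coef a r N.
Proof. by move=> r0; apply: sumr_ge0 => n _; rewrite mulr_ge0 ?sqr_ge0 ?exprn_ge0. Qed.

Lemma sq_coef_le a (r : R) m n : 0 <= r -> (m <= n)%N -> sq_coef a r m <= sq_coef a r n.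
Proof.
move=> r0 mn; rewrite /sq_coef -!(big_mkord xpredT (fun n => normc (a n) ^+ 2 * r ^+ (n + n))).
rewrite (big_cat_nat (leq0n m) mn)/= lerDl; apply: sumr_ge0 => i _.
by rewrite mulr_ge0 ?sqr_ge0 ?exprn_ge0.
Qed.

Lemma sq_coef_mean2 f a (r c : R) N : is_ps f a -> 0 <= r < 1 ->
  2 * pi * sq_coef a r N <= mean2 f r c.
Proof.
move=> ha r01; have [K [q [K0 q01 H]]] := parseval c ha r01.
have [r0 r1] := andP r01; have p0 := pi2_gt0 R.
apply/ler_addgt0Pr => e e0; have [N0 HN0] := geo_small q01 K0 e0.
have h1 : 2 * pi * sq_coef a r N <= 2 * pi * sq_coef a r (maxn N N0).
  by rewrite ler_pM2l// sq_coef_le// leq_maxl.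
have := le_trans (H (maxn N N0)) (HN0 _ (leq_maxr _ _)).
by rewrite ler_norml => /andP[h2 h3]; lra.
Qed.

Lemma mean2_le f a (r c B : R) : is_ps f a -> 0 <= r < 1 ->
  (forall N, sq_coef a r N <= B) -> mean2 f r c <= 2 * pi * B.
Proof.
move=> ha r01 hB; have [K [q [K0 q01 H]]] := parseval c ha r01.
have p0 := pi2_gt0 R.
apply/ler_addgt0Pr => e e0; have [N0 HN0] := geo_small q01 K0 e0.
have h1 : 2 * pi * sq_coef a r N0 <= 2 * pi * B by rewrite ler_pM2l.
have := le_trans (H N0) (HN0 _ (leqnn _)).
by rewrite ler_norml => /andP[h2 h3]; lra.
Qed.

Lemma circle_mean2E f (r : R) : holomorphic_disc f -> 0 < r < 1 ->
  circle_mean2 f r = ((2 * pi)^-1 * mean2 f r 0)%:E.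
Proof.
move=> hf /andP[r0 r1]; rewrite /circle_mean2 EFinM /mean2 add0r; congr (_ * _)%E.
rewrite /Rintegral fineK//; apply: integrable_fin_num => //.
apply: cont_integrable => x _; apply: normc2_continuous.
by apply: holo_circ_rcont; rewrite ?(ltW r0).
Qed.

Lemma bernoulli_pow (x : R) n : 0 <= x <= 1 -> 1 - n%:R * x <= (1 - x) ^+ n.
Proof.
move=> /andP[x0 x1]; elim: n => [|n IH]; first by rewrite mul0r subr0.
rewrite exprSr -natr1.
apply: le_trans (_ : (1 - n%:R * x) * (1 - x) <= _); last by rewrite ler_wpM2r// subr_ge0.
have : 0 <= n%:R * x * x by rewrite !mulr_ge0.
lra.
Qed.

Definition sqnorm a N : R := \sum_(n < N) normc (a n) ^+ 2.

Lemma sq_coef_norm2 a (r : R) N : 0 <= r <= 1 -> sq_coef a r N <= sqnorm a N.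
Proof.
move=> /andP[r0 r1]; apply: ler_sum => n _.
by rewrite ler_piMr ?sqr_ge0// exprn_ile1.
Qed.

(** The limit r -> 1 in a finite sum, made quantitative: at r = 1 - x every factor r^(n + n) is at
    least 1 - 2 N x by Bernoulli's inequality. *)
Lemma norm2_coef_sq a N B : (forall r : R, 0 < r < 1 -> sq_coef a r N <= B) ->
  sqnorm a N <= B.
Proof.
move=> H; set S := sqnorm a N.
have S0 : 0 <= S by apply: sumr_ge0 => n _; exact: sqr_ge0.
apply/ler_addgt0Pr => e e0.
pose x := Num.min (1 / 2) (e / ((N + N)%:R * S + 1)).
have d0 : 0 < (N + N)%:R * S + 1 by rewrite ltr_wpDl ?mulr_ge0.
have x0 : 0 < x by rewrite lt_min !divr_gt0.
have x2 : x <= 1 / 2 by rewrite ge_min lexx.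
have xe : (N + N)%:R * S * x <= e.
  have : x * ((N + N)%:R * S + 1) <= e by rewrite -ler_pdivlMr// ge_min lexx orbT.
  by apply: le_trans; rewrite mulrC ler_wpM2l ?(ltW x0)// lerDl.
have h := H (1 - x); have : sq_coef a (1 - x) N <= B by apply: h; apply/andP; split; lra.
have : (1 - (N + N)%:R * x) * S <= sq_coef a (1 - x) N.
  rewrite mulr_sumr; apply: ler_sum => n _; rewrite mulrC ler_wpM2l ?sqr_ge0//.
  apply: le_trans (bernoulli_pow (N + N) _) _; first by apply/andP; split; lra.
  apply: ler_wiXn2l; [lra|lra|].
  by rewrite leq_add// ltnW.
lra.
Qed.

(** The supremum of circle means becomes a bound on all partial sums of |a_n|^2, which is how later
    norm estimates are proved. *)
Lemma h2norm_leP f a (M : R) : is_ps f a -> 0 <= M ->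
  (h2norm f <= M%:E)%E <-> (forall N, sqnorm a N <= M ^+ 2).
Proof.
move=> ha M0; have hf := is_ps_holo ha; have p0 := pi2_gt0 R.
set S := ereal_sup [set circle_mean2 f r | r in `]0%R, 1%R[].
have sqM : M%:E = sqrte ((M ^+ 2)%:E) by rewrite /= sqrtr_sqr ger0_norm.
have -> : (h2norm f <= M%:E)%E = (S <= (M ^+ 2)%:E)%E.
  by rewrite sqM lee_sqrt// lee_fin sqr_ge0.
split.
  move=> SM N; apply: norm2_coef_sq => r r01.
  have : (circle_mean2 f r <= (M ^+ 2)%:E)%E.
    by apply: le_trans SM; apply: ereal_sup_ubound; exists r => //=; rewrite in_itv.
  rewrite circle_mean2E// lee_fin ler_pdivrMl//.
  have r01' : 0 <= r < 1 by case/andP: r01 => /ltW -> ->.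
  move=> h; have := le_trans (sq_coef_mean2 0 N ha r01') h.
  by rewrite ler_pM2l.
move=> H; apply: ge_ereal_sup => y [r r01 <-]; move: r01; rewrite /= in_itv/= => r01.
rewrite circle_mean2E// lee_fin ler_pdivrMl//.
have r01' : 0 <= r < 1 by case/andP: r01 => /ltW -> ->.
apply: (mean2_le _ ha r01') => N; apply: le_trans (H N); apply: sq_coef_norm2.
by case/andP: r01' => -> /ltW.
Qed.

Lemma is_psD f g a b : is_ps f a -> is_ps g b ->
  is_ps (fun z => f z + g z) (fun n => a n + b n).
Proof.
move=> ha hb z z1 e e0; have e2 : 0 < e / 2 by rewrite divr_gt0.
have [N1 H1] := ha z z1 _ e2; have [N2 H2] := hb z z1 _ e2.
exists (maxn N1 N2) => N; rewrite geq_max => /andP[n1 n2].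
have -> : f z + g z - psum (fun n => a n + b n) z N = (f z - psum a z N) + (g z - psum b z N).
  by rewrite /psum -[RHS]addrACA -opprD -big_split/=; congr (_ - _); apply: eq_bigr => n _; ring.
by apply: normcD_le; rewrite [e]splitr lerD// ?H1 ?H2.
Qed.

Lemma is_psZ f a c : is_ps f a -> is_ps (fun z => c * f z) (fun n => c * a n).
Proof.
move=> ha z z1 e e0; have c0 : 0 < normc c + 1 by rewrite ltr_wpDl ?normc_ge0.
have [N1 H1] := ha z z1 _ (divr_gt0 e0 c0).
exists N1 => N /H1 h.
have -> : c * f z - psum (fun n => c * a n) z N = c * (f z - psum a z N).
  by rewrite mulrBr /psum mulr_sumr; congr (_ - _); apply: eq_bigr => n _; ring.
rewrite normcM; apply: le_trans (ler_wpM2l (normc_ge0 _) h) _.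
by rewrite mulrCA ler_piMr ?(ltW e0)// ler_pdivrMr// mul1r lerDl.
Qed.

(** The difference of the two expansions represents 0, and Parseval at radius 1/2 annihilates each
    of its coefficients. *)
Lemma is_ps_uniq f a b : is_ps f a -> is_ps f b -> a = b.
Proof.
move=> ha hb; pose d n := a n + -1 * b n.
have hd0 : is_ps (fun=> 0) d.
  by apply: is_ps_ext (is_psD ha (is_psZ (-1) hb)) _ => z _; ring.
apply/funext => n; have r01 : 0 <= (2^-1 : R) < 1.
  by rewrite invr_ge0 ler0n/= invf_lt1 ?ltr1n.
have := sq_coef_mean2 0 n.+1 hd0 r01.
have -> : mean2 (fun=> 0) 2^-1 0 = 0.
  by rewrite /mean2 /Rintegral integral0_eq// => x _; rewrite normc0 expr0n.
rewrite pmulr_rle0 ?pi2_gt0// /sq_coef big_ord_recr/= => H.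
have h0 : 0 <= \sum_(i < n) normc (d i) ^+ 2 * 2^-1 ^+ (i + i).
  by apply: sumr_ge0 => i _; rewrite mulr_ge0 ?sqr_ge0 ?exprn_ge0 ?invr_ge0.
have h1 : normc (d n) ^+ 2 * 2^-1 ^+ (n + n) <= 0 by lra.
have : normc (d n) ^+ 2 <= 0 by rewrite pmulr_lle0 in h1.
rewrite le_eqVlt ltNge sqr_ge0 orbF sqrf_eq0 => /eqP/eq0_normc.
by rewrite /d mulN1r => /eqP; rewrite subr_eq0 => /eqP.
Qed.

End Parseval.

(** * The Cauchy and Poisson formulas *)

Section Poisson.
Variable R : realType.
Local Notation C := R[i].
Implicit Types (f : C -> C) (z w : C).

Lemma circ_int_kernel z (rho : R) : normc z < rho ->
  circ_int (fun w => w / (w - z)) rho 0 = (2 * pi)%:C.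
Proof.
move=> zr; have rho0 : 0 < rho by exact: le_lt_trans (normc_ge0 z) zr.
have pp := pi2_gt0 R.
have w0 t : circle rho t != 0 by apply: circle_neq0; rewrite gt_eqF.
have nw t : normc (circle rho t) = rho by rewrite normc_circ gtr0_norm.
have wz t : circle rho t - z != 0 by have [] := @normc_gtr _ z (circle rho t); rewrite ?nw.
have cV t : rcont (fun t => (circle rho t)^-1) t.
  by apply: (@rcont_comp _ (fun w => w^-1)); [exact: ccontV|exact: circle_rcont].
have cK t : rcont (fun t => circle rho t / (circle rho t - z)) t.
  apply: rcontM; first exact: circle_rcont.
  apply: (@rcont_comp _ (fun w => w^-1) (fun t => circle rho t - z)); first exact: ccontV.
  by apply: rcontD; [exact: circle_rcont|exact: rcont_cst].
pose B := rho / (rho - normc z).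
have nz : 0 < rho - normc z by rewrite subr_gt0.
have q01 : 0 <= normc z / rho < 1.
  by rewrite divr_ge0 ?normc_ge0 ?(ltW rho0)//= ltr_pdivrMr// mul1r.
apply/eqP; rewrite -subr_eq0; apply/eqP/normc_eq0_small => e e0.
have BB : 0 <= 2 * (B * (2 * pi)) by nonneg.
have [N HN] := geo_small q01 BB e0.
pose T (n : nat) t := z ^+ n * (circle rho t)^-1 ^+ n.
pose Rm t := (z * (circle rho t)^-1) ^+ N.+1 * (circle rho t / (circle rho t - z)).
have cT n : rconti (T n) 0 (2 * pi).
  by move=> t _; apply: rcontM; [exact: rcont_cst|exact: rcontX].
have cR : rconti Rm 0 (2 * pi).
  by move=> t _; apply: rcontM => //; apply/rcontX/rcontM; [exact: rcont_cst|].
have E : circ_int (fun w => w / (w - z)) rho 0 = (2 * pi)%:C + cint 0 (2 * pi) Rm.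
  rewrite /circ_int add0r (eq_cint (q := fun t => \sum_(n < N.+1) T n t + Rm t)); last first.
    move=> t _; rewrite {1}(geo_kernel N.+1 (w0 t) (wz t)); congr (_ + _).
    by apply: eq_bigr => n _; rewrite exprMn.
  rewrite cintD; [|exact: rconti_sum|exact: cR].
  rewrite cint_sum//; congr (_ + _).
  have ET n : cint 0 (2 * pi) (T n) = z ^+ n * (if n is 0 then (2 * pi)%:C else 0).
    rewrite cintZ; last by move=> t _; exact: rcontX.
    by have := @circ_int_invX R rho n 0 rho0; rewrite /circ_int add0r => ->.
  under eq_bigr do rewrite ET.
  by rewrite big_ord_recl/= expr0 mul1r big1 ?addr0// => i _; rewrite mulr0.
rewrite E addrAC subrr add0r.
have Rb t : 0 <= t <= 2 * pi -> normc (Rm t) <= B * (normc z / rho) ^+ N.+1.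
  move=> _; rewrite /Rm !normcM normcX normcM !normcV nw /B mulrC.
  apply: ler_wpM2r; first by rewrite exprn_ge0// divr_ge0 ?normc_ge0// ltW.
  have dz : rho - normc z <= normc (circle rho t - z).
    by have := ler_normcB (circle rho t) z; rewrite nw.
  by rewrite ler_pM2l// lef_pV2// posrE// (lt_le_trans nz).
apply: le_trans (cint_bound (ltW pp) cR Rb) _; apply: le_trans (HN N.+1 (leqnSn _)).
by rewrite subr0; apply: le_of_eq; ring.
Qed.

Lemma cauchy_formula f z (rho : R) : holomorphic_disc f -> normc z < rho -> rho < 1 ->
  circ_int (fun w => f w * (w / (w - z))) rho 0 = (2 * pi)%:C * f z.
Proof.
move=> hf zr r1; have rho0 : 0 < rho by exact: le_lt_trans (normc_ge0 z) zr.
have hr : 0 <= rho < 1 by rewrite ltW.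
have nw t : normc (circle rho t) = rho by rewrite normc_circ gtr0_norm.
have wz t : circle rho t - z != 0 by have [] := @normc_gtr _ z (circle rho t); rewrite ?nw.
have cK t : rcont (fun t => circle rho t / (circle rho t - z)) t.
  apply: rcontM; first exact: circle_rcont.
  apply: (@rcont_comp _ (fun w => w^-1) (fun t => circle rho t - z)); first exact: ccontV.
  by apply: rcontD; [exact: circle_rcont|exact: rcont_cst].
rewrite -(circ_int_kernel zr) mulrC -(addr0 (f z * _)) -(cauchy_dquot hf zr r1).
rewrite /circ_int add0r -cintZ; last by move=> t _; exact: cK.
rewrite -cintD; last 2 first.
- by move=> t _; apply: rcontM => //; exact: rcont_cst.
- move=> t _; have -> : (fun t => circle rho t * dquot f z (circle rho t)) =
    (fun t => (f (circle rho t) - f z) * (circle rho t / (circle rho t - z))).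
    apply/funext => x; rewrite /dquot -subr_eq0 (negbTE (wz x)); field; exact: wz.
  apply: rcontM => //; apply: rcontB; first exact: holo_circ_rcont.
  exact: rcont_cst.
apply: eq_cint => t _; rewrite /dquot -subr_eq0 (negbTE (wz t)); field; exact: wz.
Qed.

(** On |w| = rho the Poisson kernel is w / (w - z) plus conj(z) w / (rho^2 - conj(z) w). The second
    term is holomorphic for |w| <= rho and vanishes at 0, so that it integrates to 0 against f. *)
Lemma poisson_formula f z (rho c : R) : holomorphic_disc f -> normc z < rho -> rho < 1 ->
  cint c (c + 2 * pi) (fun t => f (circle rho t) *
     ((rho ^+ 2 - normc z ^+ 2) / normc (circle rho t - z) ^+ 2)%:C) = (2 * pi)%:C * f z.
Proof.
move=> hf zr r1; have rho0 : 0 < rho by exact: le_lt_trans (normc_ge0 z) zr.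
pose D w := (rho ^+ 2)%:C - conjc z * w.
have D0 w : normc w <= rho -> D w != 0.
  move=> wr; rewrite subr_eq0 eq_sym; apply/eqP => /(congr1 (@normc R)).
  rewrite normcM normc_conj normcR ger0_norm ?sqr_ge0// => H.
  have : normc z * normc w < rho ^+ 2.
    apply: le_lt_trans (_ : normc z * rho < _); first by rewrite ler_wpM2l ?normc_ge0.
    by rewrite expr2 ltr_pM2r.
  by rewrite H ltxx.
pose phi w := f w * (conjc z * w / D w).
have hphi w : normc w <= rho -> exists E, cderive phi w E.
  move=> wr; have hD : cderive D w (0 + - (conjc z * 1 + w * 0)).
    rewrite /D; apply: cderiveD; first exact: cderive_cst.
    have -> : (fun w => - (conjc z * w)) = (fun w => (- conjc z) * w) by apply/funext => x; ring.
    have := cderiveM (cderive_cst (- conjc z) w) (cderive_id w).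
    by rewrite !mulr0 !addr0 !mulr1.
  eexists; apply: cderiveM; first by apply: holo_cderive => //; exact: le_lt_trans wr r1.
  apply: cderiveM; last exact: (cderiveV (f := D) (D0 _ wr) hD).
  exact: cderiveM (cderive_cst (conjc z) w) (cderive_id w).
have nw r t : 0 < r -> normc (circle r t) = r by move=> r0; rewrite normc_circ gtr0_norm.
have cphi r t : 0 < r -> r <= rho -> ccont phi (circle r t).
  move=> r0 rr; have [|E] := hphi (circle r t); first by rewrite nw.
  exact: cderive_ccont.
have I0 : circ_int phi rho 0 = 0.
  apply: (@circ_int_to0 _ phi rho 0) => //.
  - by move=> r t /andP[r0 rr]; apply: cphi => //; exact: ltW.
  - by have [|E] := hphi 0; [rewrite normc0 ltW|exact: cderive_ccont].
  - by rewrite /phi mulr0 mul0r mulr0.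
  move=> r /andP[r0 rr]; apply: (circ_int_const _ r0 (ltW rr)) => s t /andP[s0 s1].
  by apply: hphi; rewrite nw//; exact: lt_le_trans s0.
have wz t : circle rho t - z != 0 by have [] := @normc_gtr _ z (circle rho t); rewrite ?nw.
have c1 t : ccont (fun w => f w * (w / (w - z))) (circle rho t).
  apply: ccontM; first by apply: holo_ccont => //; rewrite nw.
  apply: ccontM; first exact: ccont_id.
  apply: (@ccont_comp _ (fun w => w^-1) (fun w => w - z)); first exact: ccontV.
  by apply: ccontD; [exact: ccont_id|exact: ccont_cst].
have <- : circ_int (fun w => f w * (w / (w - z)) + phi w) rho c = (2 * pi)%:C * f z.
  rewrite circ_int_shift; last by move=> t; apply: ccontD => //; exact: cphi.
  rewrite -(cauchy_formula hf zr r1) -[RHS]addr0 -[in RHS]I0 /circ_int cintD//.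
    by move=> t _; apply: (@rcont_comp _ (fun w => f w * (w / (w - z)))) => //; exact: circle_rcont.
  by move=> t _; apply: rcont_comp; [exact: cphi|exact: circle_rcont].
apply: eq_cint => t _; rewrite /phi -mulrDr; congr (_ * _).
set w := circle rho t.
have w0 : w != 0 by apply: circle_neq0; rewrite gt_eqF.
have ww : w * conjc w = (rho ^+ 2)%:C by rewrite mulcJ nw.
have Dw : D w = w * conjc (w - z) by rewrite /D -ww rmorphB/=; ring.
have cwz : conjc (w - z) != 0 by rewrite conjc_eq0; exact: wz.
have -> : ((rho ^+ 2 - normc z ^+ 2) / normc (w - z) ^+ 2)%:C =
  (w * conjc w - z * conjc z) / ((w - z) * conjc (w - z)).
  by rewrite ww !mulcJ -rmorphB -fmorph_div.
have wz' : w - z != 0 by exact: wz.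
rewrite Dw; move: cwz; rewrite rmorphB/= => cwz.
by field; rewrite wz' w0 cwz.
Qed.

End Poisson.

(** * The Hilbert space structure of the Hardy space *)

Section ConjSums.
Variable R : realType.
Local Notation C := R[i].

Lemma conjD (z w : C) : conjc (z + w) = conjc z + conjc w.
Proof. exact: rmorphD. Qed.

Lemma conjB (z w : C) : conjc (z - w) = conjc z - conjc w.
Proof. exact: rmorphB. Qed.

Lemma conj_sum I (r : seq I) (P : pred I) (F : I -> C) :
  conjc (\sum_(i <- r | P i) F i) = \sum_(i <- r | P i) conjc (F i).
Proof. by elim/big_rec2 : _ => [|i x y _ <-]; rewrite ?conjc0 ?conjD. Qed.

End ConjSums.

(** * Limits of complex sequences *)

Section ComplexLimits.
Variable R : realType.
Local Notation C := R[i].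
Implicit Types (u v : nat -> C) (l m c : C).

Definition clim u l := forall e : R, 0 < e ->
  exists N0, forall N, (N0 <= N)%N -> normc (l - u N) <= e.

Lemma clim_uniq u l m : clim u l -> clim u m -> l = m.
Proof.
move=> hl hm; apply/eqP; rewrite -subr_eq0; apply/eqP/normc_eq0_small => e e0.
have e2 : 0 < e / 2 by rewrite divr_gt0.
have [N1 H1] := hl _ e2; have [N2 H2] := hm _ e2.
have h1 := H1 _ (leq_maxl N1 N2); have h2 := H2 _ (leq_maxr N1 N2).
set N := maxn N1 N2 in h1 h2.
have -> : l - m = (l - u N) - (m - u N) by ring.
by apply: normcD_le; rewrite normcN [e]splitr lerD.
Qed.

Lemma climD u v l m : clim u l -> clim v m -> clim (fun n => u n + v n) (l + m).
Proof.
move=> hl hm e e0; have e2 : 0 < e / 2 by rewrite divr_gt0.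
have [N1 H1] := hl _ e2; have [N2 H2] := hm _ e2.
exists (maxn N1 N2) => N; rewrite geq_max => /andP[n1 n2].
have -> : l + m - (u N + v N) = (l - u N) + (m - v N) by ring.
by apply: normcD_le; rewrite [e]splitr lerD ?H1 ?H2.
Qed.

Lemma climZ u l c : clim u l -> clim (fun n => c * u n) (c * l).
Proof.
move=> hl e e0; have c0 : 0 < normc c + 1 by rewrite ltr_wpDl ?normc_ge0.
have [N1 H1] := hl _ (divr_gt0 e0 c0); exists N1 => N /H1 h.
rewrite -mulrBr normcM; apply: le_trans (ler_wpM2l (normc_ge0 _) h) _.
by rewrite mulrCA ler_piMr ?(ltW e0)// ler_pdivrMr// mul1r lerDl.
Qed.

Lemma clim_conj u l : clim u l -> clim (fun n => conjc (u n)) (conjc l).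
Proof.
by move=> hl e /hl[N0 H]; exists N0 => N /H; rewrite -conjB normc_conj.
Qed.

Lemma eq_clim u v l : u =1 v -> clim u l -> clim v l.
Proof. by move=> uv hl e /hl[N0 H]; exists N0 => N /H; rewrite uv. Qed.

Lemma clim_near u l c (K : nat) : (forall n, (K <= n)%N -> u n = c) -> clim u l -> l = c.
Proof.
move=> H hl; apply: (clim_uniq hl) => e e0; exists K => N /H ->.
by rewrite subrr normc0 ltW.
Qed.

Lemma clim_const u c (K : nat) : (forall n, (K <= n)%N -> u n = c) -> clim u c.
Proof. by move=> H e e0; exists K => N /H ->; rewrite subrr normc0 ltW. Qed.

Lemma clim_re_le u l (B : R) : clim u l -> (forall n, complex.Re (u n) <= B) ->
  complex.Re l <= B.
Proof.
move=> hl hB; apply/ler_addgt0Pr => e /hl[N0 /(_ _ (leqnn _)) H].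
have := le_trans (Re_le_normc _) H; rewrite ReD ReN ler_norml => /andP[_].
by have := hB N0; lra.
Qed.

Lemma clim_re_ge u l (B : R) N1 : clim u l -> (forall n, (N1 <= n)%N -> B <= complex.Re (u n)) ->
  B <= complex.Re l.
Proof.
move=> hl hB; apply/ler_addgt0Pr => e /hl[N0 /(_ _ (leq_maxl _ N1)) H].
have := le_trans (Re_le_normc _) H; rewrite ReD ReN ler_norml => /andP[+ _].
by have := hB _ (leq_maxr N0 N1); lra.
Qed.

Lemma clim_norm_le u l (B : R) : clim u l -> (forall n, normc (u n) <= B) -> normc l <= B.
Proof.
move=> hl hB; apply/ler_addgt0Pr => e /hl[N0 /(_ _ (leqnn _)) H].
have := ler_normcB l (u N0); have := hB N0; lra.
Qed.

Lemma abs_sum_clim u (B : R) : (forall N, \sum_(i < N) normc (u i) <= B) ->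
  exists l, clim (fun N => \sum_(i < N) u i) l.
Proof.
move=> hB.
have nc : cvgn [series normc (u n)]_n.
  apply: nondecreasing_is_cvgn; last first.
    by exists B => _ [n _ <-]; rewrite /series/= big_mkord.
  by apply/nondecreasing_seqP => n; rewrite /series/= big_nat_recr//= lerDl normc_ge0.
have K (v : nat -> R) : (forall i, `|v i| <= normc (u i)) ->
    exists l : R, (fun N => \sum_(i < N) v i) @ \oo --> l.
  move=> hv; have H : cvgn [series `|v n|]_n.
    apply: (@series_le_cvg _ _ (fun n => normc (u n))) => //.
    - by move=> n; exact: normr_ge0.
    - by move=> n; exact: normc_ge0.
  have /cvg_ex[l hl] := normed_cvg H; exists l.
  rewrite (_ : (fun N => _) = [series v n]_n)//.
  by apply/funext => n; rewrite /series/= big_mkord.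
have [x hx] := K (fun i => complex.Re (u i)) (fun i => Re_le_normc (u i)).
have [y hy] := K (fun i => complex.Im (u i)) (fun i => Im_le_normc (u i)).
exists (x +i* y) => e e0; have e2 : 0 < e / 2 by rewrite divr_gt0.
move/cvgrPdist_lt : hx => /(_ _ e2)[N1 _ H1]; move/cvgrPdist_lt : hy => /(_ _ e2)[N2 _ H2].
exists (maxn N1 N2) => N; rewrite geq_max => /andP[n1 n2].
apply: le_trans (normc_le_ReIm _) _; rewrite ReD ReN ImD ImN Re_sum Im_sum/= [e]splitr.
by apply: lerD; apply: ltW; [apply: H1|apply: H2].
Qed.

End ComplexLimits.

Section HardyHilbert.
Variable R : realType.
Local Notation C := R[i].
Local Notation V := (H2 R).
Implicit Types (f g h k : V) (a b : nat -> C) (c : C).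

Definition coef (F : C -> C) : nat -> C := xget (fun=> 0) [set a | is_ps F a].

Lemma coefP (F : C -> C) : holomorphic_disc F -> is_ps F (coef F).
Proof. by move=> /holo_ps ex; exact: (xgetPex (fun=> 0) ex). Qed.

Lemma coef_eq (F : C -> C) a : is_ps F a -> coef F = a.
Proof. by move=> ha; apply: is_ps_uniq (coefP (is_ps_holo ha)) ha. Qed.

Lemma H2_holo f : holomorphic_disc f.
Proof. by have /asboolP[[]] := h2funP f. Qed.

Lemma H2_out f z : ~ disc z -> f z = 0.
Proof. by have /asboolP[_] := h2funP f; apply. Qed.

Lemma H2_ps f : is_ps f (coef f).
Proof. by apply: coefP; exact: H2_holo. Qed.

Lemma H2_eq f g : (forall z, disc z -> f z = g z) -> f = g.
Proof.
move=> H; apply: val_inj; apply/funext => z.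
by have [/H//|nz] := pselect (disc z); change (f z = g z); rewrite !H2_out.
Qed.

Lemma H2D f g z : (f + g : V) z = f z + g z.
Proof. by []. Qed.

Lemma H2Z c f z : (c *: f : V) z = c * f z.
Proof. by []. Qed.

Lemma coefD f g : coef (f + g : V) = (fun n => coef f n + coef g n).
Proof. by apply: coef_eq; exact: is_psD (H2_ps f) (H2_ps g). Qed.

Lemma coefZ c f : coef (c *: f : V) = (fun n => c * coef f n).
Proof. by apply: coef_eq; exact: is_psZ (H2_ps f). Qed.

Lemma coef_inj f g : coef f = coef g -> f = g.
Proof.
move=> E; apply: H2_eq => z hz; have hf := H2_ps f; have hg := H2_ps g.
by rewrite E in hf; apply: clim_uniq (hf z hz) (hg z hz).
Qed.

Definition l2 a := exists B : R, forall N, sqnorm a N <= B.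

Lemma norm2_coef_ge0 a N : 0 <= sqnorm a N :> R.
Proof. by apply: sumr_ge0 => n _; exact: sqr_ge0. Qed.

Lemma H2_l2 f : l2 (coef f).
Proof.
have /asboolP[[hf nf] _] := h2funP f.
have fin : h2norm f \is a fin_num by rewrite ge0_fin_numE// sqrte_ge0.
exists (fine (h2norm f) ^+ 2); apply: (h2norm_leP (H2_ps f) _).1.
  by rewrite fine_ge0// sqrte_ge0.
by rewrite fineK.
Qed.

Lemma l2_cbd a : l2 a -> cbd a.
Proof.
move=> [B hB] r /andP[r0 r1]; exists (1 + B).
  by rewrite addr_ge0//; apply: le_trans (hB 0%N); exact: norm2_coef_ge0.
move=> n; apply: le_trans (_ : normc (a n) <= _).
  by rewrite ler_piMr ?normc_ge0// exprn_ile1// ltW.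
have h : normc (a n) ^+ 2 <= B.
  by apply: le_trans (hB n.+1); rewrite /sqnorm big_ord_recr/= lerDr; exact: norm2_coef_ge0.
have := sqr_ge0 (normc (a n) - 1); have := sqr_ge0 (normc (a n)); rewrite sqrrB1; lra.
Qed.

Definition mkfun a (z : C) : C := if `[< disc z >] then pssum a z else 0.

Lemma mkfun_ps a : l2 a -> is_ps (mkfun a) a.
Proof.
move=> /l2_cbd/pssumP ha; apply: is_ps_ext ha _ => z hz.
by rewrite /mkfun asboolT.
Qed.

Lemma mkfun_hardy a : l2 a -> mkfun a \in @hardy2_pred R.
Proof.
move=> ha; have hp := mkfun_ps ha; have [B hB] := ha.
apply/asboolP; split; last by move=> z hz; rewrite /mkfun asboolF.
split; first exact: is_ps_holo hp.
have B0 : 0 <= B by apply: le_trans (hB 0%N); exact: norm2_coef_ge0.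
apply: le_lt_trans (_ : (_ <= (Num.sqrt B)%:E)%E) (ltry _).
by apply: (h2norm_leP hp (sqrtr_ge0 _)).2 => N; rewrite sqr_sqrtr.
Qed.

Lemma mkH2_ex a : l2 a -> exists f, coef f = a.
Proof.
by move=> ha; exists (MkH2 (mkfun_hardy ha)); apply: coef_eq; exact: mkfun_ps.
Qed.

(** The pairing of Taylor coefficients; [h2norm_hn2] shows that it induces the norm given by circle
    means. *)
Definition ip f g : C :=
  xget 0 [set l | clim (fun N => \sum_(n < N) coef f n * conjc (coef g n)) l].

Lemma ipP f g : clim (fun N => \sum_(n < N) coef f n * conjc (coef g n)) (ip f g).
Proof.
have [A hA] := H2_l2 f; have [B hB] := H2_l2 g.
suff ex : exists l, [set l | clim (fun N => \sum_(n < N) coef f n * conjc (coef g n)) l] l.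
  exact: (xgetPex 0 ex).
apply: (@abs_sum_clim _ (fun n => coef f n * conjc (coef g n)) ((A + B) / 2)) => N.
apply: le_trans (_ : \sum_(i < N) (normc (coef f i) ^+ 2 + normc (coef g i) ^+ 2) / 2 <= _).
  apply: ler_sum => i _; rewrite normcM normc_conj.
  have := sqr_ge0 (normc (coef f i) - normc (coef g i)); rewrite sqrrB; lra.
rewrite -mulr_suml big_split/= ler_wpM2r ?invr_ge0//.
by apply: lerD; [exact: hA|exact: hB].
Qed.

Lemma ip_linear c f g h : ip (c *: f + g) h = c * ip f h + ip g h.
Proof.
apply: clim_uniq (ipP _ _) _.
apply: eq_clim (climD (climZ c (ipP f h)) (ipP g h)) => N.
rewrite mulr_sumr -big_split/=; apply: eq_bigr => n _.
by rewrite (coefD (c *: f) g) coefZ; ring.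
Qed.

Lemma ipC f g : ip g f = conjc (ip f g).
Proof.
apply: clim_uniq (ipP _ _) _; apply: eq_clim (clim_conj (ipP f g)) => N.
by rewrite conj_sum; apply: eq_bigr => n _; rewrite conjM conjI mulrC.
Qed.

Lemma ip0l g : ip 0 g = 0.
Proof.
by have := ip_linear (-1) 0 0 g; rewrite scaler0 add0r mulN1r addNr.
Qed.

Lemma ipDl f g h : ip (f + g) h = ip f h + ip g h.
Proof. by have := ip_linear 1 f g h; rewrite scale1r mul1r. Qed.

Lemma ipZl c f h : ip (c *: f) h = c * ip f h.
Proof. by have := ip_linear c f 0 h; rewrite ip0l !addr0. Qed.

Lemma ipNl f h : ip (- f) h = - ip f h.
Proof. by rewrite -scaleN1r ipZl mulN1r. Qed.

Lemma ipZr c f h : ip f (c *: h) = conjc c * ip f h.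
Proof. by rewrite ipC ipZl conjM -ipC. Qed.

Lemma ipDr f g h : ip f (g + h) = ip f g + ip f h.
Proof. by rewrite ipC ipDl conjD -!ipC. Qed.

Lemma ip0r f : ip f 0 = 0.
Proof. by rewrite ipC ip0l conjc0. Qed.

Lemma ip_suml I (r : seq I) (F : I -> V) h : ip (\sum_(i <- r) F i) h = \sum_(i <- r) ip (F i) h.
Proof.
by elim: r => [|i r IH]; rewrite ?big_nil ?ip0l// !big_cons ipDl IH.
Qed.

Lemma ip_sumr I (r : seq I) (F : I -> V) h : ip h (\sum_(i <- r) F i) = \sum_(i <- r) ip h (F i).
Proof.
by elim: r => [|i r IH]; rewrite ?big_nil ?ip0r// !big_cons ipDr IH.
Qed.

Definition hn2 f : R := complex.Re (ip f f).

Lemma re_norm2_coef f N :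
  complex.Re (\sum_(n < N) coef f n * conjc (coef f n)) = sqnorm (coef f) N.
Proof. by rewrite Re_sum; apply: eq_bigr => n _; rewrite mulcJ. Qed.

Lemma ipE f : ip f f = (hn2 f)%:C.
Proof.
apply: complex_eq => //=.
have : ip f f = conjc (ip f f) by rewrite -ipC.
by case: (ip f f) => x y [] /= h; lra.
Qed.

Lemma norm2_coef_le f N : sqnorm (coef f) N <= hn2 f.
Proof.
apply: (clim_re_ge (N1 := N) (ipP f f)) => n; rewrite re_norm2_coef.
move=> Nn; rewrite /sqnorm -!(big_mkord xpredT (fun n => normc (coef f n) ^+ 2)).
rewrite (big_cat_nat (leq0n N) Nn)/= lerDl; apply: sumr_ge0 => i _; exact: sqr_ge0.
Qed.

Lemma hn2_le f B : (forall N, sqnorm (coef f) N <= B) -> hn2 f <= B.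
Proof. by move=> H; apply: clim_re_le (ipP f f) _ => n; rewrite re_norm2_coef. Qed.

Lemma hn2_ge0 f : 0 <= hn2 f.
Proof. exact: le_trans (norm2_coef_ge0 _ 0) (norm2_coef_le f 0). Qed.

Lemma coef0 : coef (0 : V) = fun=> 0.
Proof. by have := coefZ 0 (0 : V); rewrite scale0r => ->; apply/funext => n; rewrite mul0r. Qed.

Lemma hn2_eq0 f : hn2 f = 0 -> f = 0.
Proof.
move=> f0; apply: coef_inj; rewrite coef0; apply/funext => n.
have := norm2_coef_le f n.+1; rewrite f0 /sqnorm big_ord_recr/= => H.
have h0 := norm2_coef_ge0 (coef f) n; rewrite /sqnorm in h0.
have : normc (coef f n) ^+ 2 <= 0 by lra.
by rewrite le_eqVlt ltNge sqr_ge0 orbF sqrf_eq0 => /eqP/eq0_normc.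
Qed.

Lemma hn2Z c f : hn2 (c *: f) = normc c ^+ 2 * hn2 f.
Proof. by apply: complexI; rewrite -ipE ipZl ipZr mulrA mulcJ ipE -rmorphM. Qed.

Lemma h2norm_hn2 f (M : R) : 0 <= M -> (h2norm f <= M%:E)%E <-> hn2 f <= M ^+ 2.
Proof.
move=> M0; apply: (iff_trans (h2norm_leP (H2_ps f) M0)); split; first exact: hn2_le.
by move=> H N; exact: le_trans (norm2_coef_le f N) H.
Qed.

Section Orthonormal.
Variables (I : eqType) (e : I -> V) (s : seq I).
Hypotheses (us : uniq s)
  (oe : forall i j, i \in s -> j \in s -> ip (e i) (e j) = (i == j)%:R).

(** Orthonormal families run over a duplicate-free list in any [eqType], so that dyadic indices,
    degrees of monomials and positions in a basis can all serve as indices. *)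
Lemma ip_comb (c : I -> C) j : j \in s ->
  ip (\sum_(i <- s) c i *: e i) (e j) = c j.
Proof.
move=> js; rewrite ip_suml (bigD1_seq j)//= ipZl oe// eqxx mulr1 big_seq_cond big1 ?addr0//.
by move=> i /andP[iS ij]; rewrite ipZl oe// (negbTE ij) mulr0.
Qed.

Lemma hn2_comb (c : I -> C) :
  hn2 (\sum_(i <- s) c i *: e i) = \sum_(i <- s) normc (c i) ^+ 2.
Proof.
apply: complexI; rewrite -ipE {2}(big_morph _ (fun x y => erefl (x + y)) (erefl 0)) ip_sumr.
rewrite rmorph_sum/= big_seq [RHS]big_seq; apply: eq_bigr => j js.
by rewrite ipZr ip_comb// mulrC mulcJ.
Qed.

Definition proj f := \sum_(i <- s) ip f (e i) *: e i.

Lemma ip_sub_proj f j : j \in s -> ip (f - proj f) (e j) = 0.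
Proof. by move=> js; rewrite ipDl ipNl ip_comb// subrr. Qed.

Lemma hn2_pythagoras d p : ip d p = 0 -> hn2 (d + p) = hn2 d + hn2 p.
Proof.
move=> P; apply: complexI.
by rewrite rmorphD/= -!ipE ipDl !ipDr P (ipC d p) P conjc0 addr0 add0r.
Qed.

Lemma bessel_eq f : hn2 (f - proj f) + \sum_(i <- s) normc (ip f (e i)) ^+ 2 = hn2 f.
Proof.
have P : ip (f - proj f) (proj f) = 0.
  by rewrite /proj ip_sumr big_seq big1// => i iS; rewrite ipZr ip_sub_proj// mulr0.
by have := hn2_pythagoras P; rewrite subrK hn2_comb.
Qed.

Lemma bessel f : \sum_(i <- s) normc (ip f (e i)) ^+ 2 <= hn2 f.
Proof. by rewrite -[leRHS]bessel_eq lerDr hn2_ge0. Qed.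

Lemma hn2_sub_proj f : hn2 (f - proj f) <= hn2 f.
Proof.
by rewrite -[leRHS]bessel_eq lerDl sumr_ge0// => i _; exact: sqr_ge0.
Qed.

End Orthonormal.

Lemma cauchy_schwarz f u : hn2 u = 1 -> normc (ip f u) ^+ 2 <= hn2 f.
Proof.
move=> u1; have := @bessel unit (fun=> u) [:: tt] isT _ f.
rewrite big_seq1; apply=> i j _ _; rewrite ipE u1.
by case: i j => -[].
Qed.

Definition orthonormal (us : seq V) :=
  forall i j, (i < size us)%N -> (j < size us)%N -> ip us`_i us`_j = (i == j)%:R.

(** The last clause expresses membership in the span as invariance under the projection, the only
    form in which it is used. *)
Lemma gram_schmidt (ks : seq V) : exists us : seq V, [/\ (size us <= size ks)%N,
  orthonormal us &
  forall k, k \in ks -> k = \sum_(i <- iota 0 (size us)) ip k us`_i *: us`_i].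
Proof.
elim: ks => [|k0 ks [us [sz oe sp]]]; first by exists [::]; split.
have oe' i j : i \in iota 0 (size us) -> j \in iota 0 (size us) -> ip us`_i us`_j = (i == j)%:R.
  by rewrite !mem_iota/= !add0n; exact: oe.
pose P := proj (fun i => us`_i) (iota 0 (size us)).
(* A vector already in the span adds no basis element, which is why only an inequality between the
   sizes holds. *)
have [E|E] := eqVneq (k0 - P k0) 0.
  exists us; split=> //=; first exact: leqW.
  move=> k; rewrite inE => /predU1P[->|/sp//].
  by apply/eqP; rewrite -subr_eq0; apply/eqP.
pose w := k0 - P k0.
have w0 : 0 < hn2 w.
  by rewrite lt_def hn2_ge0 andbT; apply: contra_neq E; exact: hn2_eq0.
pose c : C := ((Num.sqrt (hn2 w))^-1)%:C.
pose v := c *: w.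
have v1 : ip v v = 1.
  rewrite ipE hn2Z normcR ger0_norm ?invr_ge0 ?sqrtr_ge0//.
  by rewrite exprVn sqr_sqrtr ?(ltW w0)// mulVf ?gt_eqF.
have wv i : (i < size us)%N -> ip v us`_i = 0.
  move=> hi; rewrite ipZl (@ip_sub_proj _ (fun i => us`_i) (iota 0 (size us)))//.
  - by rewrite mulr0.
  - exact: iota_uniq.
  - by rewrite mem_iota.
have nthr i : (i < size us)%N -> (rcons us v)`_i = us`_i.
  by move=> hi; rewrite nth_rcons hi.
have nthv : (rcons us v)`_(size us) = v by rewrite nth_rcons ltnn eqxx.
exists (rcons us v); rewrite size_rcons; split=> //.
- move=> i j; rewrite size_rcons !ltnS => hi hj.
  have [i1|i1] := ltnP i (size us); have [j1|j1] := ltnP j (size us).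
  + by rewrite !nthr//; exact: oe.
  + have -> : j = size us by apply/eqP; rewrite eqn_leq hj j1.
    by rewrite nthv (nthr i i1) ipC wv// conjc0 ltn_eqF.
  + have -> : i = size us by apply/eqP; rewrite eqn_leq hi i1.
    by rewrite nthv (nthr j j1) wv// gtn_eqF.
  + have -> : i = size us by apply/eqP; rewrite eqn_leq hi i1.
    have -> : j = size us by apply/eqP; rewrite eqn_leq hj j1.
    by rewrite nthv v1 eqxx.
have S k : \sum_(i <- iota 0 (size us).+1) ip k (rcons us v)`_i *: (rcons us v)`_i =
    P k + ip k v *: v.
  rewrite -addn1 iotaD add0n big_cat/= big_seq1 nthv; congr (_ + _).
  by rewrite big_seq [RHS]big_seq; apply: eq_bigr => i; rewrite mem_iota add0n => /= hi; rewrite nthr.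
move=> k; rewrite inE S => /predU1P[->|/sp kE].
  have kw : ip k0 w = (hn2 w)%:C.
    have -> : k0 = w + P k0 by rewrite subrK.
    rewrite ipDl ipE [ip (P k0) w]ipC ip_sumr big_seq big1 ?conjc0 ?addr0// => i.
    rewrite mem_iota add0n => /= hi; rewrite ipZr.
    have := wv i hi; rewrite ipZl => /eqP; rewrite mulf_eq0.
    have c0 : c != 0 by rewrite eq_complex/= eqxx andbT invr_eq0 sqrtr_eq0 -ltNge.
    by rewrite (negbTE c0)/= => /eqP ->; rewrite mulr0.
  have cc : conjc c * (hn2 w)%:C * c = 1.
    rewrite /c conjc_real -!rmorphM/= mulrAC -expr2 exprVn sqr_sqrtr ?(ltW w0)//.
    by rewrite mulVf ?gt_eqF.
  have -> : ip k0 v *: v = w by rewrite ipZr kw scalerA cc scale1r.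
  by rewrite addrC subrK.
have -> : ip k v = 0.
  rewrite kE ip_suml big_seq big1// => i; rewrite mem_iota add0n => /= hi.
  by rewrite ipZl [ip us`_i v]ipC wv// conjc0 mulr0.
by rewrite scale0r addr0 {1}kE.
Qed.

Lemma le_mul_sqrt_le (x M : R) : 0 <= x -> 0 <= M -> x ^+ 2 <= M ^+ 2 * x -> x <= M ^+ 2.
Proof.
move=> x0 M0; have [->|xn] := eqVneq x 0; first by rewrite sqr_ge0.
by rewrite expr2 ler_pM2r// lt_def xn.
Qed.

Section FiniteRank.
Variables (X : {linear V -> V}) (us : seq V) (M : R).
Hypotheses (M0 : 0 <= M) (ou : orthonormal us)
  (rX : forall f, X f = \sum_(l <- iota 0 (size us)) ip (X f) us`_l *: us`_l)
  (bX : forall f, hn2 (X f) <= M ^+ 2 * hn2 f).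
Variables (I : eqType) (e : I -> V) (s : seq I).
Hypotheses (us_s : uniq s)
  (oe : forall i j, i \in s -> j \in s -> ip (e i) (e j) = (i == j)%:R).

(** The sum S is the squared norm of the adjoint at u_l, seen on the e_i. Testing X on the
    combination of the e_i with conjugate coefficients gives S^2 <= M^2 S without introducing the
    adjoint. *)
Lemma adjoint_column_le l : (l < size us)%N ->
  \sum_(i <- s) normc (ip (X (e i)) us`_l) ^+ 2 <= M ^+ 2.
Proof.
move=> hl; pose c i := conjc (ip (X (e i)) us`_l).
pose f := \sum_(i <- s) c i *: e i.
have Xf : ip (X f) us`_l = (\sum_(i <- s) normc (c i) ^+ 2)%:C.
  rewrite linear_sum ip_suml rmorph_sum/=; apply: eq_bigr => i _.
  by rewrite linearZ ipZl {2}/c -[X in _ * X]conjI mulcJ.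
have u1 : hn2 us`_l = 1 by apply: complexI; rewrite -ipE ou// eqxx.
have -> : \sum_(i <- s) normc (ip (X (e i)) us`_l) ^+ 2 = \sum_(i <- s) normc (c i) ^+ 2.
  by apply: eq_bigr => i _; rewrite /c normc_conj.
have := le_trans (cauchy_schwarz (X f) u1) (bX f).
rewrite Xf normcR real_normK ?num_real// hn2_comb//.
apply: le_mul_sqrt_le => //; apply: sumr_ge0 => i _; exact: sqr_ge0.
Qed.

(** The Hilbert-Schmidt norm is computed against the basis of the range; each basis vector
    contributes at most M^2. *)
Lemma hilbert_schmidt_le : \sum_(i <- s) hn2 (X (e i)) <= (size us)%:R * M ^+ 2.
Proof.
have E i : hn2 (X (e i)) = \sum_(l <- iota 0 (size us)) normc (ip (X (e i)) us`_l) ^+ 2.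
  rewrite {1}rX (@hn2_comb _ (fun l => us`_l)) ?iota_uniq// => j l.
  by rewrite !mem_iota !add0n => /= hj hl; exact: ou.
under eq_bigr => i _ do rewrite E.
rewrite exchange_big/=.
apply: le_trans (_ : \sum_(l <- iota 0 (size us)) M ^+ 2 <= _); last first.
  by rewrite big_const_seq count_predT size_iota iter_addr addr0 mulr_natl.
rewrite big_seq [leRHS]big_seq; apply: ler_sum => l; rewrite mem_iota add0n => /= hl.
exact: adjoint_column_le.
Qed.

(** A substitute for the trace norm. Expanding X e_i along u_l, each product x y is split as x^2 / M
    + M y^2. Summed over i, the first part is at most M by [adjoint_column_le] and the second at
    most M K by the hypothesis on q at the unit vector u_l. *)
Lemma trace_le (q : I -> V -> R) (K : R) : 0 < M ->
  (forall i f, 0 <= q i f) -> (forall i, q i 0 = 0) ->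
  (forall i f h, q i (f + h) <= q i f + q i h) ->
  (forall i c f, q i (c *: f) = normc c * q i f) ->
  (forall f, \sum_(i <- s) q i f ^+ 2 <= K * hn2 f) ->
  \sum_(i <- s) q i (X (e i)) <= (size us)%:R * (M * (1 + K)).
Proof.
move=> Mp q0 qz qD qZ qK.
have qsum i (r : seq nat) (F : nat -> V) : q i (\sum_(l <- r) F l) <= \sum_(l <- r) q i (F l).
  elim: r => [|l r IH]; rewrite ?big_nil ?qz// !big_cons.
  by apply: le_trans (qD _ _ _) _; rewrite lerD2l.
pose t i l := normc (ip (X (e i)) us`_l) ^+ 2.
apply: le_trans (_ : \sum_(i <- s) \sum_(l <- iota 0 (size us))
   (M^-1 * t i l + M * q i us`_l ^+ 2) <= _).
  apply: ler_sum => i _; rewrite {1}rX; apply: le_trans (qsum _ _ _) _.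
  apply: ler_sum => l _; rewrite qZ /t.
  set x := normc _; set y := q _ _.
  have E : M^-1 * x ^+ 2 + M * y ^+ 2 - x * y = M^-1 * ((x - M * y / 2) ^+ 2 + 3 / 4 * (M * y) ^+ 2).
    by field; rewrite gt_eqF.
  rewrite -subr_ge0 E mulr_ge0 ?invr_ge0 ?(ltW Mp)// addr_ge0 ?sqr_ge0//.
  by rewrite mulr_ge0 ?sqr_ge0//; lra.
rewrite exchange_big/=.
apply: le_trans (_ : \sum_(l <- iota 0 (size us)) M * (1 + K) <= _); last first.
  by rewrite big_const_seq count_predT size_iota iter_addr addr0 mulr_natl.
rewrite big_seq [leRHS]big_seq; apply: ler_sum => l; rewrite mem_iota add0n => /= hl.
rewrite big_split/= -!mulr_sumr mulrDr mulr1 lerD//.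
  by rewrite ler_pdivrMl// -expr2; exact: adjoint_column_le.
rewrite ler_wpM2l//; apply: le_trans (qK _) _.
by have -> : hn2 us`_l = 1 by [apply: complexI; rewrite -ipE ou// eqxx]; rewrite mulr1.
Qed.

End FiniteRank.

Lemma mono_ex n : exists f, coef f = fun m => (m == n)%:R.
Proof.
apply: mkH2_ex; exists 1 => N; rewrite /sqnorm.
have [nN|nN] := ltnP n N.
  rewrite (bigD1 (Ordinal nN))//= eqxx normc1 expr1n big1 ?addr0// => i /negbTE.
  by rewrite -val_eqE/= => ->; rewrite normc0 expr0n.
rewrite big1 ?ler01// => i _; rewrite (_ : _ == _ = false) ?normc0 ?expr0n//.
by apply/negbTE; rewrite ltn_eqF// (leq_trans _ nN).
Qed.

Definition mono n : V := projT1 (cid (mono_ex n)).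

Lemma coef_mono n : coef (mono n) = fun m => (m == n)%:R.
Proof. exact: (projT2 (cid (mono_ex n))). Qed.

Lemma ip_mono f n : ip f (mono n) = coef f n.
Proof.
apply: (clim_near (K := n.+1)) (ipP f (mono n)) => N nN.
rewrite coef_mono (bigD1 (Ordinal nN))//= eqxx conjc1 mulr1 big1 ?addr0// => i /negbTE.
by rewrite -val_eqE/= => ->; rewrite conjc0 mulr0.
Qed.

Lemma mono_on i j : ip (mono i) (mono j) = (i == j)%:R.
Proof. by rewrite ip_mono coef_mono eq_sym. Qed.

Lemma tail_to0 f (e : R) : 0 < e -> exists N0, forall N, (N0 <= N)%N ->
  hn2 (f - proj mono (iota 0 N) f) <= e.
Proof.
move=> e0; have [N0 H] := ipP f f e0; exists N0 => N /H.
rewrite ipE => h; have {h} := le_trans (Re_le_normc _) h.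
rewrite ReD ReN re_norm2_coef/= => /(le_trans (ler_norm _)); apply: le_trans.
rewrite lerBrDr -[leRHS](@bessel_eq _ mono (iota 0 N)) ?iota_uniq//; last first.
  by move=> i j _ _; exact: mono_on.
rewrite lerD2l /sqnorm -(big_mkord xpredT (fun n => normc (coef f n) ^+ 2)).
by rewrite /index_iota subn0; under [leRHS]eq_bigr => i _ do rewrite ip_mono.
Qed.

(** The representing vector has the coefficients conj(L(z^n)). They are square-summable by testing L
    on their own partial sums, and both functionals agree on polynomials, hence everywhere by
    continuity. *)
Lemma riesz (L : V -> C) (B : R) : (forall c f h, L (c *: f + h) = c * L f + L h) ->
  (forall f, normc (L f) ^+ 2 <= B * hn2 f) -> exists k, forall f, L f = ip f k.
Proof.
move=> linL bL.
have L0 : L 0 = 0 by have := linL (-1) 0 0; rewrite scaler0 add0r mulN1r addNr.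
have LZ c f : L (c *: f) = c * L f by have := linL c f 0; rewrite L0 !addr0.
have LD f h : L (f + h) = L f + L h by have := linL 1 f h; rewrite scale1r mul1r.
have Lsum (r : seq nat) (F : nat -> V) : L (\sum_(i <- r) F i) = \sum_(i <- r) L (F i).
  by elim: r => [|i r IH]; rewrite ?big_nil ?L0// !big_cons LD IH.
pose a n := conjc (L (mono n)).
have B0 : 0 <= B.
  have := le_trans (sqr_ge0 _) (bL (mono 0)).
  by rewrite /hn2 mono_on eqxx mulr1.

have la : l2 a.
  exists B => N; pose f := \sum_(i <- iota 0 N) a i *: mono i.
  have Lf : L f = (sqnorm a N)%:C.
    rewrite Lsum /sqnorm -(big_mkord xpredT (fun n => normc (a n) ^+ 2)).
    rewrite /index_iota subn0 rmorph_sum/=; apply: eq_bigr => i _.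
    by rewrite LZ -mulcJ /a conjI.
  have hf : hn2 f = sqnorm a N.
    rewrite (@hn2_comb _ mono) ?iota_uniq//; last by move=> i j _ _; exact: mono_on.
    by rewrite /sqnorm -(big_mkord xpredT (fun n => normc (a n) ^+ 2)) /index_iota subn0.
  have := bL f; rewrite Lf hf normcR real_normK ?num_real// -(sqr_sqrtr B0).
  by apply: le_mul_sqrt_le; rewrite ?sqrtr_ge0 ?norm2_coef_ge0.
have [k hk] := mkH2_ex la; exists k => f; apply/eqP; rewrite -subr_eq0; apply/eqP.
apply/normc_eq0_small => e e0.
have e2 : 0 < e / 2 by rewrite divr_gt0.
have [N1 H1] := ipP f k e2.
have B1 : 0 < B + 1 by rewrite ltr_wpDl.
have e3 : 0 < (e / 2) ^+ 2 / (B + 1) by rewrite divr_gt0// exprn_gt0.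
have [N2 H2] := tail_to0 f e3.
set N := maxn N1 N2; have h1 := H1 N (leq_maxl _ _); have h2 := H2 N (leq_maxr _ _).
have E : L (proj mono (iota 0 N) f) = \sum_(n < N) coef f n * conjc (coef k n).
  rewrite Lsum -(big_mkord xpredT (fun n => coef f n * conjc (coef k n))).
  rewrite /index_iota subn0; apply: eq_bigr => i _.
  by rewrite LZ ip_mono hk /a conjI.
have -> : L f - ip f k = L (f - proj mono (iota 0 N) f) - (ip f k - L (proj mono (iota 0 N) f)).
  have := LD (f - proj mono (iota 0 N) f) (proj mono (iota 0 N) f).
  by rewrite subrK => ->; ring.
apply: normcD_le; rewrite normcN [e]splitr lerD ?E//.
rewrite -(@ler_pXn2r _ 2) ?nnegrE ?normc_ge0 ?(ltW e2)//.
apply: le_trans (bL _) _; apply: le_trans (ler_wpM2l B0 h2) _.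
rewrite mulrCA ler_piMr ?sqr_ge0// ler_pdivrMr// mul1r; lra.
Qed.

End HardyHilbert.

(** * Area integrals and the Littlewood-Paley identity *)

Section PlaneIntegral.
Variable R : realType.
Local Notation MR := (measurableTypeR R).
Local Notation mu := (@lebesgue_measure R).
Local Notation mu2 := (mu \x mu)%E.

Lemma integral_affine (G : MR -> \bar R) (r s : R) : 0 < r ->
  measurable_fun setT G -> (forall x, 0 <= G x)%E ->
  (\int[mu]_x G x = r%:E * \int[mu]_x G (affine_map r s x))%E.
Proof.
move=> r0 mG G0.
pose m1 := image_measure mu (measurable_affine_map r s).
have -> : (\int[mu]_x G x = \int[mscale (NngNum (ltW r0)) m1]_x G x)%E.
  apply: eq_measure_integral => A mA _.
  exact: (lebesgue_affine s r0 mA).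
rewrite ge0_integral_mscale//; congr (_ * _)%E.
by rewrite ge0_integral_image// => x _; exact: G0.
Qed.

Definition lin1 (r a : R) (p : MR * MR) : MR * MR := (r * p.1 + a * p.2 : R, p.2).
Definition lin2 (r a : R) (p : MR * MR) : MR * MR := (p.1, r * p.2 + a * p.1 : R).

Lemma measurable_linc (r a : R) (u v : MR * MR -> R) : measurable_fun setT u ->
  measurable_fun setT v -> measurable_fun setT (fun p => r * u p + a * v p).
Proof. by move=> mu mv; apply: measurable_funD; exact: measurable_funM. Qed.

Lemma measurable_p1 : measurable_fun setT (fun p : MR * MR => p.1 : R).
Proof. by have := @measurable_fst _ _ MR MR. Qed.

Lemma measurable_p2 : measurable_fun setT (fun p : MR * MR => p.2 : R).
Proof. by have := @measurable_snd _ _ MR MR. Qed.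

Lemma measurable_lin1 r a : measurable_fun setT (lin1 r a).
Proof.
apply: measurable_fun_pair; last exact: measurable_snd.
exact: measurable_linc measurable_p1 measurable_p2.
Qed.

Lemma measurable_lin2 r a : measurable_fun setT (lin2 r a).
Proof.
apply: measurable_fun_pair; first exact: measurable_fst.
exact: measurable_linc measurable_p2 measurable_p1.
Qed.

Lemma integral_lin1 (F : MR * MR -> \bar R) r a : 0 < r ->
  measurable_fun setT F -> (forall p, 0 <= F p)%E ->
  (\int[mu2]_p F p = r%:E * \int[mu2]_p F (lin1 r a p))%E.
Proof.
move=> r0 mF F0; rewrite fubini_tonelli2// [in RHS]fubini_tonelli2//; last first.
  exact: measurableT_comp mF (measurable_lin1 r a).
rewrite -ge0_integralZl_EFin//; last 3 first.
- by move=> y _; apply: integral_ge0.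
- apply: measurable_fun_fubini_tonelli_G => //.
  exact: measurableT_comp mF (measurable_lin1 r a).
- exact: ltW.
apply: eq_integral => y _; rewrite /fubini_G (integral_affine (a * y) r0)//.
exact: measurable_fun_pair1.
Qed.

Lemma integral_lin2 (F : MR * MR -> \bar R) r a : 0 < r ->
  measurable_fun setT F -> (forall p, 0 <= F p)%E ->
  (\int[mu2]_p F p = r%:E * \int[mu2]_p F (lin2 r a p))%E.
Proof.
move=> r0 mF F0; rewrite fubini_tonelli1// [in RHS]fubini_tonelli1//; last first.
  exact: measurableT_comp mF (measurable_lin2 r a).
rewrite -ge0_integralZl_EFin//; last 3 first.
- by move=> y _; apply: integral_ge0.
- apply: measurable_fun_fubini_tonelli_F => //.
  exact: measurableT_comp mF (measurable_lin2 r a).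
- exact: ltW.
apply: eq_integral => y _; rewrite /fubini_F (integral_affine (a * y) r0)//.
exact: measurable_fun_pair2.
Qed.

Definition rot (c s : R) (p : MR * MR) : MR * MR := (c * p.1 - s * p.2 : R, s * p.1 + c * p.2 : R).

Lemma measurable_rot c s : measurable_fun setT (rot c s).
Proof.
apply: measurable_fun_pair; last exact: measurable_linc measurable_p1 measurable_p2.
have := @measurable_linc c (- s) _ _ measurable_p1 measurable_p2.
by under eq_fun do rewrite mulNr.
Qed.

(* A rotation by an angle different from [pi] is a product of three shears. *)
Lemma integral_rot_shear (F : MR * MR -> \bar R) c s : c ^+ 2 + s ^+ 2 = 1 -> c != -1 ->
  measurable_fun setT F -> (forall p, 0 <= F p)%E ->
  (\int[mu2]_p F p = \int[mu2]_p F (rot c s p))%E.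
Proof.
move=> cs c1 mF F0.
have c1' : 1 + c != 0 by rewrite addrC; apply: contraNneq c1 => h; apply/eqP; lra.
pose a := - (s / (1 + c)).
have m1 : measurable_fun setT (F \o lin1 1 a) := measurableT_comp mF (measurable_lin1 1 a).
have m2 : measurable_fun setT (F \o lin1 1 a \o lin2 1 s) :=
  measurableT_comp m1 (measurable_lin2 1 s).
rewrite (integral_lin1 a ltr01 mF F0) mul1e.
rewrite (integral_lin2 s ltr01 m1)//; last by move=> p; exact: F0.
rewrite mul1e (integral_lin1 a ltr01 m2)//; last by move=> p; exact: F0.
rewrite mul1e; apply: eq_integral => -[x y] _; congr (F _).
have sa : s * a = c - 1.
  have E : s ^+ 2 = (1 - c) * (1 + c) by have := congr1 (fun z => z - c ^+ 2) cs; rewrite addrAC subrr add0r => ->; ring.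
  by rewrite /a mulrN mulrA -expr2 E mulfK//; ring.
have ac : a * (1 + c) = - s by rewrite /a mulNr divfK.
rewrite /lin1 /lin2 /rot/=; congr pair.
  have -> : 1 * (1 * x + a * y) + a * (1 * y + s * (1 * x + a * y)) =
     (1 + s * a) * x + (a * (1 + (1 + s * a))) * y by ring.
  by rewrite sa [1 + (c - 1)]addrC subrK ac mulNr.
have -> : 1 * y + s * (1 * x + a * y) = s * x + (1 + s * a) * y by ring.
by rewrite sa [1 + (c - 1)]addrC subrK.
Qed.

(** The half turn, which escapes the shear decomposition, is two quarter turns. *)
Lemma integral_rot (F : MR * MR -> \bar R) c s : c ^+ 2 + s ^+ 2 = 1 ->
  measurable_fun setT F -> (forall p, 0 <= F p)%E ->
  (\int[mu2]_p F p = \int[mu2]_p F (rot c s p))%E.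
Proof.
move=> cs mF F0; have [c1|c1] := eqVneq c (-1); last exact: integral_rot_shear.
have s0 : s = 0 by apply/eqP; rewrite -sqrf_eq0; apply/eqP; move: cs; rewrite c1; lra.
have h01 : 0 ^+ 2 + 1 ^+ 2 = 1 :> R by rewrite expr0n expr1n add0r.
have n01 : 0 != -1 :> R by rewrite eq_sym oppr_eq0 oner_eq0.
have m1 : measurable_fun setT (F \o rot 0 1) := measurableT_comp mF (measurable_rot 0 1).
rewrite (integral_rot_shear h01 n01 mF F0) (integral_rot_shear h01 n01 m1)//; last first.
  by move=> p; exact: F0.
apply: eq_integral => -[x y] _; congr (F _); rewrite /rot/= c1 s0.
by congr pair; ring.
Qed.

Lemma integral_scale (F : MR * MR -> \bar R) r : 0 < r ->
  measurable_fun setT F -> (forall p, 0 <= F p)%E ->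
  (\int[mu2]_p F p = (r ^+ 2)%:E * \int[mu2]_p F (r * p.1, r * p.2)%R)%E.
Proof.
move=> r0 mF F0.
have m1 : measurable_fun setT (F \o lin1 r 0) := measurableT_comp mF (measurable_lin1 r 0).
rewrite (integral_lin1 0 r0 mF F0) (integral_lin2 0 r0 m1); last by move=> p; exact: F0.
rewrite muleA -EFinM expr2; congr (_ * _)%E; apply: eq_integral => -[x y] _; congr (F _).
by rewrite /lin1 /lin2/= !mul0r !addr0.
Qed.

(** A separate constant for planar Lebesgue measure, to carry the sigma-finiteness required by
    Tonelli on the product of the line and the plane. *)
Definition area : set (MR * MR) -> \bar R := mu2.

HB.instance Definition _ := Measure.on area.

Lemma area_sigma_finite : sigma_finite setT area.
Proof.
have /sigma_finiteP[F [TF ndF Foo]] := sigma_finiteT mu.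
exists (fun n => F n `*` F n).
  rewrite -setXTT TF predeqE => -[x y]; split.
    move=> [/= [n _ Fnx] [k _ Gky]]; exists (maxn n k) => //; split.
    - by move: x Fnx; exact/subsetPset/ndF/leq_maxl.
    - by move: y Gky; exact/subsetPset/ndF/leq_maxr.
  by move=> [n _ []/= ? ?]; split; exists n.
move=> k; have [mk fk] := Foo k; split; first exact: measurableX.
by rewrite /area product_measure1E// lte_mul_pinfty// ge0_fin_numE.
Qed.

HB.instance Definition _ := Measure_isSigmaFinite.Build _ _ _ area area_sigma_finite.

(** Rotation invariance and Tonelli; this stands in for integration in polar coordinates. *)
Lemma rot_average (F : MR * MR -> \bar R) :
  measurable_fun setT F -> (forall p, 0 <= F p)%E ->
  ((2 * pi)%:E * \int[mu2]_p F p =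
   \int[mu2]_p \int[mu]_(t in `[0%R, (2 * pi)%R]) F (rot (cos t) (sin t) p))%E.
Proof.
move=> mF F0.
have mp : measurable_fun setT (fun q : MR * (MR * MR) => rot (cos q.1) (sin q.1) q.2).
  have mc : measurable_fun setT (fun q : MR * (MR * MR) => cos (q.1 : R)).
    apply: (measurableT_comp (f := @cos R)); last exact: measurable_fst.
    by apply: continuous_measurable_fun => t; exact: continuous_cos.
  have ms : measurable_fun setT (fun q : MR * (MR * MR) => sin (q.1 : R)).
    apply: (measurableT_comp (f := @sin R)); last exact: measurable_fst.
    by apply: continuous_measurable_fun => t; exact: continuous_sin.
  have m1 : measurable_fun setT (fun q : MR * (MR * MR) => q.2.1 : R).
    exact: measurableT_comp measurable_p1 (@measurable_snd _ _ MR (MR * MR)%type).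
  have m2 : measurable_fun setT (fun q : MR * (MR * MR) => q.2.2 : R).
    exact: measurableT_comp measurable_p2 (@measurable_snd _ _ MR (MR * MR)%type).
  apply: measurable_fun_pair.
    by apply: measurable_funB; exact: measurable_funM.
  by apply: measurable_funD; exact: measurable_funM.
pose G (q : MR * (MR * MR)) : \bar R :=
  ((\1_`[0%R, (2 * pi)%R] (q.1 : R))%:E * F (rot (cos q.1) (sin q.1) q.2))%E.
have G0 q : (0 <= G q)%E by rewrite mule_ge0// lee_fin.
have mG : measurable_fun setT G.
  apply: emeasurable_funM; last exact: measurableT_comp mF mp.
  have mI : measurable_fun setT (\1_`[0%R, (2 * pi)%R] : MR -> R) by exact: measurable_indic.
  apply/measurable_EFinP.
  exact: (measurableT_comp mI (@measurable_fst _ _ MR (MR * MR)%type)).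
have := @fubini_tonelli1 _ _ _ _ _ mu area G mG G0.
rewrite (@fubini_tonelli2 _ _ _ _ _ mu area G mG G0).
rewrite /fubini_G /fubini_F => E.
transitivity (\int[mu2]_y \int[mu]_x G (x, y))%E; last first.
  apply: eq_integral => p _; rewrite [RHS]integral_mkcond; apply: eq_integral => t _.
  rewrite /G patchE indicE/=; case: ifPn => _; by rewrite ?mul1e ?mul0e.
rewrite E; transitivity (\int[mu]_x ((\1_`[0%R, (2 * pi)%R] x)%:E * \int[mu2]_p F p))%E; last first.
  apply: eq_integral => t _; rewrite /G/= ge0_integralZl_EFin//; last first.
    exact: measurableT_comp mF (measurable_rot _ _).
  by congr (_ * _)%E; apply: integral_rot => //; exact: cos2Dsin2.
rewrite ge0_integralZr//; last 2 first.
- by apply/measurable_EFinP; exact: measurable_indic.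
- exact: integral_ge0.
rewrite integral_indic// setIT; congr (_ * _)%E.
suff L : mu `[0%R, (2 * pi)%R]%classic = (2 * pi)%:E by exact: esym L.
by rewrite lebesgue_measure_itv/= lte_fin mulr_gt0// ?pi_gt0// -EFinB subr0.
Qed.

End PlaneIntegral.

(** * Radial weights, moments and the Littlewood-Paley estimates *)

Section LittlewoodPaley.
Variable R : realType.
Local Notation C := R[i].
Local Notation MR := (measurableTypeR R).
Local Notation mu := (@lebesgue_measure R).
Local Notation mu2 := (mu \x mu)%E.
Implicit Types (S T : set C) (F G W : C -> R) (z : C).

Definition toC (p : MR * MR) : C := (p.1 : R) +i* (p.2 : R).

Definition pl S : set (MR * MR) := [set p | S (toC p)].

Definition aint S F : \bar R := (\int[mu2]_(p in pl S) (F (toC p))%:E)%E.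

Definition cmeas S := measurable (pl S).

Record cmeasf S F : Prop := Cmeasf { cmeasfP : measurable_fun (pl S) (F \o toC) }.

Lemma plI S T : pl (S `&` T) = pl S `&` pl T.
Proof. by []. Qed.

Lemma cmeasI S T : cmeas S -> cmeas T -> cmeas (S `&` T).
Proof. by move=> mS mT; rewrite /cmeas plI; exact: measurableI. Qed.

Lemma cmeasU S T : cmeas S -> cmeas T -> cmeas (S `|` T).
Proof. exact: measurableU. Qed.

Lemma cmeasC S : cmeas S -> cmeas (~` S).
Proof. exact: measurableC. Qed.

Lemma cmeasfS S T F : cmeas S -> T `<=` S -> cmeasf S F -> cmeasf T F.
Proof. by move=> mS TS [mF]; split; apply: measurable_funS mF => // p; exact: TS. Qed.

Lemma cmeasfT S F : cmeasf setT F -> cmeasf S F.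
Proof. by move=> [mF]; split; exact: measurable_funTS. Qed.

Lemma cmeasf_Re : cmeasf setT (@complex.Re R).
Proof. by split; exact: measurable_p1. Qed.

Lemma cmeasf_Im : cmeasf setT (@complex.Im R).
Proof. by split; exact: measurable_p2. Qed.

Lemma cmeasfM S F G : cmeasf S F -> cmeasf S G -> cmeasf S (fun z => F z * G z).
Proof. by move=> [?] [?]; split; exact: measurable_funM. Qed.

Lemma cmeasfD S F G : cmeasf S F -> cmeasf S G -> cmeasf S (fun z => F z + G z).
Proof. by move=> [?] [?]; split; exact: measurable_funD. Qed.

Lemma cmeasf_cst S (c : R) : cmeasf S (fun=> c).
Proof. by split; exact: measurable_cst. Qed.

Lemma cmeasfX S F n : cmeasf S F -> cmeasf S (fun z => F z ^+ n).
Proof. by move=> [?]; split; exact: measurable_funX. Qed.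

Lemma cmeasf_sqrt S F : cmeasf S F -> cmeasf S (fun z => Num.sqrt (F z)).
Proof.
move=> [mF]; split; apply: (measurableT_comp (f := @Num.sqrt R)) => //.
by apply: continuous_measurable_fun; exact: sqrt_continuous.
Qed.

Lemma cmeasf_ext S F G : (forall z, S z -> F z = G z) -> cmeasf S F -> cmeasf S G.
Proof.
by move=> FG [mF]; split; apply: eq_measurable_fun mF => p; rewrite inE => /FG.
Qed.

Lemma cmeasf_normc2 S : cmeasf S (fun z => normc z ^+ 2).
Proof.
apply: cmeasf_ext (_ : cmeasf S (fun z => complex.Re z ^+ 2 + complex.Im z ^+ 2)).
  by move=> z _; rewrite normc2.
by apply: cmeasfT; apply: cmeasfD; apply: cmeasfX; [exact: cmeasf_Re|exact: cmeasf_Im].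
Qed.

Lemma cmeasf_normc S : cmeasf S (@normc R).
Proof.
apply: cmeasf_ext (cmeasf_sqrt (cmeasf_normc2 S)) => z _.
by rewrite sqrtr_sqr ger0_norm ?normc_ge0.
Qed.

Lemma cmeas_lt F (r : R) : cmeasf setT F -> cmeas [set z | F z < r].
Proof.
move=> [mF]; have := mF measurableT `]-oo, r[%classic (measurable_itv _).
by rewrite setTI /cmeas (_ : _ @^-1` _ = pl [set z | F z < r]).
Qed.

Lemma cmeas_le F (r : R) : cmeasf setT F -> cmeas [set z | r <= F z].
Proof.
move=> /(cmeas_lt r)/cmeasC; rewrite (_ : ~` _ = [set z | r <= F z])//.
by apply/seteqP; split => z /=; [move/negP; rewrite -leNgt|rewrite leNgt => /negP].
Qed.

Lemma cmeas_ball (r : R) : cmeas [set z | normc z < r].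
Proof. exact: (cmeas_lt r (cmeasf_normc _)). Qed.

Lemma cmeas_disc : cmeas (@disc R).
Proof. exact: cmeas_ball. Qed.

Lemma cmeasf_cvg S (Fn : nat -> C -> R) F : (forall n, cmeasf S (Fn n)) ->
  (forall z, S z -> (fun n => Fn n z) @ \oo --> F z) -> cmeasf S F.
Proof.
move=> mF cF; split; apply: (measurable_fun_cvg (fun n => cmeasfP (mF n))) => p.
exact: cF.
Qed.

Lemma cmeasf_psum a N : cmeasf setT (fun z => complex.Re (psum a z N)) /\
  cmeasf setT (fun z => complex.Im (psum a z N)).
Proof.
have mX n : cmeasf setT (fun z => complex.Re (z ^+ n)) /\ cmeasf setT (fun z => complex.Im (z ^+ n)).
  elim: n => [|n [h1 h2]].
    by split; [apply: (cmeasf_cst _ 1)|apply: (cmeasf_cst _ 0)].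
  split.
    apply: cmeasf_ext (cmeasfD (cmeasfM cmeasf_Re h1)
      (cmeasfM (cmeasf_cst _ (-1)) (cmeasfM cmeasf_Im h2))) => z _.
    by rewrite exprS ReM; ring.
  apply: cmeasf_ext (cmeasfD (cmeasfM cmeasf_Re h2) (cmeasfM cmeasf_Im h1)) => z _.
  by rewrite exprS ImM; ring.
elim: N => [|N [h1 h2]].
  split; apply: cmeasf_ext (cmeasf_cst _ 0) => z _; by rewrite /psum big_ord0.
have [m1 m2] := mX N; split.
  apply: cmeasf_ext (cmeasfD h1 (cmeasfD (cmeasfM (cmeasf_cst _ (complex.Re (a N))) m1)
     (cmeasfM (cmeasf_cst _ (- complex.Im (a N))) m2))) => z _.
  by rewrite /psum big_ord_recr/= ReD ReM; ring.
apply: cmeasf_ext (cmeasfD h2 (cmeasfD (cmeasfM (cmeasf_cst _ (complex.Re (a N))) m2)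
   (cmeasfM (cmeasf_cst _ (complex.Im (a N))) m1))) => z _.
by rewrite /psum big_ord_recr/= ImD ImM; ring.
Qed.

Lemma cvg_normc (u : nat -> C) (l : C) : clim u l ->
  (fun n => normc (u n)) @ \oo --> (normc l : R).
Proof.
move=> hl; apply/cvgrPdist_le => e e0; have [N0 H] := hl _ e0.
exists N0 => //= N /H h; apply: le_trans h; rewrite ler_norml.
have := ler_normcB l (u N); have := ler_normcB (u N) l.
by rewrite -(normcN (u N - l)) opprB => h1 h2; apply/andP; split; lra.
Qed.

Lemma cmeasf_ps h a : is_ps h a -> cmeasf (@disc R) (fun z => normc (h z)).
Proof.
move=> ha; apply: (@cmeasf_cvg _ (fun n z => normc (psum a z n))).
  move=> n; have [m1 m2] := cmeasf_psum a n; apply: cmeasfT.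
  apply: cmeasf_ext (cmeasf_sqrt (cmeasfD (cmeasfX 2 m1) (cmeasfX 2 m2))) => z _.
  by rewrite -normc2 sqrtr_sqr ger0_norm ?normc_ge0.
by move=> z hz; apply: cvg_normc; exact: ha.
Qed.

Lemma cmeasf_EFin S F : cmeasf S F -> measurable_fun (pl S) (fun p => (F (toC p))%:E).
Proof. by move=> [mF]; exact/measurable_EFinP. Qed.

Lemma aint_ge0 S F : (forall z, S z -> 0 <= F z) -> (0 <= aint S F)%E.
Proof. by move=> F0; apply: integral_ge0 => p hp; rewrite lee_fin F0. Qed.

Lemma aint_le S F G : cmeas S -> (forall z, S z -> 0 <= F z) ->
  (forall z, S z -> F z <= G z) -> cmeasf S F -> cmeasf S G ->
  (aint S F <= aint S G)%E.
Proof.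
move=> mS F0 FG mF mG; apply: ge0_le_integral => //; try exact: cmeasf_EFin.
- by move=> p hp; rewrite lee_fin F0.
- by move=> p hp; rewrite lee_fin FG.
Qed.

Lemma eq_aint S F G : (forall z, S z -> F z = G z) -> aint S F = aint S G.
Proof. by move=> FG; apply: eq_integral => p; rewrite inE => /FG ->. Qed.

Lemma aintD S F G : cmeas S -> (forall z, S z -> 0 <= F z) -> (forall z, S z -> 0 <= G z) ->
  cmeasf S F -> cmeasf S G -> aint S (fun z => F z + G z) = (aint S F + aint S G)%E.
Proof.
move=> mS F0 G0 mF mG; rewrite /aint -ge0_integralD//; try exact: cmeasf_EFin.
- by move=> p hp; rewrite lee_fin F0.
- by move=> p hp; rewrite lee_fin G0.
Qed.

Lemma aintZ S F (k : R) : cmeas S -> 0 <= k -> (forall z, S z -> 0 <= F z) ->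
  cmeasf S F -> aint S (fun z => k * F z) = (k%:E * aint S F)%E.
Proof.
move=> mS k0 F0 mF; rewrite /aint -ge0_integralZl_EFin//; try exact: cmeasf_EFin.
by move=> p hp; rewrite lee_fin F0.
Qed.

Lemma aint_mono S T F : cmeas S -> cmeas T -> S `<=` T -> (forall z, T z -> 0 <= F z) ->
  cmeasf T F -> (aint S F <= aint T F)%E.
Proof.
move=> mS mT ST F0 mF; apply: ge0_subset_integral => //; first exact: cmeasf_EFin.
- by move=> p hp; rewrite lee_fin F0.
- by move=> p; exact: ST.
Qed.

Lemma aintU S T F : cmeas S -> cmeas T -> (forall z, S z -> T z -> False) ->
  (forall z, (S `|` T) z -> 0 <= F z) -> cmeasf (S `|` T) F ->
  aint (S `|` T) F = (aint S F + aint T F)%E.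
Proof.
move=> mS mT ST F0 mF; rewrite /aint; have -> : pl (S `|` T) = pl S `|` pl T by [].
rewrite ge0_integral_setU//; first exact: (cmeasf_EFin mF).
- by move=> p hp; rewrite lee_fin F0.
- by apply/disj_set2P/seteqP; split => // p [] /ST; apply.
Qed.

Lemma aint_scale (r : R) F : 0 < r -> cmeasf setT F -> (forall z, 0 <= F z) ->
  aint [set z | normc z < r] F = ((r ^+ 2)%:E * aint (@disc R) (fun z => F (r%:C * z)%R))%E.
Proof.
move=> r0 mF F0; rewrite /aint integral_mkcond [in RHS]integral_mkcond.
have mG : measurable_fun setT ((fun p => (F (toC p))%:E) \_ (pl [set z | normc z < r])).
  apply/(measurable_restrictT _ (cmeas_ball r)); apply: measurable_funTS.
  exact: (cmeasf_EFin mF).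
rewrite (integral_scale r0 mG); last first.
  by move=> p; rewrite patchE; case: ifP => // _; rewrite lee_fin.
congr (_ * _)%E; apply: eq_integral => -[x y] _; rewrite [LHS]patchE [RHS]patchE.
have E : toC (r * x, r * y) = r%:C * toC (x, y).
  by apply: complex_eq; rewrite ?ReM ?ImM/=; ring.
have -> : ((r * x, r * y) \in pl [set z | normc z < r]) = ((x, y) \in pl (@disc R)).
  apply/idP/idP; rewrite !inE /pl /mkset E normcM normcR gtr0_norm// /disc /mkset.
    by rewrite gtr_pMr.
  by rewrite gtr_pMr.
by rewrite /= E.
Qed.

Definition disc_area : \bar R := aint (@disc R) (fun=> 1).

Lemma cmeas_rect (a b : R) : cmeas [set z | [/\ a <= complex.Re z <= b & a <= complex.Im z <= b]] /\
  aint [set z | [/\ a <= complex.Re z <= b & a <= complex.Im z <= b]] (fun=> 1) =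
  (mu `[a, b]%classic * mu `[a, b]%classic)%E.
Proof.
have E : pl [set z | [/\ a <= complex.Re z <= b & a <= complex.Im z <= b]] =
  (`[a, b]%classic `*` `[a, b]%classic : set (MR * MR)).
  by apply/seteqP; split => -[x y] /=; rewrite !in_itv.
have mE : measurable (`[a, b]%classic `*` `[a, b]%classic : set (MR * MR)).
  by apply: measurableX; exact: measurable_itv.
split; first by rewrite /cmeas E.
rewrite /aint E integral_cst// mul1e.
by apply: product_measure1E; exact: measurable_itv.
Qed.

(** The area of the disc is kept as an unnamed constant A; comparison with two squares shows that it
    is positive and finite. *)
Lemma disc_area_fin : exists2 A : R, 0 < A & disc_area = A%:E.
Proof.
have [m1 a1] := cmeas_rect (-1) 1; have [m2 a2] := cmeas_rect 0 2^-1.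
have c1 S : cmeasf S (fun=> 1) by exact: cmeasf_cst.
have le1 : (disc_area <= 4%:E)%E.
  have -> : (4%:E = (mu `[(-1)%R, 1%R]%classic * mu `[(-1)%R, 1%R]%classic) :> \bar R)%E.
    rewrite lebesgue_measure_itv/= lte_fin; have -> : (-1 < 1 :> R) by lra.
    by rewrite -EFinB -EFinM; congr EFin; ring.
  rewrite -a1; apply: aint_mono => //; first exact: cmeas_disc.
  move=> z; rewrite /disc/mkset => hz.
  have := Re_le_normc z; have := Im_le_normc z.
  by rewrite !ler_norml => /andP[? ?] /andP[? ?]; split; apply/andP; split; lra.
have le2 : (4^-1%:E <= disc_area)%E.
  have -> : (4^-1%:E = (mu `[0%R, 2^-1%R]%classic * mu `[0%R, 2^-1%R]%classic) :> \bar R)%E.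
    rewrite lebesgue_measure_itv/= lte_fin; have -> : (0 < 2^-1 :> R) by rewrite invr_gt0.
    by rewrite -EFinB -EFinM; congr EFin; field.
  rewrite -a2; apply: aint_mono => //; first exact: cmeas_disc.
  case=> x y [/= hx hy]; rewrite /disc /mkset.
  rewrite -(@ltr_pXn2r _ 2)// ?nnegrE ?normc_ge0// normc2/= expr1n.
  nra.
have fA : disc_area \is a fin_num.
  by rewrite ge0_fin_numE ?(le_lt_trans le1) ?ltry//; apply: aint_ge0.
exists (fine disc_area); last by rewrite fineK.
by rewrite fine_gt0// (lt_le_trans _ le2) ?lte_fin// (le_lt_trans le1) ?ltry.
Qed.

(** As u tends to 1, u^n tends to 1 and the sum to n + 1. For each inequality u = 1 - t, with t so
    small that Bernoulli's inequality loses at most e. *)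
Lemma moment_squeeze (x a : R) n : 0 <= x -> 0 <= a ->
  (forall u, 0 < u < 1 -> u ^+ n * a <= x * \sum_(i < n.+1) u ^+ i <= a) ->
  x * n.+1%:R = a.
Proof.
move=> x0 a0 H; apply/eqP; rewrite eq_le; apply/andP; split; apply/ler_addgt0Pr => e e0.
  pose t := e / (e + (n.+1%:R * n.+1%:R * x + 1)).
  have K0 : 0 <= n.+1%:R * n.+1%:R * x by rewrite !mulr_ge0.
  have D0 : 0 < e + (n.+1%:R * n.+1%:R * x + 1) by lra.
  have t01 : 0 < t < 1 by rewrite divr_gt0//= ltr_pdivrMr// mul1r; lra.
  have [t0 t1] := andP t01.
  have /H/andP[_ h] : 0 < 1 - t < 1 by lra.
  have s : n.+1%:R * (1 - n%:R * t) <= \sum_(i < n.+1) (1 - t) ^+ i.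
    apply: le_trans (_ : \sum_(i < n.+1) (1 - n%:R * t) <= _).
      by rewrite big_const_ord iter_addr addr0 mulr_natl.
    apply: ler_sum => i _; apply: le_trans (bernoulli_pow i _); last by lra.
    by rewrite lerD2l lerN2 ler_wpM2r ?(ltW t0)// ler_nat -ltnS.
  have {h s} := le_trans (ler_wpM2l x0 s) h.
  have : n.+1%:R * n.+1%:R * x * t <= e.
    rewrite /t mulrA ler_pdivrMr// mulrC ler_wpM2l// ?ltW//; lra.
  have n1 : (n%:R : R) <= n.+1%:R by rewrite ler_nat.
  have : x * n.+1%:R * t * n%:R <= x * n.+1%:R * t * n.+1%:R.
    by apply: ler_wpM2l n1; apply: mulr_ge0; [exact: mulr_ge0|exact: ltW].
  nra.
pose t := e / (e + (n%:R * a + 1)).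
have K0 : 0 <= n%:R * a by rewrite !mulr_ge0.
have D0 : 0 < e + (n%:R * a + 1) by lra.
have t01 : 0 < t < 1 by rewrite divr_gt0//= ltr_pdivrMr// mul1r; lra.
have [t0 t1] := andP t01.
have /H/andP[h _] : 0 < 1 - t < 1 by lra.
have s : \sum_(i < n.+1) (1 - t) ^+ i <= n.+1%:R.
  apply: le_trans (_ : \sum_(i < n.+1) 1 <= _).
    by apply: ler_sum => i _; rewrite exprn_ile1//; lra.
  by rewrite big_const_ord iter_addr addr0.
have b : 1 - n%:R * t <= (1 - t) ^+ n by apply: bernoulli_pow; lra.
have {h s} h := le_trans h (ler_wpM2l x0 s).
have {b h} h := le_trans (ler_wpM2r a0 b) h.
have : n%:R * a * t <= e.
  rewrite /t mulrA ler_pdivrMr// mulrC ler_wpM2l// ?ltW//; lra.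
lra.
Qed.

(** Let x be the moment and u = r^2. Scaling gives the disc of radius r the moment u^(n+1) x, and on
    the remaining ring, of area A (1 - u), the integrand lies between u^n and 1. Dividing by 1 - u
    yields the hypothesis of [moment_squeeze]. *)
Lemma aint_monomial n : exists2 A : R, disc_area = A%:E &
  aint (@disc R) (fun z => normc z ^+ (n + n)) = (A / n.+1%:R)%:E.
Proof.
have [A A0 EA] := disc_area_fin; exists A => //.
pose F z := normc z ^+ (n + n).
have mF S : cmeasf S F by apply: cmeasfX; exact: cmeasf_normc.
have F0 z : 0 <= F z by apply: exprn_ge0; exact: normc_ge0.
have m1 S : cmeasf S (fun=> 1) by exact: cmeasf_cst.
have mD := cmeas_disc.
have fin : (aint (@disc R) F <= A%:E)%E.
  rewrite -EA; apply: aint_le => // z hz; rewrite exprn_ile1 ?normc_ge0//; exact: ltW.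
have [x x0 Ex] : exists2 x : R, 0 <= x & aint (@disc R) F = x%:E.
  have h0 : (0 <= aint (@disc R) F)%E by apply: aint_ge0 => z _; exact: F0.
  exists (fine (aint (@disc R) F)); first by rewrite fine_ge0.
  by rewrite fineK// ge0_fin_numE// (le_lt_trans fin) ?ltry.
rewrite -/F Ex; congr EFin; apply: (canRL (mulfK _)); first by rewrite pnatr_eq0.
apply: moment_squeeze (ltW A0) _ => // u /andP[u0 u1].
pose r := Num.sqrt u; have r0 : 0 < r by rewrite sqrtr_gt0.
have r2 : r ^+ 2 = u by rewrite sqr_sqrtr ?ltW.
have r1 : r < 1 by rewrite -(@ltr_pXn2r _ 2)// ?nnegrE ?(ltW r0)// r2 expr1n.
pose B : set C := [set z | normc z < r]; pose Q := @disc R `&` [set z | r <= normc z].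
have mB : cmeas B by exact: cmeas_ball.
have mQ : cmeas Q by apply: cmeasI => //; exact: (cmeas_le r (cmeasf_normc _)).
have DE : @disc R = B `|` Q.
  apply/seteqP; split => z /=; rewrite /B /Q /disc /mkset.
    by move=> h; have [?|?] := ltP (normc z) r; [left|right].
  by case=> [/lt_trans|[]//]; apply.
have dis z : B z -> Q z -> False by rewrite /B /Q /mkset => h [_]; rewrite leNgt h.
have SF G : cmeasf setT G -> (forall z, 0 <= G z) -> aint (@disc R) G = (aint B G + aint Q G)%E.
  by move=> mG G0; rewrite {1}DE aintU//; exact: cmeasfT.
have B1 : aint B (fun=> 1) = (u * A)%:E.
  by rewrite aint_scale// r2 -/disc_area EA.
have BF : aint B F = (u ^+ n.+1 * x)%:E.
  rewrite aint_scale// r2 (@eq_aint _ _ (fun z => u ^+ n * F z)).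
    by rewrite aintZ ?exprn_ge0 ?(ltW u0)// Ex -!EFinM exprS mulrA.
  move=> z _; rewrite /F normcM normcR gtr0_norm// exprMn; congr (_ * _).
  by rewrite exprD -exprMn -expr2 r2.
have Q1 : aint Q (fun=> 1) = (A * (1 - u))%:E.
  have := SF (fun=> 1) (m1 _) (fun=> ler01); rewrite -/disc_area EA B1 => E.
  have q0 : (0 <= aint Q (fun=> 1%R))%E by apply: aint_ge0.
  by move: E q0; case: (aint Q _) => [q||]//=; rewrite -EFinD => -[E] _; congr EFin; lra.
have QF : aint Q F = (x * (1 - u ^+ n.+1))%:E.
  have := SF F (mF _) F0; rewrite Ex BF => E.
  have q0 : (0 <= aint Q F)%E by apply: aint_ge0 => z _; exact: F0.
  by move: E q0; case: (aint Q _) => [q||]//=; rewrite -EFinD => -[E] _; congr EFin; lra.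
have gE : 1 - u ^+ n.+1 = (1 - u) * \sum_(i < n.+1) u ^+ i.
  by have := subrX1 u n.+1 => h; rewrite -opprB h -mulNr opprB.
have u1' : 0 < 1 - u by rewrite subr_gt0.
apply/andP; split; rewrite -(ler_pM2r u1').
  have : (aint Q (fun=> (u ^+ n * 1)%R) <= aint Q F)%E.
    apply: aint_le => //.
    - by move=> z _; rewrite mulr1 exprn_ge0 ?ltW.
    - move=> z [_ rz]; rewrite mulr1 -r2 -exprM mulnC muln2 -addnn.
      by apply: lerXn2r => //; rewrite nnegrE ?normc_ge0 ?ltW.
    - exact: cmeasf_cst.
  rewrite aintZ ?exprn_ge0 ?(ltW u0)// Q1 QF -EFinM lee_fin gE; nra.
have : (aint Q F <= aint Q (fun=> 1%R))%E.
  apply: aint_le => // z [hz _]; rewrite exprn_ile1 ?normc_ge0//; exact: ltW.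
rewrite Q1 QF lee_fin gE; nra.
Qed.

Section Radial.
Variables (h : C -> C) (a : nat -> C) (W : C -> R).
Hypotheses (ha : is_ps h a) (mW : cmeasf (@disc R) W) (W0 : forall z, disc z -> 0 <= W z)
  (Wrot : forall t z, W (circle 1 t * z) = W z).

Definition wmoment n := aint (@disc R) (fun z => normc z ^+ (n + n) * W z).

Lemma mean2_rot z : disc z -> exists c,
  (\int[mu]_(t in `[0%R, (2 * pi)%R]) (normc (h (circle 1 t * z)%R) ^+ 2)%:E)%E =
  (mean2 h (normc z) c)%:E.
Proof.
move=> hz; have hh := is_ps_holo ha.
have [s Es] : exists s, z = circle (normc z) s.
  have [->|/polar[s [_ _ Es]]] := eqVneq z 0; last by exists s.
  by exists 0; rewrite normc0 circle_r0.
exists s; have rz : 0 <= normc z < 1 by rewrite normc_ge0.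
pose u t := normc (h (circle (normc z) t)) ^+ 2.
have cu : continuous u by move=> t; apply: normc2_continuous; exact: holo_circ_rcont.
have cus : continuous (fun t => u (t + s)).
  move=> t; apply: (@continuous_comp _ _ _ (fun t => t + s) u); last exact: cu.
  by apply: cvgD; [exact: cvg_id|exact: cvg_cst].
transitivity (\int[mu]_(t in `[0%R, (2 * pi)%R]) (u (t + s)%R)%:E)%E.
  apply: eq_integral => t _; congr (_ %:E); rewrite /u; congr (normc (h _) ^+ 2).
  by rewrite {1}Es circleM mul1r.
have -> : mean2 h (normc z) s = \int[mu]_(t in `[0, 2 * pi]) u (t + s).
  rewrite -(Rint_shift 0 (2 * pi) s cu) add0r [2 * pi + s]addrC.
  by [].
rewrite /Rintegral fineK//; apply: integrable_fin_num => //.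
by apply: cont_integrable => x _; exact: cus.
Qed.

Lemma sq_coef_cvg (r c : R) : 0 <= r < 1 ->
  (fun N => sq_coef a r N) @ \oo --> (2 * pi)^-1 * mean2 h r c.
Proof.
move=> r01; have [K [q [K0 q01 H]]] := parseval c ha r01; have p0 := pi2_gt0 R.
apply/cvgrPdist_le => e e0.
have [N0 HN] := geo_small q01 K0 (mulr_gt0 p0 e0).
exists N0 => //= N /HN /(le_trans (H N)) h1.
rewrite -(ler_pM2l p0) -{1}(gtr0_norm p0) -normrM mulrBr mulrA mulfV ?gt_eqF//.
by rewrite mul1r.
Qed.

(** The mean of |h|^2 over the circle through z, see [rmean2E]. As a limit of polynomials in |z| it
    is visibly measurable and open to monotone convergence. *)
Definition rmean2 z := limn (sq_coef a (normc z)).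

Lemma rmean2_cvg z : disc z -> sq_coef a (normc z) @ \oo --> rmean2 z.
Proof.
move=> hz; have rz : 0 <= normc z < 1 by rewrite normc_ge0.
by apply: cvgP; exact: (sq_coef_cvg (c := 0) rz).
Qed.

Lemma rmean2E z (c : R) : disc z -> mean2 h (normc z) c = 2 * pi * rmean2 z.
Proof.
move=> hz; have rz : 0 <= normc z < 1 by rewrite normc_ge0.
have -> : rmean2 z = (2 * pi)^-1 * mean2 h (normc z) c by apply/cvg_lim => //; exact: sq_coef_cvg.
by rewrite mulrA mulfV ?mul1r// gt_eqF// pi2_gt0.
Qed.

Lemma rmean2_ge z N : disc z -> sq_coef a (normc z) N <= rmean2 z.
Proof.
move=> hz; have rz : 0 <= normc z < 1 by rewrite normc_ge0.
rewrite -(ler_pM2l (pi2_gt0 R)) -(rmean2E 0 hz).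
exact: sq_coef_mean2.
Qed.

Lemma cmeasf_sq_coef N : cmeasf setT (fun z => sq_coef a (normc z) N).
Proof.
elim: N => [|N IH].
  by apply: cmeasf_ext (cmeasf_cst _ 0) => z _; rewrite /sq_coef big_ord0.
apply: cmeasf_ext (cmeasfD IH (cmeasfM (cmeasf_cst _ (normc (a N) ^+ 2))
  (cmeasfX (N + N) (cmeasf_normc _)))) => z _.
by rewrite /sq_coef big_ord_recr.
Qed.

Lemma cmeasf_rmean2 : cmeasf (@disc R) rmean2.
Proof.
apply: (@cmeasf_cvg _ (fun N z => sq_coef a (normc z) N)); last exact: rmean2_cvg.
by move=> N; apply: cmeasfT; exact: cmeasf_sq_coef.
Qed.

Lemma rmean2_ge0 z : disc z -> 0 <= rmean2 z.
Proof. by move=> /(rmean2_ge 0); rewrite /sq_coef big_ord0. Qed.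

(** By [rot_average] the integrand may be averaged over rotations; W is invariant and |h|^2 averages
    to its circle mean. *)
Lemma aint_radial :
  aint (@disc R) (fun z => normc (h z) ^+ 2 * W z) = aint (@disc R) (fun z => rmean2 z * W z).
Proof.
have p0 := pi2_gt0 R.
have mF : cmeasf (@disc R) (fun z => normc (h z) ^+ 2 * W z).
  by apply: cmeasfM => //; apply: cmeasfX; exact: cmeasf_ps ha.
pose F := (fun p => (normc (h (toC p)) ^+ 2 * W (toC p))%:E) \_ (pl (@disc R)).
have mF1 : measurable_fun setT F.
  by apply/(measurable_restrictT _ cmeas_disc); exact: (cmeasf_EFin mF).
have F0 p : (0 <= F p)%E.
  rewrite /F patchE; case: ifPn => // /set_mem hp.
  by rewrite lee_fin mulr_ge0 ?sqr_ge0 ?W0.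
have := rot_average mF1 F0; rewrite -integral_mkcond -/(aint (@disc R) _) => E.
have : ((2 * pi)%:E * aint (@disc R) (fun z => (normc (h z) ^+ 2 * W z)%R) =
        (2 * pi)%:E * aint (@disc R) (fun z => (rmean2 z * W z)%R))%E.
  rewrite -[RHS]ge0_integralZl_EFin ?(ltW p0)//; last 3 first.
  - exact: cmeas_disc.
  - by move=> p hp; rewrite lee_fin mulr_ge0 ?W0 ?rmean2_ge0.
  - have mR : cmeasf (@disc R) (fun z => rmean2 z * W z).
      by apply: cmeasfM => //; exact: cmeasf_rmean2.
    exact: (cmeasf_EFin mR).
  rewrite E [RHS]integral_mkcond; apply: eq_integral => p _; rewrite patchE.
  have dr t : disc (toC (rot (cos t) (sin t) p)) = disc (toC p).
    have -> : toC (rot (cos t) (sin t) p) = circle 1 t * toC p.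
      by apply: complex_eq; rewrite ?ReM ?ImM/=; ring.
    by rewrite /disc /mkset normcM normc_circle// mul1r.
  case: ifPn => [/set_mem hp|/negP hp]; last first.
    apply: integral0_eq => t _; rewrite /F patchE; case: ifPn => // /set_mem.
    by rewrite /pl/mkset dr => hp'; exfalso; apply: hp; exact: mem_set.
  have [c Ec] := mean2_rot hp.
  rewrite -EFinM mulrA -(rmean2E c hp) EFinM -Ec muleC.
  rewrite -ge0_integralZl_EFin//; last 3 first.
  - by move=> t _; rewrite lee_fin sqr_ge0.
  - apply/measurable_EFinP; apply: measurable_funTS; apply: continuous_measurable_fun => t.
    apply: (@normc2_continuous _ (fun t => h (circle 1 t * toC p))).
    apply: rcont_comp; last by apply: rcontM; [exact: circle_rcont|exact: rcont_cst].
    by apply: holo_ccont (is_ps_holo ha) _; rewrite normcM normc_circle// mul1r.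
  - exact: W0.
  apply: eq_integral => t _; rewrite /F patchE.
  have -> : toC (rot (cos t) (sin t) p) = circle 1 t * toC p.
    by apply: complex_eq; rewrite ?ReM ?ImM/=; ring.
  rewrite mem_set; last by rewrite /pl/mkset dr.
  by rewrite Wrot -EFinM mulrC.
move/(congr1 (fun x => (2 * pi)^-1%:E * x)%E).
by rewrite !muleA -!EFinM mulVf ?gt_eqF// !mul1e.
Qed.

Lemma aint_sq_coef N : aint (@disc R) (fun z => sq_coef a (normc z) N * W z) =
  (\sum_(n < N) (normc (a n) ^+ 2)%:E * wmoment n)%E.
Proof.
have mm n : cmeasf (@disc R) (fun z => normc z ^+ (n + n) * W z).
  by apply: cmeasfM => //; apply: cmeasfX; exact: cmeasf_normc.
elim: N => [|N IH].
  rewrite big_ord0 (@eq_aint _ _ (fun=> 0)); last by move=> z _; rewrite /sq_coef big_ord0 mul0r.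
  by rewrite /aint integral0.
rewrite big_ord_recr/= -IH /wmoment -aintZ ?sqr_ge0//; last 2 first.
- exact: cmeas_disc.
- by move=> z hz; rewrite mulr_ge0 ?W0 ?exprn_ge0 ?normc_ge0.
rewrite -aintD//.
- by apply: eq_aint => z _; rewrite {1}/sq_coef big_ord_recr/= mulrDl mulrA.
- exact: cmeas_disc.
- by move=> z hz; rewrite mulr_ge0 ?W0 ?sq_coef_ge0 ?normc_ge0.
- by move=> z hz; rewrite mulr_ge0 ?sqr_ge0// mulr_ge0 ?W0 ?exprn_ge0 ?normc_ge0.
- by apply: cmeasfM => //; apply: cmeasfT; exact: cmeasf_sq_coef.
- by apply: cmeasfM => //; exact: cmeasf_cst.
Qed.

Lemma aint_radial_ge N : (\sum_(n < N) (normc (a n) ^+ 2)%:E * wmoment n <=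
  aint (@disc R) (fun z => (normc (h z) ^+ 2 * W z)%R))%E.
Proof.
rewrite aint_radial -aint_sq_coef; apply: aint_le.
- exact: cmeas_disc.
- by move=> z hz; rewrite mulr_ge0 ?W0 ?sq_coef_ge0 ?normc_ge0.
- by move=> z hz; rewrite ler_wpM2r ?W0 ?rmean2_ge.
- by apply: cmeasfM => //; apply: cmeasfT; exact: cmeasf_sq_coef.
- by apply: cmeasfM => //; exact: cmeasf_rmean2.
Qed.

Lemma aint_radial_le B : (forall N, \sum_(n < N) (normc (a n) ^+ 2)%:E * wmoment n <= B)%E ->
  (aint (@disc R) (fun z => (normc (h z) ^+ 2 * W z)%R) <= B)%E.
Proof.
move=> hB; rewrite aint_radial.
pose G N (p : MR * MR) := (sq_coef a (normc (toC p)) N * W (toC p))%:E.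
have cv : (\int[mu2]_(p in pl (@disc R)) G N p @[N --> \oo] -->
   \int[mu2]_(p in pl (@disc R)) (limn (G^~ p)))%E.
  apply: cvg_monotone_convergence => //.
  - exact: cmeas_disc.
  - move=> N; have mG : cmeasf (@disc R) (fun z => sq_coef a (normc z) N * W z).
      by apply: cmeasfM => //; apply: cmeasfT; exact: cmeasf_sq_coef.
    exact: (cmeasf_EFin mG).
  - by move=> N p hp; rewrite lee_fin mulr_ge0 ?W0 ?sq_coef_ge0 ?normc_ge0.
  - by move=> p hp m n mn; rewrite lee_fin ler_wpM2r ?W0// sq_coef_le ?normc_ge0.
have -> : aint (@disc R) (fun z => rmean2 z * W z) = (\int[mu2]_(p in pl (@disc R)) (limn (G^~ p)))%E.
  apply: eq_integral => p /set_mem hp; apply/esym/cvg_lim => //.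
  apply: cvg_EFin; first by near=> N.
  by apply: cvgMl; exact: rmean2_cvg.
rewrite -(cvg_lim _ cv)//; apply: lime_le; first by apply/cvg_ex; eexists; exact: cv.
by near=> N; have := aint_sq_coef N; rewrite /aint => ->.
Unshelve. all: by end_near. Qed.

End Radial.

Lemma cmeasf_indic S : cmeas S -> cmeasf setT (\1_S : C -> R).
Proof.
move=> mS; split; rewrite (_ : _ \o _ = (\1_(pl S) : MR * MR -> R)); first exact: measurable_indic.
by apply/funext => p; rewrite /= !indicE; congr (_ : bool)%:R; apply/idP/idP; rewrite !inE.
Qed.

Lemma aint_indic S T F : aint S (fun z => F z * \1_T z) = aint (S `&` T) F.
Proof.
rewrite /aint plI integral_mkcondr; apply: eq_integral => p _; rewrite patchE indicE.
have -> : (toC p \in T) = (p \in pl T) by apply/idP/idP; rewrite !inE.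
by case: ifPn => _; rewrite ?mulr1 ?mulr0.
Qed.

(** The weight in [nu]. It takes the place of log(1/|z|), for which the Littlewood-Paley formula is
    an equality, so that both estimates below carry constants. *)
Definition lpw z : R := 1 - normc z ^+ 2.

Lemma lpw_ge0 z : disc z -> 0 <= lpw z.
Proof. by move=> /ltW hz; rewrite subr_ge0 exprn_ile1 ?normc_ge0. Qed.

Lemma cmeasf_lpw S : cmeasf S lpw.
Proof.
apply: cmeasfT; apply: cmeasf_ext (cmeasfD (cmeasf_cst _ 1) (cmeasfM (cmeasf_cst _ (-1))
  (cmeasf_normc2 _))) => z _.
by rewrite /lpw mulN1r.
Qed.

Lemma lpw_rot t z : lpw (circle 1 t * z) = lpw z.
Proof. by rewrite /lpw normcM normc_circle// mul1r. Qed.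

Lemma aint_monomialE (A : R) n : disc_area = A%:E ->
  aint (@disc R) (fun z => normc z ^+ (n + n)) = (A / n.+1%:R)%:E.
Proof. by move=> EA; have [B EB ->] := aint_monomial n; move: EB; rewrite EA => -[->]. Qed.

Lemma lp_moment (A : R) n : disc_area = A%:E ->
  wmoment lpw n = (A / (n.+1%:R * n.+2%:R))%:E.
Proof.
move=> EA; have h1 := aint_monomialE n EA; have h2 := aint_monomialE n.+1 EA.
have mX k : cmeasf (@disc R) (fun z => normc z ^+ (k + k)) by apply: cmeasfX; exact: cmeasf_normc.
have w0 : (0 <= wmoment lpw n)%E.
  by apply: aint_ge0 => z hz; rewrite mulr_ge0 ?lpw_ge0// exprn_ge0// normc_ge0.
have : aint (@disc R) (fun z => normc z ^+ (n + n)) =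
   (wmoment lpw n + aint (@disc R) (fun z => (normc z ^+ (n.+1 + n.+1))%R))%E.
  rewrite -aintD//.
  - apply: eq_aint => z _; rewrite /lpw addnS addSn (exprS _ (n + n).+1) (exprS _ (n + n)); ring.
  - exact: cmeas_disc.
  - by move=> z hz; rewrite mulr_ge0 ?lpw_ge0// exprn_ge0// normc_ge0.
  - by move=> z hz; rewrite exprn_ge0// normc_ge0.
  - by apply: cmeasfM => //; exact: cmeasf_lpw.
rewrite h1 h2; move: w0; case: (wmoment lpw n) => [w||]//= _; rewrite -EFinD => -[E].
congr EFin; apply: (addIr (A / n.+2%:R)); rewrite -E.
have n1 : 0 < n.+1%:R :> R by rewrite ltr0n.
rewrite -[n.+2%:R]natr1; move: (n.+1%:R) n1 => x x0.
have x1 : x + 1 != 0 by rewrite gt_eqF// addr_gt0.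
by field; rewrite x1 gt_eqF.
Qed.

Definition annulus : set C := [set z | 2^-1 <= normc z].

(** Dyadic windows start at level 1 and only reach |z| >= 1/2, so the lower estimate has to survive
    restriction to this annulus. *)
Definition lpr z : R := lpw z * \1_annulus z.

Lemma cmeas_annulus : cmeas annulus.
Proof. exact: (cmeas_le 2^-1 (cmeasf_normc _)). Qed.

(** The disc |z| < 1/2 takes at most half of the moment, because 4^(-n-1) (n + 2) <= 1/2. *)
Lemma lpr_moment (A : R) n : 0 < A -> disc_area = A%:E ->
  ((A / (2 * (n.+1%:R * n.+2%:R)))%:E <= wmoment lpr n)%E.
Proof.
move=> A0 EA; have := lp_moment n EA.
have mX k S : cmeasf S (fun z => normc z ^+ (k + k)) by apply: cmeasfX; exact: cmeasf_normc.
have X0 z : disc z -> 0 <= normc z ^+ (n + n) * lpw z.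
  by move=> hz; rewrite mulr_ge0 ?lpw_ge0// exprn_ge0// normc_ge0.
have mXl S : cmeasf S (fun z => normc z ^+ (n + n) * lpw z).
  by apply: cmeasfM => //; exact: cmeasf_lpw.
pose B : set C := [set z | normc z < 2^-1].
have BD : B `<=` @disc R by move=> z; rewrite /B /disc /mkset; lra.
have mB : cmeas B by exact: cmeas_ball.
have DE : @disc R = B `|` (@disc R `&` annulus).
  apply/seteqP; split => z; last by case=> [/BD|[]].
  by move=> hz; have [h|h] := ltP (normc z) 2^-1; [left|right].
have -> : wmoment lpw n = (aint B (fun z => (normc z ^+ (n + n) * lpw z)%R) + wmoment lpr n)%E.
  rewrite /wmoment {1}DE aintU//.
  - by rewrite -aint_indic; congr (_ + _)%E; apply: eq_aint => z _; rewrite /lpr mulrA.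
  - by apply: cmeasI; [exact: cmeas_disc|exact: cmeas_annulus].
  - by move=> z; rewrite /B /annulus /mkset => h [_]; rewrite leNgt h.
  - by move=> z; rewrite -DE; exact: X0.
have : (aint B (fun z => (normc z ^+ (n + n) * lpw z)%R) <= aint B (fun z => (normc z ^+ (n + n))%R))%E.
  apply: aint_le => // z hz; first exact/X0/BD.
  by rewrite ler_piMr ?exprn_ge0 ?normc_ge0// /lpw gerBl sqr_ge0.
have -> : aint B (fun z => normc z ^+ (n + n)) = (4^-1 * (4^-1 ^+ n * (A / n.+1%:R)))%:E.
  rewrite aint_scale//; last by move=> z; rewrite exprn_ge0 ?normc_ge0.
  have -> : 2^-1 ^+ 2 = 4^-1 :> R by field.
  rewrite (@eq_aint _ _ (fun z => 4^-1 ^+ n * normc z ^+ (n + n))).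
    rewrite aintZ ?(aint_monomialE n EA) ?exprn_ge0 ?invr_ge0//; first exact: cmeas_disc.
    by move=> z _; rewrite exprn_ge0 ?normc_ge0.
  move=> z _; rewrite normcM normcR gtr0_norm// exprMn; congr (_ * _).
  by rewrite exprD -exprMn; congr (_ ^+ n); field.
have b0 : (0 <= aint B (fun z => (normc z ^+ (n + n) * lpw z)%R))%E.
  by apply: aint_ge0 => z /BD; exact: X0.
have r0' : (0 <= wmoment lpr n)%E.
  by apply: aint_ge0 => z hz; rewrite /lpr mulrA mulr_ge0 ?X0// indicE.
move: b0 r0'; case: (aint B _) => [b||]//; case: (wmoment lpr n) => [w||]//=; rewrite !lee_fin.
move=> b0 w0 hb; rewrite -EFinD => -[E].
have h4 : 4^-1 * 4^-1 ^+ n * n.+2%:R <= 2^-1 :> R.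
  rewrite -exprS exprVn ler_pdivrMl ?exprn_gt0// ler_pdivlMr//.
  elim: (n) => [|m IH]; first by rewrite expr1 -natrM ler_nat.
  rewrite exprS; have : (m.+3%:R : R) = m.+2%:R + 1 by rewrite -natr1.
  have : (2 : R) <= m.+2%:R by rewrite ler_nat.
  nra.
have n1 : 0 < n.+1%:R :> R by rewrite ltr0n.
have n2 : 0 < n.+2%:R :> R by rewrite ltr0n.
have hb2 : b <= A / (2 * (n.+1%:R * n.+2%:R)).
  apply: le_trans hb _; rewrite !mulrA.
  have -> : 4^-1 * 4^-1 ^+ n * A / n.+1%:R = (A / (n.+1%:R * n.+2%:R)) * (4^-1 * 4^-1 ^+ n * n.+2%:R).
    move: (4^-1 ^+ n) (n.+1%:R) (n.+2%:R) (lt0r_neq0 n1) (lt0r_neq0 n2) => u x y hx hy.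
    by field; rewrite ?hx ?hy.
  have -> : A / (2 * n.+1%:R * n.+2%:R) = (A / (n.+1%:R * n.+2%:R)) * 2^-1.
    move: (n.+1%:R) (n.+2%:R) (lt0r_neq0 n1) (lt0r_neq0 n2) => x y hx hy.
    by field; rewrite ?hx ?hy.
  by rewrite ler_wpM2l// divr_ge0 ?mulr_ge0 ?(ltW A0).
have -> : w = A / (n.+1%:R * n.+2%:R) - b by rewrite -E; ring.
have -> : A / (n.+1%:R * n.+2%:R) = A / (2 * (n.+1%:R * n.+2%:R)) + A / (2 * (n.+1%:R * n.+2%:R)).
  move: (n.+1%:R) (n.+2%:R) (lt0r_neq0 n1) (lt0r_neq0 n2) => x y hx hy.
  by field; rewrite ?hx ?hy.
move: hb2; move: (A / _) => y; lra.
Qed.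

Definition energy S (h : C -> C) : \bar R := aint S (fun z => normc (h z) ^+ 2 * lpw z).

Lemma normc_natr n : normc (n%:R : C) = n%:R.
Proof. by rewrite -(rmorph_nat (real_complex R)) normcR ger0_norm. Qed.

Lemma littlewood_paley_le (A : R) (F : C -> C) a : is_ps F a -> disc_area = A%:E -> 0 < A ->
  forall B, (forall N, sqnorm a N <= B) -> (energy (@disc R) (cderiv F) <= (A * B)%:E)%E.
Proof.
move=> ha EA A0 B hB; apply: (aint_radial_le (is_ps_cderiv ha) _ lpw_ge0 lpw_rot).
  exact: cmeasf_lpw.
move=> N; under eq_bigr => n _ do rewrite (lp_moment n EA) -EFinM.
rewrite sumEFin lee_fin; apply: le_trans (_ : A * sqnorm a N.+1 <= _); last first.
  by rewrite ler_wpM2l// ltW.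
rewrite /sqnorm big_ord_recl mulrDr mulr_sumr.
apply: ler_wpDl; first by rewrite mulr_ge0 ?(ltW A0) ?sqr_ge0.
apply: ler_sum => n _; rewrite /dcoef normcM exprMn normc_natr.
have -> : n.+1%:R ^+ 2 * normc (a n.+1) ^+ 2 * (A / (n.+1%:R * n.+2%:R)) =
   (A * normc (a n.+1) ^+ 2) * (n.+1%:R / n.+2%:R) :> R.
  have n1 : n.+1%:R != 0 :> R by rewrite pnatr_eq0.
  have n2 : n.+2%:R != 0 :> R by rewrite pnatr_eq0.
  move: (n.+1%:R) (n.+2%:R) n1 n2 => x y hx hy.
  by field; rewrite ?hx ?hy.
rewrite ler_piMr//; first by rewrite mulr_ge0 ?(ltW A0) ?sqr_ge0.
by rewrite ler_pdivrMr ?ltr0n// mul1r ler_nat.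
Qed.

(** The factor 1/4 is 1/2 for the annulus times the least value 1/2 of (n + 1) / (n + 2). *)
Lemma littlewood_paley_ge (A : R) (F : C -> C) a N : is_ps F a -> disc_area = A%:E -> 0 < A ->
  ((A / 4 * \sum_(n < N) normc (a n.+1) ^+ 2)%:E <=
     energy (@disc R `&` annulus) (cderiv F))%E.
Proof.
move=> ha EA A0.
have m1 : cmeasf (@disc R) lpr.
  by apply: cmeasfM; [exact: cmeasf_lpw|apply: cmeasfT; exact: cmeasf_indic cmeas_annulus].
have p1 z : disc z -> 0 <= lpr z by move=> hz; rewrite mulr_ge0 ?lpw_ge0// indicE.
have r1 t z : lpr (circle 1 t * z) = lpr z.
  rewrite /lpr lpw_rot !indicE; congr (_ * (_ : bool)%:R).
  by apply/idP/idP; rewrite !inE /annulus /mkset normcM normc_circle// mul1r.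
have := aint_radial_ge (is_ps_cderiv ha) m1 p1 r1 N.
have -> : aint (@disc R) (fun z => normc (cderiv F z) ^+ 2 * lpr z) =
   energy (@disc R `&` annulus) (cderiv F).
  by rewrite /energy -aint_indic; apply: eq_aint => z _; rewrite /lpr mulrA.
apply: le_trans; rewrite mulr_sumr -sumEFin; apply: lee_sum => n _.
apply: le_trans (lee_wpmul2l _ (lpr_moment n A0 EA)); last by rewrite lee_fin sqr_ge0.
rewrite -EFinM lee_fin /dcoef normcM exprMn normc_natr.
have -> : n.+1%:R ^+ 2 * normc (a n.+1) ^+ 2 * (A / (2 * (n.+1%:R * n.+2%:R))) =
   (A * normc (a n.+1) ^+ 2) * (n.+1%:R / (2 * n.+2%:R)) :> R.
  have n1 : n.+1%:R != 0 :> R by rewrite pnatr_eq0.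
  have n2 : n.+2%:R != 0 :> R by rewrite pnatr_eq0.
  move: (n.+1%:R) (n.+2%:R) n1 n2 => x y hx hy.
  by field; rewrite ?hx ?hy.
rewrite [A / 4 * _]mulrAC; apply: ler_wpM2l; first by rewrite mulr_ge0 ?(ltW A0) ?sqr_ge0.
rewrite ler_pdivlMr ?mulr_gt0//; have : (n.+2%:R : R) = n.+1%:R + 1 by rewrite -natr1.
have : (1 : R) <= n.+1%:R by rewrite ler1n.
lra.
Qed.

End LittlewoodPaley.

(** * The integration operator on Taylor coefficients *)

Section IntegrationOperator.
Variable R : realType.
Local Notation C := R[i].
Local Notation V := (H2 R).
Local Notation mu := (@lebesgue_measure R).
Implicit Types (F G h : C -> C) (z w : C).

Lemma Re_real_scale (x : R) z : complex.Re (z * x%:C) = complex.Re z * x.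
Proof. by rewrite ReM/= mulr0 subr0. Qed.

Lemma Im_real_scale (x : R) z : complex.Im (z * x%:C) = complex.Im z * x.
Proof. by rewrite ImM/= mulr0 add0r. Qed.

Lemma FTC2_everywhere (u v : R -> R) : (forall t, 0 <= t <= 1 -> is_derive (t : R^o) 1 (u : R^o -> R^o) (v t)) ->
  (forall t, 0 <= t <= 1 -> {for t, continuous v}) ->
  \int[mu]_(t in `[0, 1]) v t = u 1 - u 0.
Proof.
move=> du cv; have i01 t : t \in `]0, 1[ -> 0 <= t <= 1 by rewrite in_itv/= => /andP[/ltW -> /ltW ->].
have cu t : 0 <= t <= 1 -> {for t, continuous u}.
  move=> /du h; apply: (@differentiable_continuous _ R^o R^o).
  by apply/derivable1_diffP; exact: ex_derive.
rewrite /Rintegral (@continuous_FTC2 _ v u)//.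
- by apply: continuous_in_subspaceT => t; rewrite inE/= in_itv/=; exact: cv.
- split=> [t /i01/du h||]; first exact: ex_derive.
  + by apply: cvg_at_right_filter; apply: cu; rewrite lexx ler01.
  + by apply: cvg_at_left_filter; apply: cu; rewrite lexx ler01.
- by move=> t /i01/du h; rewrite derive1E derive_val.
Qed.

Lemma segment_derive F z t D : cderive F (t%:C * z) D ->
  is_derive (t : R^o) 1 ((fun s : R => complex.Re (F (s%:C * z))) : R^o -> R^o) (complex.Re (D * z)) /\
  is_derive (t : R^o) 1 ((fun s : R => complex.Im (F (s%:C * z))) : R^o -> R^o) (complex.Im (D * z)).
Proof.
move=> hF; have n0 : 0 < normc z + 1 by rewrite ltr_wpDl ?normc_ge0.
have H (e : R) : 0 < e -> exists2 d : R, 0 < d & forall s, `|s - t| < d ->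
    normc (F (s%:C * z) - F (t%:C * z) - D * z * (s - t)%:C) <= e * `|s - t|.
  move=> e0; have [d d0 hd] := hF _ (divr_gt0 e0 n0).
  exists (d / (normc z + 1)); first exact: divr_gt0.
  have E s : s%:C * z - t%:C * z = (s - t)%:C * z by rewrite -mulrBl -rmorphB.
  move=> s; rewrite ltr_pdivlMr// => hs.
  have nE : normc (s%:C * z - t%:C * z) = `|s - t| * normc z by rewrite E normcM normcR.
  have := hd (s%:C * z); rewrite nE E [D * z * _]mulrAC -mulrA => {}hd.
  apply: le_trans (hd _) _.
    by apply: le_lt_trans hs; rewrite ler_wpM2l// lerDl.
  rewrite [e / _ * _]mulrAC ler_pdivrMr// -mulrA ler_wpM2l ?(ltW e0)// ler_wpM2l//.
  by rewrite lerDl.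
split; apply/derivable_eps => e /H[d d0 hd]; exists d => // s /hd; apply: le_trans.
  by apply: le_trans (Re_le_normc _); rewrite !ReD !ReN Re_real_scale.
by apply: le_trans (Im_le_normc _); rewrite !ImD !ImN Im_real_scale.
Qed.

Lemma segment_integral_primitive F h z : (forall w, disc w -> cderive F w (h w)) ->
  (forall w, disc w -> ccont h w) -> disc z -> segment_integral h z = F z - F 0.
Proof.
move=> dF ch hz.
have hs t : 0 <= t <= 1 -> disc (t%:C * z).
  move=> /andP[t0 t1]; rewrite /disc/mkset normcM normcR ger0_norm//.
  by apply: le_lt_trans hz; rewrite ler_piMl ?normc_ge0.
have rc t : 0 <= t <= 1 -> rcont (fun s : R => h (s%:C * z) * z) t.
  move=> /hs ht; apply: rcontM; last exact: rcont_cst.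
  apply: rcont_comp; first exact: ch.
  apply: rcontM; last exact: rcont_cst.
  by move=> e e0; exists e => // y; rewrite -rmorphB normcR.
have E1 := @FTC2_everywhere (fun s => complex.Re (F (s%:C * z)))
  (fun s => complex.Re (h (s%:C * z) * z))
  (fun t ht => (segment_derive (dF _ (hs t ht))).1)
  (fun t ht => let: And3 a _ _ := rcont_continuous (rc t ht) in a).
have E2 := @FTC2_everywhere (fun s => complex.Im (F (s%:C * z)))
  (fun s => complex.Im (h (s%:C * z) * z))
  (fun t ht => (segment_derive (dF _ (hs t ht))).2)
  (fun t ht => let: And3 _ a _ := rcont_continuous (rc t ht) in a).
rewrite /segment_integral E1 E2.
by rewrite !mul1r !mul0r; apply: complex_eq; rewrite /= ?ReD ?ImD ?ReN ?ImN.
Qed.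

Definition int_coef (c : nat -> C) n : C := if n is m.+1 then c m / m.+1%:R else 0.

Lemma dcoef_int_coef c : dcoef (int_coef c) = c.
Proof.
apply/funext => n; rewrite /dcoef /int_coef mulrCA mulfV ?mulr1//.
Qed.

Lemma cbd_int_coef c : cbd c -> cbd (int_coef c).
Proof.
move=> hc r r01; have [M M0 HM] := hc r r01; exists M => //; have [r0 r1] := andP r01.
case=> [|n]; first by rewrite /int_coef normc0 mul0r.
apply: le_trans (HM n); rewrite /int_coef normcM exprS mulrACA [X in _ * X <= _]mulrC -mulrA.
rewrite ler_wpM2l ?normc_ge0// mulrCA -[leRHS]mulr1 ler_wpM2l ?exprn_ge0//.
have -> : normc (n.+1%:R^-1 : C) = n.+1%:R^-1.
  by rewrite -(rmorph_nat (real_complex R)) -fmorphV normcR ger0_norm.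
rewrite ler_pdivrMr ?ltr0n// mul1r; apply: le_trans (ltW r1) _.
by rewrite ler1n.
Qed.

Variable g : C -> C.
Hypothesis hg : holomorphic_disc g.
Implicit Types f : V.
Local Notation gp := (cderiv g).

Lemma holo_mul F G : holomorphic_disc F -> holomorphic_disc G ->
  holomorphic_disc (fun z => F z * G z).
Proof.
move=> hF hG z hz.
by have [] := cderive_derivable (cderiveM (holo_cderive hF hz) (holo_cderive hG hz)).
Qed.

Lemma fgp_holo f : holomorphic_disc (fun z => f z * gp z).
Proof. by apply: holo_mul; [exact: H2_holo|exact: holo_cderiv]. Qed.

Lemma fgp_ps f : is_ps (fun z => f z * gp z) (coef (fun z => f z * gp z)).
Proof. by apply: coefP; exact: fgp_holo. Qed.

(** The termwise primitive of f g' is differentiable with derivative f g', and the fundamental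
    theorem along the segment from 0 to z identifies it with the segment integral. *)
Lemma integration_op_ps f :
  is_ps (integration_op g f) (int_coef (coef (fun z => f z * gp z))).
Proof.
set c := coef _; have hc : is_ps _ c := fgp_ps f.
have cb := cbd_int_coef (is_ps_cbd hc); have hb := pssumP cb.
apply: is_ps_ext (hb) _ => z hz.
have dF w : disc w -> cderive (pssum (int_coef c)) w (f w * gp w).
  move=> hw; have := is_ps_cderive hb hw; rewrite dcoef_int_coef.
  have hc' := pssumP (is_ps_cbd hc).
  by have -> : pssum c w = f w * gp w := clim_uniq (hc' w hw) (hc w hw).
rewrite /integration_op (segment_integral_primitive dF)//; last first.
  by move=> w; apply: holo_ccont; exact: fgp_holo.
have -> : pssum (int_coef c) 0 = 0.
  apply: clim_uniq (hb 0 _) _; first by rewrite normc0.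
  apply: (clim_const (K := 0)) => N _; rewrite /psum big1// => -[[|n] hn] _ /=.
    by rewrite mul0r.
  by rewrite expr0n mulr0.
by rewrite subr0.
Qed.

Lemma integration_op_deriv f z : disc z -> cderiv (integration_op g f) z = f z * gp z.
Proof.
move=> hz; have := is_ps_cderiv (integration_op_ps f); rewrite dcoef_int_coef => h.
exact: clim_uniq (h z hz) (@fgp_ps f z hz).
Qed.

Lemma coef_integration_op f : coef (integration_op g f) = int_coef (coef (fun z => f z * gp z)).
Proof. exact: coef_eq (integration_op_ps f). Qed.

Lemma coef_fgp_linear (c : C) f k : coef (fun z => (c *: f + k : V) z * gp z) =
  fun n => c * coef (fun z => f z * gp z) n + coef (fun z => k z * gp z) n.
Proof.
apply: coef_eq; apply: is_ps_ext (is_psD (is_psZ c (fgp_ps f)) (fgp_ps k)) _.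
by move=> z _; rewrite H2D H2Z; ring.
Qed.

Lemma coef_integration_op_linear (c : C) f k : coef (integration_op g (c *: f + k : V)) =
  fun n => c * coef (integration_op g f) n + coef (integration_op g k) n.
Proof.
rewrite !coef_integration_op coef_fgp_linear; apply/funext => -[|n] /=; first by rewrite mulr0 addr0.
by rewrite mulrDl mulrA.
Qed.

(** The density of [nu g] with respect to planar Lebesgue measure, up to the factor 1/pi. *)
Definition wgt z : R := normc (gp z) ^+ 2 * lpw z.

Lemma wgt_ge0 z : disc z -> 0 <= wgt z.
Proof. by move=> /lpw_ge0 h; rewrite mulr_ge0 ?sqr_ge0. Qed.

Lemma cmeasf_wgt : cmeasf (@disc R) wgt.
Proof.
apply: cmeasfM; last exact: cmeasf_lpw.
by apply: cmeasfX; exact: cmeasf_ps (coefP (holo_cderiv hg)).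
Qed.

Lemma energy_integration_op f S : S `<=` @disc R ->
  energy S (cderiv (integration_op g f)) = aint S (fun z => normc (f z) ^+ 2 * wgt z).
Proof.
move=> SD; apply: eq_aint => z /SD hz.
by rewrite integration_op_deriv// normcM exprMn /wgt mulrA.
Qed.

Lemma cmeasf_H2 f : cmeasf (@disc R) (fun z => normc (f z) ^+ 2 * wgt z).
Proof.
apply: cmeasfM; last exact: cmeasf_wgt.
by apply: cmeasfX; exact: cmeasf_ps (H2_ps f).
Qed.

End IntegrationOperator.

(** * Dyadic windows and the sequence tau *)

Section DyadicGeometry.
Variable R : realType.
Local Notation C := R[i].
Implicit Types (z : C) (n m N M : nat).

(* The argument of [z] in full turns, normalized to lie in [1, 2) so that the
   integer part of [2^n * turn z] is the binary heap index of the level [n] arc. *)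
Definition turn z : R := 1 + xget 0 [set t : R | 0 <= t < 2 * pi /\ z = circle (normc z) t] / (2 * pi).

Lemma turnP z : 1 <= turn z < 2 /\ z = circle (normc z) (2 * pi * turn z).
Proof.
have p0 := pi2_gt0 R.
have ex : exists t, [set t : R | 0 <= t < 2 * pi /\ z = circle (normc z) t] t.
  have [->|/polar[s [s0 s1 Es]]] := eqVneq z 0; last by exists s; rewrite /= s0.
  by exists 0; rewrite /= lexx p0 normc0 circle_r0.
rewrite /turn; set t := xget _ _; have [/andP[t0 t1] Et] := xgetPex 0 ex.
split.
  rewrite lerDl divr_ge0 ?(ltW p0)//= -[2]/(1 + 1) ltrD2l ltr_pdivrMr// mul1r.
  by rewrite t1.
rewrite mulrDr mulr1 [2 * pi * _]mulrC divfK ?gt_eqF//.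
by rewrite addrC circleD2pi -Et.
Qed.

Lemma circle_inj (r t t' : R) : 0 < r -> `|t - t'| < 2 * pi -> circle r t = circle r t' -> t = t'.
Proof.
move=> r0 tt H; have [h|h] := leP `|t - t'| pi; first by have [] := circle_inj_pi r0 r0 h H.
have E s : circle r (s + 2 * pi) = circle r s by exact: circleD2pi.
have [tt'|tt'] := leP t' t.
  move: tt h; rewrite ger0_norm ?subr_ge0// => tt h.
  have h' : `|t - (t' + 2 * pi)| <= pi by rewrite ler_norml; apply/andP; split; lra.
  have := circle_inj_pi r0 r0 h'; rewrite E => /(_ H)[_]; lra.
move: tt h; rewrite ltr0_norm ?subr_lt0// => tt h.
have h' : `|t + 2 * pi - t'| <= pi by rewrite ler_norml; apply/andP; split; lra.
have := circle_inj_pi r0 r0 h'; rewrite E => /(_ H)[_]; lra.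
Qed.

Lemma turn_circle (r u : R) : 0 < r -> 1 <= u < 2 -> turn (circle r (2 * pi * u)) = u.
Proof.
move=> r0 u12; have p0 := pi2_gt0 R.
have [t12] := turnP (circle r (2 * pi * u)); rewrite normc_circ gtr0_norm//.
set v := turn _ in t12 *.
have hd : `|2 * pi * u - 2 * pi * v| < 2 * pi.
  rewrite -mulrBr normrM gtr0_norm// -[ltRHS]mulr1 ltr_pM2l// ltr_norml.
  by have := andP u12; have := andP t12; move=> [? ?] [? ?]; apply/andP; split; lra.
by move/(circle_inj r0 hd)/(mulfI (lt0r_neq0 p0)).
Qed.

(** A number in [2^n, 2^(n+1)): the heap index of the level n arc towards z. Passing to the parent
    arc is division by 2, see [sidx_div]. *)
Definition sidx n z : nat := Num.truncn (2 ^+ n * turn z).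

Lemma sidx_eq n z N : (sidx n z == N) = (N%:R <= 2 ^+ n * turn z < N.+1%:R).
Proof.
rewrite /sidx truncn_eq// mulr_ge0 ?exprn_ge0//.
by have [/andP[h _] _] := turnP z; exact: le_trans h.
Qed.

Lemma sidx_bounds n z : (2 ^ n <= sidx n z < 2 ^ n.+1)%N.
Proof.
have [/andP[h1 h2] _] := turnP z.
have p : 0 < 2 ^+ n :> R by rewrite exprn_gt0.
have q : 0 <= 2 ^+ n * turn z by rewrite mulr_ge0 ?(ltW p)//; lra.
rewrite /sidx truncn_ge_nat// truncn_lt_nat// !natrX exprSr ler_pMr// h1/=.
by rewrite ltr_pM2l.
Qed.

Lemma sidx_div n i z : sidx n z = (sidx (n + i) z %/ 2 ^ i)%N.
Proof.
apply/eqP; rewrite sidx_eq; have := eqxx (sidx (n + i) z); rewrite sidx_eq.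
set N := sidx (n + i) z; rewrite exprD mulrAC => /andP[h1 h2].
have p : 0 < 2 ^+ i :> R by rewrite exprn_gt0.
rewrite -(ler_pM2r p) -(ltr_pM2r p); apply/andP; split.
  by apply: le_trans h1; rewrite -natrX -natrM ler_nat leq_divM.
apply: lt_le_trans h2 _; rewrite -natrX -natrM ler_nat.
by rewrite ltn_ceil// expn_gt0.
Qed.

(** The largest n with 1 - |z| <= 2^-n, in the form given by [lev_ge]. *)
Definition lev z : nat := trunc_log 2 (Num.truncn (1 - normc z)^-1).

Lemma lev_ge z n : disc z -> (n <= lev z)%N = (1 - normc z <= 2 ^- n).
Proof.
rewrite /disc/mkset => hz; have p : 0 < 1 - normc z by rewrite subr_gt0.
have q : 0 <= (1 - normc z)^-1 by rewrite invr_ge0 ltW.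
have q1 : (0 < Num.truncn (1 - normc z)^-1)%N.
  by rewrite truncn_gt0 invf_ge1// gerBl normc_ge0.
transitivity (2 ^ n <= Num.truncn (1 - normc z)^-1)%N.
  apply/idP/idP => [h|]; last exact: trunc_log_max.
  by apply: leq_trans (trunc_logP (isT : (1 < 2)%N) q1); rewrite leq_exp2l.
by rewrite truncn_ge_nat// natrX -[RHS]lef_pV2 ?posrE ?invr_gt0// invrK.
Qed.

Definition hidx z := sidx (lev z) z.

Lemma hidx_lev z : trunc_log 2 (hidx z) = lev z.
Proof. by apply: trunc_log_eq => //; exact: sidx_bounds. Qed.

Lemma annulusE z : disc z -> annulus z <-> (1 <= lev z)%N.
Proof.
by move=> hz; rewrite lev_ge// /annulus /mkset expr1; split; lra.
Qed.

Lemma hidx_ge2 z : disc z -> annulus z <-> (2 <= hidx z)%N.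
Proof.
move=> hz; rewrite annulusE// -hidx_lev trunc_log_gt0/=.
by rewrite ltnNge leqNgt.
Qed.

Definition lvl N := trunc_log 2 N.

Lemma lvl_bounds N : (0 < N)%N -> (2 ^ lvl N <= N < 2 ^ (lvl N).+1)%N.
Proof. by move=> N0; have := @trunc_log_bounds 2 N isT N0. Qed.

Definition sector n N : set C := [set z | z != 0 /\ sidx n z = N].

Definition window N : set C := [set z | [/\ disc z, (lvl N <= lev z)%N & sidx (lvl N) z = N]].

(** The upper half of the window N. The boxes with N >= 2 partition the annulus. *)
Definition box N : set C := [set z | disc z /\ hidx z = N].

(** The i-th ancestor of a heap index is its quotient by 2^i, so a window is the union of the boxes
    of all descendants of N. *)
Lemma windowE N z : (2 <= N)%N -> disc z ->
  window N z <-> exists i, (hidx z %/ 2 ^ i)%N = N.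
Proof.
move=> N2 hz; split.
  move=> [_ hl E]; exists (lev z - lvl N)%N.
  by rewrite -{}[RHS]E (sidx_div _ (lev z - lvl N)) subnKC.
move=> [i E]; have [/andP[b1 b2]] := sidx_bounds (lev z) z.
have hi : (i <= lev z)%N.
  rewrite leqNgt; apply/negP => hi; move: E; rewrite divn_small; first by move=> E; rewrite -E in N2.
  by apply: leq_trans b2 _; rewrite leq_exp2l.
have EN : sidx (lev z - i) z = N by rewrite -E (sidx_div _ i) subnK.
have L : lvl N = (lev z - i)%N.
  by rewrite -EN /lvl; apply: trunc_log_eq => //; exact: sidx_bounds.
by split; rewrite ?L// leq_subr.
Qed.

Lemma box_window N : (2 <= N)%N -> box N `<=` window N.
Proof. by move=> N2 z [hz E]; apply/windowE => //; exists 0%N; rewrite divn1. Qed.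

Lemma window_annulus N : (2 <= N)%N -> window N `<=` @disc R `&` @annulus R.
Proof.
move=> N2 z [hz hl E]; split=> //; apply/annulusE => //; apply: leq_trans hl.
by rewrite trunc_log_gt0.
Qed.

Lemma annulus_neq0 z : annulus z -> z != 0.
Proof. by apply: contraTneq => ->; rewrite /annulus /mkset normc0; apply/negP; lra. Qed.

(** A short sector is the intersection of two half-planes, whose measurability does not involve the
    chosen argument [turn]. *)
Lemma half_planes (r u d : R) : 0 < r -> 0 < d <= pi / 2 -> d - 2 * pi <= u < 2 * pi ->
  (0 <= u < d) <-> (0 <= r * sin u /\ r * sin (u - d) < 0).
Proof.
move=> r0 /andP[d0 d1] /andP[u0 u1].
have sinD2pi (x : R) : sin (x + 2 * pi) = sin x.
  by have := congr1 (@complex.Im R) (circleD2pi 1 x); rewrite /= !mul1r.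
rewrite pmulr_rge0// pmulr_rlt0//.
have pos (x : R) : 0 <= x <= pi -> 0 <= sin x by move=> ?; apply: sin_ge0_pi.
have neg (x : R) : - pi < x < 0 -> sin x < 0.
  by move=> /andP[? ?]; rewrite -oppr_gt0 -sinN sin_gt0_pi//; apply/andP; split; lra.
have neg2 (x : R) : pi < x < 2 * pi -> sin x < 0.
  move=> /andP[? ?]; have -> : x = x - 2 * pi + 2 * pi by rewrite subrK.
  by rewrite sinD2pi neg//; apply/andP; split; lra.
split=> [/andP[h1 h2]|[h1 h2]].
  by split; [apply: pos|apply: neg]; apply/andP; split; lra.
have [u0'|u0'] := leP 0 u; last first.
  move: h1 h2; rewrite -(sinD2pi u) -(sinD2pi (u - d)) => h1 h2; exfalso.
  have [h|h] := leP (u + 2 * pi) pi; last first.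
    suff : sin (u + 2 * pi) < 0 by rewrite ltNge h1.
    by apply: neg2; apply/andP; split; lra.
  by have := pos (u - d + 2 * pi); move: h2; rewrite ltNge => /negP + h3; apply; apply: h3; apply/andP; split; lra.
rewrite /= ltNge; apply/negP => h.
have [h'|h'] := leP u pi.
  by have := pos (u - d); move: h2; rewrite ltNge => /negP + h3; apply; apply: h3; apply/andP; split; lra.
by have := neg2 u; move: h1; rewrite leNgt => /negP + h3; apply; apply: h3; apply/andP; split; lra.
Qed.

(** Arcs of level 1 are half circles, too long for [half_planes], and are split into their two
    children. *)
Lemma cmeas_sector n N : (1 <= n)%N -> (2 ^ n <= N < 2 ^ n.+1)%N -> cmeas (sector n N).
Proof.
have p0 := @pi_gt0 R; have p20 := pi2_gt0 R.
have S2 m M : (2 <= m)%N -> (2 ^ m <= M < 2 ^ m.+1)%N -> cmeas (sector m M).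
  move=> m2 /andP[M1 M2].
  pose a : R := 2 * pi * (M%:R / 2 ^+ m); pose d : R := 2 * pi / 2 ^+ m.
  have d0 : 0 < d <= pi / 2.
    rewrite divr_gt0//= ler_pdivrMr//.
    have : 2 ^+ 2 <= 2 ^+ m :> R by rewrite ler_weXn2l// ler1n.
    by nra.
  have mI (c : C) : cmeasf setT (fun z => complex.Im (z * c)).
    apply: cmeasf_ext (cmeasfD (cmeasfM (@cmeasf_Re R) (cmeasf_cst _ (complex.Im c)))
      (cmeasfM (@cmeasf_Im R) (cmeasf_cst _ (complex.Re c)))) => z _.
    by rewrite ImM.
  rewrite (_ : sector m M = [set z | 0 <= complex.Im (z * circle 1 (- a))] `&`
      [set z | complex.Im (z * circle 1 (- (a + d))) < 0]).
    by apply: cmeasI; [exact: cmeas_le|exact: cmeas_lt].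
  have IE z b : complex.Im (z * circle 1 (- b)) = normc z * sin (2 * pi * turn z - b).
    by have [_ {1}->] := turnP z; rewrite circleM mulr1.
  have K z : z != 0 -> sidx m z = M <-> (0 <= 2 * pi * turn z - a < d).
    move=> z0; have -> : (0 <= 2 * pi * turn z - a < d) = (M%:R <= 2 ^+ m * turn z < M.+1%:R).
      rewrite /a /d subr_ge0 ler_pM2l// ler_pdivrMr// [_ * 2 ^+ m]mulrC; congr (_ && _).
      rewrite ltrBlDr -mulrDr ltr_pM2l//.
      have -> : (2 ^+ m)^-1 + M%:R / 2 ^+ m = M.+1%:R / 2 ^+ m :> R.
        by rewrite -(natr1 M) mulrDl mul1r addrC.
      by rewrite ltr_pdivlMr// [_ * 2 ^+ m]mulrC.
    by rewrite -sidx_eq; split=> [->|/eqP].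
  have rng z : d - 2 * pi <= 2 * pi * turn z - a < 2 * pi.
    have [/andP[t1 t2] _] := turnP z.
    have M1' : 1 <= M%:R / 2 ^+ m :> R by rewrite ler_pdivlMr// mul1r -natrX ler_nat.
    have M2' : M%:R / 2 ^+ m + (2 ^+ m)^-1 <= 2 :> R.
      rewrite -[X in _ + X]mul1r -mulrDl ler_pdivrMr// natr1 -exprS -natrX ler_nat.
      exact: M2.
    rewrite /a /d; apply/andP; split; nra.
  apply/seteqP; split => z.
    move=> [z0 /(K _ z0) h]; rewrite /= !IE opprD addrA.
    by apply/half_planes => //; exact: normc_gt0.
  move=> [h1]; rewrite /mkset => h2; have z0 : z != 0.
    by apply: contraTneq h2 => ->; rewrite mul0r ltxx.
  split=> //; apply/(K _ z0); move: h1 h2; rewrite /= !IE opprD addrA => h1 h2.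
  by apply/(half_planes (normc_gt0 z0) d0 (rng z)).
move=> n1 /andP[N1 N2].
rewrite (_ : sector n N = sector n.+1 (2 * N) `|` sector n.+1 (2 * N).+1).
  by apply: cmeasU; apply: S2 => //; move: N1 N2; rewrite !expnS; lia.
have E z : sidx n z = (sidx n.+1 z %/ 2)%N by rewrite (sidx_div n 1) addn1.
apply/seteqP; split => z; last by case=> -[z0 hz]; split=> //; rewrite E hz; lia.
move=> [z0]; rewrite E => h.
have [h'|h'] : (sidx n.+1 z = 2 * N \/ sidx n.+1 z = (2 * N).+1)%N by lia.
  by left.
by right.
Qed.

Lemma cmeas_window N : (2 <= N)%N -> cmeas (window N).
Proof.
move=> N2; have N0 : (0 < N)%N by exact: ltnW.
have l1 : (1 <= lvl N)%N by rewrite trunc_log_gt0.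
rewrite (_ : window N = @disc R `&` [set z | 1 - 2 ^- lvl N <= normc z] `&` sector (lvl N) N).
  apply: cmeasI; last by apply: cmeas_sector => //; exact: lvl_bounds.
  by apply: cmeasI; [exact: cmeas_disc|exact: (cmeas_le _ (cmeasf_normc _))].
have E z : disc z -> (lvl N <= lev z)%N = (1 - 2 ^- lvl N <= normc z).
  by move=> hz; rewrite lev_ge// lerBlDr lerBlDl addrC -lerBlDl; lra.
apply/seteqP; split => z.
  move=> wz; have [hz an] := window_annulus N2 wz; case: wz => _ h1 h2.
  by split; [split=> //; rewrite /mkset -E|split=> //; exact: annulus_neq0].
by move=> [[hz h1] [z0 h2]]; split=> //; rewrite E.
Qed.

Lemma cmeas_box N : (2 <= N)%N -> cmeas (box N).
Proof.
move=> N2.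
rewrite (_ : box N = window N `&` ~` [set z | 1 - 2 ^- (lvl N).+1 <= normc z]).
  apply: cmeasI; first exact: cmeas_window.
  by apply: cmeasC; exact: (cmeas_le _ (cmeasf_normc _)).
have E z : disc z -> ((lvl N).+1 <= lev z)%N = (1 - 2 ^- (lvl N).+1 <= normc z).
  by move=> hz; rewrite lev_ge// lerBlDr lerBlDl addrC -lerBlDl; lra.
apply/seteqP; split => z.
  move=> [hz h]; split; first exact: box_window.
  by move: (E z hz); rewrite -{1}h /lvl hidx_lev ltnn /= => /esym/negP.
move=> [[hz h1 h2] h3]; split=> //.
have -> : hidx z = sidx (lvl N) z; last by [].
congr (sidx _ z); apply/eqP; rewrite eqn_leq h1 andbT leqNgt; apply/negP.
by rewrite E.
Qed.

End DyadicGeometry.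

(** * Decreasing rearrangements *)

Section Rearrangement.
Variables (R : realType) (I : choiceType) (D : set I) (a : I -> \bar R).

(** If at most n - 1 indices had a value above s, then s would compete in the infimum. An infinite
    set of such indices also supplies n of them. *)
Lemma rearrangement_gt n (s : R) : (0 < n)%N -> 0 <= s -> (s%:E < rearrangement D a n)%E ->
  exists e : seq I, [/\ uniq e, size e = n & forall i, i \in e -> D i /\ (s%:E < a i)%E].
Proof.
move=> n0 s0 hs; set S := [set i | D i /\ (s%:E < a i)%E].
have nS : ~ (S #<= `I_n.-1)%card.
  move=> h; have : (rearrangement D a n <= s%:E)%E by apply: ereal_inf_lbound; split.
  by rewrite leNgt hs.
suff [B BS Bn] : exists2 B : {fset I}, [set` B] `<=` S & (n <= #|` B|)%N.
  exists (take n (finmap.enum_fset B)); split.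
  - by rewrite take_uniq// finmap.fset_uniq.
  - by rewrite size_takel.
  - by move=> i /mem_take /BS.
have [fS|iS] := pselect (finite_set S); last exact: infinite_set_fset.
have /finite_setP[m Sm] := fS; exists (fset_set S).
  by move=> i; rewrite /= in_fset_set// => /set_mem.
rewrite (card_fset_set Sm) leqNgt; apply/negP => mn; apply: nS.
by rewrite (card_le_eql Sm) card_le_II; move: mn; case: (n) n0.
Qed.

Lemma rearrangement_lt n (s : R) : (0 < n)%N -> (rearrangement D a n < s%:E)%E ->
  exists B : seq I, (size B < n)%N /\ forall i, D i -> (s%:E <= a i)%E -> i \in B.
Proof.
move=> n0 /ereal_inf_lt[t [t0 ht] ts]; set S := [set i | _] in ht.
have fS : finite_set S by apply/finite_set_leP; exists n.-1.
exists (finmap.enum_fset (fset_set S)); split.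
  by apply: leq_ltn_trans (geq_card_fset_set ht) _; rewrite prednK.
move=> i Di si; suff : i \in fset_set S by [].
by rewrite in_fset_set//; apply: mem_set; split=> //; exact: lt_le_trans si.
Qed.

Lemma rearrangement_ge0 n : (0 <= rearrangement D a n)%E.
Proof. by apply: le_ereal_inf_tmp => t []. Qed.

End Rearrangement.

(** * The sequence tau in terms of heap indices *)

Section TauHeap.
Variable R : realType.
Local Notation C := R[i].
Implicit Types (z : C) (n m N M : nat).

(** Arcs are numbered from 1 to 2^n and the last one starts at angle 0, hence the residue mod 2^n.
    The number q says whether a full turn has to be added to land in [1, 2); for k = 2^n it is
    already there. *)
Lemma heap_shift n k : (1 <= k <= 2 ^ n)%N -> exists q : nat,
  [/\ (2 ^ n + k %% 2 ^ n = k + q * 2 ^ n)%N, (q <= 1)%N & (k < 2 ^ n)%N = (q == 1)%N].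
Proof.
move=> /andP[k1 k2]; have [h|h] := ltnP k (2 ^ n).
  by exists 1%N; split; rewrite ?modn_small// mul1n addnC.
exists 0%N; have -> : k = (2 ^ n)%N by apply/eqP; rewrite eqn_leq k2 h.
by rewrite modnn addn0.
Qed.

Lemma arc_range n k (x : R) :
  (2 * pi * k%:R / 2 ^+ n <= 2 * pi * x < 2 * pi * k.+1%:R / 2 ^+ n) =
  (k%:R <= 2 ^+ n * x < k.+1%:R).
Proof.
by rewrite ler_pdivrMr// ltr_pdivlMr// -!mulrA !(ler_pM2l, ltr_pM2l) ?pi_gt0// [x * _]mulrC.
Qed.

Lemma dyadic_arc_circle n k (u : R) : (1 <= k <= 2 ^ n)%N -> 1 <= u < 2 ->
  (@dyadic_arc R n k) (circle 1 (2 * pi * u)) <->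
  ((2 ^ n + k %% 2 ^ n)%:R <= 2 ^+ n * u < (2 ^ n + k %% 2 ^ n).+1%:R).
Proof.
move=> k12 u12.
have p0 := pi2_gt0 R.
have [k1 k2] := andP k12; have [u1 u2] := andP u12.
have [q [Eq q1 qk]] := heap_shift k12; rewrite Eq.
have R1 (x : R) : ((k + q * 2 ^ n)%:R <= 2 ^+ n * (x + q%:R) < (k + q * 2 ^ n).+1%:R) =
    (k%:R <= 2 ^+ n * x < k.+1%:R).
  rewrite -addSn !natrD natrM natrX mulrDr [2 ^+ n * q%:R]mulrC.
  by rewrite lerD2r ltrD2r.
have EC (x : R) : circle 1 (2 * pi * (x + q%:R)) = circle 1 (2 * pi * x).
  by case: (q) q1 => [|[|//]] _; rewrite ?addr0// mulrDr mulr1 circleD2pi.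
split.
  move=> [t]; have -> : t = 2 * pi * (t / (2 * pi)) by rewrite mulrC divfK ?gt_eqF.
  move: (t / _) => x; rewrite /mkset arc_range -EC => hx Ex.
  have hv : 1 <= x + q%:R < 2.
    move: hx; rewrite -ler_pdivrMl// -ltr_pdivlMl// => /andP[h1 h2].
    have [/eqP qq|] := boolP (q == 1)%N; last first.
      move=> /negbTE qn; rewrite qn in qk.
      have q0 : q = 0%N by move: q1 qn; case: (q) => [|[]].
      have -> : q%:R = 0 :> R by rewrite q0.
      have kE : k%:R = 2 ^+ n :> R.
        by rewrite -natrX; congr _%:R; apply/eqP; rewrite eqn_leq k2 leqNgt qk.
      move: h1 h2; rewrite -(natr1 k) kE mulrDr mulVf ?gt_eqF// mulr1 addr0 => -> h2 /=.
      apply: lt_le_trans h2 _; rewrite -[leRHS]/(1 + 1) lerD2l invf_le1//.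
      by rewrite exprn_ege1// ler1n.
    have x0 : 0 <= x by apply: le_trans h1; rewrite mulr_ge0// invr_ge0 ltW.
    have x1 : x < 1.
      apply: lt_le_trans h2 _; rewrite ler_pdivrMl// mulr1 -natrX ler_nat.
      by rewrite qk qq eqxx.
    by rewrite qq; apply/andP; split; lra.
  have := turn_circle (@ltr01 R) hv; rewrite Ex turn_circle// => ->.
  by rewrite R1.
move=> h; exists (2 * pi * (u - q%:R)).
  by rewrite /mkset arc_range -R1 subrK.
by rewrite -EC subrK.
Qed.

Lemma arc_length_dyadic n k : (1 <= k <= 2 ^ n)%N ->
  arc_length (@dyadic_arc R n k) = 2 * pi / 2 ^+ n.
Proof.
move=> k12; have p0 := pi2_gt0 R; have pn : 0 < 2 ^+ n :> R by rewrite exprn_gt0.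
set j := (k %% 2 ^ n)%N.
have j2 : (j < 2 ^ n)%N by rewrite ltn_mod expn_gt0.
rewrite /arc_length (_ : [set t | _] = `[2 * pi * j%:R / 2 ^+ n, 2 * pi * j.+1%:R / 2 ^+ n[%classic).
  rewrite lebesgue_measure_itv/= lte_fin ltr_pM2r ?invr_gt0// ltr_pM2l// ltr_nat ltnSn.
  by rewrite -EFinB/= -mulrBl -mulrBr -(natr1 j) addrAC subrr add0r mulr1.
have EC (x : R) : circle 1 (2 * pi * x) = circle 1 (2 * pi * (x + 1)).
  have -> : 2 * pi * (x + 1) = 2 * pi * x + 2 * pi by ring.
  by rewrite circleD2pi.
have R1 (x : R) : ((2 ^ n + j)%:R <= 2 ^+ n * (x + 1) < (2 ^ n + j).+1%:R) = (j%:R <= 2 ^+ n * x < j.+1%:R).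
  by rewrite -addnS !natrD natrX mulrDr mulr1 [2 ^+ n + j%:R]addrC [2 ^+ n + j.+1%:R]addrC lerD2r ltrD2r.
apply/seteqP; split => t; rewrite /= in_itv/=;
  (have -> : t = 2 * pi * (t / (2 * pi)) by rewrite mulrC divfK ?gt_eqF);
  move: (t / _) => x; rewrite arc_range.
  rewrite pmulr_rge0// -[ltRHS]mulr1 ltr_pM2l// EC => -[/andP[x0 x1]] h.
  rewrite -R1; apply/(dyadic_arc_circle k12) => //; apply/andP; split; lra.
move=> h; have /andP[h1 h2] := h; have x01 : 0 <= x < 1.
  apply/andP; split.
    by rewrite -(pmulr_rge0 _ pn); apply: le_trans h1.
  rewrite -(ltr_pM2l pn) mulr1; apply: lt_le_trans h2 _.
  by rewrite -natrX ler_nat.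
have [x0 x1] := andP x01; split.
  by rewrite pmulr_rge0// x0 -[ltRHS]mulr1 ltr_pM2l.
rewrite EC; apply/(dyadic_arc_circle k12); last by rewrite R1.
by apply/andP; split; lra.
Qed.

Lemma carleson_window_dyadic n k : (1 <= n)%N -> (1 <= k <= 2 ^ n)%N ->
  carleson_window (@dyadic_arc R n k) = window (2 ^ n + k %% 2 ^ n).
Proof.
move=> n1 k12; have p0 := pi2_gt0 R.
have j2 : (k %% 2 ^ n < 2 ^ n)%N by rewrite ltn_mod expn_gt0.
set N := (2 ^ n + _)%N.
have lN : lvl N = n by apply: trunc_log_eq; rewrite // leq_addr/= expnS mul2n -addnn ltn_add2l.
have aE : arc_length (@dyadic_arc R n k) / (2 * pi) = 2 ^- n.
  by rewrite arc_length_dyadic// mulrAC divff ?gt_eqF// mul1r.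
have AE z : z != 0 -> (@dyadic_arc R n k) (z / (normc z)%:C) <-> sidx n z = N.
  move=> z0; have [t12 Ez] := turnP z; have nz := normc_gt0 z0.
  have -> : z / (normc z)%:C = circle 1 (2 * pi * turn z).
    rewrite {1}Ez -[(normc z)%:C]circle_r0 circleV ?gt_eqF// circleM divff ?gt_eqF//.
    by rewrite oppr0 addr0.
  apply: (iff_trans (dyadic_arc_circle k12 t12)); rewrite -/N -sidx_eq.
  by split=> [/eqP|->].
apply/seteqP; split => z.
  move=> [hz]; rewrite aE -lev_ge// => h1.
  have z0 : z != 0 by apply: annulus_neq0; apply/annulusE => //; exact: leq_trans h1.
  by move=> /(AE _ z0) h2; split; rewrite ?lN.
move=> [hz]; rewrite lN => h1 h2; split=> //; first by rewrite aE -lev_ge.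
have z0 : z != 0 by apply: annulus_neq0; apply/annulusE => //; exact: leq_trans h1.
exact/AE.
Qed.

Variable g : C -> C.

Definition wmass N : R := fine (aint (window N) (wgt g)).

Definition bmass N : R := fine (aint (box N) (wgt g)).

Hypotheses (hg : holomorphic_disc g) (gfin : (aint (@disc R) (wgt g) < +oo)%E).

Lemma aint_wgt_fin S : cmeas S -> S `<=` @disc R -> aint S (wgt g) \is a fin_num.
Proof.
move=> mS SD; have h0 : (0 <= aint S (wgt g))%E by apply: aint_ge0 => z /SD; exact: wgt_ge0.
rewrite ge0_fin_numE//; apply: le_lt_trans gfin; apply: aint_mono => //.
- exact: cmeas_disc.
- exact: wgt_ge0.
- exact: cmeasf_wgt.
Qed.

Lemma window_disc N : window N `<=` @disc R.
Proof. by move=> z []. Qed.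

Lemma box_disc N : box N `<=` @disc R.
Proof. by move=> z []. Qed.

Lemma wmassE N : (2 <= N)%N -> aint (window N) (wgt g) = (wmass N)%:E.
Proof.
by move=> N2; rewrite fineK//; apply: aint_wgt_fin; [exact: cmeas_window|exact: window_disc].
Qed.

Lemma bmassE N : (2 <= N)%N -> aint (box N) (wgt g) = (bmass N)%:E.
Proof.
by move=> N2; rewrite fineK//; apply: aint_wgt_fin; [exact: cmeas_box|exact: box_disc].
Qed.

Lemma wmass_ge0 N : 0 <= wmass N.
Proof. by apply: fine_ge0; apply: aint_ge0 => z /window_disc; exact: wgt_ge0. Qed.

Lemma bmass_ge0 N : 0 <= bmass N.
Proof. by apply: fine_ge0; apply: aint_ge0 => z /box_disc; exact: wgt_ge0. Qed.

Definition wratio N : R := wmass N * 2 ^+ lvl N.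

Definition heap (p : nat * nat) : nat := (2 ^ p.1 + p.2 %% 2 ^ p.1)%N.

Lemma heap_lvl p : dyadic_index p -> lvl (heap p) = p.1 /\ (2 <= heap p)%N.
Proof.
case: p => n k [/= n1 k12].
have j2 : (k %% 2 ^ n < 2 ^ n)%N by rewrite ltn_mod expn_gt0.
split; first by apply: trunc_log_eq; rewrite // leq_addr/= expnS mul2n -addnn ltn_add2l.
by apply: leq_trans (leq_addr _ _); rewrite -{1}[2%N]expn1 leq_exp2l.
Qed.

Lemma heap_inj p q : dyadic_index p -> dyadic_index q -> heap p = heap q -> p = q.
Proof.
move=> hp hq E; have [lp _] := heap_lvl hp; have [lq _] := heap_lvl hq.
have E1 : p.1 = q.1 by rewrite -lp -lq E.
move: p q hp hq E E1 {lp lq} => [n k] [m l] [/= n1 /andP[k1 k2]] [/= m1 /andP[l1 l2]].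
move=> E nm; subst m; congr pair; move: E; rewrite /heap/= => /addnI.
move: (2 ^ n)%N k2 l2 => T; rewrite [(k <= T)%N]leq_eqVlt [(l <= T)%N]leq_eqVlt.
move=> /predU1P[kT|kT] /predU1P[lT|lT].
- by rewrite kT lT.
- by rewrite kT modnn modn_small// => l0; rewrite -l0 in l1.
- by rewrite lT modnn modn_small// => k0; rewrite k0 in k1.
- by rewrite !modn_small.
Qed.

Lemma heap_surj N : (2 <= N)%N -> exists2 p, dyadic_index p & heap p = N.
Proof.
move=> N2; have N0 : (0 < N)%N by exact: ltnW.
have /andP[b1 b2] := lvl_bounds N0; have l1 : (1 <= lvl N)%N by rewrite trunc_log_gt0.
rewrite expnS mul2n -addnn in b2.
have [E|E] := eqVneq N (2 ^ lvl N)%N.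
  exists (lvl N, (2 ^ lvl N)%N); last by rewrite /heap/= modnn addn0 -E.
  by split=> //=; rewrite expn_gt0 leqnn.
exists (lvl N, (N - 2 ^ lvl N)%N).
  split=> //=; rewrite subn_gt0 leq_subLR (ltnW b2) andbT.
  by rewrite ltn_neqAle b1 eq_sym E.
by rewrite /heap/= modn_small ?subnKC// ltn_subLR.
Qed.

(** The normalizations left out of [wratio]: 1/pi for area, and 2 pi for the length 2 pi / 2^n of an
    arc. *)
Definition tau_const : R := pi^-1 / (2 * pi).

Lemma tau_const_gt0 : 0 < tau_const.
Proof. by rewrite divr_gt0 ?pi2_gt0// invr_gt0 pi_gt0. Qed.

Lemma tau_value p : dyadic_index p ->
  (nu g (carleson_window (@dyadic_arc R p.1 p.2)) * ((arc_length (@dyadic_arc R p.1 p.2))^-1)%:E)%E =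
  (tau_const * wratio (heap p))%:E.
Proof.
move=> hp; have [lp h2] := heap_lvl hp; case: p hp lp h2 => n k [/= n1 k12] lp h2.
rewrite carleson_window_dyadic// arc_length_dyadic// /nu.
have -> : [set p : R * R | disc (p.1 +i* p.2) /\ window (2 ^ n + k %% 2 ^ n) (p.1 +i* p.2)] =
    pl (window (heap (n, k))).
  by apply/seteqP; split => p; [case|move=> h; split=> //; exact: window_disc h].
have := wmassE h2; rewrite /aint /wgt /lpw => ->.
rewrite -!EFinM; congr EFin; rewrite /tau_const /wratio lp invf_div /=.
by ring.
Qed.

Lemma tau_ge0 n : (0 <= tau g n)%E.
Proof. exact: rearrangement_ge0. Qed.

Lemma tau_gt n (s : R) : (0 < n)%N -> 0 <= s -> (s%:E < tau g n)%E ->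
  exists e : seq nat, [/\ uniq e, size e = n &
    forall N, N \in e -> (2 <= N)%N /\ s < tau_const * wratio N].
Proof.
move=> n0 s0 /(rearrangement_gt n0 s0)[e [ue se he]].
exists (map heap e); split; rewrite ?size_map//.
  rewrite map_inj_in_uniq// => p q /he[hp _] /he[hq _]; exact: heap_inj.
move=> _ /mapP[p /he[hp h] ->]; split; first by have [] := heap_lvl hp.
by move: h; rewrite tau_value// lte_fin.
Qed.

Lemma tau_lt n (s : R) : (0 < n)%N -> (tau g n < s%:E)%E ->
  exists B : seq nat, (size B < n)%N /\
    forall N, (2 <= N)%N -> s <= tau_const * wratio N -> N \in B.
Proof.
move=> n0 /(rearrangement_lt n0)[B [sB hB]].
exists (map heap B); rewrite size_map; split=> // N /heap_surj[p hp <-] h.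
by apply: map_f; apply: hB => //; rewrite tau_value// lee_fin.
Qed.

End TauHeap.

Section TrigBounds.
Variable R : realType.
Implicit Types x t : R.

Lemma sin_le_id x : 0 <= x -> sin x <= x.
Proof.
move=> x0; have cs : {within `[0, x], continuous (@sin R)}.
  by apply: continuous_subspaceT => t; exact: continuous_sin.
have [t _] := @MVT_segment R sin cos 0 x x0 (fun t _ => is_derive_sin t) cs.
rewrite sin0 !subr0 => ->; rewrite ler_piMl//; exact: cos_le1.
Qed.

Lemma norm_sin_le x : `|sin x| <= `|x|.
Proof.
wlog x0 : x / 0 <= x => [H|].
  have [/H//|/ltW x0] := leP 0 x.
  by rewrite -normrN -sinN -[leRHS]normrN; apply: H; rewrite oppr_ge0.
rewrite [leRHS]ger0_norm// ler_norml sin_le_id// andbT.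
have [x1|x1] := leP x 1.
  apply: le_trans (_ : 0 <= _); first by rewrite oppr_le0.
  by apply: sin_ge0_pi; rewrite x0 (le_trans x1)//; have := @pi_ge2 R; lra.
by apply: le_trans (sin_geN1 x); rewrite lerN2 ltW.
Qed.

Lemma cos_half x : cos x = 1 - 2 * sin (x / 2) ^+ 2.
Proof.
rewrite [x in LHS](splitr x) cosD; have := cos2Dsin2 (x / 2); rewrite !expr2; lra.
Qed.

Lemma cos_ge_quad x : 1 - x ^+ 2 / 2 <= cos x.
Proof.
rewrite cos_half; have : sin (x / 2) ^+ 2 <= (x / 2) ^+ 2.
  rewrite -(real_normK (num_real (sin _))) -(real_normK (num_real (x / 2))).
  by rewrite lerXn2r ?nnegrE//; exact: norm_sin_le.
rewrite !expr2; lra.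
Qed.

Lemma pi_le4 : pi <= 4 :> R.
Proof. by have := @pihalf_lt2 R; lra. Qed.

Lemma circle_dist (r t t' : R) : normc (circle r t - circle r t') <= `|r| * `|t - t'|.
Proof.
rewrite -(@ler_pXn2r _ 2)// ?nnegrE ?normc_ge0 ?mulr_ge0//.
rewrite normc2 ReD ImD ReN ImN/= exprMn !real_normK ?num_real//.
have -> : (r * cos t - r * cos t') ^+ 2 + (r * sin t - r * sin t') ^+ 2 =
  r ^+ 2 * (2 * (1 - cos (t - t'))).
  rewrite cosB; have := cos2Dsin2 t; have := cos2Dsin2 t'.
  move: (cos t) (sin t) (cos t') (sin t') => a b c d h1 h2.
  have -> : (r * a - r * c) ^+ 2 + (r * b - r * d) ^+ 2 =
    r ^+ 2 * ((a ^+ 2 + b ^+ 2) + (c ^+ 2 + d ^+ 2) - 2 * (a * c + b * d)) by ring.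
  by rewrite h1 h2; ring.
rewrite ler_wpM2l ?sqr_ge0//; have := cos_ge_quad (t - t'); rewrite !expr2; lra.
Qed.

End TrigBounds.

(** * Orthonormal test functions concentrated on windows *)

Section TestFunctions.
Variable R : realType.
Local Notation C := R[i].
Local Notation V := (H2 R).
Implicit Types (z w : C) (n m N M : nat) (f : V).

Lemma sum_finsupp (W : nmodType) (F : nat -> W) K N :
  (forall m, (K <= m)%N -> F m = 0) -> (K <= N)%N -> \sum_(m < N) F m = \sum_(m < K) F m.
Proof.
move=> FK KN; rewrite -!(big_mkord xpredT F) (big_cat_nat (leq0n K) KN)/=.
rewrite [X in _ + X]big_nat_cond [X in _ + X]big1 ?addr0//.
by move=> i /andP[/andP[Ki _] _]; exact: FK.
Qed.

Lemma l2_finsupp (a : nat -> C) K : (forall m, (K <= m)%N -> a m = 0) -> l2 a.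
Proof.
move=> aK; exists (sqnorm a K) => N; rewrite /sqnorm.
have [NK|KN] := leqP N K.
  rewrite -!(big_mkord xpredT (fun n => normc (a n) ^+ 2)).
  by rewrite (big_cat_nat (leq0n N) NK)/= lerDl; apply: sumr_ge0 => i _; exact: sqr_ge0.
rewrite (@sum_finsupp _ (fun n => normc (a n) ^+ 2) K N) ?(ltnW KN)// => m Km.
by rewrite aK// normc0 expr0n.
Qed.

Lemma ip_finsupp f h K : (forall m, (K <= m)%N -> coef f m = 0) ->
  ip f h = \sum_(m < K) coef f m * conjc (coef h m).
Proof.
move=> fK; apply: (clim_near (K := K)) (ipP f h) => N KN.
rewrite (@sum_finsupp _ (fun m => coef f m * conjc (coef h m)) K N)// => m Km.
by rewrite fK// mul0r.
Qed.

Lemma H2_finsupp f K z : (forall m, (K <= m)%N -> coef f m = 0) -> disc z ->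
  f z = \sum_(m < K) coef f m * z ^+ m.
Proof.
move=> fK hz; have hf := H2_ps f; apply: (clim_near (K := K)) (hf z hz) => N KN.
rewrite /psum (@sum_finsupp _ (fun m => coef f m * z ^+ m) K N)// => m Km.
by rewrite fK// mul0r.
Qed.

Definition center_angle N : R := 2 * pi * (N%:R + 2^-1) / 2 ^+ lvl N.

(* A kernel peaking at the centre of the arc [N], with frequencies in
   [2^n, 2^(n+1)), n = [lvl N]. Different levels have disjoint spectra, and on
   one level the centres differ by 2^n-th roots of unity. *)
Definition tcoefs N m : C :=
  if (2 ^ lvl N <= m < 2 ^ (lvl N).+1)%N then
    circle (Num.sqrt (2 ^+ lvl N))^-1 (- ((m - 2 ^ lvl N)%:R * center_angle N))
  else 0.

Lemma tcoefs_out N m : (2 ^ (lvl N).+1 <= m)%N -> tcoefs N m = 0.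
Proof. by move=> h; rewrite /tcoefs [(m < _)%N]ltnNge h andbF. Qed.

Definition testf N : V := projT1 (cid (mkH2_ex (l2_finsupp (@tcoefs_out N)))).

Lemma coef_testf N : coef (testf N) = tcoefs N.
Proof. exact: (projT2 (cid (mkH2_ex (l2_finsupp (@tcoefs_out N))))). Qed.

Lemma tcoefs_sum N (F : nat -> C) : (forall m, (m < 2 ^ lvl N)%N -> F m = 0) ->
  \sum_(m < 2 ^ (lvl N).+1) F m = \sum_(j < 2 ^ lvl N) F (2 ^ lvl N + j)%N.
Proof.
move=> F0; rewrite -(big_mkord xpredT F) expnS mul2n -addnn.
rewrite (big_cat_nat (leq0n (2 ^ lvl N)) (leq_addr _ _))/= big_nat_cond big1 ?add0r; last first.
  by move=> i /andP[/andP[_ h] _]; exact: F0.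
rewrite -{1}[(2 ^ lvl N)%N]add0n big_addn addnK big_mkord.
by apply: eq_bigr => j _; rewrite addnC.
Qed.

Lemma tcoefs_in N j : (j < 2 ^ lvl N)%N -> tcoefs N (2 ^ lvl N + j) =
  circle (Num.sqrt (2 ^+ lvl N))^-1 (- (j%:R * center_angle N)).
Proof.
by move=> hj; rewrite /tcoefs leq_addr/= expnS mul2n -addnn ltn_add2l hj addKn.
Qed.

Lemma geo_sum0 (w : C) n : w != 1 -> w ^+ n = 1 -> \sum_(j < n) w ^+ j = 0.
Proof.
move=> w1 wn; have := subrX1 w n; rewrite wn subrr => /esym/eqP; rewrite mulf_eq0 subr_eq0.
by rewrite (negbTE w1)/= => /eqP.
Qed.

Lemma circle1_eq1 (t : R) : `|t| < 2 * pi -> circle 1 t = 1 -> t = 0.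
Proof.
move=> ht E; apply: (@circle_inj _ 1 t 0) => //; first by rewrite subr0.
by rewrite circle_r0.
Qed.

Lemma circle_nat2pi (k : nat) : circle 1 (2 * pi * k%:R) = 1 :> C.
Proof.
elim: k => [|k IH]; first by rewrite mulr0 circle_r0.
by rewrite -(natr1 k) mulrDr mulr1 circleD2pi.
Qed.

Lemma testf_on N M : (2 <= N)%N -> (2 <= M)%N -> ip (testf N) (testf M) = (N == M)%:R.
Proof.
move=> N2 M2; rewrite (@ip_finsupp _ _ (2 ^ (lvl N).+1)); last first.
  by rewrite coef_testf; exact: tcoefs_out.
rewrite !coef_testf; have [L|L] := eqVneq (lvl N) (lvl M); last first.
  have /negbTE -> : N != M by apply: contraNneq L => ->.
  rewrite big1// => -[m hm] _ /=; rewrite {1}/tcoefs; case: ifPn => [/andP[h1 h2]|]; last by rewrite mul0r.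
  rewrite /tcoefs ifN ?conjc0 ?mulr0//; apply/negP => /andP[h3 h4].
  have : (lvl N < (lvl M).+1)%N by rewrite -(@ltn_exp2l 2)//; exact: leq_ltn_trans h4.
  have : (lvl M < (lvl N).+1)%N by rewrite -(@ltn_exp2l 2)//; exact: leq_ltn_trans h2.
  by rewrite !ltnS => h5 h6; move: L; rewrite eqn_leq h5 h6.
rewrite (@tcoefs_sum N (fun m => tcoefs N m * conjc (tcoefs M m))); last first.
  by move=> m hm; rewrite /tcoefs [(_ <= m)%N]leqNgt hm/= mul0r.
have p2 : 0 < 2 ^+ lvl N :> R by rewrite exprn_gt0.
pose d := center_angle M - center_angle N.
have T (j : 'I_(2 ^ lvl N)) : tcoefs N (2 ^ lvl N + j) * conjc (tcoefs M (2 ^ lvl N + j)) =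
    (2 ^- lvl N)%:C * circle 1 d ^+ j.
  have tM : tcoefs M (2 ^ lvl N + j) = circle (Num.sqrt (2 ^+ lvl N))^-1 (- (j%:R * center_angle M)).
    have := @tcoefs_in M j; rewrite -L; exact.
  rewrite tcoefs_in// tM conj_circle opprK circleM circleX expr1n.
  rewrite -expr2 exprVn sqr_sqrtr ?(ltW p2)// -[(2 ^- lvl N)%:C]circle_r0 circleM mulr1 add0r.
  by congr circle; rewrite /d; ring.
rewrite (eq_bigr _ (fun j _ => T j)) -mulr_sumr.
have [NM|NM] := eqVneq N M.
  rewrite /d NM subrr circle_r0 (eq_bigr (fun=> 1)); last by move=> j _; rewrite expr1n.
  rewrite big_const_ord iter_addr addr0 -NM.
  have -> : ((2 ^ lvl N)%N%:R : C) = (2 ^+ lvl N)%:C by rewrite -natrX -(rmorph_nat (real_complex R)).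
  by rewrite -rmorphM/= mulVf ?gt_eqF.
rewrite geo_sum0 ?mulr0//.
  have dE : d = 2 * pi * (M%:R - N%:R) / 2 ^+ lvl N.
    by rewrite /d /center_angle -L -mulrBl -mulrBr; congr (_ * _ / _); ring.
  apply: contraNneq NM => /circle1_eq1 => h; have d0 : d = 0.
    apply: h; have -> : d = 2 * pi * ((M%:R - N%:R) / 2 ^+ lvl N) by rewrite dE mulrA.
    rewrite normrM (gtr0_norm (pi2_gt0 R)) -[ltRHS]mulr1 ltr_pM2l ?pi2_gt0//.
    rewrite normrM [X in _ * X]gtr0_norm ?invr_gt0// ltr_pdivrMr// mul1r.
    have /andP[a1 a2] := lvl_bounds (ltnW N2); have /andP[b1 b2] := lvl_bounds (ltnW M2).
    rewrite -L in b1 b2; rewrite expnS in a2 b2.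
    move: a1 a2 b1 b2; rewrite -!(ler_nat R) natrM natrX -(natr1 N) -(natr1 M) => a1 a2 b1 b2.
    by rewrite ltr_norml; apply/andP; split; lra.
  move: d0; rewrite dE => /eqP; rewrite !mulf_eq0 invr_eq0 (gt_eqF p2) orbF.
  rewrite -mulf_eq0 gt_eqF ?pi2_gt0//= subr_eq0 eqr_nat => /eqP ->//.
rewrite circleX expr1n natrX.
have -> : 2 ^+ lvl N * d = 2 * pi * M%:R - 2 * pi * N%:R.
  by rewrite /d /center_angle -L mulrBr ![2 ^+ lvl N * _]mulrC !divfK ?gt_eqF//; ring.
have -> : circle 1 (2 * pi * M%:R - 2 * pi * N%:R) =
  circle 1 (2 * pi * M%:R) * conjc (circle 1 (2 * pi * N%:R)) :> C.
  by rewrite conj_circle circleM mulr1.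
by rewrite !circle_nat2pi conjc1 mulr1.
Qed.

Lemma testf_val N z : disc z -> testf N z =
  z ^+ (2 ^ lvl N) * ((Num.sqrt (2 ^+ lvl N))^-1)%:C *
  \sum_(j < 2 ^ lvl N) (z * circle 1 (- center_angle N)) ^+ j.
Proof.
move=> hz; rewrite (@H2_finsupp _ (2 ^ (lvl N).+1))//; last first.
  by rewrite coef_testf; exact: tcoefs_out.
rewrite coef_testf (@tcoefs_sum N (fun m => tcoefs N m * z ^+ m)); last first.
  by move=> m hm; rewrite /tcoefs [(_ <= m)%N]leqNgt hm/= mul0r.
rewrite mulr_sumr; apply: eq_bigr => j _; rewrite tcoefs_in//.
rewrite exprMn circleX expr1n mulrN -[X in circle X](mulr1) -[X in circle _ X]add0r -circleM circle_r0.
by rewrite exprD; ring.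
Qed.

Lemma sum_centered_sq (c : R) K :
  \sum_(j < K) (j%:R - c) ^+ 2 = K%:R * (K%:R - 1) * (2 * K%:R - 1) / 6 - c * K%:R * (K%:R - 1) + K%:R * c ^+ 2.
Proof.
elim: K => [|K IH]; first by rewrite big_ord0; ring.
by rewrite big_ord_recr/= IH -(natr1 K); field.
Qed.

(** Multiplying by a unimodular number centres the frequencies at (K - 1) / 2. The real part is then
    bounded below by cos x >= 1 - x^2 / 2, and since d^2 K^2 <= 16 the centred second moment removes
    at most 2/3 of K. *)
Lemma dirichlet_lower (r d : R) K : (0 < K)%N -> 0 <= r <= 1 -> `|d| <= pi / K%:R ->
  r ^+ K * (K%:R / 3) <= normc (\sum_(j < K) circle r d ^+ j).
Proof.
move=> K0 /andP[r0 r1] hd; have K0' : 0 < K%:R :> R by rewrite ltr0n.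
pose c : R := (K%:R - 1) / 2.
have -> : normc (\sum_(j < K) circle r d ^+ j) =
    normc (circle 1 (- (c * d)) * \sum_(j < K) circle r d ^+ j).
  by rewrite normcM normc_circle// mul1r.
apply: le_trans (le_trans (ler_norm _) (Re_le_normc _)).
rewrite mulr_sumr Re_sum.
have hd2 : d ^+ 2 * K%:R ^+ 2 <= 16.
  rewrite -exprMn -(real_normK (num_real _)) normrM (gtr0_norm K0').
  have : `|d| * K%:R <= 4.
    by apply: le_trans (pi_le4 R); rewrite -ler_pdivlMr.
  have : 0 <= `|d| * K%:R by rewrite mulr_ge0// ltW.
  by move: (`|d| * _) => x; nra.
apply: le_trans (_ : \sum_(j < K) r ^+ K * (1 - ((j%:R - c) * d) ^+ 2 / 2) <= _).
  rewrite -mulr_sumr ler_wpM2l ?exprn_ge0// sumrB big_const_ord iter_addr addr0.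
  rewrite -mulr_suml; under eq_bigr => j _ do rewrite exprMn.
  rewrite -mulr_suml sum_centered_sq /c.
  have -> : K%:R * (K%:R - 1) * (2 * K%:R - 1) / 6 - (K%:R - 1) / 2 * K%:R * (K%:R - 1) +
     K%:R * ((K%:R - 1) / 2) ^+ 2 = K%:R * (K%:R ^+ 2 - 1) / 12 :> R by field.
  have -> : K%:R * (K%:R ^+ 2 - 1) / 12 * d ^+ 2 / 2 =
     K%:R / 24 * (d ^+ 2 * K%:R ^+ 2 - d ^+ 2) by field.
  have := sqr_ge0 d; move: hd2; move: (d ^+ 2 * K%:R ^+ 2) => x hx; move: (d ^+ 2) => y hy.
  have : K%:R / 24 * (x - y) <= K%:R / 24 * 16 by rewrite ler_wpM2l ?divr_ge0 ?(ltW K0')//; lra.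
  lra.
apply: ler_sum => -[j hj] _ /=; rewrite circleX circleM mul1r/=.
have -> : - (c * d) + j%:R * d = (j%:R - c) * d by ring.
have c0 : 0 <= cos ((j%:R - c) * d).
  have : `|(j%:R - c) * d| <= pi / 2.
    rewrite normrM; apply: le_trans (_ : K%:R / 2 * (pi / K%:R) <= _).
      apply: ler_pM => //; rewrite ler_norml /c.
      have : (j%:R : R) <= K%:R - 1 by rewrite lerBrDr natr1 ler_nat.
      have : 0 <= j%:R :> R by [].
      by move=> h1 h2; apply/andP; split; lra.
    have -> : K%:R / 2 * (pi / K%:R) = pi / 2 :> R by field; rewrite gt_eqF.
    by [].
  by rewrite ler_norml => h; apply: cos_ge0_pihalf; rewrite -mulrN in h *.
apply: le_trans (ler_wpM2l _ (cos_ge_quad _)) _; first exact: exprn_ge0.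
by rewrite ler_wpM2r// ler_wiXn2l// ltnW.
Qed.

(** Induction by (1 - x/2)^2 >= 1 - x, from equality at n = 1. *)
Lemma pow_quarter n : (1 <= n)%N -> 4^-1 <= (1 - 2 ^- n) ^+ (2 ^ n) :> R.
Proof.
case: n => // n _; elim: n => [|n IH].
  by rewrite expr1 (_ : 1 - 2^-1 = 2^-1 :> R) ?expn1 -?exprVn; [lra|field].
apply: le_trans IH _; rewrite [(2 ^ n.+2)%N]expnS exprM.
have p : 0 < 2 ^- n.+1 :> R by rewrite invr_gt0 exprn_gt0.
have p1 : 2 ^- n.+1 <= 1 :> R by rewrite invf_le1 ?exprn_gt0// exprn_ege1// ler1n.
have h : 2 ^- n.+2 = 2 ^- n.+1 / 2 :> R by rewrite [2 ^+ n.+2]exprSr invfM.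
apply: lerXn2r; rewrite ?nnegrE ?sqr_ge0 ?h//; first lra.
by rewrite expr2; nra.
Qed.

(** Here 48 = 4 * 4 * 3: the bound |z|^(2^n) >= 1/4 enters once through the factor z^(2^n) and once
    through [dirichlet_lower], whose own constant is 1/3. *)
Lemma testf_lower N z : (2 <= N)%N -> window N z ->
  2 ^+ lvl N / 48 ^+ 2 <= normc (testf N z) ^+ 2.
Proof.
move=> N2 wz; have [hz lz sz] := wz.
set n := lvl N in lz sz *; have n1 : (1 <= n)%N by rewrite /n trunc_log_gt0.
have p2 : 0 < 2 ^+ n :> R by rewrite exprn_gt0.
have [t12 Ez] := turnP z; set r := normc z in Ez *.
have r0 : 0 <= r by exact: normc_ge0.
have r1 : 1 - 2 ^- n <= r by move: lz; rewrite lev_ge// -/r; lra.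
have rK : 4^-1 <= r ^+ (2 ^ n).
  apply: le_trans (pow_quarter n1) _; apply: lerXn2r => //; rewrite nnegrE//.
  by rewrite subr_ge0 invf_le1// exprn_ege1// ler1n.
rewrite testf_val// -/n.
have -> : z * circle 1 (- center_angle N) = circle r (2 * pi * turn z - center_angle N).
  by rewrite {1}Ez circleM mulr1.
set d := _ - center_angle N.
have hd : `|d| <= pi / (2 ^ n)%N%:R.
  rewrite natrX ler_pdivlMr//; have := eqxx (sidx n z); rewrite {2}sz sidx_eq => /andP[h1 h2].
  rewrite -[X in _ * X <= _](gtr0_norm p2) -normrM /d /center_angle -/n mulrBl divfK ?gt_eqF//.
  have -> : 2 * pi * turn z * 2 ^+ n - 2 * pi * (N%:R + 2^-1) =
     pi * (2 * (2 ^+ n * turn z - N%:R) - 1) by field.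
  rewrite normrM ger0_norm ?pi_ge0// ler_piMr ?pi_ge0//.
  move: h2; rewrite -(natr1 N) => h2; rewrite ler_norml; apply/andP; split; lra.
have r01 : 0 <= r <= 1 by rewrite r0/= ltW.
have := dirichlet_lower (expn_gt0 2 n : (0 < 2 ^ n)%N) r01 hd.
set S := normc (\sum_(j < _) _) => hS.
rewrite !normcM normcX -/r normcR exprMn exprMn.
rewrite ger0_norm ?invr_ge0 ?sqrtr_ge0// exprVn sqr_sqrtr ?(ltW p2)//.
set x := r ^+ (2 ^ n) in rK hS *.
have hS2 : 2 ^+ n / 12 <= S.
  by apply: le_trans hS; rewrite natrX; nra.
have hS3 : (2 ^+ n / 12) ^+ 2 <= S ^+ 2.
  by rewrite lerXn2r ?nnegrE//; first nonneg; exact: normc_ge0.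
have hx2 : 16^-1 <= x ^+ 2.
  by rewrite expr2; nra.
apply: le_trans (_ : 16^-1 / 2 ^+ n * (2 ^+ n / 12) ^+ 2 <= _).
  have -> : 16^-1 / 2 ^+ n * (2 ^+ n / 12) ^+ 2 = 2 ^+ n / 48 ^+ 2 :> R.
    by move: (2 ^+ n) p2 => y y0; field; rewrite gt_eqF.
  by [].
rewrite -/S; apply: ler_pM => //.
by rewrite ler_wpM2r ?invr_ge0 ?(ltW p2).
Qed.

End TestFunctions.

Section Minkowski.
Variable R : realType.
Implicit Types (x y z : R).

(** The best t is the quotient of the two roots; adding e/2 to each keeps it positive and finite.
    Triangle inequalities thus follow from quadratic inequalities that can be integrated or
    summed. *)
Lemma minkowski_opt x y z : 0 <= x -> 0 <= y ->
  (forall t, 0 < t -> z <= (1 + t) * x + (1 + t^-1) * y) ->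
  Num.sqrt z <= Num.sqrt x + Num.sqrt y.
Proof.
move=> x0 y0 H; apply/ler_addgt0Pr => e e0.
set a := Num.sqrt x; set b := Num.sqrt y.
have a0 : 0 <= a by exact: sqrtr_ge0.
have b0 : 0 <= b by exact: sqrtr_ge0.
pose u := a + e / 2; pose v := b + e / 2.
have u0 : 0 < u by rewrite /u; lra.
have v0 : 0 < v by rewrite /v; lra.
have xu : x <= u ^+ 2.
  by rewrite -(sqr_sqrtr x0) -/a lerXn2r ?nnegrE ?(ltW u0)// lerDl; lra.
have yv : y <= v ^+ 2.
  by rewrite -(sqr_sqrtr y0) -/b lerXn2r ?nnegrE ?(ltW v0)// lerDl; lra.
have -> : a + b + e = u + v by rewrite /u /v; lra.
have <- : Num.sqrt ((u + v) ^+ 2) = u + v by rewrite sqrtr_sqr ger0_norm// ltW// addr_gt0.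
rewrite ler_wsqrtr//; apply: le_trans (H (v / u) (divr_gt0 v0 u0)) _.
have vu : 0 <= v / u by rewrite divr_ge0 ?ltW.
have uv : 0 <= (v / u)^-1 by rewrite invr_ge0.
apply: le_trans (lerD (ler_wpM2l _ xu) (ler_wpM2l _ yv)) _; [lra|lra|].
apply: le_of_eq; field.
by rewrite !gt_eqF.
Qed.

End Minkowski.

(** * Energy seminorms on windows and boxes *)

Section HardySeminorms.
Variable R : realType.
Local Notation C := R[i].
Local Notation V := (H2 R).
Implicit Types (z w : C) (n m N M : nat) (f h : V) (S : set C).

Lemma ReipE f h : complex.Re (ip h f) = complex.Re (ip f h).
Proof. by rewrite ipC; case: (ip f h). Qed.

Lemma hn2D f h : hn2 (f + h) = hn2 f + hn2 h + 2 * complex.Re (ip f h).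
Proof. by rewrite /hn2 ipDl !ipDr !ReD (ReipE f h); ring. Qed.

Lemma hn2N f : hn2 (- f) = hn2 f.
Proof. by rewrite -scaleN1r hn2Z normcN normc1 expr1n mul1r. Qed.

Lemma hn2B f h : hn2 (f - h) = hn2 f + hn2 h - 2 * complex.Re (ip f h).
Proof. by rewrite hn2D hn2N -ReipE ipNl ReN ReipE; ring. Qed.

Lemma hn2_young f h (t : R) : 0 < t -> hn2 (f + h) <= (1 + t) * hn2 f + (1 + t^-1) * hn2 h.
Proof.
move=> t0; have := hn2_ge0 (t%:C *: f - h).
rewrite hn2B hn2Z normcR gtr0_norm// ipZl ReM/= mul0r subr0 hn2D => H.
have : 0 <= t^-1 * (t ^+ 2 * hn2 f + hn2 h - 2 * (t * complex.Re (ip f h))).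
  by rewrite mulr_ge0 ?invr_ge0 ?(ltW t0).
have -> : t^-1 * (t ^+ 2 * hn2 f + hn2 h - 2 * (t * complex.Re (ip f h))) =
   t * hn2 f + t^-1 * hn2 h - 2 * complex.Re (ip f h) by field; rewrite gt_eqF.
lra.
Qed.

Lemma hn2_sqrtD f h (a b : R) k : 0 <= a -> 0 <= b ->
  hn2 f <= a ^+ 2 * hn2 k -> hn2 h <= b ^+ 2 * hn2 k -> hn2 (f + h) <= (a + b) ^+ 2 * hn2 k.
Proof.
move=> a0 b0 fa hb; have M := minkowski_opt (hn2_ge0 f) (hn2_ge0 h) (fun t => @hn2_young f h t).
have K : Num.sqrt (hn2 (f + h)) <= (a + b) * Num.sqrt (hn2 k).
  apply: le_trans M _; rewrite mulrDl; apply: lerD.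
    rewrite -[a]ger0_norm// -sqrtr_sqr -sqrtrM ?sqr_ge0//; exact: ler_wsqrtr.
  by rewrite -[b]ger0_norm// -sqrtr_sqr -sqrtrM ?sqr_ge0//; exact: ler_wsqrtr.
rewrite -(sqr_sqrtr (hn2_ge0 (f + h))) -(sqr_sqrtr (hn2_ge0 k)) -exprMn.
by apply: lerXn2r; rewrite ?nnegrE ?sqrtr_ge0// mulr_ge0 ?addr_ge0 ?sqrtr_ge0.
Qed.

Definition darea : R := fine (@disc_area R).

Lemma dareaE : @disc_area R = darea%:E /\ 0 < darea.
Proof. by rewrite /darea; have [A A0 ->] := @disc_area_fin R. Qed.

Definition en S f : R := fine (energy S (cderiv f)).

Lemma energy_le f : (energy (@disc R) (cderiv f) <= (darea * hn2 f)%:E)%E.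
Proof.
have [EA A0] := dareaE.
by apply: (littlewood_paley_le (H2_ps f) EA A0) => N; exact: norm2_coef_le.
Qed.

Lemma cmeasf_energy f : cmeasf (@disc R) (fun z => normc (cderiv f z) ^+ 2 * lpw z).
Proof.
apply: cmeasfM; last exact: cmeasf_lpw.
by apply: cmeasfX; exact: cmeasf_ps (coefP (holo_cderiv (@H2_holo _ f))).
Qed.

Lemma energy_pt_ge0 f z : disc z -> 0 <= normc (cderiv f z) ^+ 2 * lpw z.
Proof. by move=> hz; rewrite mulr_ge0 ?sqr_ge0 ?lpw_ge0. Qed.

Lemma energy_mono f S T : cmeas S -> cmeas T -> S `<=` T -> T `<=` @disc R ->
  (energy S (cderiv f) <= energy T (cderiv f))%E.
Proof.
move=> mS mT ST TD; apply: aint_mono => //; first by move=> z /TD; exact: energy_pt_ge0.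
by apply: cmeasfS (cmeasf_energy f) => //; exact: cmeas_disc.
Qed.

Lemma fine_scale (x y : \bar R) (c : R) : x \is a fin_num -> y \is a fin_num ->
  x = (c%:E * y)%E -> fine x = c * fine y.
Proof. by case: x => [x||]//; case: y => [y||]// _ _ [->]. Qed.

Lemma fine_le_comb (x y z : \bar R) (c d : R) : x \is a fin_num -> y \is a fin_num ->
  z \is a fin_num -> (x <= c%:E * y + d%:E * z)%E -> fine x <= c * fine y + d * fine z.
Proof. by case: x => [x||]//; case: y => [y||]//; case: z => [z||]//. Qed.

Lemma en_fin f S : cmeas S -> S `<=` @disc R -> energy S (cderiv f) \is a fin_num.
Proof.
move=> mS SD; rewrite ge0_fin_numE.
  apply: (@le_lt_trans _ _ (energy (@disc R) (cderiv f))).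
    by apply: energy_mono => //; exact: cmeas_disc.
  by apply: le_lt_trans (energy_le f) _; exact: ltry.
by apply: aint_ge0 => z /SD; exact: energy_pt_ge0.
Qed.

Lemma enE f S : cmeas S -> S `<=` @disc R -> energy S (cderiv f) = (en S f)%:E.
Proof. by move=> mS SD; rewrite fineK//; exact: en_fin. Qed.

Lemma en_ge0 f S : S `<=` @disc R -> 0 <= en S f.
Proof. by move=> SD; apply: fine_ge0; apply: aint_ge0 => z /SD; exact: energy_pt_ge0. Qed.

Lemma en_le f S : cmeas S -> S `<=` @disc R -> en S f <= darea * hn2 f.
Proof.
move=> mS SD; rewrite -lee_fin -enE//; apply: le_trans (energy_le f).
by apply: energy_mono => //; exact: cmeas_disc.
Qed.

Lemma cderiv_linear (c : C) f h z : disc z ->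
  cderiv (c *: f + h : V) z = c * cderiv f z + cderiv h z.
Proof.
move=> hz; have [_] := cderive_derivable (cderiveD (cderiveM (cderive_cst c z)
   (holo_cderive (@H2_holo _ f) hz)) (holo_cderive (@H2_holo _ h) hz)).
by rewrite mulr0 addr0.
Qed.

Lemma normc_young (u v : C) (t : R) : 0 < t ->
  normc (u + v) ^+ 2 <= (1 + t) * normc u ^+ 2 + (1 + t^-1) * normc v ^+ 2.
Proof.
move=> t0; set a := normc u; set b := normc v.
apply: le_trans (_ : (a + b) ^+ 2 <= _).
  by rewrite lerXn2r ?nnegrE ?addr_ge0 ?normc_ge0//; exact: le_normcD.
have -> : (1 + t) * a ^+ 2 + (1 + t^-1) * b ^+ 2 = (a + b) ^+ 2 + t^-1 * (t * a - b) ^+ 2.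
  by field; rewrite gt_eqF.
by rewrite lerDl mulr_ge0 ?sqr_ge0 ?invr_ge0 ?(ltW t0).
Qed.

Lemma en_scale (c : C) f (k : V) S : cmeas S -> S `<=` @disc R ->
  (forall z, S z -> cderiv k z = c * cderiv f z) -> en S k = normc c ^+ 2 * en S f.
Proof.
move=> mS SD kE; apply: fine_scale; [exact: en_fin|exact: en_fin|].
rewrite /energy -aintZ ?sqr_ge0//.
- by apply: eq_aint => z hz; rewrite (kE z hz) normcM exprMn -mulrA.
- by move=> z /SD; exact: energy_pt_ge0.
- by apply: cmeasfS (cmeasf_energy f) => //; exact: cmeas_disc.
Qed.

Lemma enZ (c : C) f S : cmeas S -> S `<=` @disc R -> en S (c *: f) = normc c ^+ 2 * en S f.
Proof.
move=> mS SD; apply: en_scale => // z /SD hz; have := cderiv_linear c f 0 hz.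
have := cderiv_linear (-1) 0 0 hz.
by rewrite scaler0 addr0 mulN1r addNr addr0 => ->; rewrite addr0.
Qed.

Lemma en_sum_young f h (k : V) S (t : R) : cmeas S -> S `<=` @disc R ->
  (forall z, S z -> cderiv k z = cderiv f z + cderiv h z) -> 0 < t ->
  en S k <= (1 + t) * en S f + (1 + t^-1) * en S h.
Proof.
move=> mS SD kE t0; apply: fine_le_comb; [exact: en_fin|exact: en_fin|exact: en_fin|].
have mE (l : V) : cmeasf S (fun z => normc (cderiv l z) ^+ 2 * lpw z).
  by apply: cmeasfS (cmeasf_energy l) => //; exact: cmeas_disc.
have pE (l : V) z : S z -> 0 <= normc (cderiv l z) ^+ 2 * lpw z by move=> /SD; exact: energy_pt_ge0.
have t1 : 0 <= 1 + t by rewrite addr_ge0// ltW.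
have t2 : 0 <= 1 + t^-1 by rewrite addr_ge0// invr_ge0 ltW.
rewrite /energy -(aintZ mS t1 (pE f) (mE f)) -(aintZ mS t2 (pE h) (mE h)).
have mc c (l : V) : cmeasf S (fun z => c * (normc (cderiv l z) ^+ 2 * lpw z)).
  by apply: cmeasfM => //; exact: cmeasf_cst.
rewrite -aintD//; last 2 first.
- by move=> z hz; rewrite mulr_ge0 ?pE.
- by move=> z hz; rewrite mulr_ge0 ?pE.
apply: aint_le => //; [by move=> z; exact: pE| |by apply: cmeasfD].
move=> z hz; rewrite (kE z hz) (mulrA (1 + t)) (mulrA (1 + t^-1)) -mulrDl.
exact: ler_wpM2r (lpw_ge0 (SD _ hz)) _ _ (normc_young _ _ t0).
Qed.

Lemma en_young f h S (t : R) : cmeas S -> S `<=` @disc R -> 0 < t ->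
  en S (f + h) <= (1 + t) * en S f + (1 + t^-1) * en S h.
Proof.
move=> mS SD; apply: en_sum_young => // z /SD hz; have := cderiv_linear 1 f h hz.
by rewrite scale1r mul1r.
Qed.

Definition boxes (E : seq nat) : set C := [set z | disc z /\ hidx z \in E].

Lemma boxes_cons N E : boxes (N :: E) = box N `|` boxes E.
Proof.
apply/seteqP; split => z; rewrite /boxes /box /=.
  by move=> [hz]; rewrite inE => /predU1P[h|h]; [left|right].
by move=> [[hz ->]|[hz h]]; split=> //; rewrite inE ?eqxx ?h ?orbT.
Qed.

Lemma cmeas_boxes E : (forall N, N \in E -> (2 <= N)%N) -> cmeas (boxes E).
Proof.
elim: E => [|N E IH] hE.
  by rewrite (_ : boxes [::] = set0); [exact: measurable0|apply/seteqP; split => z // []].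
rewrite boxes_cons; apply: cmeasU; first by apply: cmeas_box; apply: hE; rewrite inE eqxx.
by apply: IH => M hM; apply: hE; rewrite inE hM orbT.
Qed.

Lemma aint_boxes (F : C -> R) E : uniq E -> (forall N, N \in E -> (2 <= N)%N) ->
  (forall z, disc z -> 0 <= F z) -> cmeasf (@disc R) F ->
  aint (boxes E) F = (\sum_(N <- E) aint (box N) F)%E.
Proof.
move=> + + F0 mF; elim: E => [|N E IH] /=.
  move=> _ _; rewrite big_nil (_ : boxes [::] = set0); first by rewrite /aint integral_set0.
  by apply/seteqP; split => z // [].
move=> /andP[NE uE] hE; have hE' M : M \in E -> (2 <= M)%N by move=> hM; apply: hE; rewrite inE hM orbT.
rewrite big_cons -IH// boxes_cons aintU//.
- by apply: cmeas_box; apply: hE; rewrite inE eqxx.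
- exact: cmeas_boxes.
- by move=> z [_ h1] [_ h2]; move: NE; rewrite -h1 h2.
- by move=> z [[hz _]|[hz _]]; exact: F0.
- apply: cmeasfS mF; first exact: cmeas_disc.
  by move=> z [[]|[]].
Qed.

(** Disjoint boxes share the total energy. This is the hypothesis on the seminorms in [trace_le]. *)
Lemma en_boxes f E : uniq E -> (forall N, N \in E -> (2 <= N)%N) ->
  \sum_(N <- E) en (box N) f <= darea * hn2 f.
Proof.
move=> uE hE; have := aint_boxes uE hE (@energy_pt_ge0 f) (cmeasf_energy f).
rewrite -/(energy (boxes E) (cderiv f)) enE; last 2 first.
- exact: cmeas_boxes.
- by move=> z [].
have -> : (\sum_(N <- E) aint (box N) (fun z => (normc (cderiv f z) ^+ 2 * lpw z)%R))%E =
   (\sum_(N <- E) en (box N) f)%:E.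
  rewrite -sumEFin big_seq [RHS]big_seq; apply: eq_bigr => N /hE h2.
  by rewrite -enE//; [exact: cmeas_box|exact: box_disc].
by move=> [<-]; apply: en_le; [exact: cmeas_boxes|move=> z []].
Qed.

Definition qn S f : R := Num.sqrt (en S f).

Lemma qnD S f h : cmeas S -> S `<=` @disc R -> qn S (f + h) <= qn S f + qn S h.
Proof.
by move=> mS SD; apply: minkowski_opt => [||t t0]; rewrite ?en_ge0//; exact: en_young.
Qed.

Lemma qnZ S (c : C) f : cmeas S -> S `<=` @disc R -> qn S (c *: f) = normc c * qn S f.
Proof.
by move=> mS SD; rewrite /qn enZ// sqrtrM ?sqr_ge0// sqrtr_sqr ger0_norm ?normc_ge0.
Qed.

End HardySeminorms.

(** * Lower bounds for singular values *)

Section LowerBounds.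
Variable R : realType.
Local Notation C := R[i].
Local Notation V := (H2 R).
Implicit Types (z w : C) (n m N M j k : nat) (f h : V) (x : nat -> R).

Section FixedByProjection.
Variable us : seq V.

Definition in_span f := f = \sum_(l <- iota 0 (size us)) ip f us`_l *: us`_l.

Lemma in_spanD f h : in_span f -> in_span h -> in_span (f + h).
Proof.
move=> hf hh; rewrite /in_span {1}hf {1}hh -big_split/=; apply: eq_bigr => l _.
by rewrite ipDl scalerDl.
Qed.

Lemma in_spanZ (c : C) f : in_span f -> in_span (c *: f).
Proof.
move=> hf; rewrite /in_span {1}hf scaler_sumr; apply: eq_bigr => l _.
by rewrite ipZl scalerA.
Qed.

Lemma in_span0 : in_span 0.
Proof. by rewrite /in_span big1// => l _; rewrite ip0l scale0r. Qed.

Lemma in_span_comb (v : seq V) (c : nat -> C) : (forall k : V, k \in v -> in_span k) ->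
  in_span (\sum_(i < size v) c i *: v`_i).
Proof.
move=> hv; elim/big_ind : _ => [|f h|i _]; [exact: in_span0|exact: in_spanD|].
by apply: in_spanZ; apply: hv; exact: mem_nth.
Qed.

End FixedByProjection.

Lemma rank_diff_basis (S T : {linear V -> V}) n m : rank_lt S n -> rank_lt T m ->
  exists us : seq V, [/\ (size us <= n + m)%N, orthonormal us &
    forall f, in_span us (S f - T f)].
Proof.
move=> [v vn hS] [w wm hT]; have [us [su ou hu]] := gram_schmidt (v ++ w).
exists us; split=> //.
  by apply: leq_trans su _; rewrite size_cat; apply: leq_add; exact: ltnW.
move=> f; have [c ->] := hS f; have [d ->] := hT f.
apply: in_spanD.
  by apply: in_span_comb => k kv; apply: hu; rewrite mem_cat kv.
rewrite -scaleN1r; apply: in_spanZ.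
by apply: in_span_comb => k kw; apply: hu; rewrite mem_cat kw orbT.
Qed.

(** Since 2^0 = 1, the telescoping sum of approximants starts from the zero operator. *)
Lemma rank_lt1 (S : V -> V) f : rank_lt S 1 -> S f = 0.
Proof. by move=> [v]; case: v => // _ /(_ f)[c ->]; rewrite big_ord0. Qed.

Lemma ler_sum_seq (T : eqType) (s : seq T) (a b : T -> R) :
  (forall i, i \in s -> a i <= b i) -> \sum_(i <- s) a i <= \sum_(i <- s) b i.
Proof. by move=> H; rewrite big_seq [leRHS]big_seq; exact: ler_sum. Qed.

Lemma fine_scale_le (u v : \bar R) (c : R) : u \is a fin_num -> v \is a fin_num ->
  (c%:E * u <= v)%E -> c * fine u <= fine v.
Proof. by case: u => [u||]//; case: v => [v||]. Qed.

(** Only subadditivity of Phi on families of vectors is used, so that it can be either a sum of box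
    seminorms or a Hilbert-Schmidt norm. *)
Lemma telescope_le (T : zmodType) (Phi : (nat -> T) -> R) (a : nat -> T) (s : nat -> nat -> T) k :
  (forall F G, Phi (fun N => F N + G N) <= Phi F + Phi G) ->
  (forall F G, F =1 G -> Phi F = Phi G) -> (forall N, s 0%N N = 0) -> Phi (fun=> 0) = 0 ->
  Phi a <= Phi (fun N => a N - s k N) + \sum_(j < k) Phi (fun N => s j.+1 N - s j N).
Proof.
move=> PD Pe s0 P0.
have H : Phi (s k) <= \sum_(j < k) Phi (fun N => s j.+1 N - s j N).
  elim: k => [|k IH]; first by rewrite big_ord0 (Pe _ _ s0) P0.
  rewrite big_ord_recr/= addrC.
  apply: le_trans (_ : Phi (fun N => s k.+1 N - s k N) + Phi (s k) <= _); last by rewrite lerD2l.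
  rewrite (Pe _ (fun N => (s k.+1 N - s k N) + s k N)); first exact: PD.
  by move=> N; rewrite subrK.
apply: le_trans (_ : Phi (fun N => a N - s k N) + Phi (s k) <= _); last by rewrite lerD2l.
rewrite (Pe _ (fun N => (a N - s k N) + s k N)); first exact: PD.
by move=> N; rewrite subrK.
Qed.

Variable g : C -> C.
Hypothesis hg : hardy2 g.
Local Notation Ig := (integration_op g).
Let hgh : holomorphic_disc g := hg.1.

Lemma aint_wgt_lty : (aint (@disc R) (wgt g) < +oo)%E.
Proof.
have [EA A0] := dareaE R.
have fin : h2norm g \is a fin_num by rewrite ge0_fin_numE ?hg.2// sqrte_ge0.
have hB : forall N, sqnorm (coef g) N <= fine (h2norm g) ^+ 2.
  by apply: (h2norm_leP (coefP hgh) _).1; rewrite ?fine_ge0 ?sqrte_ge0// fineK.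
exact: le_lt_trans (littlewood_paley_le (coefP hgh) EA A0 hB) (ltry _).
Qed.

Lemma coef_Ig_scale (c : C) f : coef (Ig (c *: f : V)) = fun m => c * coef (Ig f) m.
Proof.
have E0 : coef (Ig (0 : V)) = fun=> 0.
  have := coef_integration_op_linear hgh (-1) (0 : V) 0; rewrite scaler0 addr0 => E.
  apply/funext => m; have := congr1 (fun u => u m) E => /=; rewrite mulN1r addNr//.
have := coef_integration_op_linear hgh c f 0; rewrite addr0 E0 => ->.
by apply/funext => m; rewrite addr0.
Qed.

(** A value strictly above the infimum yields an operator; its bound on the unit ball extends by
    homogeneity. *)
Lemma singular_value_approx n (y : R) : 0 < y -> (singular_value Ig n < y%:E)%E ->
  exists S : {linear V -> V}, rank_lt S n /\
    forall f N, sqnorm (fun m => coef (Ig f) m - coef (S f) m) N <= y ^+ 2 * hn2 f.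
Proof.
move=> y0 /ereal_inf_lt[_ [S [_ rS] <-] hS]; exists S; split=> // f N.
have unit_ball h : hn2 h <= 1 -> forall N,
    sqnorm (fun m => coef (Ig h) m - coef (S h) m) N <= y ^+ 2.
  move=> h1; have ps : is_ps (fun z => Ig h z - S h z)%R (fun m => coef (Ig h) m - coef (S h) m).
    have := is_psD (coefP (is_ps_holo (integration_op_ps hgh h))) (is_psZ (-1) (H2_ps (S h))).
    move=> hp; apply: is_ps_ext (_ : is_ps (fun z => Ig h z + -1 * S h z) _) _; last first.
      by move=> z _; rewrite mulN1r.
    by rewrite (_ : (fun m => _) = (fun m => coef (Ig h) m + -1 * coef (S h) m))//;
       apply/funext => m; rewrite mulN1r.
  apply: (h2norm_leP ps (ltW y0)).1; apply: le_trans (ltW hS).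
  apply: ereal_sup_ubound; exists h => //.
  by apply/(h2norm_hn2 _ ler01); rewrite expr1n.
have [f0|f0] := eqVneq (hn2 f) 0.
  rewrite f0 mulr0 (hn2_eq0 f0); have := coef_Ig_scale 0 0; rewrite scaler0 => ->.
  rewrite linear0 coef0 /sqnorm big1// => i _.
  by rewrite mul0r subr0 normc0 expr0n.
have fp : 0 < hn2 f by rewrite lt_def f0 hn2_ge0.
pose c : C := ((Num.sqrt (hn2 f))^-1)%:C.
have c2 : normc c ^+ 2 = (hn2 f)^-1.
  by rewrite normcR ger0_norm ?invr_ge0 ?sqrtr_ge0// exprVn sqr_sqrtr ?hn2_ge0.
have := unit_ball (c *: f) _ N; rewrite hn2Z c2 mulVf ?gt_eqF// => /(_ (lexx _)).
have -> : sqnorm (fun m => coef (Ig (c *: f)) m - coef (S (c *: f)) m) N =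
    (hn2 f)^-1 * sqnorm (fun m => coef (Ig f) m - coef (S f) m) N.
  rewrite /sqnorm mulr_sumr; apply: eq_bigr => m _.
  by rewrite coef_Ig_scale linearZ coefZ -mulrBr normcM exprMn c2.
by rewrite ler_pdivrMl// mulrC.
Qed.

(** [integration_op] takes values in arbitrary functions. Boundedness, deduced below from finiteness
    of s_1 and later from a bound on the window ratios, makes it the endomorphism [IgV] of H^2. *)
Definition ig_bounded := exists B : R, forall f N, sqnorm (coef (Ig f)) N <= B * hn2 f.

Lemma singular_value1_bounded : (singular_value Ig 1 < +oo)%E -> ig_bounded.
Proof.
move=> h; have [y y0 hy] : exists2 y : R, 0 < y & (singular_value Ig 1 < y%:E)%E.
  move: h; case E : (singular_value Ig 1) => [r||]// _; last by exists 1; rewrite ?ltNyr.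
  exists (`|r| + 1); first by rewrite ltr_wpDl.
  by rewrite lte_fin (le_lt_trans (ler_norm _))// ltrDl.
have [S [rS hS]] := singular_value_approx y0 hy; exists (y ^+ 2) => f N.
have := hS f N; rewrite (rank_lt1 f rS) coef0 /sqnorm.
by under eq_bigr => m _ do rewrite subr0.
Qed.

Section Bounded.
Hypothesis hB : ig_bounded.

Lemma Ig_l2 f : l2 (coef (Ig f)).
Proof. by have [B h] := hB; exists (B * hn2 f); exact: h. Qed.

Definition IgV f : V := projT1 (cid (mkH2_ex (Ig_l2 f))).

Lemma coef_IgV f : coef (IgV f) = coef (Ig f).
Proof. exact: (projT2 (cid (mkH2_ex (Ig_l2 f)))). Qed.

Lemma IgV_linear : linear IgV.
Proof.
move=> c f h; apply: coef_inj; rewrite coefD coefZ !coef_IgV.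
by rewrite coef_integration_op_linear.
Qed.

HB.instance Definition _ := GRing.isLinear.Build C V V _ IgV IgV_linear.

Lemma IgV_deriv f z : disc z -> cderiv (IgV f) z = f z * cderiv g z.
Proof.
move=> hz; rewrite -(integration_op_deriv hgh f hz).
have h1 := is_ps_cderiv (H2_ps (IgV f)).
have h2 := is_ps_cderiv (coefP (is_ps_holo (integration_op_ps hgh f))).
by rewrite coef_IgV in h1; exact: clim_uniq (h1 z hz) (h2 z hz).
Qed.

Lemma energy_IgV f S : S `<=` @disc R ->
  energy S (cderiv (IgV f)) = aint S (fun z => normc (f z) ^+ 2 * wgt g z).
Proof.
move=> SD; apply: eq_aint => z /SD hz.
by rewrite IgV_deriv// normcM exprMn /wgt mulrA.
Qed.

Lemma en_testf N S : (2 <= N)%N -> cmeas S -> S `<=` window N ->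
  2 ^+ lvl N / 48 ^+ 2 * fine (aint S (wgt g)) <= en S (IgV (testf R N)).
Proof.
move=> N2 mS SW; have SD : S `<=` @disc R by move=> z /SW[].
have mw : cmeasf S (wgt g) by apply: cmeasfS (cmeasf_wgt hgh) => //; exact: cmeas_disc.
have k0 : 0 <= 2 ^+ lvl N / 48 ^+ 2 :> R by apply: divr_ge0; [exact: exprn_ge0|exact: sqr_ge0].
have H : ((2 ^+ lvl N / 48 ^+ 2)%:E * aint S (wgt g) <=
    aint S (fun z => (normc (testf R N z) ^+ 2 * wgt g z)%R))%E.
  rewrite -(aintZ mS k0 (fun z hz => wgt_ge0 g (SD z hz)) mw); apply: (aint_le mS).
  - by move=> z /SD hz; rewrite mulr_ge0 ?wgt_ge0.
  - by move=> z hz; apply: ler_wpM2r (wgt_ge0 g (SD z hz)) _ _ (testf_lower N2 (SW z hz)).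
  - by apply: cmeasfM mw; exact: cmeasf_cst.
  - apply: cmeasfS (cmeasf_H2 hgh (testf R N)); [exact: cmeas_disc|exact: SD].
rewrite -(energy_IgV (testf R N) SD) in H.
exact: fine_scale_le (aint_wgt_fin hgh aint_wgt_lty mS SD) (en_fin (IgV (testf R N)) mS SD) H.
Qed.

Definition bratio N : R := bmass g N * 2 ^+ lvl N.

Lemma wratio_le N : (2 <= N)%N -> wratio g N <= 48 ^+ 2 * (darea R * hn2 (IgV (testf R N))).
Proof.
move=> N2; have mW := @cmeas_window R N N2.
have := en_testf N2 mW (@subset_refl _ (window N)).
have := en_le (IgV (testf R N)) mW (@window_disc R N).
rewrite -/(wmass g N) /wratio => h1 h2; have := le_trans h2 h1.
rewrite mulrAC ler_pdivrMr; last by apply: exprn_gt0; rewrite ltr0n.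
by rewrite mulrC [leRHS]mulrC.
Qed.

Lemma bratio_le N : (2 <= N)%N -> Num.sqrt (bratio N) <= 48 * qn (box N) (IgV (testf R N)).
Proof.
move=> N2; have mW := @cmeas_box R N N2.
have := en_testf N2 mW (box_window N2); rewrite -/(bmass g N) => h.
have -> : 48 = Num.sqrt (48 ^+ 2) :> R by rewrite sqrtr_sqr ger0_norm ?ler0n.
rewrite /qn -sqrtrM; last exact: sqr_ge0.
apply: ler_wsqrtr; rewrite /bratio; move: h; rewrite mulrAC ler_pdivrMr; last first.
  by apply: exprn_gt0; rewrite ltr0n.
by rewrite mulrC [leRHS]mulrC.
Qed.

Section Approximants.
Variables (S : nat -> {linear V -> V}) (x : nat -> R) (k : nat) (E : seq nat).
Hypotheses (rS : forall j, (j <= k)%N -> rank_lt (S j) (2 ^ j))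
  (bS : forall j f, (j <= k)%N -> hn2 (IgV f - S j f) <= x j ^+ 2 * hn2 f)
  (x0 : forall j, (j <= k)%N -> 0 < x j) (uE : uniq E) (hE : forall N, N \in E -> (2 <= N)%N)
  (sE : (size E <= 2 ^ k)%N).

Let on N M : N \in E -> M \in E -> ip (testf R N) (testf R M) = (N == M)%:R.
Proof. by move=> /hE hN /hE hM; exact: testf_on. Qed.

(** Consecutive approximants are both close to I_g, so their difference has norm at most x_j +
    x_(j+1), and its rank is at most the sum of the two ranks. *)
Lemma step_basis j : (j < k)%N -> exists us : seq V, [/\ (size us <= 4 * 2 ^ j)%N, orthonormal us,
  forall f, in_span us ((S j.+1 \- S j) f) &
  forall f, hn2 ((S j.+1 \- S j) f) <= (x j + x j.+1) ^+ 2 * hn2 f].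
Proof.
move=> jk; have [us [su ou hu]] := rank_diff_basis (rS jk) (rS (ltnW jk)).
exists us; split=> //; first by apply: leq_trans su _; rewrite expnS; lia.
move=> f; have -> : (S j.+1 \- S j) f = (IgV f - S j f) + - (IgV f - S j.+1 f).
  by rewrite opprB addrC addrA subrK.
apply: hn2_sqrtD; [exact/ltW/x0/ltnW|exact/ltW/x0|exact/bS/ltnW|].
by rewrite hn2N; exact: bS.
Qed.

Lemma hn2_testf N : N \in E -> hn2 (testf R N) = 1.
Proof. by move=> hN; apply: complexI; rewrite -ipE on// eqxx. Qed.

Lemma sum_sqrt2 (u : nat -> R) : (forall j, (j <= k)%N -> 0 <= u j) ->
  u k + \sum_(j < k) 4 * (u j + u j.+1) <= 9 * \sum_(j < k.+1) u j.
Proof.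
(* The coefficient 5 lets the induction close: its step brings in 4 u_m + 4 u_(m+1). *)
move=> u0; suff : 5 * u k + \sum_(j < k) 4 * (u j + u j.+1) <= 9 * \sum_(j < k.+1) u j.
  by have := u0 k (leqnn k); move: (\sum_(j < k) _) (\sum_(j < k.+1) _) => p q; lra.
elim: k u0 => [|m IH] u0.
  by rewrite big_ord0 addr0 big_ord1; have := u0 0%N (leqnn _); lra.
rewrite big_ord_recr/= [X in _ <= 9 * X]big_ord_recr/=.
have := IH (fun j jm => u0 j (leqW jm)).
have := u0 m (leqnSn m); have := u0 m.+1 (leqnn _).
move: (\sum_(j < m) _) (\sum_(j < m.+1) _) => p q; lra.
Qed.

(** The box seminorm of I_g f_N sees the mass of the box N. Differences of approximants are handled
    by [trace_le] with rank O(2^j), and I_g - S_k term by term, E having at most 2^k elements. *)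
Lemma trace_lower : \sum_(N <- E) Num.sqrt (bratio N) <=
  48 * (9 * (1 + darea R)) * \sum_(j < k.+1) 2 ^+ j * x j.
Proof.
have [_ A0] := dareaE R.
pose Phi (F : nat -> V) := \sum_(N <- E) qn (box N) (F N).
have mB N : N \in E -> cmeas (@box R N) /\ @box R N `<=` @disc R.
  by move=> /hE hN; split; [exact: cmeas_box|exact: box_disc].
have PD F G : Phi (fun N => F N + G N) <= Phi F + Phi G.
  rewrite /Phi -big_split/=; apply: ler_sum_seq => N hN; have [h1 h2] := mB N hN.
  exact: qnD.
have Pe F G : F =1 G -> Phi F = Phi G by move=> FG; apply: eq_bigr => N _; rewrite FG.
have q00 N : N \in E -> qn (@box R N) (0 : V) = 0.
  by move=> /mB[h1 h2]; have := qnZ 0 0 h1 h2; rewrite scaler0 normc0 mul0r.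
have P0 : Phi (fun=> 0) = 0 by rewrite /Phi big_seq big1.
pose s j N := S j (testf R N).
have s00 N : s 0%N N = 0 by rewrite /s rank_lt1//; exact: (rS (leq0n k)).
have := telescope_le (fun N => IgV (testf R N)) k PD Pe s00 P0 => T.
apply: le_trans (_ : 48 * Phi (fun N => IgV (testf R N)) <= _).
  rewrite /Phi mulr_sumr; apply: ler_sum_seq => N /hE; exact: bratio_le.
rewrite -mulrA; apply: ler_wpM2l; [exact: ler0n|apply: le_trans T _].
have D1 : Phi (fun N => IgV (testf R N) - s k N) <= (1 + darea R) * (2 ^+ k * x k).
  apply: le_trans (_ : \sum_(N <- E) (1 + darea R) * x k <= _).
    rewrite /Phi; apply: ler_sum_seq => N hN; have [h1 h2] := mB N hN.
    have xk := ltW (x0 (leqnn k)).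
    rewrite -[leRHS]ger0_norm; last by rewrite mulr_ge0 ?addr_ge0 ?(ltW A0).
    rewrite -sqrtr_sqr ler_wsqrtr//; apply: le_trans (en_le _ h1 h2) _.
    have := bS (testf R N) (leqnn k); rewrite hn2_testf// mulr1 => hb.
    rewrite exprMn; apply: le_trans (ler_wpM2l (ltW A0) hb) _.
    by rewrite ler_wpM2r ?sqr_ge0//; nra.
  rewrite big_const_seq count_predT iter_addr addr0 -[_ *+ size E]mulr_natl mulrCA.
  apply: ler_wpM2l; first by rewrite addr_ge0// ltW.
  apply: ler_wpM2r; first exact/ltW/x0.
  by rewrite -natrX ler_nat.
have D2 j : (j < k)%N -> Phi (fun N => s j.+1 N - s j N) <=
    (1 + darea R) * (4 * (2 ^+ j * x j + 2 ^+ j.+1 * x j.+1)).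
  move=> jk; have [us [su ou hu hb]] := step_basis jk.
  have xx : 0 < x j + x j.+1 by rewrite addr_gt0// x0// ltnW.
  (* [trace_le] asks for a seminorm at every index, while boxes are known to be measurable from
     index 2 on; outside E the seminorm is set to 0. *)
  have := @trace_le R [the {linear V -> V} of (S j.+1 \- S j)] us _ (ltW xx) ou hu hb _ _ _ uE on
    (fun N => if N \in E then @qn R (box N) else fun=> 0) (darea R) xx.
  have -> : \sum_(N <- E) (if N \in E then @qn R (box N) else fun=> 0) ((S j.+1 \- S j) (testf R N)) =
      Phi (fun N => s j.+1 N - s j N).
    by rewrite /Phi big_seq [RHS]big_seq; apply: eq_bigr => N ->.
  move=> H; apply: le_trans (H _ _ _ _ _) _.
  - by move=> N f; case: ifP => // _; exact: sqrtr_ge0.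
  - by move=> N; case: ifP => // hN; exact: q00.
  - by move=> N f h; case: ifP => [/mB[]|_]; [exact: qnD|rewrite addr0].
  - by move=> N c f; case: ifP => [/mB[]|_]; [exact: qnZ|rewrite mulr0].
  - move=> f; apply: le_trans (en_boxes f uE hE).
    by apply: ler_sum_seq => N hN; rewrite hN /qn sqr_sqrtr// en_ge0//; exact: box_disc.
  have c1 : 0 <= (x j + x j.+1) * (1 + darea R) by rewrite mulr_ge0 ?addr_ge0 ?ltW// x0// ltnW.
  apply: le_trans (_ : (4 * 2 ^ j)%N%:R * ((x j + x j.+1) * (1 + darea R)) <= _).
    by rewrite ler_wpM2r// ler_nat.
  rewrite natrM natrX exprS.
  have -> : 4 * 2 ^+ j * ((x j + x j.+1) * (1 + darea R)) =
    (1 + darea R) * (4 * (2 ^+ j * x j + 2 ^+ j * x j.+1)) by ring.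
  apply: ler_wpM2l; first by rewrite addr_ge0// ltW.
  apply: ler_wpM2l; first exact: ler0n.
  rewrite lerD2l -mulrA ler_peMl ?ler1n//.
  by apply: mulr_ge0; [exact: exprn_ge0|exact/ltW/x0].
apply: le_trans (_ : (1 + darea R) * (2 ^+ k * x k) + \sum_(j < k)
    (1 + darea R) * (4 * (2 ^+ j * x j + 2 ^+ j.+1 * x j.+1)) <= _).
  by apply: lerD; [exact: D1|apply: ler_sum => -[i hi] _; exact: D2].
rewrite -mulr_sumr -mulrDr [9 * (1 + _)]mulrC -mulrA.
apply: ler_wpM2l; first by rewrite addr_ge0// ltW.
by apply: (sum_sqrt2 (u := fun j => 2 ^+ j * x j)) => j jk; rewrite mulr_ge0 ?exprn_ge0 ?ltW ?x0.
Qed.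

(** The same telescoping in the Hilbert-Schmidt norm, where rank m and norm y give sqrt(m) y; hence
    2^(j/2) in place of 2^j. Overlapping windows are harmless because only the norms |I_g f_N| are
    summed. *)
Lemma hs_lower : \sum_(N <- E) wratio g N <=
  48 ^+ 2 * darea R * (9 * \sum_(j < k.+1) Num.sqrt 2 ^+ j * x j) ^+ 2.
Proof.
have [_ A0] := dareaE R.
pose Q (F : nat -> V) := \sum_(N <- E) hn2 (F N).
have Q0 F : 0 <= Q F by apply: sumr_ge0 => N _; exact: hn2_ge0.
pose Phi F := Num.sqrt (Q F).
have PD F G : Phi (fun N => F N + G N) <= Phi F + Phi G.
  apply: minkowski_opt => // t t0; rewrite /Q !mulr_sumr -big_split/=.
  by apply: ler_sum => N _; exact: hn2_young.
have Pe F G : F =1 G -> Phi F = Phi G.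
  by move=> FG; congr Num.sqrt; apply: eq_bigr => N _; rewrite FG.
have P0 : Phi (fun=> 0) = 0.
  by rewrite /Phi /Q big1 ?sqrtr0// => N _; rewrite /hn2 ip0l.
pose s j N := S j (testf R N).
have s00 N : s 0%N N = 0 by rewrite /s rank_lt1//; exact: (rS (leq0n k)).
have := telescope_le (fun N => IgV (testf R N)) k PD Pe s00 P0 => T.
apply: le_trans (_ : 48 ^+ 2 * darea R * Phi (fun N => IgV (testf R N)) ^+ 2 <= _).
  rewrite sqr_sqrtr// /Q mulr_sumr; apply: ler_sum_seq => N /hE h2.
  by rewrite -mulrA; exact: wratio_le.
apply: ler_wpM2l; first by apply: mulr_ge0; [exact: sqr_ge0|exact: ltW].
apply: lerXn2r; [exact: sqrtr_ge0| |].
  rewrite nnegrE; apply: mulr_ge0; first exact: ler0n.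
  by apply: sumr_ge0 => -[j hj] _; apply: mulr_ge0; [apply: exprn_ge0; exact: sqrtr_ge0|exact/ltW/x0].
apply: le_trans T _.
have s2 j : Num.sqrt 2 ^+ j = Num.sqrt (2 ^+ j) :> R.
  by elim: j => [|j IH]; rewrite ?expr0 ?sqrtr1// !exprS IH sqrtrM.
have sq (m : nat) (y : R) (F : nat -> V) : 0 <= y -> Q F <= m%:R * y ^+ 2 -> Phi F <= Num.sqrt m%:R * y.
  move=> y0 h; rewrite -[y]ger0_norm// -sqrtr_sqr -sqrtrM//; exact: ler_wsqrtr.
have D1 : Phi (fun N => IgV (testf R N) - s k N) <= Num.sqrt 2 ^+ k * x k.
  rewrite s2 -natrX; apply: sq; first exact/ltW/x0.
  apply: le_trans (_ : \sum_(N <- E) x k ^+ 2 <= _).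
    rewrite /Q; apply: ler_sum_seq => N hN.
    by have := bS (testf R N) (leqnn k); rewrite hn2_testf// mulr1.
  rewrite big_const_seq count_predT iter_addr addr0 -[_ *+ size E]mulr_natl.
  by apply: ler_wpM2r; [exact: sqr_ge0|rewrite ler_nat].
have sqrt2_ge1 : 1 <= Num.sqrt 2 :> R by rewrite -{1}[1]sqrtr1 ler_wsqrtr// ler1n.
have D2 j : (j < k)%N -> Phi (fun N => s j.+1 N - s j N) <=
    4 * (Num.sqrt 2 ^+ j * x j + Num.sqrt 2 ^+ j.+1 * x j.+1).
  move=> jk; have [us [su ou hu hb]] := step_basis jk.
  have [xj xj1] := (x0 (ltnW jk), x0 jk).
  have xx : 0 <= x j + x j.+1 by rewrite addr_ge0// ltW.
  have H := @hilbert_schmidt_le R [the {linear V -> V} of (S j.+1 \- S j)] us _ xx ou hu hb _ _ _ uE on.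
  apply: le_trans (_ : Num.sqrt (4 * 2 ^ j)%N%:R * (x j + x j.+1) <= _).
    by apply: sq => //; apply: le_trans H _; rewrite ler_wpM2r ?sqr_ge0// ler_nat.
  rewrite natrM natrX sqrtrM// (_ : 4%:R = 2 ^+ 2 :> R); last by rewrite -natrX; congr _%:R.
  rewrite sqrtr_sqr ger0_norm// -s2 exprS; set t := Num.sqrt 2 ^+ j.
  have t0 : 0 < t by rewrite exprn_gt0// sqrtr_gt0.
  have : t * x j.+1 <= Num.sqrt 2 * t * x j.+1.
    by rewrite -mulrA ler_peMl// mulr_ge0 ?ltW.
  have : 0 <= t * x j by rewrite mulr_ge0 ?ltW.
  have : 0 <= t * x j.+1 by rewrite mulr_ge0 ?ltW.
  rewrite expr1 [Num.sqrt 2 ^+ j.+1]exprS -/t; move: (Num.sqrt 2 * t) => u; lra.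
apply: le_trans (_ : Num.sqrt 2 ^+ k * x k + \sum_(j < k)
    4 * (Num.sqrt 2 ^+ j * x j + Num.sqrt 2 ^+ j.+1 * x j.+1) <= _).
  by apply: lerD; [exact: D1|apply: ler_sum => -[i hi] _; exact: D2].
by apply: (sum_sqrt2 (u := fun j => Num.sqrt 2 ^+ j * x j)) => j jk;
   rewrite mulr_ge0 ?exprn_ge0 ?sqrtr_ge0 ?ltW ?x0.
Qed.

End Approximants.

End Bounded.

End LowerBounds.

(** * The dyadic Carleson embedding *)

Section DyadicTree.
Variable R : realType.
Implicit Types (w a x y : nat -> nat -> R) (d m i l : nat) (K : R).

(* Nodes are pairs (level, position), the children of (m, i) being (m+1, 2i) and
   (m+1, 2i+1). Positions range over all of nat: this unrolls the circle, level
   [m] of the heap being the period [2^m, 2^(m+1)). *)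
Fixpoint tsum w d m i : R :=
  if d is e.+1 then w m i + (tsum w e m.+1 i.*2 + tsum w e m.+1 i.*2.+1) else 0.

Lemma tsum_ge0 w d m i : (forall m i, 0 <= w m i) -> 0 <= tsum w d m i.
Proof. by move=> w0; elim: d m i => //= d IH m i; rewrite !addr_ge0. Qed.

Lemma tsumD w w' d m i :
  tsum (fun m i => w m i + w' m i) d m i = tsum w d m i + tsum w' d m i.
Proof. by elim: d m i => [|d IH] m i /=; rewrite ?addr0// !IH; lra. Qed.

Lemma sum_double (u : nat -> R) n : \sum_(i < n.*2) u i = \sum_(i < n) (u i.*2 + u i.*2.+1).
Proof.
elim: n => [|n IH]; first by rewrite !big_ord0.
by rewrite doubleS !big_ord_recr/= IH addrA.
Qed.

Lemma tsum_levels w d m n :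
  \sum_(i < n) tsum w d m i = \sum_(t < d) \sum_(i < 2 ^ t * n) w (m + t)%N i.
Proof.
elim: d m n => [|d IH] m n; first by rewrite big_ord0 big1.
rewrite /= big_split/= -(sum_double (tsum w d m.+1)) IH big_ord_recl/= expn0 mul1n addn0.
congr (_ + _); apply: eq_bigr => t _.
by rewrite /bump/= add1n addnS addSn expnS -mul2n mulnCA mulnA.
Qed.

Definition carleson w K := forall d m i, 2 ^+ m * tsum w d m i <= K.

(** Midpoint convexity of x^2 / (1 + M); the defect is a square over a positive denominator. *)
Lemma sqr_div_convex (x1 x2 M1 M2 : R) : 0 <= M1 -> 0 <= M2 ->
  ((x1 + x2) / 2) ^+ 2 / (1 + (M1 + M2) / 2) <=
  (x1 ^+ 2 / (1 + M1) + x2 ^+ 2 / (1 + M2)) / 2.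
Proof.
move=> h1 h2; set p := 1 + M1; set q := 1 + M2.
have p0 : 0 < p by rewrite /p; lra.
have q0 : 0 < q by rewrite /q; lra.
have -> : 1 + (M1 + M2) / 2 = (p + q) / 2 by rewrite /p /q; field.
have pq : 0 < p + q by rewrite addr_gt0.
rewrite -subr_ge0.
have -> : (x1 ^+ 2 / p + x2 ^+ 2 / q) / 2 - ((x1 + x2) / 2) ^+ 2 / ((p + q) / 2) =
    (x1 * q - x2 * p) ^+ 2 / (2 * p * q * (p + q)).
  by field; rewrite ?gt_eqF.
by rewrite divr_ge0 ?sqr_ge0// !mulr_ge0// ltW.
Qed.

(* Bellman function of the dyadic Carleson embedding: [B = 4 (y - x^2 / (1 + M))]. *)
Lemma carleson_tree a x y K d m i : 0 < K -> (forall m i, 0 <= a m i) -> carleson a K ->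
  (forall m i, x m i = (x m.+1 i.*2 + x m.+1 i.*2.+1) / 2) ->
  (forall m i, y m i = (y m.+1 i.*2 + y m.+1 i.*2.+1) / 2) ->
  (forall m i, x m i ^+ 2 <= y m i) ->
  2 ^+ m * tsum (fun m i => a m i * x m i ^+ 2) d m i <= 4 * K * y m i.
Proof.
move=> K0 a0 hc hx hy xy; pose M d m i := 2 ^+ m * tsum a d m i / K.
have M0 e n j : 0 <= M e n j.
  by apply: divr_ge0 (ltW K0); apply: mulr_ge0; [exact: exprn_ge0|exact: tsum_ge0].
have M1 e n j : M e n j <= 1 by rewrite ler_pdivrMr// mul1r.
suff H : 2 ^+ m * tsum (fun m i => a m i * x m i ^+ 2) d m i <=
    4 * K * (y m i - x m i ^+ 2 / (1 + M d m i)).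
  apply: le_trans H _; rewrite ler_wpM2l ?mulr_ge0 ?(ltW K0)// gerBl.
  by rewrite divr_ge0 ?sqr_ge0// addr_ge0.
elim: d m i => [|d IH] m i /=.
  rewrite mulr0 mulr_ge0 ?mulr_ge0 ?(ltW K0)//.
  by rewrite /M/= mulr0 mul0r addr0 divr1 subr_ge0.
have Eq : M d.+1 m i = 2 ^+ m * a m i / K + (M d m.+1 i.*2 + M d m.+1 i.*2.+1) / 2.
  by rewrite /M/= !exprS; field; rewrite gt_eqF.
have := IH m.+1 i.*2; have := IH m.+1 i.*2.+1; rewrite Eq.
have := sqr_div_convex (x m.+1 i.*2) (x m.+1 i.*2.+1) (M0 d m.+1 i.*2) (M0 d m.+1 i.*2.+1).
have := M1 d.+1 m i; rewrite Eq -hx (hy m i).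
have := M0 d m.+1 i.*2; have := M0 d m.+1 i.*2.+1; rewrite ![2 ^+ m.+1]exprS.
set N := (_ + _) / 2; have eN : N = (M d m.+1 i.*2 + M d m.+1 i.*2.+1) / 2 by [].
move=> p1 p2; have N0 : 0 <= N by rewrite eN; lra.
clearbody N; clear eN p1 p2.
set b := 2 ^+ m * a m i / K => N1 cvx.
have b0 : 0 <= b by apply: divr_ge0 (ltW K0); apply: mulr_ge0; [exact: exprn_ge0|exact: a0].
have Eb : 2 ^+ m * a m i = b * K by rewrite /b mulfVK// gt_eqF.
(* While M <= 1, the function x^2 / (1 + M) decreases in M at rate at least x^2 / 4. This decrease
   pays for the mass b at the node itself. *)
have key : x m i ^+ 2 / (1 + (b + N)) <= x m i ^+ 2 / (1 + N) - b * x m i ^+ 2 / 4.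
  rewrite -subr_ge0.
  have -> : x m i ^+ 2 / (1 + N) - b * x m i ^+ 2 / 4 - x m i ^+ 2 / (1 + (b + N)) =
     b * x m i ^+ 2 * (4 - (1 + N) * (1 + (b + N))) / (4 * (1 + N) * (1 + (b + N))).
    by field; rewrite !gt_eqF//; lra.
  apply: divr_ge0; last by rewrite !mulr_ge0//; lra.
  apply: mulr_ge0; first by rewrite mulr_ge0 ?sqr_ge0.
  by nra.
move=> h2 h1.
have Em : 2 ^+ m * (a m i * x m i ^+ 2) = K * (b * x m i ^+ 2) by rewrite mulrA Eb; ring.
rewrite mulrDr Em.
move: h1 h2 cvx key; move: (x m i ^+ 2 / _) (x m.+1 i.*2 ^+ 2 / _) (x m.+1 i.*2.+1 ^+ 2 / _).
move: (x m i ^+ 2 / _) (tsum _ d _ i.*2) (tsum _ d _ i.*2.+1) (b * _) => t T1 T2 c r r1 r2.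
move=> h1 h2 cvx key.
have := ler_wpM2l (ltW K0) cvx; have := ler_wpM2l (ltW K0) key.
lra.
Qed.

Lemma carleson_levels a x y K d n : 0 < K -> (forall m i, 0 <= a m i) -> carleson a K ->
  (forall m i, x m i = (x m.+1 i.*2 + x m.+1 i.*2.+1) / 2) ->
  (forall m i, y m i = (y m.+1 i.*2 + y m.+1 i.*2.+1) / 2) ->
  (forall m i, x m i ^+ 2 <= y m i) ->
  \sum_(m < d) \sum_(i < 2 ^ m * n) a m i * x m i ^+ 2 <= 4 * K * \sum_(i < n) y 0%N i.
Proof.
move=> K0 a0 hc hx hy xy.
rewrite -(tsum_levels (fun m i => a m i * x m i ^+ 2) d 0 n) mulr_sumr.
by apply: ler_sum => i _; have := carleson_tree d 0 i K0 a0 hc hx hy xy; rewrite expr0 mul1r.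
Qed.

(** Shifting all positions by one exchanges, in each subtree, one edge for the corresponding edge of
    the neighbouring subtree. The spines are these edges. *)
Fixpoint lspine w d m i : R := if d is e.+1 then w m i + lspine w e m.+1 i.*2 else 0.
Fixpoint rspine w d m i : R := if d is e.+1 then w m i + rspine w e m.+1 i.*2.+1 else 0.

Lemma spine_le w d m i : (forall m i, 0 <= w m i) ->
  [/\ 0 <= lspine w d m i, lspine w d m i <= tsum w d m i,
      0 <= rspine w d m i & rspine w d m i <= tsum w d m i].
Proof.
move=> w0; elim: d m i => [|d IH] m i //=.
have [h1 h2 h3 h4] := IH m.+1 i.*2; have [k1 k2 k3 k4] := IH m.+1 i.*2.+1; have := w0 m i.
by split; lra.
Qed.

Definition shiftl (u : nat -> R) i := if i is j.+1 then u j else 0.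

Lemma tsum_shiftr w d m i :
  tsum (fun m i => w m i.+1) d m i + lspine w d m i = tsum w d m i + lspine w d m i.+1.
Proof.
elim: d m i => [|d IH] m i //=.
by have := IH m.+1 i.*2; have := IH m.+1 i.*2.+1; rewrite doubleS; lra.
Qed.

Lemma tsum_shiftl w d m i :
  tsum (fun m => shiftl (w m)) d m i + rspine w d m i =
  tsum w d m i + shiftl (rspine w d m) i.
Proof.
elim: d m i => [|d IH] m i /=; first by case: i.
have := IH m.+1 i.*2; have := IH m.+1 i.*2.+1; case: i => [|i]/=; lra.
Qed.

Lemma carleson_shiftr w K : (forall m i, 0 <= w m i) -> carleson w K ->
  carleson (fun m i => w m i.+1) (2 * K).
Proof.
move=> w0 hc d m i; have := tsum_shiftr w d m i; have := hc d m i; have := hc d m i.+1.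
have [h1 h2 _ _] := spine_le d m i w0; have [h3 h4 _ _] := spine_le d m i.+1 w0.
move=> k1 k2 E; apply: le_trans (_ : 2 ^+ m * tsum w d m i + 2 ^+ m * tsum w d m i.+1 <= _).
  by rewrite -mulrDr ler_wpM2l ?exprn_ge0//; lra.
lra.
Qed.

Lemma carleson_shiftl w K : (forall m i, 0 <= w m i) -> carleson w K ->
  carleson (fun m => shiftl (w m)) (2 * K).
Proof.
move=> w0 hc d m i; have := tsum_shiftl w d m i; have := hc d m i; have := hc d m i.-1.
have [_ _ h1 h2] := spine_le d m i w0; have [_ _ h3 h4] := spine_le d m i.-1 w0.
have h5 : shiftl (rspine w d m) i <= tsum w d m i.-1.
  by case: (i) h4 => //= _; exact: tsum_ge0.
move=> k1 k2 E; apply: le_trans (_ : 2 ^+ m * tsum w d m i + 2 ^+ m * tsum w d m i.-1 <= _).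
  by rewrite -mulrDr ler_wpM2l ?exprn_ge0//; lra.
lra.
Qed.

(** Moves all masses one level up. After l steps a factor depending on the l-th ancestor has become
    a factor at the node, see [fold_sum]. *)
Definition fold1 w m i : R := w m.+1 i.*2 + w m.+1 i.*2.+1.

Lemma tsum_fold w d m i : tsum (fold1 w) d m i = tsum w d m.+1 i.*2 + tsum w d m.+1 i.*2.+1.
Proof.
elim: d m i => [|d IH] m i /=; first by rewrite addr0.
by rewrite !IH /fold1; lra.
Qed.

Lemma fold_ge0 w l m i : (forall m i, 0 <= w m i) -> 0 <= iter l fold1 w m i.
Proof. by move=> w0; elim: l m i => //= l IH m i; rewrite /fold1 addr_ge0. Qed.

Lemma carleson_fold w K l : (forall m i, 0 <= w m i) -> carleson w K ->
  carleson (iter l fold1 w) K.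
Proof.
move=> w0 hc; elim: l => //= l IH d m i; rewrite tsum_fold.
apply: le_trans (IH d.+1 m i); rewrite ler_wpM2l ?exprn_ge0//= lerDr.
exact: fold_ge0.
Qed.

Lemma fold_sum w (X : nat -> R) l m n :
  \sum_(i < 2 ^ l * n) w (m + l)%N i * X (i %/ 2 ^ l)%N =
  \sum_(i < n) iter l fold1 w m i * X i.
Proof.
elim: l m n X => [|l IH] m n X.
  by rewrite expn0 mul1n; apply: eq_bigr => i _; rewrite addn0 divn1.
have -> : (2 ^ l.+1 * n = 2 ^ l * n.*2)%N by rewrite expnS -mul2n; lia.
rewrite -addSnnS; pose X2 j := X (j %/ 2)%N.
under eq_bigr => i _ do rewrite expnSr divnMA -/(X2 _).
rewrite (IH m.+1 n.*2 X2) (sum_double (fun j => iter l fold1 w m.+1 j * X2 j)).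
apply: eq_bigr => -[i hi] _; have e0 : (i.*2 %/ 2 = i)%N by lia.
have e1 : (i.*2.+1 %/ 2 = i)%N by lia.
by rewrite /X2 /= e0 e1 /fold1; ring.
Qed.

Definition heap_supp w := forall m i, ~~ (2 ^ m <= i < 2 ^ m.+1)%N -> w m i = 0.

Lemma heap_supp_fold w l : heap_supp w -> heap_supp (iter l fold1 w).
Proof.
move=> hw; elim: l => //= l IH m i hi; rewrite /fold1 !IH ?addr0//; rewrite !expnS in hi *.
  by apply: contra hi => /andP[h1 h2]; apply/andP; split; lia.
by apply: contra hi => /andP[h1 h2]; apply/andP; split; lia.
Qed.

Lemma sum_antidiag (b : nat -> nat -> R) d :
  \sum_(m < d) \sum_(l < m.+1) b l (m - l)%N = \sum_(l < d) \sum_(m < d - l) b l m.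
Proof.
elim: d => [|d IH]; first by rewrite !big_ord0.
rewrite big_ord_recr/= IH [RHS]big_ord_recr/= subSnn big_ord1.
have -> : \sum_(i < d) \sum_(m < d.+1 - i) b i m =
    \sum_(i < d) (\sum_(m < d - i) b i m + b i (d - i)%N).
  by apply: eq_bigr => -[i hi] _ /=; rewrite subSn ?(ltnW hi)// big_ord_recr.
by rewrite big_split/= -addrA; congr (_ + _); rewrite big_ord_recr/= subnn.
Qed.

Lemma sum_geo_half n : \sum_(l < n) 2^-1 ^+ l <= 2 :> R.
Proof.
suff -> : \sum_(l < n) 2^-1 ^+ l = 2 - 2 * 2^-1 ^+ n :> R by rewrite gerBl mulr_ge0// exprn_ge0.
elim: n => [|n IH]; first by rewrite big_ord0 expr0; lra.
by rewrite big_ord_recr/= IH exprS; field.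
Qed.

(** Cauchy-Schwarz for weights 2^-l of total mass at most 2, from the nonnegativity of the weighted
    sum of (s_l - c)^2 at c = q / 2. *)
Lemma sqr_sum_geo n (s : nat -> R) :
  (\sum_(l < n) 2^-1 ^+ l * s l) ^+ 2 <= 2 * \sum_(l < n) 2^-1 ^+ l * s l ^+ 2.
Proof.
pose p := \sum_(l < n) 2^-1 ^+ l : R; set q := \sum_(l < n) _ * s l; set t := \sum_(l < n) _.
have H c : 0 <= t - 2 * c * q + c ^+ 2 * p.
  have -> : t - 2 * c * q + c ^+ 2 * p = \sum_(l < n) 2^-1 ^+ l * (s l - c) ^+ 2.
    rewrite /t /q /p !mulr_sumr -sumrB -big_split/=; apply: eq_bigr => l _; ring.
  by apply: sumr_ge0 => l _; rewrite mulr_ge0 ?sqr_ge0 ?exprn_ge0.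
have := H (q / 2); have : p <= 2 := sum_geo_half n.
by nra.
Qed.

Definition nbr_sum x m i : R := x m i.-1 + x m i + x m i.+1.

(** Values at the neighbours are exchanged for shifted weights. The total weight has Carleson
    constant 2 K + K + 2 K, and 60 = 3 * 4 * 5, with 3 from squaring a sum of three terms and 4 from
    [carleson_levels]. *)
Lemma carleson_neighbours w x y K d : 0 < K -> (forall m i, 0 <= w m i) -> heap_supp w ->
  carleson w K ->
  (forall m i, x m i = (x m.+1 i.*2 + x m.+1 i.*2.+1) / 2) ->
  (forall m i, y m i = (y m.+1 i.*2 + y m.+1 i.*2.+1) / 2) ->
  (forall m i, x m i ^+ 2 <= y m i) ->
  \sum_(m < d) \sum_(i < 2 ^ m * 4) w m i * nbr_sum x m i ^+ 2 <= 60 * K * \sum_(i < 4) y 0%N i.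
Proof.
move=> K0 w0 ws hc hx hy xy.
pose a m i := shiftl (w m) i + (w m i + w m i.+1).
have a0 m i : 0 <= a m i by rewrite !addr_ge0//; case: i => //=.
have ca : carleson a (5 * K).
  move=> e m i; rewrite /a tsumD tsumD !mulrDr.
  have := carleson_shiftl w0 hc e m i; have := carleson_shiftr w0 hc e m i; have := hc e m i.
  lra.
have K5 : 0 < 5 * K by rewrite mulr_gt0.
have := carleson_levels d 4 K5 a0 ca hx hy xy => H.
apply: le_trans (_ : 3 * \sum_(m < d) \sum_(i < 2 ^ m * 4) a m i * x m i ^+ 2 <= _); last lra.
rewrite mulr_sumr; apply: ler_sum => -[m hm] _ /=.
have -> : (2 ^ m * 4 = (2 ^ m * 4).-1.+1)%N by rewrite prednK// muln_gt0 expn_gt0.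
(* The last index lies beyond the period carrying w, so shifting the sums produces no boundary
   term. *)
set n := (_.-1); have hn : (2 ^ m.+1 <= n)%N.
  by rewrite /n expnS; have := expn_gt0 2 m; lia.
pose X i := x m i ^+ 2; have X0 i : 0 <= X i by exact: sqr_ge0.
apply: le_trans (_ : 3 * \sum_(i < n.+1) (w m i * X i.-1 + (w m i * X i + w m i * X i.+1)) <= _).
  rewrite mulr_sumr; apply: ler_sum => i _; rewrite -!mulrDr [leRHS]mulrCA; apply: ler_wpM2l => //.
  rewrite /nbr_sum /X; set p := x m i.-1; set q := x m i; set r := x m i.+1.
  by have := sqr_ge0 (p - q); have := sqr_ge0 (q - r); have := sqr_ge0 (p - r); nra.
rewrite ler_wpM2l//.
have -> : \sum_(i < n.+1) a m i * X i = \sum_(i < n.+1) shiftl (w m) i * X i +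
    (\sum_(i < n.+1) w m i * X i + \sum_(i < n.+1) w m i.+1 * X i).
  by rewrite -!big_split/=; apply: eq_bigr => i _; rewrite /a !mulrDl.
rewrite !big_split/= addrCA [leRHS]addrC -[leRHS]addrA lerD2l lerD//.
- rewrite big_ord_recl/= ws ?mul0r ?add0r; last by rewrite leqn0 expn_eq0.
  rewrite [leRHS]big_ord_recr/= lerDl mulr_ge0//.
- rewrite big_ord_recr/= (ws m n) ?mul0r ?addr0; last by rewrite negb_and -!leqNgt hn orbT.
  by rewrite [leRHS]big_ord_recl/= mul0r add0r.
Qed.

(** [sqr_sum_geo] moves the square inside the sum over l. For each l the weights are folded l levels
    up, so that the ancestors become the nodes of [carleson_neighbours]. The constant is 240 = 2 * 2
    * 60. *)
Lemma carleson_ancestors w x y K d : 0 < K -> (forall m i, 0 <= w m i) -> heap_supp w ->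
  carleson w K ->
  (forall m i, x m i = (x m.+1 i.*2 + x m.+1 i.*2.+1) / 2) ->
  (forall m i, y m i = (y m.+1 i.*2 + y m.+1 i.*2.+1) / 2) ->
  (forall m i, x m i ^+ 2 <= y m i) ->
  \sum_(m < d) \sum_(i < 2 ^ m * 4) w m i *
    (\sum_(l < m.+1) 2^-1 ^+ l * nbr_sum x (m - l) (i %/ 2 ^ l)) ^+ 2 <=
  240 * K * \sum_(i < 4) y 0%N i.
Proof.
move=> K0 w0 ws hc hx hy xy.
have y0 : 0 <= \sum_(i < 4) y 0%N i.
  by apply: sumr_ge0 => i _; apply: le_trans (sqr_ge0 _) (xy _ _).
pose b l m := 2^-1 ^+ l * \sum_(i < 2 ^ (m + l) * 4) w (m + l)%N i * nbr_sum x m (i %/ 2 ^ l) ^+ 2.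
apply: le_trans (_ : 2 * \sum_(m < d) \sum_(l < m.+1) b l (m - l)%N <= _).
  rewrite mulr_sumr; apply: ler_sum => m _; rewrite /b.
  have -> : \sum_(l < m.+1) 2^-1 ^+ l *
       \sum_(i < 2 ^ (m - l + l) * 4) w (m - l + l)%N i * nbr_sum x (m - l) (i %/ 2 ^ l) ^+ 2 =
     \sum_(l < m.+1) \sum_(i < 2 ^ m * 4)
       w m i * (2^-1 ^+ l * nbr_sum x (m - l) (i %/ 2 ^ l) ^+ 2).
    apply: eq_bigr => -[l hl] _ /=; rewrite mulr_sumr (subnK (hl : (l <= m)%N)).
    by apply: eq_bigr => i _; rewrite mulrCA.
  rewrite exchange_big/= mulr_sumr; apply: ler_sum => i _; rewrite -mulr_sumr [leRHS]mulrCA.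
  apply: ler_wpM2l => //.
  exact: (sqr_sum_geo m.+1 (fun l => nbr_sum x (m - l) (i %/ 2 ^ l))).
rewrite sum_antidiag.
have bl l e : \sum_(m < e) b l m <= 2^-1 ^+ l * (60 * K * \sum_(i < 4) y 0%N i).
  rewrite -mulr_sumr ler_wpM2l ?exprn_ge0//.
  have := carleson_neighbours e K0 (fun m i => fold_ge0 l m i w0) (@heap_supp_fold w l ws)
    (carleson_fold l w0 hc) hx hy xy; apply: le_trans; apply: ler_sum => m _.
  rewrite -(fold_sum w (fun i => nbr_sum x m i ^+ 2)).
  by have -> : (2 ^ (m + l) * 4 = 2 ^ l * (2 ^ m * 4))%N by rewrite expnD mulnAC mulnC.
apply: le_trans (_ : 2 * \sum_(l < d) 2^-1 ^+ l * (60 * K * \sum_(i < 4) y 0%N i) <= _).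
  by rewrite ler_wpM2l//; apply: ler_sum => l _; exact: bl.
have := sum_geo_half d; rewrite -mulr_suml; set s := \sum_(l < d) _; set Y := \sum_(i < 4) _ in y0 *.
have : 0 <= K * Y by rewrite mulr_ge0// ltW.
by nra.
Qed.

End DyadicTree.

(** * Averages over dyadic arcs and dyadic shells *)

Section DyadicAverages.
Variable R : realType.
Local Notation mu := (@lebesgue_measure R).
Implicit Types (u v : R -> R) (a b c : R) (m n i l N : nat).

Definition rint a b u : R := \int[mu]_(t in `[a, b]) u t.
Local Notation J := rint.

Lemma J_int u a b : continuous u -> mu.-integrable `[a, b] (EFin \o u).
Proof. by move=> cu; apply: cont_integrable => x _; exact: cu. Qed.

Lemma J_cat u a b c : continuous u -> a <= b -> b <= c -> J a c u = J a b u + J b c u.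
Proof. by move=> cu ab bc; apply: Rint_cat => //; exact: J_int. Qed.

Lemma J_ge0 u a b : (forall t, 0 <= u t) -> 0 <= J a b u.
Proof. by move=> u0; apply: Rintegral_ge0 => t _; exact: u0. Qed.

Lemma J_sub u a b c d : continuous u -> (forall t, 0 <= u t) -> c <= a -> a <= b -> b <= d ->
  J a b u <= J c d u.
Proof.
move=> cu u0 ca ab bd; rewrite (J_cat cu ca (le_trans ab bd)) (J_cat cu ab bd).
by have := J_ge0 c a u0; have := J_ge0 b d u0; lra.
Qed.

Lemma J_le u v a b : continuous u -> continuous v -> (forall t, a <= t <= b -> u t <= v t) ->
  J a b u <= J a b v.
Proof. move=> cu cv uv; apply: le_Rintegral => //; try exact: J_int. Qed.

Lemma J_scale u a b c : continuous u -> J a b (fun t => c * u t) = c * J a b u.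
Proof. by move=> cu; rewrite /rint RintegralZl//; exact: J_int. Qed.

(** Integrate u^2 >= 2 q u - q^2, where q is the mean of u. *)
Lemma J_cauchy_schwarz u a b : continuous u -> a < b ->
  J a b u ^+ 2 <= (b - a) * J a b (fun t => u t ^+ 2).
Proof.
move=> cu ab; have L0 : 0 < b - a by rewrite subr_gt0.
have cc c : continuous (fun _ : R => c) by move=> x; exact: cvg_cst.
have cl c : continuous (fun t => c * u t) by move=> x; apply: continuousM; [exact: cc|exact: cu].
have cs : continuous (fun t => u t ^+ 2) by move=> x; apply: continuousM; exact: cu.
pose q := J a b u / (b - a).
have : J a b (fun t => 2 * q * u t - q ^+ 2) <= J a b (fun t => u t ^+ 2).
  apply: J_le => //; first by move=> x; apply: cvgB; [exact: cl|exact: cvg_cst].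
  by move=> t _; have := sqr_ge0 (u t - q); rewrite sqrrB; lra.
rewrite {1}/rint RintegralB//; try by apply: J_int.
rewrite -/(rint a b (fun t => 2 * q * u t)) J_scale// Rintegral_cst//= lebesgue_measure_itv/= lte_fin ab /=.
have -> : J a b u = q * (b - a) by rewrite /q divfK ?gt_eqF.
set S := J a b (fun t => _); nra.
Qed.

Definition dyp m i : R := 2 * pi * i%:R / 2 ^+ m.
Definition davg u m i : R := 2 ^+ m / (2 * pi) * J (dyp m i) (dyp m i.+1) u.

Lemma dypS m i : dyp m i.+1 = dyp m i + 2 * pi / 2 ^+ m.
Proof. by rewrite /dyp -(natr1 i); ring. Qed.

Lemma dyp_lt m i : dyp m i < dyp m i.+1.
Proof. by rewrite dypS ltrDl divr_gt0 ?pi2_gt0// exprn_gt0. Qed.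

Lemma dyp_double m i : dyp m.+1 i.*2 = dyp m i.
Proof. by rewrite /dyp -mul2n natrM exprS; field; rewrite expf_neq0. Qed.

Lemma davg_split u m i : continuous u ->
  davg u m i = (davg u m.+1 i.*2 + davg u m.+1 i.*2.+1) / 2.
Proof.
move=> cu; rewrite /davg -doubleS !dyp_double.
have h1 := ltW (dyp_lt m.+1 i.*2); have h2 := ltW (dyp_lt m.+1 i.*2.+1).
rewrite -doubleS !dyp_double in h1 h2.
rewrite (J_cat cu h1 h2) exprS; have := pi2_gt0 R; move: (2 * pi) (J _ _ u) (J _ _ u) (2 ^+ m) => P p q r P0.
by field; rewrite gt_eqF.
Qed.

Lemma davg_sqr u m i : continuous u -> davg u m i ^+ 2 <= davg (fun t => u t ^+ 2) m i.
Proof.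
move=> cu; have := J_cauchy_schwarz cu (dyp_lt m i); rewrite /davg.
have -> : dyp m i.+1 - dyp m i = 2 * pi / 2 ^+ m by rewrite dypS addrAC subrr add0r.
set I := J _ _ u; set S := J _ _ (fun t => _ ^+ 2); have p0 := pi2_gt0 R => H.
have q0 : 0 < 2 ^+ m :> R by rewrite exprn_gt0.
rewrite exprMn; apply: le_trans (ler_wpM2l (sqr_ge0 _) H) _.
apply: le_of_eq; move: p0 q0.
by move: (2 * pi) (2 ^+ m) => P r P0 r0; field; rewrite !gt_eqF.
Qed.

Lemma davg_ge0 u m i : (forall t, 0 <= u t) -> 0 <= davg u m i.
Proof.
move=> u0; apply: mulr_ge0; last exact: J_ge0.
by apply: divr_ge0; [exact: exprn_ge0|exact/ltW/pi2_gt0].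
Qed.

Lemma davg_sum u m i k : continuous u ->
  \sum_(j < k) davg u m (i + j)%N = 2 ^+ m / (2 * pi) * J (dyp m i) (dyp m (i + k)%N) u.
Proof.
move=> cu; have mono j : dyp m i <= dyp m (i + j)%N.
  elim: j => [|j IH]; first by rewrite addn0.
  by rewrite addnS; apply: le_trans IH (ltW (dyp_lt _ _)).
elim: k => [|k IH]; first by rewrite big_ord0 addn0 /rint set_itv1 Rintegral_set1 mulr0.
rewrite big_ord_recr/= IH /davg addnS (J_cat cu (mono k) (ltW (dyp_lt _ _))).
by rewrite [RHS]mulrDr.
Qed.

Lemma nbr_sum_davg u m i : continuous u -> (0 < i)%N ->
  nbr_sum (davg u) m i = 2 ^+ m / (2 * pi) * J (dyp m i - 2 * pi / 2 ^+ m)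
    (dyp m i.+1 + 2 * pi / 2 ^+ m) u.
Proof.
move=> cu; case: i => // i _; rewrite -dypS (dypS m i) addrK /nbr_sum/=.
have := davg_sum m i 3 cu; rewrite !big_ord_recr big_ord0/= add0r addn0 addn1 addn2 addn3 => ->.
by [].
Qed.

(** On the ring between the intervals l and l + 1 the bound for P is the one attached to l, which is
    4 times the weight of the interval l + 1; hence the factor 4. *)
Lemma shell_sum (F P : R -> R) s0 n (K : R) : continuous F -> continuous P -> 0 <= K ->
  (forall t, 0 <= F t) ->
  (forall t, P t <= K * 2 ^+ n) ->
  (forall l t, pi * 2 ^+ l / 2 ^+ n <= `|t - s0| <= pi -> P t <= K * 2 ^+ n / 4 ^+ l) ->
  J (s0 - pi) (s0 + pi) (fun t => F t * P t) <=
  4 * K * \sum_(l < n.+1) 2 ^+ n / 4 ^+ l *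
     J (s0 - pi * 2 ^+ l / 2 ^+ n) (s0 + pi * 2 ^+ l / 2 ^+ n) F.
Proof.
move=> cF cP K0 F0 h0 hl; pose w l : R := pi * 2 ^+ l / 2 ^+ n.
have p0 := @pi_gt0 R.
have w0 l : 0 <= w l by rewrite divr_ge0 ?mulr_ge0 ?exprn_ge0 ?ltW.
have wS l : w l <= w l.+1.
  rewrite /w exprS ler_pM2r ?invr_gt0// ler_pM2l// ler_peMl ?exprn_ge0//; lra.
have wn l : (l <= n)%N -> w l <= pi.
  move=> ln; rewrite /w ler_pdivrMr// ler_pM2l// ler_weXn2l//; lra.
have cFP : continuous (fun t => F t * P t) by move=> x; apply: continuousM; [exact: cF|exact: cP].
have H l : (l <= n)%N -> J (s0 - w l) (s0 + w l) (fun t => F t * P t) <=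
    4 * K * \sum_(j < l.+1) 2 ^+ n / 4 ^+ j * J (s0 - w j) (s0 + w j) F.
  have side c a b : continuous (fun t => c * F t) -> (forall t, a <= t <= b -> P t <= c) ->
      J a b (fun t => F t * P t) <= c * J a b F.
    move=> cc hc; rewrite -J_scale//; apply: J_le => // t /hc ht.
    by rewrite [leRHS]mulrC ler_wpM2l.
  have cZ c : continuous (fun t => c * F t).
    by move=> x; apply: continuousM; [exact: cvg_cst|exact: cF].
  elim: l => [|l IH] ln.
    rewrite big_ord1 expr0 divr1; apply: le_trans (side (K * 2 ^+ n) _ _ (cZ _) _) _; first by [].
    have := J_ge0 (s0 - w 0%N) (s0 + w 0%N) F0; move: (J _ _ F) => j j0.
    have : 0 <= K * (2 ^+ n * j) by rewrite !mulr_ge0// ltW.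
    by lra.
  have ln' := ltnW ln; have a1 := w0 l; have a2 := wS l; have a3 := wn _ ln.
  have b1 : s0 - w l.+1 <= s0 - w l by lra.
  have b2 : s0 - w l <= s0 + w l by lra.
  have b3 : s0 + w l <= s0 + w l.+1 by lra.
  have b4 := le_trans b2 b3.
  have c1 := side (K * 2 ^+ n / 4 ^+ l) (s0 - w l.+1) (s0 - w l) (cZ _) _.
  have c2 := side (K * 2 ^+ n / 4 ^+ l) (s0 + w l) (s0 + w l.+1) (cZ _) _.
  have {}c1 := c1 _; have {}c2 := c2 _.
  rewrite (J_cat cFP b1 b4) (J_cat cFP b2 b3) big_ord_recr/= mulrDr.
  have d1 : J (s0 - w l.+1) (s0 - w l) (fun t => F t * P t) <=
      K * 2 ^+ n / 4 ^+ l * J (s0 - w l.+1) (s0 - w l) F.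
    apply: c1 => t /andP[t1 t2]; apply: hl; rewrite -/(w l) ler0_norm; last by lra.
    by apply/andP; split; lra.
  have d2 : J (s0 + w l) (s0 + w l.+1) (fun t => F t * P t) <=
      K * 2 ^+ n / 4 ^+ l * J (s0 + w l) (s0 + w l.+1) F.
    apply: c2 => t /andP[t1 t2]; apply: hl; rewrite -/(w l) ger0_norm; last by lra.
    by apply/andP; split; lra.
  have := IH ln'; rewrite (J_cat cF b1 b4) (J_cat cF b2 b3).
  have := J_ge0 (s0 - w l) (s0 + w l) F0.
  move: d1 d2; rewrite exprS; set A := J (s0 - w l.+1) _ F; set B := J (s0 - w l) _ F.
  set D := J (s0 + w l) _ F; move: (J _ _ _) (J _ _ _) (J _ _ _) (\sum_(j < _) _) => X1 X2 X3 S.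
  move=> d1 d2 B0 ih.
  have k0 : 0 <= K * 2 ^+ n / 4 ^+ l by rewrite divr_ge0 ?mulr_ge0 ?exprn_ge0.
  have -> : 4 * K * (2 ^+ n / (4 * 4 ^+ l) * (A + (B + D))) =
      K * 2 ^+ n / 4 ^+ l * (A + (B + D)) by field; rewrite expf_neq0.
  have : 0 <= K * 2 ^+ n / 4 ^+ l * B by rewrite mulr_ge0.
  lra.
have := H n (leqnn n); rewrite {1 2}/w mulfK ?gt_eqF//.
Qed.

End DyadicAverages.

(** * Poisson averages and the Carleson embedding for boxes *)

Section PoissonNeighbours.
Variable R : realType.
Local Notation C := R[i].
Local Notation J := (@rint R).
Implicit Types (r t s : R) (n N l : nat) (f : C -> C).

Lemma sin_ge_half (x : R) : 0 <= x <= 1 -> x / 2 <= sin x.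
Proof.
move=> /andP[x0 x1]; have [->|xn0] := eqVneq x 0; first by rewrite sin0 mul0r.
have xp : 0 < x by rewrite lt_def xn0.
have cs : {within `[0, x], continuous (@sin R)}.
  by apply: continuous_subspaceT => t; exact: continuous_sin.
have [c] := @MVT R sin cos 0 x xp (fun t _ => is_derive_sin t) cs.
rewrite in_itv/= sin0 !subr0 => /andP[c0 cx] ->.
by have := cos_ge_quad c; nra.
Qed.

Lemma circle_chord_ge r t t' : 0 <= r -> `|t - t'| <= pi ->
  r * `|t - t'| / 4 <= normc (circle r t - circle r t').
Proof.
move=> r0 ht.
rewrite -(@ler_pXn2r _ 2)// ?nnegrE ?normc_ge0 ?divr_ge0 ?mulr_ge0//.
rewrite normc2 ReD ImD ReN ImN/=.
have -> : (r * cos t - r * cos t') ^+ 2 + (r * sin t - r * sin t') ^+ 2 =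
    2 * r ^+ 2 * (1 - cos (t - t')).
  rewrite cosB; have := cos2Dsin2 t; have := cos2Dsin2 t'; nra.
have -> : cos (t - t') = cos `|t - t'| by have [_|_] := ger0P (t - t'); rewrite ?cosN.
set x := `|t - t'| in ht *; have x0 : 0 <= x by exact: normr_ge0.
rewrite cos_half; have p4 := @pi_le4 R.
have h1 : x / 4 / 2 <= sin (x / 4) by apply: sin_ge_half; lra.
have h2 := cos_ge_quad (x / 4).
have Es : sin (x / 2) = 2 * (sin (x / 4) * cos (x / 4)).
  by rewrite (_ : x / 2 = (x / 4) *+ 2) ?sin_mulr2n; [ring|field].
have h3 : x / 8 <= sin (x / 2).
  rewrite Es; have : 1 / 2 <= cos (x / 4) by nra.
  by move=> h; have := ler_pM _ _ h1 h; nra.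
have h4 : (x / 8) ^+ 2 <= sin (x / 2) ^+ 2 by rewrite lerXn2r// nnegrE; lra.
have : 0 <= r ^+ 2 by exact: sqr_ge0.
rewrite !exprMn; move: (sin (x / 2) ^+ 2) h4 => q; rewrite !exprMn.
move: (r ^+ 2) (x ^+ 2) => a b h4 a0; have := ler_wpM2l a0 h4; lra.
Qed.

(** The point r e^(i s) is at distance comparable to 2^-n from the circle of radius rho and sees it
    near the angle s0. At angular distance 2^l 2^-n the chord has at least that order, so that the
    kernel is O(2^n 4^-l). *)
Lemma poisson_kernel_bounds (A r s rho s0 t : R) n : 1 <= A ->
  0 <= r -> 2^-1 <= rho -> rho <= 1 ->
  2 ^- n / A <= rho - r <= A * 2 ^- n -> `|s - s0| <= A * 2 ^- n ->
  let P := (rho ^+ 2 - r ^+ 2) / normc (circle rho t - circle r s) ^+ 2 in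
  P <= 288 * A ^+ 5 * 2 ^+ n /\
  forall l, pi * 2 ^+ l / 2 ^+ n <= `|t - s0| <= pi -> P <= 288 * A ^+ 5 * 2 ^+ n / 4 ^+ l.
Proof.
move=> A1 r0 hr1 hr2 /andP[d1 d2] ds P.
have A0 : 0 < A by lra.
set u : R := 2 ^- n in d1 d2 ds; have u0 : 0 < u by rewrite invr_gt0 exprn_gt0.
have Eu : 2 ^+ n = u^-1 by rewrite /u invrK.
pose d := normc (circle rho t - circle r s).
have dA : u <= A * d.
  have : rho - r <= d.
    rewrite /d; have := ler_normcB (circle rho t) (circle r s); rewrite !normc_circle//; lra.
  by move: d1; rewrite ler_pdivrMr// => d1 h; have := ler_wpM2l (ltW A0) h; lra.
have dp : 0 < d by rewrite -(pmulr_rgt0 _ A0); exact: lt_le_trans dA.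
have num : rho ^+ 2 - r ^+ 2 <= 2 * A * u.
  have -> : rho ^+ 2 - r ^+ 2 = (rho - r) * (rho + r) by ring.
  have : 0 <= u / A by rewrite divr_ge0// ltW.
  nra.
(* The constant 288 A^5 is 2 A, from the numerator, times the square of 12 A^2. *)
have main (L : R) : 0 < L -> L * u <= 12 * A ^+ 2 * d -> P <= 288 * A ^+ 5 * u^-1 / L ^+ 2.
  move=> L0 hL; rewrite /P -/d ler_pdivrMr ?exprn_gt0//.
  apply: le_trans num _; have e1 : (L * u) ^+ 2 <= (12 * A ^+ 2 * d) ^+ 2.
    by rewrite lerXn2r// nnegrE ltW ?mulr_gt0 ?exprn_gt0.
  have Lu : 0 < L ^+ 2 * u by rewrite mulr_gt0 ?exprn_gt0.
  have -> : 288 * A ^+ 5 / u / L ^+ 2 * d ^+ 2 = 288 * A ^+ 5 * d ^+ 2 / (L ^+ 2 * u).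
    by field; rewrite !gt_eqF.
  rewrite ler_pdivlMr//.
  have A2 : 0 <= 2 * A by rewrite mulr_ge0// ltW.
  have := ler_wpM2l A2 e1; rewrite !exprMn; lra.
split=> [|l /andP[tl tp]].
  have := main 1 ltr01; rewrite expr1n divr1 mul1r Eu; apply.
  by nra.
have L0 : 0 < 2 ^+ l :> R by rewrite exprn_gt0.
have -> : 4 ^+ l = (2 ^+ l) ^+ 2 :> R by rewrite exprAC; congr (_ ^+ l); rewrite expr2; lra.
rewrite Eu; apply: main => //.
have c1 : rho * `|t - s0| / 4 <= normc (circle rho t - circle rho s0).
  by apply: circle_chord_ge => //; lra.
have c2 : normc (circle rho s0 - circle r s) <= 2 * A * u.
  have -> : circle rho s0 - circle r s = (circle rho s0 - circle r s0) + (circle r s0 - circle r s).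
    by rewrite addrA subrK.
  apply: normcD_le.
  have -> : circle rho s0 - circle r s0 = (rho - r)%:C * circle 1 s0.
    by apply: complex_eq; rewrite ?ReM ?ImM ?ReD ?ReN ?ImD ?ImN/=; ring.
  rewrite normcM normcR normc_circle ?ler01// mulr1 ger0_norm; last first.
    by apply: le_trans d1; rewrite divr_ge0// ltW.
  have := circle_dist r s0 s; rewrite ger0_norm// distrC.
  have : r * `|s - s0| <= `|s - s0|.
    by rewrite ler_piMl//; have : 0 <= u / A by [rewrite divr_ge0// ltW]; lra.
  lra.
have c3 : normc (circle rho t - circle rho s0) <= d + 2 * A * u.
  have -> : circle rho t - circle rho s0 =
      (circle rho t - circle r s) + - (circle rho s0 - circle r s) by rewrite opprB addrA subrK.
  by apply: normcD_le; rewrite normcN; exact: lerD.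
have p3 := @pi_ge2 R.
have tl' : 2 * (2 ^+ l * u) <= `|t - s0|.
  apply: le_trans tl; rewrite -mulrA ler_wpM2r//.
  by rewrite mulr_ge0 ?ltW// invr_gt0 exprn_gt0.
have Lu : 0 < 2 ^+ l * u by rewrite mulr_gt0.
nra.
Qed.

Lemma continuous_circle_norm (f : H2 R) rho : 0 <= rho < 1 ->
  continuous (fun t => normc (f (circle rho t))).
Proof.
move=> /andP[h0 h1] t; have hd : disc (circle rho t) by rewrite /disc/mkset normc_circle.
by have [] := rcont_continuous (rcont_comp (holo_ccont (@H2_holo R f) hd) (circle_rcont rho t)).
Qed.

(** The l-th interval around s0 is contained in the union of the l-th ancestor arc of N and its two
    neighbours. Normalizing to averages turns the weight 2^n 4^-l into 2^-l. *)
Lemma poisson_neighbours (A : R) (f : H2 R) n N r s rho : 1 <= A -> 0 <= r -> 2^-1 <= rho < 1 ->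
  2 ^- n / A <= rho - r <= A * 2 ^- n -> `|s - dyp R n N| <= A * 2 ^- n -> (2 ^ n <= N)%N ->
  normc (f (circle r s)) <= 8 * (288 * A ^+ 5) * \sum_(l < n.+1) 2^-1 ^+ l *
     nbr_sum (davg (fun t => normc (f (circle rho t)))) (n - l) (N %/ 2 ^ l).
Proof.
move=> A1 r0 /andP[h1 h2] hr hs nN; have A0 : 0 < A by lra.
have rho0 : 0 <= rho by lra.
set F := fun t => normc (f (circle rho t)); set s0 := dyp R n N in hs *.
have cF : continuous F by apply: continuous_circle_norm; rewrite rho0.
have rr : r < rho.
  by rewrite -subr_gt0; case/andP: hr => /(lt_le_trans _) + _; apply; rewrite divr_gt0// invr_gt0 exprn_gt0.
have zr : normc (circle r s) < rho by rewrite normc_circle.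
have zz t : circle rho t - circle r s != 0.
  rewrite subr_eq0; apply/eqP => /(congr1 (@normc R)); rewrite !normc_circle// => E.
  by rewrite E ltxx in rr.
pose P t : R := (rho ^+ 2 - r ^+ 2) / normc (circle rho t - circle r s) ^+ 2.
have P0 t : 0 <= P t.
  by rewrite divr_ge0 ?sqr_ge0// subr_ge0 lerXn2r ?nnegrE// ltW.
have cP : continuous P.
  move=> t; apply: cvgM; first exact: cvg_cst.
  have nz : normc (circle rho t - circle r s) != 0 by rewrite gt_eqF// normc_gt0.
  have [_ _ cn] := rcont_continuous (rcontD (circle_rcont rho t) (rcont_cst (- circle r s) t)).
  by apply: cvgV; [rewrite expf_neq0|apply: cvgM; exact: cn].
have := @poisson_formula R f (circle r s) rho (s0 - pi) (@H2_holo R f) zr h2.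
have -> : s0 - pi + 2 * pi = s0 + pi by ring.
rewrite normc_circle// -/(P _) => E.
have rc : rconti (fun t => f (circle rho t) *
    ((rho ^+ 2 - r ^+ 2) / normc (circle rho t - circle r s) ^+ 2)%:C) (s0 - pi) (s0 + pi).
  move=> t _; apply: rcontM.
    apply: rcont_comp (circle_rcont rho t); apply: holo_ccont (@H2_holo R f) _.
    by rewrite /disc/mkset normc_circle.
  apply: continuous_rcont; first exact: cP.
  by apply: cvg_cst.
have p0 := @pi_gt0 R; have p20 := pi2_gt0 R.
have := normc_cint rc; rewrite E normcM normcR gtr0_norm// => H.
have {H} : 2 * pi * normc (f (circle r s)) <= 2 * J (s0 - pi) (s0 + pi) (fun t => F t * P t).
  apply: le_trans H _; rewrite ler_pM2l// /rint; apply: le_Rintegral => //.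
  - by have [] := rconti_integrable rc.
  - by apply: J_int => x; apply: cvgM; [exact: cF|exact: cP].
  - by move=> t _; rewrite normcM normcR ger0_norm//; exact: P0.
have K0 : 0 <= 288 * A ^+ 5 by apply: mulr_ge0 (ler0n _ _) (exprn_ge0 _ (ltW A0)).
have kb t := poisson_kernel_bounds t A1 r0 h1 (ltW h2) hr hs.
have := shell_sum cF cP K0 (fun t => normc_ge0 _) (fun t => (kb t).1) (fun l t => (kb t).2 l).
set S := \sum_(l < _) _ => S1 S2.
have {S1 S2} S3 := le_trans S2 (ler_wpM2l (ler0n _ 2) S1).
rewrite -(ler_pM2l p20); apply: le_trans S3 _.
have -> : 2 * (4 * (288 * A ^+ 5) * S) = 8 * (288 * A ^+ 5) * S by ring.
rewrite [leRHS]mulrCA; apply: ler_wpM2l; first by rewrite mulr_ge0.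
rewrite /S mulr_sumr; apply: ler_sum => -[l ln] _ /=.
have {}ln : (l <= n)%N := ln.
have i0 : (0 < N %/ 2 ^ l)%N.
  by rewrite divn_gt0 ?expn_gt0// (leq_trans _ nN)// leq_exp2l.
rewrite nbr_sum_davg//; set i := (N %/ 2 ^ l)%N.
have En : 2 ^+ n = 2 ^+ (n - l) * 2 ^+ l :> R by rewrite -exprD subnK.
have [q0 q1] : 0 < 2 ^+ (n - l) :> R /\ 0 < 2 ^+ l :> R by rewrite !exprn_gt0.
have Ed j : dyp R (n - l) j = 2 * pi / 2 ^+ n * (j * 2 ^ l)%N%:R.
  rewrite /dyp En natrM natrX; move: q0 q1; move: (2 ^+ (n - l)) (2 ^+ l) => a b a0 b0.
  by field; rewrite !gt_eqF.
have c0 : 0 < 2 * pi / 2 ^+ n :> R by rewrite divr_gt0// exprn_gt0.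
have Es : s0 = 2 * pi / 2 ^+ n * N%:R by rewrite /s0 /dyp mulrAC.
have i1 : dyp R (n - l) i <= s0 by rewrite Ed Es ler_pM2l// ler_nat leq_divM.
have i2 : s0 <= dyp R (n - l) i.+1.
  by rewrite Ed Es ler_pM2l// ler_nat ltnW// ltn_ceil// expn_gt0.
have hw : pi * 2 ^+ l / 2 ^+ n = pi / 2 ^+ (n - l) :> R.
  by rewrite En; move: q0 q1; move: (2 ^+ (n - l)) (2 ^+ l) => a b a0 b0; field; rewrite !gt_eqF.
have hq : 0 < pi / 2 ^+ (n - l) :> R by rewrite divr_gt0.
apply: le_trans (_ : 2 ^+ n / 4 ^+ l * J (dyp R (n - l) i - 2 * pi / 2 ^+ (n - l))
   (dyp R (n - l) i.+1 + 2 * pi / 2 ^+ (n - l)) F <= _).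
  apply: ler_wpM2l; first by rewrite divr_ge0 ?exprn_ge0.
  rewrite hw; have F0 t : 0 <= F t by exact: normc_ge0.
  move: hq i1 i2; rewrite -(mulrA 2 pi); move: (pi / 2 ^+ (n - l)) => q hq i1 i2.
  by apply: (J_sub cF F0); lra.
rewrite En (_ : 4 ^+ l = 2 ^+ l * 2 ^+ l); last by rewrite -exprMn; congr (_ ^+ l); lra.
rewrite exprVn; move: (J _ _ _) q0 q1 p20; move: (2 ^+ (n - l)) (2 ^+ l) (2 * pi) => a b p j a0 b0 p1.
by apply: le_of_eq; field; rewrite !gt_eqF.
Qed.

Definition heapw (al : nat -> R) m i : R := if (2 ^ m <= i < 2 ^ m.+1)%N then al i else 0.

Lemma heap_weight_sum (al X : nat -> R) d :
  \sum_(m < d) \sum_(i < 2 ^ m * 4) heapw al m i * X i = \sum_(1 <= N < 2 ^ d) al N * X N.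
Proof.
elim: d => [|d IH]; first by rewrite big_ord0 big_geq.
rewrite big_ord_recr/= IH (@big_cat_nat _ _ _ (2 ^ d) 1 (2 ^ d.+1)) ?expn_gt0//=; last first.
  by rewrite leq_exp2l.
congr (_ + _); rewrite -(big_mkord xpredT (fun i => heapw al d i * X i)).
have h1 : (2 ^ d <= 2 ^ d.+1)%N by rewrite leq_exp2l.
have h2 : (2 ^ d.+1 <= 2 ^ d * 4)%N by rewrite expnS; lia.
rewrite (@big_cat_nat _ _ _ (2 ^ d) 0)//=; last exact: leq_trans h2.
rewrite (@big_cat_nat _ _ _ (2 ^ d.+1) (2 ^ d) (2 ^ d * 4))//=.
have Z a b : (forall i, (a <= i < b)%N -> heapw al d i * X i = 0) ->
    \sum_(a <= i < b) heapw al d i * X i = 0.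
  by move=> h; rewrite big_nat big1.
rewrite (Z 0%N (2 ^ d)%N) ?add0r; last first.
  by move=> i /andP[_ hi]; rewrite /heapw leqNgt hi mul0r.
rewrite (Z (2 ^ d.+1)%N) ?addr0; last first.
  by move=> i /andP[hi _]; rewrite /heapw [(i < _)%N]ltnNge hi andbF mul0r.
by rewrite big_nat [RHS]big_nat; apply: eq_bigr => i hi; rewrite /heapw hi.
Qed.

(** E N stands for the integral over the box N. It is described only through suprema X of |f|^2 on a
    region near the box, which lets a later application use a weight al N smaller than the mass. *)
Lemma carleson_embedding (A : R) : 2 <= A -> exists2 K : R, 0 < K &
  forall (f : H2 R) (al E : nat -> R) (k : R) d, (forall N, 0 <= al N) -> 0 < k ->
  carleson (heapw al) k ->
  (forall n N X, (2 ^ n <= N < 2 ^ n.+1)%N -> 0 <= X ->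
     (forall r s, 0 <= r -> 2 * 2 ^- n / A <= 1 - r <= A * 2 ^- n ->
        `|s - dyp R n N| <= A * 2 ^- n -> normc (f (circle r s)) ^+ 2 <= X) ->
     E N <= al N * X) ->
  \sum_(1 <= N < 2 ^ d) E N <= K * k * hn2 f.
Proof.
move=> A2; have A0 : 0 < A by lra.
pose c : R := 8 * (288 * A ^+ 5); have c0 : 0 < c.
  by apply: mulr_gt0; [rewrite ltr0n|apply: mulr_gt0; [rewrite ltr0n|exact: exprn_gt0]].
exists (c ^+ 2 * 960); first by apply: mulr_gt0; [exact: exprn_gt0|rewrite ltr0n].
move=> f al E k d al0 k0 hc hE.
(* The averages live on a circle outside all regions of level n < d. The factor 2 in the condition
   on 1 - r leaves rho - r >= 2^-n / A. *)
pose rho : R := 1 - 2 ^- d / A.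
have d1 : 2 ^- d <= 1 :> R by rewrite invf_le1 ?exprn_gt0// exprn_ege1//; lra.
have dA : 0 < 2 ^- d / A by rewrite divr_gt0.
have rho1 : 2^-1 <= rho < 1.
  have : 2 ^- d / A <= 1 / 2 by rewrite ler_pdivrMr//; lra.
  by rewrite /rho; lra.
pose F t := normc (f (circle rho t)).
have cF : continuous F by apply: continuous_circle_norm; lra.
have cF2 : continuous (fun t => F t ^+ 2) by move=> x; apply: cvgM; exact: cF.
have w0 m i : 0 <= heapw al m i by rewrite /heapw; case: ifP.
have ws : heap_supp (heapw al) by move=> m i /negbTE hmi; rewrite /heapw hmi.
have := carleson_ancestors d k0 w0 ws hc (fun m i => davg_split m i cF)
   (fun m i => davg_split m i cF2) (fun m i => davg_sqr m i cF).
pose Sm m i : R := \sum_(l < m.+1) 2^-1 ^+ l * nbr_sum (davg F) (m - l) (i %/ 2 ^ l).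
(* Arcs of level 0 are full turns, so each average is a circle mean of |f|^2, bounded independently
   of rho and d. *)
have hm : \sum_(i < 4) davg (fun t => F t ^+ 2) 0 i <= 4 * hn2 f.
  apply: le_trans (_ : \sum_(i < 4) hn2 f <= _); last first.
    by rewrite sumr_const card_ord mulr_natl.
  apply: ler_sum => i _; have := @mean2_le R f (coef f) rho (2 * pi * i%:R) (hn2 f) (H2_ps f).
  rewrite /davg expr0 div1r ler_pdivrMl ?pi2_gt0// dypS /dyp expr0 !divr1; apply; first lra.
  move=> N; apply: le_trans (norm2_coef_le f N); rewrite /sq_coef /sqnorm.
  by apply: ler_sum => j _; rewrite ler_piMr ?sqr_ge0// exprn_ile1//; lra.
move=> H; have {H} H : \sum_(m < d) \sum_(i < 2 ^ m * 4) heapw al m i * Sm m i ^+ 2 <=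
    960 * k * hn2 f.
  apply: le_trans H _; have k240 : 0 <= 240 * k by apply: mulr_ge0 (ler0n _ _) (ltW k0).
  apply: le_trans (ler_wpM2l k240 hm) _; rewrite mulrACA -natrM; lra.
have -> : \sum_(1 <= N < 2 ^ d) E N = \sum_(1 <= N < 2 ^ d) E N * 1.
  by apply: eq_bigr => N _; rewrite mulr1.
rewrite -heap_weight_sum.
apply: le_trans (_ : c ^+ 2 * \sum_(m < d) \sum_(i < 2 ^ m * 4) heapw al m i * Sm m i ^+ 2 <= _).
  rewrite mulr_sumr; apply: ler_sum => -[m md] _ /=; rewrite mulr_sumr; apply: ler_sum => i _.
  rewrite mulrCA mulr1 /heapw; case: ifP => hi; last by rewrite !mul0r.
  rewrite -exprMn; apply: (hE _ _ _ hi); first exact: sqr_ge0.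
  move=> r s r0 /andP[h1 h2] h3.
  rewrite lerXn2r ?nnegrE ?normc_ge0//.
    apply: mulr_ge0; first exact: ltW.
    apply: sumr_ge0 => l _; apply: mulr_ge0; first exact: exprn_ge0.
    have F0 t : 0 <= F t by exact: normc_ge0.
    by apply: addr_ge0; [apply: addr_ge0|]; exact: davg_ge0.
  apply: poisson_neighbours h3 _ => //; [lra| |by case/andP: hi].
  have : 2 ^- d <= 2 ^- m :> R.
    by rewrite lef_pV2 ?posrE ?exprn_gt0// ler_weXn2l//; [lra|exact: ltnW].
  have Ai : 0 < A^-1 by rewrite invr_gt0.
  rewrite /rho => dm; have := ler_wpM2r (ltW Ai) dm; lra.
apply: le_trans (ler_wpM2l (ltW (exprn_gt0 2 c0)) H) _.
by rewrite -!mulrA.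
Qed.

End PoissonNeighbours.

(** * Upper bounds for singular values *)

Section LocalVanishing.
Variable R : realType.
Local Notation C := R[i].
Local Notation V := (H2 R).
Implicit Types (z w t : C) (n N m i : nat).

Lemma coef_half_bound (F : C -> C) a (X : R) i : is_ps F a ->
  (forall s, normc (F (circle 2^-1 s)) ^+ 2 <= X) -> normc (a i) ^+ 2 <= X * 4 ^+ i.
Proof.
move=> ha hX; have h01 : 0 <= (2^-1 : R) < 1 by rewrite invr_ge0 ler0n invf_lt1 ?ltr0n ?ltr1n.
have := sq_coef_mean2 0 i.+1 ha h01.
have hc (x : R) : {for x, continuous (fun s : R => normc (F (circle 2^-1 s)))}.
  by have [_ _] := rcont_continuous (holo_circ_rcont x (is_ps_holo ha) h01).
have : mean2 F 2^-1 0 <= 2 * pi * X.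
  have -> : 2 * pi * X = \int[lebesgue_measure]_(t in `[0, 0 + 2 * pi : R]) X.
    rewrite Rintegral_cst//= lebesgue_measure_itv/= lte_fin add0r pi2_gt0/= subr0.
    by rewrite mulrC.
  apply: le_Rintegral => //; apply: cont_integrable => x _; last exact: cvg_cst.
  by apply: cvgM; exact: hc.
move=> h1 h2; have := le_trans h2 h1; rewrite ler_pM2l ?pi2_gt0// => H.
have : normc (a i) ^+ 2 * 2^-1 ^+ (i + i) <= X.
  apply: le_trans H; rewrite /sq_coef big_ord_recr/= lerDr; apply: sumr_ge0 => j _.
  by apply: mulr_ge0; [exact: sqr_ge0|exact: exprn_ge0].
rewrite addnn -mul2n exprM (_ : 2^-1 ^+ 2 = 4^-1 :> R); last by rewrite exprVn; congr (_^-1); lra.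
by rewrite exprVn ler_pdivrMr// exprn_gt0.
Qed.

(** The Schwarz lemma by coefficients: |a_i| <= sqrt(X) 2^i and |t| <= 1/8 leave a geometric series
    of ratio 1/4 starting at i = m. The constant 2 majorizes (4/3)^2. *)
Lemma vanish_gain (F : C -> C) a m (X : R) t : is_ps F a -> (forall i, (i < m)%N -> a i = 0) ->
  (forall s, normc (F (circle 2^-1 s)) ^+ 2 <= X) -> normc t <= 8^-1 ->
  normc (F t) ^+ 2 <= 2 * 16^-1 ^+ m * X.
Proof.
move=> ha a0 hX ht; have X0 : 0 <= X := le_trans (sqr_ge0 _) (hX 0).
pose S := Num.sqrt X; have S0 : 0 <= S by exact: sqrtr_ge0.
have aS i : normc (a i) <= S * 2 ^+ i.
  rewrite -(@ler_pXn2r _ 2)// ?nnegrE ?normc_ge0 ?mulr_ge0 ?exprn_ge0// exprMn sqr_sqrtr//.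
  rewrite exprAC (_ : 2 ^+ 2 = 4 :> R); last by rewrite expr2; lra.
  exact: coef_half_bound ha hX.
have q0 i : 0 <= 4^-1 ^+ i :> R by exact: exprn_ge0.
have bd N : normc (psum a t N) <= 4 / 3 * S * 4^-1 ^+ m.
  have [Nm|mN] := ltnP N m.
    rewrite /psum big1 => [|i _]; last by rewrite a0 ?mul0r// (ltn_trans _ Nm).
    by rewrite normc0 !mulr_ge0.
  suff : normc (psum a t N) <= 4 / 3 * S * (4^-1 ^+ m - 4^-1 ^+ N).
    move/le_trans; apply; apply: ler_wpM2l; first by rewrite !mulr_ge0.
    by have := q0 N; lra.
  rewrite -(subnK mN) addnC; elim: (N - m)%N => [|j IH].
    rewrite addn0 subrr mulr0 /psum big1 ?normc0// => i _; by rewrite a0 ?mul0r.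
  rewrite addnS /psum big_ord_recr/= -/(psum a t (m + j)); apply: normcD_le.
  apply: le_trans (lerD IH _) (_ : _ + S * 4^-1 ^+ (m + j) <= _); last first.
    by rewrite exprS; have := q0 m; move: (4^-1 ^+ m) (4^-1 ^+ (m + j)) => p q; lra.
  rewrite normcM normcX.
  have : normc t ^+ (m + j) <= 8^-1 ^+ (m + j) by rewrite lerXn2r// nnegrE ?normc_ge0.
  have -> : S * 4^-1 ^+ (m + j) = S * 2 ^+ (m + j) * 8^-1 ^+ (m + j).
    by rewrite -mulrA -exprMn; congr (_ * _ ^+ _); lra.
  by move=> h; apply: ler_pM => //; [exact: normc_ge0|apply: exprn_ge0; exact: normc_ge0].
have t1 : normc t < 1 by lra.
have H : normc (F t) <= 4 / 3 * S * 4^-1 ^+ m by apply: (clim_norm_le (u := psum a t)) => //; exact: ha.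
have : normc (F t) ^+ 2 <= (4 / 3 * S * 4^-1 ^+ m) ^+ 2.
  by rewrite lerXn2r// nnegrE ?normc_ge0// !mulr_ge0.
move/le_trans; apply; rewrite !exprMn sqr_sqrtr// exprAC.
have -> : 4^-1 ^+ 2 = 16^-1 :> R by rewrite exprVn; congr (_^-1); rewrite expr2; lra.
have : 0 <= X * 16^-1 ^+ m by rewrite mulr_ge0// exprn_ge0.
by rewrite !expr2; lra.
Qed.

Lemma cauchy_schwarz_ip (f k : V) : normc (ip f k) ^+ 2 <= hn2 f * hn2 k.
Proof.
have [k0|k0] := eqVneq (hn2 k) 0.
  by rewrite (hn2_eq0 k0) -(scale0r (0 : V)) ipZr conjc0 mul0r normc0 expr0n/= scale0r mulr_ge0 ?hn2_ge0.
have kp : 0 < hn2 k by rewrite lt_def k0 hn2_ge0.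
pose c : C := ((Num.sqrt (hn2 k))^-1)%:C.
have c2 : normc c ^+ 2 = (hn2 k)^-1.
  by rewrite normcR ger0_norm ?invr_ge0 ?sqrtr_ge0// exprVn sqr_sqrtr ?hn2_ge0.
have := @cauchy_schwarz R f (c *: k); rewrite hn2Z c2 mulVf// => /(_ erefl).
by rewrite ipZr normcM normc_conj exprMn c2 ler_pdivrMl// mulrC.
Qed.

(** Evaluation at z is the pairing with the reproducing kernel, whose coefficients are conj(z)^j. *)
Lemma evaluation_bound (f : V) (r : R) z : r < 1 -> normc z <= r ->
  normc (f z) ^+ 2 <= (1 - r)^-1 * hn2 f.
Proof.
move=> r1 zr; have z1 : normc z < 1 by exact: le_lt_trans r1.
have r0 : 0 <= r by exact: le_trans (normc_ge0 z) zr.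
have nk : forall N, sqnorm (fun j => conjc z ^+ j) N <= (1 - r)^-1.
  move=> N; have rr : 0 < 1 - r by rewrite subr_gt0.
  suff : sqnorm (fun j => conjc z ^+ j) N <= (1 - r ^+ N) / (1 - r).
    move/le_trans; apply; rewrite ler_pdivrMr// mulVf ?gt_eqF//.
    by have := exprn_ge0 N r0; lra.
  rewrite /sqnorm; elim: N => [|N IH]; first by rewrite big_ord0 expr0 subrr mul0r.
  rewrite big_ord_recr/=; apply: le_trans (lerD IH (_ : _ <= r ^+ N)) _.
    rewrite normcX normc_conj -exprM mulnC exprM; apply: lerXn2r; rewrite ?nnegrE ?sqr_ge0//.
    by have := normc_ge0 z; rewrite expr2; nra.
  by rewrite exprS ler_pdivlMr// mulrDl divfK ?gt_eqF//; lra.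
have lk : l2 (fun j => conjc z ^+ j) by exists (1 - r)^-1.
have [k hk] := mkH2_ex lk.
have hkk : hn2 k <= (1 - r)^-1 by apply: hn2_le; rewrite hk.
have -> : f z = ip f k.
  apply: (clim_uniq _ (ipP f k)); have := H2_ps f z1; rewrite /clim.
  move=> H e e0; have [N0 hN] := H e e0; exists N0 => N /hN; rewrite hk /psum.
  by under [in X in _ -> X]eq_bigr => j _ do rewrite conjX conjI.
apply: le_trans (cauchy_schwarz_ip f k) _.
by rewrite mulrC; apply: ler_wpM2r => //; exact: hn2_ge0.
Qed.

Lemma affine_holo (f : C -> C) w (rho : R) : holomorphic_disc f -> 0 < rho -> normc w + rho <= 1 ->
  holomorphic_disc (fun t => f (w + rho%:C * t)).
Proof.
move=> hf r0 hw t; rewrite /disc/mkset => ht.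
have hd : normc (w + rho%:C * t) < 1.
  apply: le_lt_trans (le_normcD _ _) _; rewrite normcM normcR gtr0_norm//.
  by apply: lt_le_trans hw; rewrite ltrD2l gtr_pMr.
have h1 := holo_cderive hf hd.
have h2 : cderive (fun t => w + rho%:C * t) t (0 + (rho%:C * 1 + t * 0)).
  by apply: cderiveD; [exact: cderive_cst|apply: cderiveM; [exact: cderive_cst|exact: cderive_id]].
by have [] := cderive_derivable (cderive_comp h2 h1).
Qed.

Definition local_coef (f : C -> C) w (rho : R) i := coef (fun t => f (w + rho%:C * t)) i.

(** Coefficients at a centre inside the disc are bounded functionals, so that a prescribed order of
    vanishing is orthogonality to finitely many vectors. *)
Lemma local_coef_rep w (rho : R) i : 0 < rho -> normc w + rho <= 1 ->
  exists k : V, forall f : V, local_coef f w rho i = ip f k.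
Proof.
move=> r0 hw; pose aff (f : V) t := f (w + rho%:C * t).
have ps (f : V) : is_ps (aff f) (coef (aff f)) by apply: coefP; exact: affine_holo (@H2_holo _ f) r0 hw.
pose r1 := normc w + rho / 2; have hr1 : r1 < 1 by rewrite /r1; lra.
apply: (riesz (B := 4 ^+ i * (1 - r1)^-1)) => [c f h|f].
  rewrite /local_coef -/(aff _) -/(aff f) -/(aff h).
  have E : is_ps (aff (c *: f + h)) (fun j => c * coef (aff f) j + coef (aff h) j).
    by have := is_psD (is_psZ c (ps f)) (ps h).
  by rewrite (is_ps_uniq (ps _) E).
rewrite -mulrA mulrC; apply: coef_half_bound (ps f) _ => s.
apply: evaluation_bound hr1 _; apply: normcD_le.
by rewrite normcM normcR gtr0_norm// normc_circle// lerD2l.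
Qed.

End LocalVanishing.

(** * Covering a box by small discs *)

Section Mesh.
Variable R : realType.
Local Notation C := R[i].
Implicit Types (z w t : C) (n N a b : nat).

(* The discs of radius [mesh_radius / 8] around these points cover the box. *)
Definition mesh_idx : seq (nat * nat) := [seq (a, b) | a <- iota 0 32, b <- iota 0 512].

(** Mesh points of level n satisfy 1 - |w| >= 2^-n / 2, so discs of this radius around them stay in
    the unit disc. *)
Definition mesh_radius n : R := 2 ^- n / 4.

Definition mesh_pt N (p : nat * nat) : C :=
  circle (1 - 2 ^- lvl N + p.1%:R / 64 * 2 ^- lvl N)
         (2 * pi * (N%:R + p.2%:R / 512) / 2 ^+ lvl N).

Lemma mesh_in p : p \in mesh_idx -> (p.1 < 32)%N /\ (p.2 < 512)%N.
Proof.
move=> /allpairsP[[a b] [h1 h2 ->]]; move: h1 h2; rewrite !mem_iota.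
by move=> /andP[_ h1] /andP[_ h2].
Qed.

Lemma mesh_norm N p : (1 <= lvl N)%N -> p \in mesh_idx ->
  [/\ 2^-1 <= normc (mesh_pt N p), normc (mesh_pt N p) <= 1 - 2 ^- lvl N / 2 &
      normc (mesh_pt N p) = 1 - 2 ^- lvl N + p.1%:R / 64 * 2 ^- lvl N].
Proof.
move=> n1 /mesh_in[p1 _]; set u : R := 2 ^- lvl N.
have u0 : 0 < u by rewrite invr_gt0 exprn_gt0.
have u2 : u <= 2^-1.
  by rewrite /u lef_pV2 ?posrE ?exprn_gt0// -[leLHS]expr1 ler_weXn2l//; lra.
have hp : p.1%:R <= 32 :> R by rewrite ler_nat ltnW.
have q0 : 0 <= p.1%:R / 64 * u by apply: mulr_ge0 (ltW u0); rewrite divr_ge0.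
have q1 : p.1%:R / 64 * u <= 2^-1 * u.
  by rewrite ler_pM2r// ler_pdivrMr//; lra.
rewrite /mesh_pt -/u normc_circle; last by lra.
by split; lra.
Qed.

(** With u = 2^-n, the box has radial depth u / 2, that is 32 steps of u / 64, and 512 angular steps
    of 2 pi u / 512 <= u / 64. Rounding both coordinates costs at most u / 32, an eighth of the mesh
    radius. *)
Lemma mesh_cover N z : (2 <= N)%N -> box N z -> exists2 p, p \in mesh_idx &
  exists2 t, normc t <= 8^-1 & z = mesh_pt N p + (mesh_radius (lvl N))%:C * t.
Proof.
move=> N2 [hz hN]; have hl : lev z = lvl N by rewrite -hN /lvl hidx_lev.
set n := lvl N in hl *; set u : R := 2 ^- n.
have u0 : 0 < u by rewrite invr_gt0 exprn_gt0.
have [_ zE] := turnP z.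
have h1 : 1 - normc z <= u by rewrite -lev_ge// hl.
have h2 : u / 2 < 1 - normc z.
  by rewrite ltNge; have := lev_ge n.+1 hz; rewrite hl ltnn exprS invfM mulrC => <-.
have := eqxx (hidx z); rewrite {1}/hidx hl sidx_eq hN => /andP[t1 t2].
pose x := (normc z - (1 - u)) / u * 64; pose y := (2 ^+ n * turn z - N%:R) * 512.
have x0 : 0 <= x by rewrite /x mulr_ge0//; apply: divr_ge0 (ltW u0); lra.
have x1 : x < 32.
  have : (normc z - (1 - u)) / u < 2^-1 by rewrite ltr_pdivrMr//; lra.
  by rewrite /x; lra.
have y0 : 0 <= y by rewrite /y; apply: mulr_ge0; [lra|exact: ler0n].
have y1 : y < 512 by move: t2; rewrite /y -natr1; lra.
have /andP[a1 a2] := truncn_itv x0; have /andP[b1 b2] := truncn_itv y0.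
set a := Num.truncn x in a1 a2; set b := Num.truncn y in b1 b2.
have ha : (a < 32)%N by rewrite -(ltr_nat R); exact: le_lt_trans x1.
have hb : (b < 512)%N by rewrite -(ltr_nat R); exact: le_lt_trans y1.
exists (a, b); first by apply/allpairsP; exists (a, b); rewrite !mem_iota.
pose rho := mesh_radius n; have rho0 : 0 < rho by rewrite divr_gt0.
exists ((rho^-1)%:C * (z - mesh_pt N (a, b))); last first.
  by rewrite mulrA -rmorphM/= mulfV ?gt_eqF// mul1r addrC subrK.
rewrite normcM normcR gtr0_norm ?invr_gt0// ler_pdivrMl//.
rewrite zE /mesh_pt -/n -/u /=.
set r' := 1 - u + _; set s' := 2 * pi * _ / _; set s := 2 * pi * turn z.
have -> : circle (normc z) s - circle r' s' =
    (circle (normc z) s - circle (normc z) s') + (circle (normc z) s' - circle r' s').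
  by rewrite addrA subrK.
apply: normcD_le.
have -> : circle (normc z) s' - circle r' s' = (normc z - r')%:C * circle 1 s'.
  by apply: complex_eq; rewrite ?ReM ?ImM ?ReD ?ReN ?ImD ?ImN/=; ring.
rewrite [normc (_%:C * _)]normcM normcR normc_circle ?ler01// mulr1.
have dr : `|normc z - r'| <= u / 64.
  have -> : normc z - r' = (x - a%:R) / 64 * u by rewrite /x /r'; field; rewrite gt_eqF.
  rewrite -natr1 in a2; rewrite ger0_norm; last by apply: mulr_ge0 (ltW u0); rewrite divr_ge0//; lra.
  by rewrite mulrC ler_pM2l//; lra.
have ds : `|s - s'| <= u / 64.
  have p4 := @pi_le4 R; have p0 := @pi_gt0 R.
  have -> : s - s' = (y - b%:R) * (2 * pi / 512) * u.
    by rewrite /s /s' /y /u; field; rewrite expf_neq0.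
  rewrite -natr1 in b2; rewrite ger0_norm; last first.
    by apply: mulr_ge0 (ltW u0); apply: mulr_ge0; [lra|apply: divr_ge0; [lra|exact: ler0n]].
  rewrite mulrC ler_pM2l//.
  apply: le_trans (_ : 1 * (2 * pi / 512) <= _); last lra.
  by apply: ler_wpM2r; lra.
have := circle_dist (normc z) s s'; rewrite ger0_norm ?normc_ge0// => cd.
have : normc z * `|s - s'| <= `|s - s'|.
  by rewrite ler_piMl//; exact: ltW.
have -> : rho / 8 = u / 32 by rewrite /rho /mesh_radius -/u; field.
lra.
Qed.

(** The angle of z is taken within pi of s0, where the chord controls it; an angle normalized to one
    period could differ by a full turn. *)
Lemma polar_near w z (s0 : R) : w = circle (normc w) s0 -> z != 0 ->
  exists s, z = circle (normc z) s /\ normc z * `|s - s0| <= 8 * normc (z - w).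
Proof.
move=> wE z0.
have [|t [t0 t1 tE]] := @polar _ (z * circle 1 (pi - s0)).
  by rewrite mulf_neq0//; apply/eqP => /(congr1 (@normc R));
     rewrite normc_circle ?ler01// normc0 => /eqP; rewrite oner_eq0.
have circM (r1 r2 a b : R) : circle r1 a * circle r2 b = circle (r1 * r2) (a + b).
  by apply: complex_eq; rewrite ?ReM ?ImM/= ?cosD ?sinD; ring.
rewrite normcM normc_circle ?ler01// mulr1 in tE.
pose s := t + s0 - pi; have zE : z = circle (normc z) s.
  rewrite -[LHS](mulr1 z) (_ : 1 = circle 1 (pi - s0) * circle 1 (s0 - pi)).
    by rewrite mulrA tE circM mulr1 addrA.
  rewrite circM mulr1 addrA subrK subrr; apply: complex_eq => /=; by rewrite ?cos0 ?sin0; ring.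
exists s; split=> //.
have hs : `|s - s0| <= pi by rewrite /s ler_norml; apply/andP; split; lra.
have := circle_chord_ge (normc_ge0 z) hs; rewrite -zE.
have -> : z - circle (normc z) s0 = (z - w) + (w - circle (normc z) s0) by rewrite addrA subrK.
move=> /le_trans/(_ (le_normcD _ _)).
rewrite {2}wE (_ : circle (normc w) s0 - circle (normc z) s0 = (normc w - normc z)%:C * circle 1 s0).
  rewrite [normc (_%:C * _)]normcM normcR normc_circle ?ler01// mulr1.
  have := ler_normcB w z; have := ler_normcB z w; rewrite (normcB w z) => h1 h2.
  have : `|normc w - normc z| <= normc (z - w) by rewrite ler_norml; apply/andP; split; lra.
  lra.
by apply: complex_eq; rewrite ?ReM ?ImM ?ReD ?ReN ?ImD ?ImN/=; ring.
Qed.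

(** The discs on which f is controlled thus lie in the regions of [carleson_embedding] for A =
    16. *)
Lemma mesh_region N p z : (1 <= lvl N)%N -> p \in mesh_idx ->
  normc (z - mesh_pt N p) <= mesh_radius (lvl N) / 2 ->
  exists r s, [/\ z = circle r s, 0 <= r, 2 * 2 ^- lvl N / 16 <= 1 - r <= 16 * 2 ^- lvl N &
    `|s - dyp R (lvl N) N| <= 16 * 2 ^- lvl N].
Proof.
move=> n1 hp hz; have [w1 w2 w3] := mesh_norm n1 hp; have [p1 p2] := mesh_in hp.
move: hz; set w := mesh_pt N p in w1 w2 w3 *; rewrite /mesh_radius; set u : R := 2 ^- lvl N => hz.
have u0 : 0 < u by rewrite invr_gt0 exprn_gt0.
have u2 : u <= 2^-1.
  by rewrite /u lef_pV2 ?posrE ?exprn_gt0// -[leLHS]expr1 ler_weXn2l//; lra.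
have q0 : 0 <= p.1%:R / 64 * u by apply: mulr_ge0 (ltW u0); rewrite divr_ge0.
have d1 := ler_normcB w z; have d2 := ler_normcB z w; rewrite (normcB w z) in d1.
rewrite -/u in w2 w3.
have nz : 4^-1 <= normc z by lra.
have z0 : z != 0 by apply/eqP => z0; rewrite z0 normc0 in nz; lra.
pose s0 : R := 2 * pi * (N%:R + p.2%:R / 512) / 2 ^+ lvl N.
have wE : w = circle (normc w) s0 by rewrite w3.
have [s [zE hs]] := polar_near wE z0.
exists (normc z), s; split=> //; [exact: normc_ge0|by apply/andP; split; lra|].
have h1 : `|s - s0| <= 4 * u.
  have := ler_wpM2r (normr_ge0 (s - s0)) nz; lra.
have p4 := @pi_le4 R; have p0 := @pi_gt0 R.
have h2 : `|s0 - dyp R (lvl N) N| <= 8 * u.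
  have -> : s0 - dyp R (lvl N) N = p.2%:R / 512 * (2 * pi) * u.
    by rewrite /s0 /dyp /u; field; rewrite expf_neq0.
  have hb : p.2%:R / 512 <= 1 :> R by rewrite ler_pdivrMr ?ltr0n// mul1r ler_nat ltnW.
  have b0 : 0 <= p.2%:R / 512 :> R by apply: divr_ge0; exact: ler0n.
  rewrite ger0_norm; last by apply: mulr_ge0 (ltW u0); rewrite mulr_ge0//; lra.
  rewrite ler_pM2r//; nra.
have := ler_normD (s - s0) (s0 - dyp R (lvl N) N); rewrite addrA subrK; lra.
Qed.

End Mesh.

(** * Vanishing conditions and finite rank approximation *)

Section UpperBound.
Variable R : realType.
Local Notation C := R[i].
Local Notation V := (H2 R).
Implicit Types (z w : C) (n N M m i j k d : nat) (f : V).

Lemma lvl_double N : (0 < N)%N -> lvl N.*2 = (lvl N).+1 /\ lvl N.*2.+1 = (lvl N).+1.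
Proof.
by move=> /lvl_bounds/andP[h1 h2]; split; apply: trunc_log_eq => //; rewrite !expnS in h2 *;
   apply/andP; split; lia.
Qed.

Lemma window_child N z (b : bool) : (0 < N)%N -> window (b + N.*2) z -> window N z.
Proof.
move=> N0; have [l1 l2] := lvl_double N0.
have lb : lvl (b + N.*2) = (lvl N).+1 by case: b.
move=> [hz h1 h2]; rewrite lb in h1 h2; split=> //; first exact: ltnW.
by rewrite (sidx_div _ 1) addn1 h2 expn1; case: b {lb h2}; lia.
Qed.

Lemma tsum_out (w : nat -> nat -> R) d m i : heap_supp w ->
  ~~ (2 ^ m <= i < 2 ^ m.+1)%N -> tsum w d m i = 0.
Proof.
move=> hw; elim: d m i => //= d IH m i hi; rewrite hw// !IH ?addr0//.
  by rewrite !expnS in hi *; apply: contra hi => /andP[h1 h2]; apply/andP; split; lia.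
by rewrite !expnS in hi *; apply: contra hi => /andP[h1 h2]; apply/andP; split; lia.
Qed.

Lemma tsum_le (w w' : nat -> nat -> R) d m i : (forall m i, w m i <= w' m i) ->
  tsum w d m i <= tsum w' d m i.
Proof. by move=> ww; elim: d m i => //= d IH m i; rewrite !lerD. Qed.

Lemma heap_weight_supp (al : nat -> R) : heap_supp (heapw al).
Proof. by move=> m i /negbTE hi; rewrite /heapw hi. Qed.

Lemma heap_child m i (b : bool) : (2 ^ m <= i < 2 ^ m.+1)%N ->
  (2 ^ m.+1 <= b + i.*2 < 2 ^ m.+2)%N.
Proof. by rewrite !expnS => /andP[h1 h2]; case: b; apply/andP; split; lia. Qed.

Lemma carleson_sum (I : Type) (r : seq I) (al : I -> nat -> R) (c t : I -> R) :
  (forall a, 0 <= c a) -> (forall a, carleson (heapw (al a)) (t a)) ->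
  carleson (heapw (fun N => \sum_(a <- r) c a * al a N)) (\sum_(a <- r) c a * t a).
Proof.
move=> c0 ht d m i.
have -> : tsum (heapw (fun N => \sum_(a <- r) c a * al a N)) d m i =
    \sum_(a <- r) c a * tsum (heapw (al a)) d m i.
  elim: d m i => [|d IH] m i /=; first by rewrite big1// => a _; rewrite mulr0.
  rewrite !IH -!big_split/= /heapw; case: ifP => _.
    by rewrite -big_split/=; apply: eq_bigr => a _; rewrite !mulrDr.
  by rewrite add0r; apply: eq_bigr => a _; rewrite add0r !mulrDr.
rewrite mulr_sumr; apply: ler_sum => a _; rewrite mulrCA.
by apply: ler_wpM2l; [exact: c0|exact: ht].
Qed.

Lemma carleson_le (al al' : nat -> R) (t : R) : (forall N, al N <= al' N) ->
  carleson (heapw al') t -> carleson (heapw al) t.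
Proof.
move=> aa ha d m i; apply: le_trans (ha d m i); rewrite ler_wpM2l ?exprn_ge0//.
by apply: tsum_le => p q; rewrite /heapw; case: ifP.
Qed.

Variable g : C -> C.
Hypothesis hg : hardy2 g.
Local Notation Ig := (integration_op g).
Let hgh : holomorphic_disc g := hg.1.
Let gfin : (aint (@disc R) (wgt g) < +oo)%E := aint_wgt_lty hg.

Lemma wmass_split N : (2 <= N)%N -> bmass g N + (wmass g N.*2 + wmass g N.*2.+1) <= wmass g N.
Proof.
move=> N2; have N0 : (0 < N)%N by exact: ltnW.
have [l1 l2] := lvl_double N0.
have [D1 D2] : (2 <= N.*2)%N /\ (2 <= N.*2.+1)%N by split; lia.
rewrite -lee_fin !EFinD -(bmassE hgh gfin N2) -(wmassE hgh gfin D1) -(wmassE hgh gfin D2).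
rewrite -(wmassE hgh gfin N2).
have w1 : window N.*2 `<=` @window R N by move=> z; exact: (@window_child N z false).
have w2 : window N.*2.+1 `<=` @window R N by move=> z; exact: (@window_child N z true).
have wU : window N.*2 `|` window N.*2.+1 `<=` @window R N by move=> z [/w1|/w2].
have [m0 m1 m2 m3] : [/\ cmeas (@box R N), cmeas (@window R N.*2), cmeas (@window R N.*2.+1) &
    cmeas (@window R N)].
  by split; [exact: cmeas_box|exact: cmeas_window|exact: cmeas_window|exact: cmeas_window].
have sub : box N `|` (window N.*2 `|` window N.*2.+1) `<=` @window R N.
  by move=> z [/(box_window N2)|/wU].
have ge0 (S : set C) : S `<=` @window R N -> forall z, S z -> 0 <= wgt g z.
  by move=> SW z /SW[hz _ _]; exact: wgt_ge0.
have mf (S : set C) : S `<=` @window R N -> cmeasf S (wgt g).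
  by move=> SW; apply: cmeasfS (cmeasf_wgt hgh); [exact: cmeas_disc|move=> z /SW[]].
rewrite -aintU//; last 3 first.
- by move=> z [_ _ h1] [_ _ h2]; move: h1 h2; rewrite l1 l2 => -> h; lia.
- exact: ge0.
- exact: mf.
rewrite -aintU//; last 4 first.
- exact: cmeasU.
- move=> z [_ h] [[_ + _]|[_ + _]]; rewrite ?l1 ?l2 -hidx_lev h => H.
    by rewrite /lvl ltnn in H.
  by rewrite /lvl ltnn in H.
- exact: ge0.
- exact: mf.
apply: aint_mono => //; first by apply: cmeasU => //; exact: cmeasU.
  exact: (ge0 _ (@subset_refl _ _)).
exact: (mf _ (@subset_refl _ _)).
Qed.

(** Index 1 belongs to the central disc |z| < 1/2, which lies outside the dyadic family; its mass is
    replaced by 0. *)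
Definition bmass2 N : R := if (2 <= N)%N then bmass g N else 0.

Lemma bmass2_ge0 N : 0 <= bmass2 N.
Proof. by rewrite /bmass2; case: ifP => // _; exact: bmass_ge0. Qed.

Lemma tsum_bmass d m i : (2 <= i)%N -> (2 ^ m <= i < 2 ^ m.+1)%N ->
  tsum (heapw bmass2) d m i <= wmass g i.
Proof.
elim: d m i => [|d IH] m i i2 hi /=; first exact: wmass_ge0.
rewrite {1}/heapw hi /bmass2 i2 -/bmass2.
apply: le_trans (wmass_split i2); rewrite lerD2l; apply: lerD; apply: IH; [lia| |lia|].
  exact: (heap_child false).
exact: (heap_child true).
Qed.

(** A subtree rooted outside B weighs at most its window, which satisfies the bound. A root in B
    weighs nothing itself, and the bounds for its two children add up to the bound for it, by
    induction on the depth. *)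
Lemma carleson_masked (B : seq nat) (t : R) : 0 <= t ->
  (forall N, (2 <= N)%N -> N \notin B -> wratio g N <= t) ->
  carleson (heapw (fun N => if N \in B then 0 else bmass2 N)) t.
Proof.
move=> t0 hB; set al := fun N => _.
elim=> [|d IH] m i; first by rewrite mulr0.
have [hi|hi] := boolP (2 ^ m <= i < 2 ^ m.+1)%N; last first.
  by rewrite tsum_out ?mulr0//; exact: heap_weight_supp.
have [/andP[i2 iB]|no] := boolP ((2 <= i)%N && (i \notin B)).
  have lm : lvl i = m by apply: trunc_log_eq.
  have := hB i i2 iB; rewrite /wratio lm mulrC; apply: le_trans.
  rewrite ler_wpM2l ?exprn_ge0//; apply: le_trans (tsum_bmass d.+1 i2 hi).
  apply: tsum_le => p q; rewrite /heapw; case: ifP => // _; rewrite /al.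
  by case: ifP => // _; exact: bmass2_ge0.
rewrite /= {1}/heapw hi.
have -> : al i = 0.
  rewrite /al; case: ifP => // /negbT iB; rewrite /bmass2; case: ifP => // i2.
  by rewrite i2 iB in no.
have := IH m.+1 i.*2; have := IH m.+1 i.*2.+1; rewrite exprS add0r mulrDr.
by lra.
Qed.

Lemma cmeasf_H2_box f N : cmeasf (box N) (fun z => normc (f z) ^+ 2 * wgt g z).
Proof. by apply: cmeasfS (cmeasf_H2 hgh f); [exact: cmeas_disc|exact: box_disc]. Qed.

Lemma box_int_le f N (X : R) : (2 <= N)%N -> 0 <= X -> (forall z, box N z -> normc (f z) ^+ 2 <= X) ->
  (aint (box N) (fun z => (normc (f z) ^+ 2 * wgt g z)%R) <= (X * bmass g N)%:E)%E.
Proof.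
move=> N2 X0 hX; have mB := @cmeas_box R N N2.
rewrite EFinM -(bmassE hgh gfin N2).
have ge z : box N z -> 0 <= wgt g z by move=> /box_disc; exact: wgt_ge0.
have mw : cmeasf (box N) (wgt g).
  by apply: cmeasfS (cmeasf_wgt hgh); [exact: cmeas_disc|exact: box_disc].
rewrite -(aintZ mB X0 ge mw); apply: (aint_le mB).
- by move=> z hz; apply: mulr_ge0; [exact: sqr_ge0|exact: ge].
- by move=> z hz; apply: ler_wpM2r; [exact: ge|exact: hX].
- exact: cmeasf_H2_box.
- by apply: cmeasfM mw; exact: cmeasf_cst.
Qed.

Lemma box_int_fin f N : (2 <= N)%N ->
  aint (box N) (fun z => normc (f z) ^+ 2 * wgt g z) \is a fin_num.
Proof.
move=> N2; rewrite ge0_fin_numE; last first.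
  by apply: aint_ge0 => z /box_disc hz; rewrite mulr_ge0 ?sqr_ge0 ?wgt_ge0.
have r1 : 1 - 2 ^- (lvl N).+1 < 1 :> R by rewrite gtrBl invr_gt0 exprn_gt0.
apply: le_lt_trans (box_int_le (f := f) (X := (1 - (1 - 2 ^- (lvl N).+1))^-1 * hn2 f) N2 _ _) (ltry _).
  by apply: mulr_ge0; [rewrite invr_ge0 subr_ge0 ltW|exact: hn2_ge0].
move=> z [hz hN]; apply: evaluation_bound r1 _.
have := lev_ge (lvl N).+1 hz; rewrite -hidx_lev hN -/(lvl N) ltnn => /esym/negbT.
by rewrite -ltNge; lra.
Qed.

(** The boxes with N >= 2 exhaust the annulus, and 4 / [darea] is the constant of
    [littlewood_paley_ge]. *)
Lemma norm2_coef_boxes f (X : R) : (forall d, \sum_(1 <= N < 2 ^ d)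
    (if (2 <= N)%N then fine (aint (box N) (fun z => (normc (f z) ^+ 2 * wgt g z)%R)) else 0) <= X) ->
  forall N, sqnorm (coef (Ig f)) N <= 4 / darea R * X.
Proof.
move=> hX n; have [EA A0] := dareaE R.
set F := fun z => normc (f z) ^+ 2 * wgt g z in hX.
pose B i := @box R i.+2.
have mB i : cmeas (B i) by exact: cmeas_box.
have UB : @disc R `&` @annulus R = \bigcup_i B i.
  apply/seteqP; split=> z.
    move=> [hz /(hidx_ge2 hz) h2]; exists (hidx z - 2)%N => //; split=> //.
    by rewrite -addn2 subnK.
  move=> [i _ [hz h]]; split=> //; apply/hidx_ge2 => //; by rewrite h.
have F0 z : disc z -> 0 <= F z by move=> hz; rewrite mulr_ge0 ?sqr_ge0 ?wgt_ge0.
have E : (aint (@disc R `&` @annulus R) F <= X%:E)%E.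
  have plU : pl (\bigcup_i B i) = \bigcup_i pl (B i).
    by apply/seteqP; split=> p [i _ hi]; exists i.
  rewrite /aint UB plU.
  rewrite ge0_integral_bigcup//; first last.
  - move=> i j _ _ [p [[_ h1] [_ h2]]].
    by have := etrans (esym h1) h2 => -[].
  - by move=> p [i _ [hz _]]; rewrite lee_fin; exact: F0.
  - rewrite -plU; apply: cmeasf_EFin; apply: cmeasfS (cmeasf_H2 hgh f); first exact: cmeas_disc.
    by move=> z [i _ []].
  apply: lime_le.
    apply: is_cvg_nneseries => i _ _; apply: integral_ge0 => p [hz _].
    by rewrite lee_fin; exact: F0.
  apply: nearW => k; apply: le_trans (_ : (\sum_(1 <= N < 2 ^ k.+2)
     (if (2 <= N)%N then fine (aint (box N) F) else 0))%:E <= _)%E; last by rewrite lee_fin.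
  rewrite -sumEFin.
  have k2 : (k.+2 <= 2 ^ k.+2)%N by exact/ltnW/ltn_expl.
  rewrite (@big_cat_nat _ _ _ 2 1 (2 ^ k.+2))//=; last exact: leq_trans k2.
  rewrite big_nat1/= add0e (@big_cat_nat _ _ _ k.+2 2 (2 ^ k.+2))//=.
  rewrite -[X in (X <= _)%E]adde0; apply: leeD.
    rewrite !big_add1/= big_nat [leRHS]big_nat.
    apply: lee_sum => i /andP[_ ik]; rewrite fineK//; exact: box_int_fin.
  rewrite big_nat; apply: sume_ge0 => i /andP[hi _]; case: ifP => // i2.
  by rewrite lee_fin; apply: fine_ge0; apply: aint_ge0 => z /box_disc; exact: F0.
have sub : @disc R `&` @annulus R `<=` @disc R by move=> z [].
have := littlewood_paley_ge n (integration_op_ps hgh f) EA A0.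
rewrite (energy_integration_op hgh f sub) => /le_trans/(_ E); rewrite lee_fin.
rewrite coef_integration_op// => H.
apply: le_trans (_ : sqnorm (int_coef (coef (fun z => f z * cderiv g z))) n.+1 <= _).
  by rewrite /sqnorm big_ord_recr/= lerDl sqr_ge0.
rewrite /sqnorm big_ord_recl/= normc0 expr0n/= add0r.
have A4 : 0 < darea R / 4 by rewrite divr_gt0.
rewrite -(ler_pM2l A4); apply: le_trans H _.
have -> : darea R / 4 * (4 / darea R * X) = X; last exact: lexx.
by move: (darea R) A0 => D D0; field; rewrite gt_eqF.
Qed.

(** The mass of a box is allowed to be traded for a smaller weight al N, provided f is
    correspondingly small on the box; this is where vanishing enters. *)
Lemma carleson_energy : exists2 K : R, 0 < K & forall f (al : nat -> R) (t : R),
  (forall N, 0 <= al N) -> 0 < t -> carleson (heapw al) t ->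
  (forall N (X : R), (2 <= N)%N -> 0 <= X ->
     (forall r s, 0 <= r -> 2 * 2 ^- lvl N / 16 <= 1 - r <= 16 * 2 ^- lvl N ->
        `|s - dyp R (lvl N) N| <= 16 * 2 ^- lvl N -> normc (f (circle r s)) ^+ 2 <= X) ->
     forall z, box N z -> normc (f z) ^+ 2 * bmass g N <= al N * X) ->
  forall N, sqnorm (coef (Ig f)) N <= K * t * hn2 f.
Proof.
have [_ A0] := dareaE R.
have A2 : 2 <= 16 :> R by rewrite ler_nat.
have [K K0 hK] := carleson_embedding A2.
exists (4 / darea R * K); first by rewrite mulr_gt0// divr_gt0.
move=> f al t al0 t0 hc hE N.
have -> : 4 / darea R * K * t * hn2 f = 4 / darea R * (K * t * hn2 f) by rewrite !mulrA.
apply: norm2_coef_boxes => d; apply: (hK _ _ _ _ _ al0 t0 hc) => n M X hM X0 hX.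
case: ifP => M2; last exact: mulr_ge0 (al0 M) X0.
have lM : lvl M = n by apply: trunc_log_eq.
rewrite -lM in hX; have H := hE M X M2 X0 hX.
have [b0|b0] := eqVneq (bmass g M) 0.
  apply: le_trans (_ : 0 <= _); last exact: mulr_ge0.
  have r1 : 1 - 2 ^- (lvl M).+1 < 1 :> R by rewrite gtrBl invr_gt0 exprn_gt0.
  rewrite -lee_fin fineK; last exact: box_int_fin.
  have := @box_int_le f M ((1 - (1 - 2 ^- (lvl M).+1))^-1 * hn2 f) M2; rewrite b0 mulr0; apply.
    by apply: mulr_ge0; [rewrite invr_ge0 subr_ge0 ltW|exact: hn2_ge0].
  move=> z [hz hN]; apply: evaluation_bound r1 _.
  have := lev_ge (lvl M).+1 hz; rewrite -hidx_lev hN -/(lvl M) ltnn => /esym/negbT.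
  by rewrite -ltNge; lra.
have bp : 0 < bmass g M by rewrite lt_def b0 bmass_ge0.
rewrite -lee_fin fineK; last exact: box_int_fin.
have := @box_int_le f M (al M * X / bmass g M) M2; rewrite divfK//; apply.
  by apply: divr_ge0 (ltW bp); exact: mulr_ge0.
by move=> z hz; rewrite ler_pdivlMr//; exact: H.
Qed.

Section Lists.
Variables (B : nat -> seq nat) (t : nat -> R) (k : nat).
Hypotheses (sB : forall j, (j <= k)%N -> (size (B j) < 2 ^ j)%N) (t0 : forall j, 0 < t j)
  (hB : forall j, (j <= k)%N -> forall N, (2 <= N)%N -> N \notin B j -> wratio g N <= t j).

(* An arc is listed once for each [B j] containing it; [order N] is its
   multiplicity, and the order of vanishing required on its box. *)
Fixpoint merged n : seq nat := if n is m.+1 then merged m ++ undup (B n) else undup (B 0).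

Definition order N := count_mem N (merged k).

(** The slack 2, due to the strict bounds on the lists, later makes the number of conditions
    strictly less than the rank and shows that there are none for k = 0. *)
Lemma size_merged n : (n <= k)%N -> (size (merged n) + 2 <= 2 ^ n.+1)%N.
Proof.
elim: n => [|n IH] nk /=.
  by rewrite addn2 !ltnS; apply: leq_trans (size_undup _) _; have := sB nk; rewrite expn0 ltnS.
rewrite size_cat; have := IH (ltnW nk); have := leq_ltn_trans (size_undup _) (sB nk).
by rewrite [(2 ^ n.+2)%N]expnS mul2n -addnn => h1 h2; rewrite addnAC leq_add// ltnW.
Qed.

(** Adding a list that contains N multiplies both sides by 1/16. Adding one that does not contain N
    contributes the term 1, which bounds the left side. *)
Lemma order_weight N : 16^-1 ^+ order N <=
  \sum_(j < k.+1) 16^-1 ^+ (k - j) * (if N \in B j then 0 else 1) :> R.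
Proof.
have B0 : N \notin B 0 by have := sB (leq0n k); rewrite expn0 ltnS leqn0 size_eq0 => /eqP ->.
have q0 : (0 : R) <= 16^-1 by rewrite invr_ge0 ler0n.
have q1 : (16^-1 : R) <= 1 by rewrite invf_le1 ?ltr0n// ler1n.
rewrite /order; elim: (k) => [|m IH].
  by rewrite big_ord1 subnn expr0 mul1r (negbTE B0) exprn_ile1.
rewrite /= count_cat [count_mem N (undup _)]count_uniq_mem ?undup_uniq// mem_undup big_ord_recr/= subnn expr0 mul1r.
case: ifP => NB.
  rewrite addn1 exprS addr0; apply: le_trans (ler_wpM2l q0 IH) _.
  rewrite mulr_sumr; apply: ler_sum => -[j hj] _ /=.
  by rewrite (subSn (hj : (j <= m)%N)) exprS mulrA lexx.
rewrite addn0; apply: le_trans (_ : 1 <= _); first by rewrite exprn_ile1.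
rewrite lerDr; apply: sumr_ge0 => j _; apply: mulr_ge0; first exact: exprn_ge0.
by case: ifP.
Qed.

Definition damped N : R := 2 * 16^-1 ^+ order N * bmass2 N.

Definition list_const : R := 2 * \sum_(j < k.+1) 16^-1 ^+ (k - j) * t j.

(** By [order_weight] the damped masses are dominated by a combination of masked ones, and Carleson
    constants combine linearly. *)
Lemma carleson_damped : carleson (heapw damped) list_const.
Proof.
have q0 : (0 : R) <= 16^-1 by rewrite invr_ge0 ler0n.
have h (j : 'I_k.+1) : carleson
    (heapw (fun N => if N \in B j then 0 else bmass2 N)) (t j).
  apply: carleson_masked; first exact/ltW/t0.
  by apply: hB; rewrite -ltnS.
have c0 (j : 'I_k.+1) : 0 <= 2 * 16^-1 ^+ (k - j) :> R by apply: mulr_ge0 (ler0n _ _) (exprn_ge0 _ q0).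
have := carleson_sum (index_enum 'I_k.+1) c0 h.
have -> : \sum_(j : 'I_k.+1) (2 * 16^-1 ^+ (k - j) * t j) = list_const.
  by rewrite /list_const mulr_sumr; apply: eq_bigr => j _; rewrite mulrA.
apply: carleson_le => N; rewrite /damped -mulrA.
have -> : \sum_(a : 'I_k.+1) 2 * 16^-1 ^+ (k - a) * (if N \in B a then 0 else bmass2 N) =
    2 * ((\sum_(j < k.+1) 16^-1 ^+ (k - j) * (if N \in B j then 0 else 1)) * bmass2 N).
  rewrite mulr_suml mulr_sumr; apply: eq_bigr => j _; rewrite -!mulrA.
  by case: ifP => _; rewrite ?mul0r// mul1r.
apply: ler_wpM2l (ler0n _ _) _ _ _; apply: ler_wpM2r; [exact: bmass2_ge0|exact: order_weight].
Qed.

(** The occurrence of N preceded by exactly i others is the entry of the merged list that kills the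
    coefficient of order i. *)
Lemma nth_count (s : seq nat) N i : (i < count_mem N s)%N ->
  exists2 q, (q < size s)%N & nth 0%N s q = N /\ count_mem N (take q s) = i.
Proof.
elim/last_ind: s => // s x IH; rewrite -cats1 count_cat /= addn0.
have [lt_i|ge_i] := ltnP i (count_mem N s).
  move=> _; have [q qs [h1 h2]] := IH lt_i; exists q; first by rewrite size_cat addn1 ltnS ltnW.
  by rewrite nth_cat qs takel_cat// ltnW.
case: eqP => [->|_] h; last by rewrite addn0 ltnNge ge_i in h.
exists (size s); first by rewrite size_cat addn1.
rewrite nth_cat ltnn subnn take_size_cat//; split=> //.
by apply/eqP; rewrite eqn_leq ge_i -ltnS; move: h; rewrite addn1 => ->.
Qed.

Definition rep N p i : V :=
  xget 0 [set v : V | forall f, local_coef f (mesh_pt R N p) (mesh_radius R (lvl N)) i = ip f v].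

Definition constraints : seq V :=
  [seq rep (nth 0%N (merged k) q) p
     (count_mem (nth 0%N (merged k) q) (take q (merged k))) | q <- iota 0 (size (merged k)), p <- mesh_idx].

Lemma mesh_disc N p : (2 <= N)%N -> p \in mesh_idx ->
  0 < mesh_radius R (lvl N) /\ normc (mesh_pt R N p) + mesh_radius R (lvl N) <= 1.
Proof.
move=> N2 hp; have l1 : (1 <= lvl N)%N by rewrite trunc_log_gt0.
have [_ h _] := @mesh_norm R N p l1 hp; rewrite /mesh_radius.
have u0 : 0 < 2 ^- lvl N :> R by rewrite invr_gt0 exprn_gt0.
by split; [rewrite divr_gt0|lra].
Qed.

Lemma constrained_vanish f : (forall v : V, v \in constraints -> ip f v = 0) ->
  forall N p i, (2 <= N)%N -> p \in mesh_idx -> (i < order N)%N ->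
  local_coef f (mesh_pt R N p) (mesh_radius R (lvl N)) i = 0.
Proof.
move=> hf N p i N2 hp hi; have [r0 hr] := mesh_disc N2 hp.
have := @xgetPex _ 0 [set v : V | forall f, local_coef f (mesh_pt R N p) (mesh_radius R (lvl N)) i = ip f v]
  (local_coef_rep i r0 hr); rewrite /mkset -/(rep N p i) => ->; apply: hf.
have [q qs [h1 h2]] := nth_count hi.
by apply/allpairsP; exists (q, p); split; rewrite ?mem_iota//= h1 h2.
Qed.

Lemma constrained_box f : (forall v : V, v \in constraints -> ip f v = 0) ->
  forall N (X : R), (2 <= N)%N -> 0 <= X ->
     (forall r s, 0 <= r -> 2 * 2 ^- lvl N / 16 <= 1 - r <= 16 * 2 ^- lvl N ->
        `|s - dyp R (lvl N) N| <= 16 * 2 ^- lvl N -> normc (f (circle r s)) ^+ 2 <= X) ->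
     forall z, box N z -> normc (f z) ^+ 2 * bmass g N <= damped N * X.
Proof.
move=> hf N X N2 X0 hX z hz; have [p hp [u hu zE]] := mesh_cover N2 hz.
have [r0 hr] := mesh_disc N2 hp; have l1 : (1 <= lvl N)%N by rewrite trunc_log_gt0.
pose F u := f (mesh_pt R N p + (mesh_radius R (lvl N))%:C * u).
have ps : is_ps F (coef F) by apply: coefP; exact: affine_holo (@H2_holo _ f) r0 hr.
have van i : (i < order N)%N -> coef F i = 0 by exact: constrained_vanish.
have FX s : normc (F (circle 2^-1 s)) ^+ 2 <= X.
  rewrite /F; have [|r [s' [-> h1 h2 h3]]] :=
    @mesh_region R N p (mesh_pt R N p + (mesh_radius R (lvl N))%:C * circle 2^-1 s) l1 hp.
    by rewrite addrAC subrr add0r normcM normcR gtr0_norm// normc_circle// invr_ge0 ler0n.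
  exact: hX.
have := vanish_gain ps van FX hu; rewrite /F -zE => H.
rewrite /damped /bmass2 N2 [leRHS]mulrAC; apply: ler_wpM2r => //; exact: bmass_ge0.
Qed.

End Lists.

(** One condition per mesh point and list entry; the factor 2 is there because the merged list may
    have almost 2^(k+1) entries. *)
Definition rank_const : nat := 2 * size mesh_idx.

Lemma opnorm_lists : exists2 K : R, 0 < K &
  forall (B : nat -> seq nat) (t : nat -> R) k,
    (forall j, (j <= k)%N -> (size (B j) < 2 ^ j)%N) -> (forall j, 0 < t j) ->
    (forall j, (j <= k)%N -> forall N, (2 <= N)%N -> N \notin B j -> wratio g N <= t j) ->
  exists ks : seq V, (size ks + rank_const <= rank_const * 2 ^ k)%N /\
    forall f, (forall v : V, v \in ks -> ip f v = 0) ->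
    forall N, sqnorm (coef (Ig f)) N <= K * (\sum_(j < k.+1) 16^-1 ^+ (k - j) * t j) * hn2 f.
Proof.
have [K K0 hK] := carleson_energy.
exists (K * 2); first by rewrite mulr_gt0.
move=> B t k sB t0 hB; exists (constraints B k); split.
  rewrite size_allpairs size_iota /rank_const.
  have := size_merged sB (leqnn k); rewrite expnS [X in (_ -> _ <= X)%N]mulnAC -mulnDl => h.
  by rewrite leq_mul2r h orbT.
move=> f hf N; have := hK f _ _ _ _ (carleson_damped sB t0 hB) (constrained_box hf) N.
rewrite /list_const !mulrA; apply.
  move=> M; apply: mulr_ge0; last exact: bmass2_ge0.
  by apply: mulr_ge0 (ler0n _ _) _; apply: exprn_ge0; rewrite invr_ge0 ler0n.
apply: mulr_gt0; first by rewrite ltr0n.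
rewrite big_ord_recr/= subnn expr0 mul1r; apply: ltr_wpDl => //.
apply: sumr_ge0 => j _; apply: mulr_ge0; last exact/ltW/t0.
by apply: exprn_ge0; rewrite invr_ge0 ler0n.
Qed.

(** With empty lists and k = 0 there are no conditions, so the norm estimate holds on all of H^2. *)
Lemma ig_bounded_of_wratio (t : R) : 0 < t -> (forall N, (2 <= N)%N -> wratio g N <= t) ->
  ig_bounded g.
Proof.
move=> t0 ht; have [K K0 hK] := opnorm_lists.
have [] := hK (fun=> [::]) (fun=> t) 0%N; rewrite ?expn0 ?muln1.
- by move=> j; rewrite leqn0 => /eqP ->.
- by [].
- by move=> j _ N N2 _; exact: ht.
move=> ks [+ H]; rewrite -[X in (_ <= X)%N]add0n leq_add2r leqn0 size_eq0 => /eqP ks0.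
by eexists => f N; apply: (H f) => v; rewrite ks0.
Qed.

Section Compression.
Hypothesis hB : ig_bounded g.
Variable us : seq V.

(** I_g after the projection onto the span of the constraints. Its difference with I_g is I_g after
    the projection onto the orthogonal complement, where all constraints hold. *)
Definition compress f : V := IgV hB (\sum_(l <- iota 0 (size us)) ip f us`_l *: us`_l).

Lemma compress_linear : linear compress.
Proof.
move=> c f h; rewrite /compress -linearP; congr (IgV hB _).
rewrite scaler_sumr -big_split/=; apply: eq_bigr => l _.
by rewrite ipDl ipZl scalerDl scalerA.
Qed.

HB.instance Definition _ := GRing.isLinear.Build C V V _ compress compress_linear.

Lemma rank_compress n : (size us < n)%N -> rank_lt compress n.
Proof.
move=> sn; exists [seq IgV hB u | u <- us]; first by rewrite size_map.
move=> f; exists (fun l => ip f us`_l); rewrite size_map /compress linear_sum.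
have -> : iota 0 (size us) = index_iota 0 (size us) by rewrite /index_iota subn0.
rewrite big_mkord; apply: eq_bigr => -[l hl] _ /=.
by rewrite linearZ/= (nth_map 0).
Qed.

Lemma hn2_IgV : exists2 B : R, 0 <= B & forall f, hn2 (IgV hB f) <= B * hn2 f.
Proof.
have [B h] := hB; exists (Num.max 0 B); first by rewrite le_max lexx.
move=> f; apply: hn2_le => N; rewrite coef_IgV; apply: le_trans (h f N) _.
by apply: ler_wpM2r; [exact: hn2_ge0|rewrite le_max lexx orbT].
Qed.

Lemma compress_approx n (y : R) : orthonormal us -> (size us < n)%N -> 0 <= y ->
  (forall f, (forall l, (l < size us)%N -> ip f us`_l = 0) ->
     forall N, sqnorm (coef (Ig f)) N <= y ^+ 2 * hn2 f) ->
  (singular_value Ig n <= y%:E)%E.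
Proof.
move=> ou sn y0 hy.
have oi i j : i \in iota 0 (size us) -> j \in iota 0 (size us) -> ip us`_i us`_j = (i == j)%:R.
  by rewrite !mem_iota/= !add0n; exact: ou.
pose P f := \sum_(l <- iota 0 (size us)) ip f us`_l *: us`_l.
have hP f : hn2 (P f) <= hn2 f.
  rewrite /P (hn2_comb (iota_uniq _ _) oi); exact: (bessel (iota_uniq _ _) oi).
have hQ f : hn2 (f - P f) <= hn2 f by exact: (hn2_sub_proj (iota_uniq _ _) oi).
have unit_ball f : (h2norm f <= 1)%E -> hn2 f <= 1.
  by move=> /(h2norm_hn2 f ler01); rewrite expr1n.
have bounded : (opnorm (fun f => compress f) < +oo)%E.
  have [B B0 hIg] := hn2_IgV; apply: (@le_lt_trans _ _ (Num.sqrt B)%:E); last exact: ltry.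
  apply: ge_ereal_sup => _ [f /unit_ball f1 <-]; apply/(h2norm_hn2 _ (sqrtr_ge0 B)).
  rewrite sqr_sqrtr//; apply: le_trans (hIg _) _; rewrite -[leRHS]mulr1.
  by apply: ler_wpM2l => //; exact: le_trans (hP f) f1.
apply: ereal_inf_le; exists (opnorm (fun f z => Ig f z - compress f z)%R).
  exists [the {linear V -> V} of compress] => //; split=> //; exact: rank_compress.
apply: ge_ereal_sup => _ [f /unit_ball f1 <-].
have ps : is_ps (fun z => Ig f z - compress f z) (coef (Ig (f - P f))).
  have hp := is_psD (coefP (is_ps_holo (integration_op_ps hgh f))) (is_psZ (-1) (H2_ps (compress f))).
  have : is_ps (fun z => Ig f z - compress f z) (fun m => coef (Ig f) m + -1 * coef (compress f) m).
    by apply: is_ps_ext hp _ => z _; rewrite mulN1r.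
  rewrite (_ : (fun m => _) = coef (Ig (f - P f)))//.
  rewrite /compress -/(P f) -!(coef_IgV hB) linearB/=.
  suff E : coef ((-1) *: IgV hB (P f) + IgV hB f) =
      fun m => coef (IgV hB f) m + -1 * coef (IgV hB (P f)) m.
    by rewrite -E scaleN1r addrC.
  by rewrite coefD coefZ; apply/funext => m; rewrite addrC.
apply: (h2norm_leP ps y0).2 => N; apply: le_trans (hy _ _ _) _.
  move=> l hl; have li : l \in iota 0 (size us) by rewrite mem_iota.
  exact: (ip_sub_proj (iota_uniq _ _) oi).
rewrite -[leRHS]mulr1; apply: ler_wpM2l; first exact: sqr_ge0.
exact: le_trans (hQ f) f1.
Qed.

End Compression.

Lemma singular_value_lists : exists2 K : R, 0 < K &
  forall (B : nat -> seq nat) (t : nat -> R) k,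
    (forall j, (j <= k)%N -> (size (B j) < 2 ^ j)%N) -> (forall j, 0 < t j) ->
    (forall j, (j <= k)%N -> forall N, (2 <= N)%N -> N \notin B j -> wratio g N <= t j) ->
  forall n, (rank_const * 2 ^ k <= n)%N ->
  (singular_value Ig n <= (Num.sqrt (K * \sum_(j < k.+1) 16^-1 ^+ (k - j) * t j))%:E)%E.
Proof.
have [K K0 hK] := opnorm_lists; exists K => // B t k sB t0 hBt n kn.
have bd : ig_bounded g.
  apply: (ig_bounded_of_wratio (t0 0%N)) => N N2; apply: (hBt 0%N) => //.
  by have := sB 0%N isT; rewrite expn0 ltnS leqn0 size_eq0 => /eqP ->.
have [ks [sk hks]] := hK B t k sB t0 hBt; have [us [su ou hu]] := gram_schmidt ks.
apply: (compress_approx bd ou).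
- apply: leq_ltn_trans su _; apply: leq_trans kn; apply: leq_trans sk.
  by rewrite -addn1 leq_add2l.
- exact: sqrtr_ge0.
move=> f hf N; rewrite sqr_sqrtr; last first.
  apply: mulr_ge0; first exact: ltW.
  apply: sumr_ge0 => j _; apply: mulr_ge0; last exact/ltW/t0.
  by apply: exprn_ge0; rewrite invr_ge0 ler0n.
apply: hks => v /hu ->; rewrite ip_sumr big_seq big1// => l; rewrite mem_iota add0n => /andP[_ hl].
by rewrite ipZr hf// mulr0.
Qed.

End UpperBound.

(** * Sequence inequalities and profiles *)

Section GeometricKernels.
Variable R : realType.
Implicit Types (p X Z : nat -> R) (n k j i t d : nat).

Lemma geo_sum_le (q : R) n : 0 <= q < 1 -> \sum_(i < n) q ^+ i <= (1 - q)^-1.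
Proof.
move=> /andP[q0 q1]; have r0 : 0 < 1 - q by rewrite subr_gt0.
suff -> : \sum_(i < n) q ^+ i = (1 - q ^+ n) / (1 - q).
  by rewrite ler_pdivrMr// mulVf ?gt_eqF// gerBl exprn_ge0.
elim: n => [|n IH]; first by rewrite big_ord0 expr0 subrr mul0r.
by rewrite big_ord_recr/= IH exprS; field; rewrite gt_eqF.
Qed.

Lemma geo_sum_rev (q : R) k : \sum_(j < k.+1) q ^+ (k - j) = \sum_(j < k.+1) q ^+ j.
Proof.
rewrite -!(big_mkord xpredT) big_nat_rev/=; rewrite !big_mkord.
by apply: eq_bigr => -[j hj] _ /=; rewrite add0n subSS.
Qed.

Section OneSided.
Variables (kap th D : R) (p : nat -> R).
Hypotheses (kap0 : 0 <= kap) (kap1 : kap <= 1) (th01 : 0 <= th < 1) (D0 : 0 <= D)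
  (p0 : forall k, 0 < p k)
  (hp : forall j k, (j <= k)%N -> kap ^+ (k - j) * p j <= D * th ^+ (k - j) * p k).

(** The hypothesis [hp] says that the kernel decays faster than the profile by a ratio th < 1, which
    leaves a geometric series. *)
Lemma kernel_fwd X (T : R) k : 0 <= T -> (forall j, X j <= T * p j) ->
  \sum_(j < k.+1) kap ^+ (k - j) * X j <= T * D / (1 - th) * p k.
Proof.
move=> T0 hX; apply: le_trans (_ : T * D * p k * \sum_(j < k.+1) th ^+ (k - j) <= _).
  rewrite mulr_sumr; apply: ler_sum => -[j hj] _ /=.
  apply: le_trans (ler_wpM2l (exprn_ge0 _ kap0) (hX j)) _; rewrite mulrCA.
  apply: le_trans (ler_wpM2l T0 (hp (hj : (j <= k)%N))) _.
  by apply: le_of_eq; ring.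
rewrite geo_sum_rev [leRHS]mulrAC; apply: ler_wpM2l; last exact: geo_sum_le.
by rewrite !mulr_ge0// ltW.
Qed.

Lemma kernel_rev (T c : R) L : 0 <= T -> 0 < c -> exists M, exists2 c', 0 < c' & forall X,
  (forall j, 0 <= X j) -> (forall j, X j <= T * p j) ->
  (forall k, (L <= k)%N -> c * p k <= \sum_(j < k.+1) kap ^+ (k - j) * X j) ->
  forall k, c' * p (k + M)%N <= \sum_(i < M.+1) X (k + i)%N.
Proof.
move=> T0 c0; have [t0 t1] := andP th01.
have K0 : 0 <= T * D / (1 - th) by rewrite divr_ge0 ?mulr_ge0// subr_ge0 ltW.
have c2 : 0 < c / 2 by rewrite divr_gt0.
have [M0 hM] := geo_small th01 K0 c2; pose M := maxn M0 L; exists M, (c / 2) => // X X0 hX H k.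
have := H (k + M)%N (leq_trans (leq_maxr _ _) (leq_addl _ _)).
rewrite -addnS big_split_ord/=.
have : \sum_(i < M.+1) kap ^+ (k + M - (k + i)) * X (k + i)%N <= \sum_(i < M.+1) X (k + i)%N.
  by apply: ler_sum => i _; rewrite ler_piMl// exprn_ile1.
have : \sum_(i < k) kap ^+ (k + M - i) * X i <= c / 2 * p (k + M)%N.
  apply: le_trans (_ : T * D * th ^+ M * p (k + M)%N * \sum_(i < k.+1) th ^+ (k - i) <= _).
    rewrite [X in _ <= _ * X]big_ord_recr/= mulrDr; apply: ler_wpDr.
      by rewrite !mulr_ge0 ?exprn_ge0// ltW.
    rewrite mulr_sumr; apply: ler_sum => -[j hj] _ /=.
    apply: le_trans (ler_wpM2l (exprn_ge0 _ kap0) (hX j)) _; rewrite mulrCA.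
    have hj' : (j <= k + M)%N by exact: leq_trans (ltnW hj) (leq_addr _ _).
    apply: le_trans (ler_wpM2l T0 (hp hj')) _.
    have -> : th ^+ (k + M - j) = th ^+ M * th ^+ (k - j).
      by rewrite -exprD; congr (_ ^+ _); rewrite addnC addnBA ?(ltnW hj)// addnC.
    by apply: le_of_eq; ring.
  rewrite geo_sum_rev.
  have p1 := ltW (p0 (k + M)%N); have q0 : 0 <= T * D * th ^+ M * p (k + M)%N.
    by rewrite !mulr_ge0 ?exprn_ge0.
  apply: le_trans (ler_wpM2l q0 (geo_sum_le k.+1 th01)) _.
  have := ler_wpM2r p1 (hM M (leq_maxl _ _)).
  apply: le_trans; apply: le_of_eq; ring.
lra.
Qed.

(** For decreasing X the whole block is dominated by its first term, while p loses at most A^M along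
    it. *)
Lemma kernel_rev_anti (T c : R) L : 0 <= T -> 0 < c ->
  (exists2 A : R, 0 < A & forall k, p k <= A * p k.+1) -> exists2 c', 0 < c' & forall X,
  (forall j, 0 <= X j) ->
  (forall j, X j <= T * p j) -> (forall j k, (j <= k)%N -> X k <= X j) ->
  (forall k, (L <= k)%N -> c * p k <= \sum_(j < k.+1) kap ^+ (k - j) * X j) ->
  forall k, c' * p k <= X k.
Proof.
move=> T0 c0 [A A0 hA]; have [M [c' c'0 hM']] := kernel_rev L T0 c0.
exists (c' / A ^+ M / M.+1%:R); first by rewrite !divr_gt0// exprn_gt0.
have pA k i : p k <= A ^+ i * p (k + i)%N.
  elim: i => [|i IH]; first by rewrite expr0 mul1r addn0.
  apply: le_trans IH _; rewrite exprSr -mulrA addnS; apply: ler_wpM2l => //.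
  by rewrite exprn_ge0// ltW.
move=> X X0 hX aX H k; have hM := hM' X X0 hX H.
rewrite mulrAC ler_pdivrMr// mulrAC ler_pdivrMr ?exprn_gt0//.
apply: le_trans (ler_wpM2l (ltW c'0) (pA k M)) _; rewrite mulrCA mulrC.
apply: ler_wpM2r; first by rewrite exprn_ge0// ltW.
apply: le_trans (hM k) _; apply: le_trans (_ : \sum_(i < M.+1) X k <= _).
  by apply: ler_sum => i _; apply: aX; exact: leq_addr.
by rewrite sumr_const card_ord -[X k *+ _]mulr_natr.
Qed.

(** The variant for powers of half averages, which need not decrease but cannot drop fast. The block
    is compared with its last term, so the conclusion starts at M. *)
Lemma kernel_rev_slow (T c A : R) L : 0 <= T -> 0 < c -> 1 <= A ->
  exists M, exists2 c', 0 < c' & forall X, (forall j, 0 <= X j) ->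
  (forall j, X j <= T * p j) -> (forall j, X j <= A * X j.+1) ->
  (forall k, (L <= k)%N -> c * p k <= \sum_(j < k.+1) kap ^+ (k - j) * X j) ->
  forall k, (M <= k)%N -> c' * p k <= X k.
Proof.
move=> T0 c0 A1; have [M [c' c'0 hM']] := kernel_rev L T0 c0.
have A0 : 0 < A by lra.
exists M, (c' / A ^+ M / M.+1%:R); first by rewrite !divr_gt0// exprn_gt0.
move=> X X0 hX aX H; have hM := hM' X X0 hX H.
have XA k i : X k <= A ^+ i * X (k + i)%N.
  elim: i => [|i IH]; first by rewrite expr0 mul1r addn0.
  apply: le_trans IH _; rewrite exprSr -mulrA addnS; apply: ler_wpM2l => //.
  by rewrite exprn_ge0// ltW.
move=> k Mk; rewrite mulrAC ler_pdivrMr// mulrAC ler_pdivrMr ?exprn_gt0//.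
rewrite -(subnK Mk); move: (k - M)%N => {Mk}k.
apply: le_trans (hM k) _; apply: le_trans (_ : \sum_(i < M.+1) A ^+ M * X (k + M)%N <= _).
  apply: ler_sum => -[i hi] _ /=; apply: le_trans (XA (k + i)%N (M - i)%N) _.
  rewrite -addnA subnKC//; apply: ler_wpM2r; first exact: X0.
  by rewrite ler_weXn2l// leq_subr.
rewrite sumr_const card_ord -[_ *+ M.+1]mulr_natr.
by apply: le_of_eq; ring.
Qed.

End OneSided.

Section Tails.
Variables (rho phi : R) (P : nat -> R).
Hypotheses (rho1 : 1 <= rho) (phi01 : 0 <= phi < 1) (P0 : forall k, 0 < P k)
  (hP : forall k t, rho ^+ t * P (k + t)%N <= phi ^+ t * P k).

Lemma tail_fwd Z (T : R) k d : 0 <= T -> (forall j, Z j <= T * P j) ->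
  \sum_(t < d) rho ^+ t * Z (k + t)%N <= T / (1 - phi) * P k.
Proof.
move=> T0 hZ; have r0 := le_trans ler01 rho1.
apply: le_trans (_ : T * P k * \sum_(t < d) phi ^+ t <= _).
  rewrite mulr_sumr; apply: ler_sum => t _.
  apply: le_trans (ler_wpM2l (exprn_ge0 _ r0) (hZ _)) _; rewrite mulrCA.
  by apply: le_trans (ler_wpM2l T0 (hP _ _)) _; rewrite mulrA [T * _ * _]mulrAC.
rewrite [leRHS]mulrAC; apply: ler_wpM2l; last exact: geo_sum_le.
by rewrite mulr_ge0// ltW.
Qed.

(** The upper bound makes the terms from L on amount to at most half of the left side; the first L
    terms are compared with Z (k + L), since Z at most halves at each step. *)
Lemma tail_rev (T c : R) : 0 <= T -> 0 < c -> (forall j k, (j <= k)%N -> P k <= P j) ->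
  exists L, exists2 c', 0 < c' & forall Z, (forall j, 0 <= Z j) ->
  (forall j, Z j <= T * P j) -> (forall j, Z j <= 2 * Z j.+1) ->
  (forall k, exists d, c * P k <= \sum_(t < d) rho ^+ t * Z (k + t)%N) ->
  forall k, (L <= k)%N -> c' * P k <= Z k.
Proof.
move=> T0 c0 aP; have [f0 f1] := andP phi01.
have K0 : 0 <= T / (1 - phi) by rewrite divr_ge0// subr_ge0 ltW.
have c2 : 0 < c / 2 by rewrite divr_gt0.
have [L0 hL] := geo_small phi01 K0 c2; pose L := L0.+1.
have r0 := le_trans ler01 rho1; have r1 := lt_le_trans ltr01 rho1.
have q0 : 0 < L%:R * (rho ^+ L * 2 ^+ L) by rewrite !mulr_gt0 ?exprn_gt0//; lra.
exists L, (c / 2 / (L%:R * (rho ^+ L * 2 ^+ L))); first by rewrite divr_gt0.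
move=> Z Z0 hZ Z2 H.
have ZZ k i : Z k <= 2 ^+ i * Z (k + i)%N.
  elim: i => [|i IH]; first by rewrite expr0 mul1r addn0.
  by apply: le_trans IH _; rewrite exprSr -mulrA addnS; apply: ler_wpM2l => //; exact: exprn_ge0.
move=> k Lk; rewrite -(subnK Lk); move: (k - L)%N => {Lk}k.
apply: le_trans (ler_wpM2l _ (aP _ _ (leq_addr L k))) _.
  by rewrite divr_ge0 ?ltW.
rewrite mulrAC ler_pdivrMr//; have [d hd] := H k.
have tail : \sum_(t < d) rho ^+ (L + t) * Z (k + (L + t))%N <= c / 2 * P k.
  have := tail_fwd (k + L)%N d T0 hZ => tf.
  apply: le_trans (_ : rho ^+ L * (T / (1 - phi) * P (k + L)%N) <= _).
    apply: le_trans (ler_wpM2l (exprn_ge0 L r0) tf); rewrite mulr_sumr; apply: ler_sum => t _.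
    by rewrite exprD mulrA addnA.
  rewrite mulrCA; apply: le_trans (ler_wpM2l K0 (hP k L)) _.
  by rewrite mulrA; apply: ler_wpM2r; [exact: ltW|apply: hL; exact: leqnSn].
have head : \sum_(t < L) rho ^+ t * Z (k + t)%N <= Z (k + L)%N * (L%:R * (rho ^+ L * 2 ^+ L)).
  apply: le_trans (_ : \sum_(t < L) rho ^+ L * 2 ^+ L * Z (k + L)%N <= _).
    apply: ler_sum => -[t ht] _ /=; rewrite -mulrA; apply: ler_pM => //; first exact: exprn_ge0.
      by rewrite ler_weXn2l// ltnW.
    apply: le_trans (ZZ (k + t)%N (L - t)%N) _; rewrite -addnA subnKC ?(ltnW ht)//.
    by apply: ler_wpM2r => //; rewrite ler_weXn2l ?leq_subr//; lra.
  rewrite sumr_const card_ord -[_ *+ L]mulr_natr.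
  by apply: le_of_eq; ring.
(* d depends on k and may be smaller than L; lengthening the sum makes the cut at L possible. *)
have : \sum_(t < d) rho ^+ t * Z (k + t)%N <= \sum_(t < L + d) rho ^+ t * Z (k + t)%N.
  rewrite addnC big_split_ord/= lerDl; apply: sumr_ge0 => i _; apply: mulr_ge0 => //.
  exact: exprn_ge0.
rewrite big_split_ord/=; lra.
Qed.

End Tails.

End GeometricKernels.

(** * The profile n^(-a) log^(-b)(n + 1) at powers of 2 *)

Section Profile.
Variable R : realType.
Implicit Types (a b : R) (n m k j : nat).

Definition prof a b n : R := 1 / (n%:R `^ a * ln n.+1%:R `^ b).

Lemma ln_pos n : (1 <= n)%N -> 0 < ln n.+1%:R :> R.
Proof. by move=> n1; rewrite ln_gt0// ltr1n. Qed.

Lemma prof_gt0 a b n : (1 <= n)%N -> 0 < prof a b n.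
Proof.
move=> n1; rewrite /prof divr_gt0// mulr_gt0//; first by rewrite powR_gt0// ltr0n.
by rewrite powR_gt0// ln_pos.
Qed.

Lemma lnpow_le b n m : 0 <= b -> (1 <= n)%N -> (n <= m)%N ->
  ln n.+1%:R `^ b <= ln m.+1%:R `^ b :> R.
Proof.
move=> b0 n1 nm; apply: ge0_ler_powR => //; rewrite ?nnegrE; try exact/ltW/ln_pos.
  by apply/ltW/ln_pos; exact: leq_trans nm.
by rewrite ler_ln ?posrE// ler_nat ltnS.
Qed.

Lemma prof_anti a b n m : 0 <= a -> 0 <= b -> (1 <= n)%N -> (n <= m)%N ->
  prof a b m <= prof a b n.
Proof.
move=> a0 b0 n1 nm; have m1 : (1 <= m)%N by exact: leq_trans nm.
rewrite /prof !div1r lef_pV2 ?posrE ?mulr_gt0 ?powR_gt0 ?ltr0n ?ln_pos//.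
apply: ler_pM; rewrite ?powR_ge0//.
  by rewrite ge0_ler_powR// ?nnegrE// ler_nat.
exact: lnpow_le.
Qed.

Lemma prof_powR a b (q : R) n : (1 <= n)%N -> prof a b n `^ q = prof (a * q) (b * q) n.
Proof.
move=> n1; rewrite /prof !div1r.
have h : 0 <= n%:R `^ a * ln n.+1%:R `^ b :> R by rewrite mulr_ge0 ?powR_ge0.
rewrite -(powR_inv1 h) -powRrM mulN1r powRN; congr (_^-1).
by rewrite powRM ?powR_ge0// -!powRrM.
Qed.

Lemma prof_sqr a b n : (1 <= n)%N -> prof a b n ^+ 2 = prof (2 * a) (2 * b) n.
Proof.
by move=> n1; rewrite -powR_mulrn ?(ltW (prof_gt0 _ _ n1))// prof_powR// mulrC [2 * b]mulrC.
Qed.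

Lemma powR_exp2 a k : (2 ^ k)%N%:R `^ a = (2 `^ a) ^+ k :> R.
Proof.
rewrite natrX -(powR_mulrn k (ler0n R 2)) -(powR_mulrn k (powR_ge0 2 a)).
exact: powRAC.
Qed.

Lemma prof_dyadic_decay a b k j : 0 <= b ->
  prof a b (2 ^ (k + j)) <= (2 `^ (- a)) ^+ j * prof a b (2 ^ k).
Proof.
move=> b0; have e1 m : (1 <= 2 ^ m)%N by rewrite expn_gt0.
rewrite /prof !div1r powR_exp2 powRN exprVn -invfM.
rewrite lef_pV2 ?posrE ?mulr_gt0 ?exprn_gt0 ?powR_gt0 ?ln_pos ?ltr0n//.
rewrite powR_exp2 mulrA -exprD addnC ler_wpM2l ?exprn_ge0 ?powR_ge0//.
by apply: lnpow_le => //; rewrite leq_exp2l// leq_addr.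
Qed.

(** The logarithms are compared with (k + 1) ln 2 and (j + 1) ln 2, and k + 1 <= (k - j + 1) (j +
    1). *)
Lemma log_ratio j k : (j <= k)%N ->
  ln (2 ^ k).+1%:R <= 2 * (k - j).+1%:R * ln (2 ^ j).+1%:R :> R.
Proof.
move=> jk; have l2 : 0 < ln 2 :> R by rewrite ln_gt0// ltr1n.
have h1 : ln (2 ^ k).+1%:R <= k.+1%:R * ln 2 :> R.
  rewrite -[k.+1%:R * _]mulrC mulr_natr -lnXn// ler_ln ?posrE ?exprn_gt0// -natrX ler_nat expnS.
  by have := expn_gt0 2 k; lia.
have h2 : j.+1%:R * ln 2 <= 2 * ln (2 ^ j).+1%:R :> R.
  rewrite -[j.+1%:R * _]mulrC mulr_natr mulr_natl -!lnXn// ler_ln ?posrE ?exprn_gt0//.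
  by rewrite -!natrX ler_nat !expnS expn0 muln1; have := expn_gt0 2 j; nia.
have h3 : k.+1%:R <= (k - j).+1%:R * j.+1%:R :> R.
  by rewrite -natrM ler_nat; nia.
apply: le_trans h1 _; apply: le_trans (ler_wpM2r (ltW l2) h3) _.
rewrite -[leLHS]mulrA [2 * _]mulrC -[leRHS]mulrA; exact: ler_wpM2l.
Qed.

Lemma poly_le_exp b (e : R) : 0 <= b -> 0 < e -> exists2 D : R, 0 < D &
  forall i, (2 * i.+1%:R) `^ b <= D * (2 `^ e) ^+ i.
Proof.
move=> b0 e0; have l2 : 0 < ln 2 :> R by rewrite ln_gt0// ltr1n.
(* The inequality ln y < y is applied at y = d x with x = 2 (i + 1). This d makes 2 b d at most e ln
   2, so the exponential absorbs the linear term. *)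
pose d := e * ln 2 / (2 * b + 1); have d0 : 0 < d by rewrite divr_gt0 ?mulr_gt0//; lra.
exists (expR (e * ln 2 - b * ln d)); first exact: expR_gt0.
move=> i; have x0 : 0 < 2 * i.+1%:R :> R by rewrite mulr_gt0.
rewrite /powR gt_eqF// gt_eqF// -expRM_natr -expRD ler_expR.
have := ln_sublinear (mulr_gt0 d0 x0); rewrite [ln (d * _)]lnM ?posrE// => h.
have hb : 2 * b * d <= e * ln 2.
  by rewrite /d mulrA ler_pdivrMr; [have := mulr_gt0 e0 l2; nra|lra].
have := ler_wpM2l b0 (ltW h); rewrite mulrDr => h'.
have : b * (d * (2 * i.+1%:R)) <= e * ln 2 * i.+1%:R.
  have -> : b * (d * (2 * i.+1%:R)) = 2 * b * d * i.+1%:R by ring.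
  exact: ler_wpM2r.
by rewrite -natr1; lra.
Qed.

(** The logarithm costs a power of k - j + 1, which is absorbed by the gap between a and a'. *)
Lemma prof_dyadic_growth a b a' : 0 <= b -> a < a' -> exists2 D : R, 0 < D &
  forall j k, (j <= k)%N -> prof a b (2 ^ j) <= D * (2 `^ a') ^+ (k - j) * prof a b (2 ^ k).
Proof.
move=> b0 aa; have e0 : 0 < a' - a by rewrite subr_gt0.
have [D D0 hD] := poly_le_exp b0 e0; exists D => // j k jk.
have e1 m : (1 <= 2 ^ m)%N by rewrite expn_gt0.
have pl m : 0 < ln (2 ^ m).+1%:R `^ b :> R by rewrite powR_gt0// ln_pos.
rewrite /prof !div1r !powR_exp2 ler_pdivlMr ?mulr_gt0// ler_pdivrMl ?mulr_gt0//.
have -> : 2 `^ a' = 2 `^ (a' - a) * 2 `^ a :> R by rewrite -powRD ?subrK// ?pnatr_eq0 ?implybT.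
have -> : (2 `^ a) ^+ k = (2 `^ a) ^+ j * (2 `^ a) ^+ (k - j) :> R by rewrite -exprD subnKC.
rewrite exprMn.
have h : ln (2 ^ k).+1%:R `^ b <= D * (2 `^ (a' - a)) ^+ (k - j) * ln (2 ^ j).+1%:R `^ b.
  apply: le_trans (_ : (2 * (k - j).+1%:R * ln (2 ^ j).+1%:R) `^ b <= _).
    apply: ge0_ler_powR => //; rewrite ?nnegrE; last exact: log_ratio.
      exact/ltW/ln_pos.
    by rewrite !mulr_ge0// ltW// ln_pos.
  rewrite powRM; [|by rewrite mulr_ge0|exact/ltW/ln_pos].
  by apply: ler_wpM2r; [exact: ltW|exact: hD].
have q0 : 0 <= (2 `^ a) ^+ j * (2 `^ a) ^+ (k - j) :> R by rewrite ltW// mulr_gt0.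
apply: le_trans (ler_wpM2l q0 h) _.
by apply: le_of_eq; ring.
Qed.

End Profile.

(** * From masses of boxes to masses of windows *)

Section Layers.
Variable R : realType.
Implicit Types (u v : nat -> R) (w : nat -> nat -> R) (E : seq nat) (k i j t d m N K : nat).

(** The shares x / (x + y) and y / (x + y) add up to 1, and each is at most its r-th power. *)
Lemma powR_subadd (x y r : R) : 0 <= x -> 0 <= y -> 0 < r <= 1 ->
  (x + y) `^ r <= x `^ r + y `^ r.
Proof.
move=> x0 y0 /andP[r0 r1]; have [s0|s0] := eqVneq (x + y) 0.
  by rewrite s0 powR0 ?gt_eqF// addr_ge0// powR_ge0.
have sp : 0 < x + y by rewrite lt_def s0 addr_ge0.
have H z : 0 <= z -> z <= x + y -> z / (x + y) * (x + y) `^ r <= z `^ r.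
  move=> z0 zs; have [->|zn0] := eqVneq z 0; first by rewrite !mul0r powR_ge0.
  have zp : 0 < z by rewrite lt_def zn0.
  have zs1 : 0 < z / (x + y) <= 1 by rewrite divr_gt0//= ler_pdivrMr// mul1r.
  have -> : z `^ r = (z / (x + y)) `^ r * (x + y) `^ r.
    by rewrite -powRM ?divfK// ?divr_ge0 ?ltW.
  by apply: ler_wpM2r; [exact: powR_ge0|exact: ger1_powR].
apply: le_trans (lerD (H x x0 _) (H y y0 _)); rewrite ?lerDl ?lerDr//.
by rewrite -mulrDl -mulrDl divff// mul1r.
Qed.

Lemma tsum_powR w (r : R) d m i : (forall m i, 0 <= w m i) -> 0 < r <= 1 ->
  tsum w d m i `^ r <= tsum (fun m i => w m i `^ r) d m i.
Proof.
move=> w0 hr; have r0 : r != 0 by case/andP: hr => /gt_eqF ->.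
elim: d m i => [|d IH] m i /=; first by rewrite powR0.
apply: le_trans (powR_subadd (w0 _ _) _ hr) _; first by rewrite addr_ge0// tsum_ge0.
rewrite lerD2l; apply: le_trans (powR_subadd _ _ hr) _; rewrite ?tsum_ge0//.
exact: lerD.
Qed.

Lemma tsum_expand w d m i :
  tsum w d m i = \sum_(t < d) \sum_(s < 2 ^ t) w (m + t)%N (2 ^ t * i + s)%N.
Proof.
elim: d m i => [|d IH] m i /=; first by rewrite big_ord0.
rewrite big_ord_recl big_ord1; congr (_ + _).
  by rewrite /= addn0; congr (w m _); rewrite (_ : (2 ^ 0 = 1)%N)// mul1n addn0.
rewrite !IH -big_split/=; apply: eq_bigr => t _; rewrite /bump/= add1n addSn addnS.
have -> : (2 ^ t.+1 = 2 ^ t + 2 ^ t)%N by rewrite expnS mul2n addnn.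
rewrite big_split_ord/=; congr (_ + _); apply: eq_bigr => s _; congr (w _ _); lia.
Qed.

(* The [i]-th dyadic block of the decreasing rearrangement is bounded by [v i]. *)
Lemma sorted_layers u v (q : R) (D : pred nat) : 0 <= q -> (forall N, 0 <= u N) ->
  (forall E i, uniq E -> {subset E <= D} -> (size E <= 2 ^ i)%N -> \sum_(N <- E) u N <= 2 ^+ i * v i) ->
  forall K E, uniq E -> {subset E <= D} -> (size E <= 2 ^ K)%N ->
  \sum_(N <- E) u N `^ q <= v 0%N `^ q + \sum_(i < K) 2 ^+ i * v i `^ q.
Proof.
move=> q0 u0 hv; have v0 i : 0 <= v i.
  have nilD : {subset [::] <= D} by [].
  by have := hv [::] i isT nilD (leq0n _); rewrite big_nil pmulr_rge0// exprn_gt0.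
elim=> [|K IH] E uE ED sE.
  rewrite big_ord0 addr0; case: E uE ED sE => [|N [|//]] uE ED _; first by rewrite big_nil powR_ge0.
  rewrite big_seq1; apply: ge0_ler_powR; rewrite ?nnegrE//.
  by have := hv [:: N] 0%N uE ED isT; rewrite big_seq1 expr0 mul1r.
pose leT I J := u J <= u I.
have leT_total : total leT by move=> I J; exact: le_total.
have leT_trans : transitive leT by move=> J I L h1 h2; exact: le_trans h2 h1.
pose s := sort leT E; pose top := take (2 ^ K) s; pose bot := drop (2 ^ K) s.
have us : uniq s by rewrite sort_uniq.
have sD : {subset s <= D} by move=> N; rewrite mem_sort; exact: ED.
have Es : top ++ bot = s by exact: cat_take_drop.
have -> : \sum_(N <- E) u N `^ q = \sum_(N <- top) u N `^ q + \sum_(N <- bot) u N `^ q.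
  by rewrite -big_cat Es; apply: perm_big; rewrite perm_sym perm_sort.
have utop : uniq top by exact: take_uniq.
have Dtop : {subset top <= D} by move=> N /mem_take; exact: sD.
have stop : (size top <= 2 ^ K)%N by rewrite size_take; case: ltnP.
rewrite big_ord_recr/= addrA; apply: lerD; first exact: IH.
have sbot : (size bot <= 2 ^ K)%N.
  by rewrite size_drop size_sort leq_subLR addnn -mul2n -expnS.
have rel : allrel leT top bot.
  have : pairwise leT s by rewrite -sorted_pairwise// sort_sorted.
  by rewrite -Es pairwise_cat => /andP[].
(* If [bot] is nonempty, [top] has exactly 2^K entries, each with value at least u N; the hypothesis
   on [top] is then a bound on their mean. *)
have hb N : N \in bot -> u N <= v K.
  move=> hN; have st : size top = (2 ^ K)%N.
    rewrite size_take; case: ltnP => // h.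
    by have : bot = [::]; [exact: drop_oversize|move=> E0; rewrite E0 in hN].
  have p2 : 0 < 2 ^+ K :> R by rewrite exprn_gt0.
  rewrite -(ler_pM2l p2); apply: le_trans (hv top K utop Dtop stop).
  have -> : 2 ^+ K * u N = \sum_(I <- top) u N.
    by rewrite big_const_seq count_predT iter_addr addr0 st -[u N *+ _]mulr_natl natrX.
  apply: ler_sum_seq => I hI; have /allrelP := rel; exact.
apply: le_trans (_ : \sum_(N <- bot) v K `^ q <= _).
  by apply: ler_sum_seq => N hN; apply: ge0_ler_powR; rewrite ?nnegrE//; exact: hb.
rewrite big_const_seq count_predT iter_addr addr0 -[_ *+ size bot]mulr_natl.
by apply: ler_wpM2r; [exact: powR_ge0|rewrite -natrX ler_nat].
Qed.

Lemma lvl_descendant t N s : (0 < N)%N -> (s < 2 ^ t)%N ->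
  lvl (2 ^ t * N + s) = (lvl N + t)%N.
Proof.
move=> /lvl_bounds/andP[h1 h2] hs; apply: trunc_log_eq => //.
have -> : ((lvl N + t).+1 = (lvl N).+1 + t)%N by rewrite addSn.
rewrite !expnD ![(_ * 2 ^ t)%N]mulnC; apply/andP; split.
  by apply: leq_trans (leq_addr _ _); rewrite leq_mul2l h1 orbT.
by apply: leq_trans (_ : 2 ^ t * N.+1 <= _)%N; [rewrite mulnS addnC ltn_add2r|
   rewrite leq_mul2l h2 orbT].
Qed.

Definition descendants E t := [seq (2 ^ t * N + s)%N | N <- E, s <- iota 0 (2 ^ t)].

Lemma sum_descendants (F : nat -> R) E t :
  \sum_(M <- descendants E t) F M = \sum_(N <- E) \sum_(s < 2 ^ t) F (2 ^ t * N + s)%N.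
Proof.
elim: E => [|N E IH]; first by rewrite !big_nil.
rewrite big_cons -IH /descendants/= big_cat big_map; congr (_ + _).
have -> : iota 0 (2 ^ t) = index_iota 0 (2 ^ t) by rewrite /index_iota subn0.
by rewrite big_mkord.
Qed.

Lemma uniq_descendants E t : uniq E -> uniq (descendants E t).
Proof.
move=> uE; apply: allpairs_uniq => //; first exact: iota_uniq.
have p0 : (0 < 2 ^ t)%N by rewrite expn_gt0.
move=> [N s] [M s'] /allpairsP[[N1 s1] [_ /= + [-> ->]]] /allpairsP[[M1 s1'] [_ /= + [-> ->]]].
rewrite !mem_iota !add0n => /andP[_ h1] /andP[_ h2] /= E0.
have := congr1 (fun x : nat => x %/ 2 ^ t)%N E0; rewrite !(mulnC (2 ^ t)%N) !divnMDl// !divn_small// !addn0 => ->.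
by have := congr1 (fun x : nat => x %% 2 ^ t)%N E0; rewrite !(mulnC (2 ^ t)%N) !modnMDl !modn_small// => ->.
Qed.

Lemma descendants_ge2 E t N : (forall M, M \in E -> (2 <= M)%N) -> N \in descendants E t -> (2 <= N)%N.
Proof.
move=> hE /allpairsP[[M s] [/= /hE M2 _ ->]].
by have := expn_gt0 2 t; move: (2 ^ t)%N => p; nia.
Qed.

Variable g : R[i] -> R[i].
Hypothesis hg : hardy2 g.
Let hgh : holomorphic_disc g := hg.1.
Let gfin : (aint (@disc R) (wgt g) < +oo)%E := aint_wgt_lty hg.

(** The mass of the window N truncated to d generations of boxes. All sums stay finite, and a large
    d recovers any value below the full mass, see [wratio_tmass]. *)
Definition tmass d N : R := tsum (heapw (bmass2 g)) d (lvl N) N.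

Lemma tmass_expand d N : (2 <= N)%N ->
  tmass d N = \sum_(t < d) \sum_(M <- descendants [:: N] t) bmass g M.
Proof.
move=> N2; rewrite /tmass tsum_expand; apply: eq_bigr => t _.
rewrite sum_descendants big_seq1; apply: eq_bigr => -[s hs] _ /=.
have N0 : (0 < N)%N by exact: ltnW.
have hin : (2 ^ t * N + s)%N \in descendants [:: N] t.
  by apply/allpairsP; exists (N, s); rewrite mem_iota inE eqxx add0n.
have M2 : (2 <= 2 ^ t * N + s)%N.
  by apply: descendants_ge2 hin => M; rewrite inE => /eqP ->.
rewrite /heapw /bmass2 M2 -(lvl_descendant N0 hs) lvl_bounds//.
exact: ltnW.
Qed.

(** Countable additivity over the generations of descendants; each partial sum is a [tmass]. *)
Lemma wmass_le_tmass N (X : R) : (2 <= N)%N -> (forall d, tmass d N <= X) -> wmass g N <= X.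
Proof.
move=> N2 hX; have N0 : (0 < N)%N by exact: ltnW.
pose F t := @boxes R (descendants [:: N] t).
have d2 t M : M \in descendants [:: N] t -> (2 <= M)%N.
  by move=> h; apply: descendants_ge2 h => L; rewrite inE => /eqP ->.
have mF t : cmeas (F t) by apply: cmeas_boxes; exact: d2.
have UF : @window R N = \bigcup_t F t.
  apply/seteqP; split=> z.
    move=> hz; have hd : disc z by case: hz.
    have [i hi] := (windowE N2 hd).1 hz; exists i => //; split=> //.
    apply/allpairsP; exists (N, (hidx z %% 2 ^ i)%N); rewrite inE eqxx mem_iota add0n ltn_mod expn_gt0.
    by split=> //=; rewrite -hi mulnC -divn_eq.
  move=> [i _ [hd /allpairsP[[M s] [/= hM + E]]]]; rewrite mem_iota add0n => /andP[_ hs].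
  apply/windowE => //; exists i; move: hM; rewrite inE => /eqP EM.
  by rewrite E EM mulnC divnMDl ?expn_gt0// divn_small// addn0.
rewrite -lee_fin -(wmassE hgh gfin N2) /aint UF.
have plU : pl (\bigcup_t F t) = \bigcup_t pl (F t).
  by apply/seteqP; split=> p [i _ hi]; exists i.
rewrite plU ge0_integral_bigcup//; first last.
- move=> t t' _ _ [p [[_ /allpairsP[[M s] [/= hM hs E1]]] [_ /allpairsP[[M' s'] [/= hM' hs' E2]]]]].
  move: hM hM' hs hs' E1 E2; rewrite !inE !mem_iota !add0n => /eqP-> /eqP-> /andP[_ hs] /andP[_ hs'].
  move=> E1 E2; have := lvl_descendant N0 hs; rewrite -E1 E2 lvl_descendant// => /eqP.
  by rewrite eqn_add2l => /eqP ->.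
- by move=> p [i _ [hz _]]; rewrite lee_fin wgt_ge0.
- rewrite -plU -UF; apply: cmeasf_EFin; apply: cmeasfS (cmeasf_wgt hgh); first exact: cmeas_disc.
  exact: window_disc.
apply: lime_le.
  apply: is_cvg_nneseries => i _ _; apply: integral_ge0 => p [hz _].
  by rewrite lee_fin wgt_ge0.
apply: nearW => d; apply: le_trans (_ : (tmass d N)%:E <= _)%E; last by rewrite lee_fin.
rewrite tmass_expand// big_mkord -sumEFin; apply: lee_sum => t _.
have ge z : disc z -> 0 <= wgt g z by exact: wgt_ge0.
have := aint_boxes (uniq_descendants t (isT : uniq [:: N])) (@d2 t) ge (cmeasf_wgt hgh).
rewrite /aint => ->; rewrite -sumEFin big_seq [leRHS]big_seq.
by apply: lee_sum => M hM; rewrite -(bmassE hgh gfin)//; exact: d2 hM.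
Qed.

Lemma tmass_mono d e N : (d <= e)%N -> tmass d N <= tmass e N.
Proof.
move=> /subnK <-; elim: (e - d)%N => // k IH; apply: le_trans IH _; rewrite addSn /tmass.
elim: (k + d)%N (lvl N) {2 4}N => [|n IH] m i.
  by apply: tsum_ge0 => p q; rewrite /heapw; case: ifP => // _; exact: bmass2_ge0.
by rewrite [tsum _ n.+1 _ _]/= [tsum _ n.+2 _ _]/= lerD2l lerD.
Qed.

Lemma wratio_tmass N (lam : R) : (2 <= N)%N -> lam < wratio g N ->
  exists d, lam < 2 ^+ lvl N * tmass d N.
Proof.
move=> N2 hl; apply: contrapT => no.
have : wmass g N <= lam / 2 ^+ lvl N.
  apply: wmass_le_tmass => // d; rewrite ler_pdivlMr// mulrC leNgt; apply/negP => h.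
  by apply: no; exists d.
rewrite ler_pdivlMr// -/(wratio g N) => h.
by have := le_lt_trans h hl; rewrite ltxx.
Qed.

Lemma wratio_tmass_seq E (lam : R) : (forall N, N \in E -> (2 <= N)%N /\ lam < wratio g N) ->
  exists d, forall N, N \in E -> lam < 2 ^+ lvl N * tmass d N.
Proof.
elim: E => [|N E IH] hE; first by exists 0%N.
have hE' M : M \in E -> (2 <= M)%N /\ lam < wratio g M.
  by move=> hM; apply: hE; rewrite inE hM orbT.
have [d hd] := IH hE'.
have [N2 hN] := hE N (mem_head _ _); have [e he] := wratio_tmass N2 hN.
exists (maxn d e) => M; rewrite inE => /predU1P[->|/hd h].
  apply: lt_le_trans he _; apply: ler_wpM2l; first exact: exprn_ge0.
  by apply: tmass_mono; exact: leq_maxr.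
apply: lt_le_trans h _; apply: ler_wpM2l; first exact: exprn_ge0.
by apply: tmass_mono; exact: leq_maxl.
Qed.

(** The power r is distributed over the boxes by subadditivity. In generation t the normalizing
    factor of a box is 2^t times that of N, whence 2^(-r t). *)
Lemma tmass_powR E (r : R) d : 0 < r <= 1 -> (forall N, N \in E -> (2 <= N)%N) ->
  \sum_(N <- E) (2 ^+ lvl N * tmass d N) `^ r <=
  \sum_(t < d) (2 `^ (- r)) ^+ t * \sum_(M <- descendants E t) bratio g M `^ r.
Proof.
move=> hr hE.
have w0 m i : 0 <= heapw (bmass2 g) m i.
  by rewrite /heapw; case: ifP => // _; exact: bmass2_ge0.
under [leRHS]eq_bigr => t _ do rewrite sum_descendants mulr_sumr.
rewrite exchange_big/=; apply: ler_sum_seq => N /hE N2; have N0 : (0 < N)%N by exact: ltnW.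
rewrite powRM ?exprn_ge0 ?tsum_ge0//.
apply: le_trans (ler_wpM2l (powR_ge0 _ _) (tsum_powR d _ _ w0 hr)) _.
rewrite tsum_expand mulr_sumr; apply: ler_sum => -[t ht] _ /=; rewrite !mulr_sumr.
apply: ler_sum => -[s hs] _ /=.
have M2 : (2 <= 2 ^ t * N + s)%N.
  apply: (@descendants_ge2 [:: N] t) => [M|]; first by rewrite inE => /eqP ->.
  by apply/allpairsP; exists (N, s); rewrite mem_iota inE eqxx add0n.
have lM := lvl_descendant N0 hs.
rewrite /heapw /bmass2 M2 -lM lvl_bounds; last exact: ltnW.
rewrite /bratio lM exprD mulrA powRM ?mulr_ge0 ?bmass_ge0 ?exprn_ge0//.
have -> : (2 ^+ t) `^ r = (2 `^ r) ^+ t :> R.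
  by rewrite -powR_exp2 natrX.
rewrite powRN exprVn mulrCA mulVf ?mulr1; last by rewrite expf_neq0// powR_eq0 pnatr_eq0.
by rewrite powRM ?bmass_ge0 ?exprn_ge0// mulrC.
Qed.

End Layers.

(** * Inequalities between singular values and tau *)

Section OperatorInequalities.
Variable R : realType.
Local Notation C := R[i].
Local Notation V := (H2 R).
Implicit Types (n N j k d : nat) (x t : nat -> R).

Variable g : C -> C.
Hypothesis hg : hardy2 g.
Local Notation Ig := (integration_op g).
Let hgh : holomorphic_disc g := hg.1.
Let gfin : (aint (@disc R) (wgt g) < +oo)%E := aint_wgt_lty hg.
Local Notation s n := (singular_value Ig n).
Local Notation tc := (tau_const R).

Lemma opnorm_ge0 (T : V -> (C -> C)) : (0 <= opnorm T)%E.
Proof.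
apply: (@le_trans _ _ (h2norm (T 0))); first exact: sqrte_ge0.
apply: ereal_sup_ubound; exists 0 => //.
by apply/(h2norm_hn2 _ ler01); rewrite /hn2 ip0l expr1n.
Qed.

Lemma singular_value_ge0 n : (0 <= s n)%E.
Proof. by apply: le_ereal_inf_tmp => _ [S _ <-]; exact: opnorm_ge0. Qed.

Lemma singular_value_anti n m : (n <= m)%N -> (s m <= s n)%E.
Proof.
move=> nm; apply: ereal_inf_le_tmp => _ [S [bS [v sv hv]] <-]; exists S => //; split=> //.
by exists v => //; exact: leq_trans nm.
Qed.

Lemma tau_anti n m : (n <= m)%N -> (tau g m <= tau g n)%E.
Proof.
move=> nm; apply: ereal_inf_le_tmp => e [e0 he]; split=> //.
apply: card_le_trans he _; apply: subset_card_le => i; rewrite /mkset => /leq_trans; apply.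
by rewrite -!subn1 leq_sub2r.
Qed.

(* The witness for [m] is the large closed numeral [rank_const]; the existential
   keeps conversion from computing it. *)
Lemma singular_upper : exists2 m, (0 < m)%N & exists2 K : R, 0 < K & forall t,
  (forall j, 0 < t j) -> (forall j, (tau g (2 ^ j) < (t j)%:E)%E) ->
  forall k n, (m * 2 ^ k <= n)%N ->
  (s n <= (Num.sqrt (K * \sum_(j < k.+1) 16^-1 ^+ (k - j) * t j))%:E)%E.
Proof.
have [K K0 hK] := singular_value_lists hg; exists rank_const.
  by rewrite /rank_const muln_gt0 size_allpairs !size_iota.
have c0 := tau_const_gt0 R; exists (K / tc); first exact: divr_gt0.
move=> t t0 ht k n kn.
have ex j : exists B : seq nat, (size B < 2 ^ j)%N /\
    forall N, (2 <= N)%N -> N \notin B -> wratio g N <= t j / tc.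
  have j0 : (0 < 2 ^ j)%N by rewrite expn_gt0.
  have [B [sB hB]] := tau_lt hgh gfin j0 (ht j); exists B; split=> // N N2 NB.
  rewrite ler_pdivlMr// mulrC leNgt; apply/negP => /ltW/(hB N N2) h.
  by rewrite h in NB.
have [B hB] := choice ex.
have := hK B (fun j => t j / tc) k _ _ _ n kn.
have -> : \sum_(j < k.+1) 16^-1 ^+ (k - j) * (t j / tc) = tc^-1 * \sum_(j < k.+1) 16^-1 ^+ (k - j) * t j.
  by rewrite mulr_sumr; apply: eq_bigr => j _; ring.
rewrite mulrA; apply.
- by move=> j _; exact: (hB j).1.
- by move=> j; exact: divr_gt0.
- by move=> j _; exact: (hB j).2.
Qed.

(** Finite tau_1 makes I_g bounded, and compression along the empty family is the zero operator,
    which competes for s_1. *)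
Lemma singular_fin : (tau g 1 < +oo)%E -> (s 1 < +oo)%E.
Proof.
move=> h; have [y y0 hy] : exists2 y : R, 0 < y & (tau g 1 < y%:E)%E.
  move: h; case E : (tau g 1) => [r||]// _; last by exists 1; rewrite ?ltNyr.
  exists (`|r| + 1); first by rewrite ltr_wpDl.
  by rewrite lte_fin (le_lt_trans (ler_norm _))// ltrDl.
have c0 := tau_const_gt0 R; have [B [sB hB]] := tau_lt hgh gfin (ltn0Sn 0) hy.
have bd : ig_bounded g.
  apply: (ig_bounded_of_wratio hg (divr_gt0 y0 c0)) => N N2.
  rewrite ler_pdivlMr// mulrC leNgt; apply/negP => /ltW/(hB N N2).
  by move: sB; rewrite ltnS leqn0 size_eq0 => /eqP ->.
have [b hb] := bd; pose b' := Num.max 0 b.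
have b'0 : 0 <= b' by rewrite le_max lexx.
apply: le_lt_trans (ltry (Num.sqrt b')).
apply: (@compress_approx R g hg bd [::] 1 (Num.sqrt b')); [by move=> i j|by []|exact: sqrtr_ge0|].
move=> f _ N; rewrite sqr_sqrtr//; apply: le_trans (hb f N) _.
by apply: ler_wpM2r; [exact: hn2_ge0|rewrite le_max lexx orbT].
Qed.

Section Lower.
Variable x : nat -> R.
Hypotheses (x0 : forall j, 0 < x j) (hx : forall j, (s (2 ^ j) < (x j)%:E)%E).

Lemma ig_bounded_of_singular : ig_bounded g.
Proof. by apply: singular_value1_bounded => //; exact: lt_trans (hx 0%N) (ltry _). Qed.

Let hB := ig_bounded_of_singular.

Lemma approximants : exists S : nat -> {linear V -> V}, (forall j, rank_lt (S j) (2 ^ j)) /\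
  forall j f, hn2 (IgV hB f - S j f) <= x j ^+ 2 * hn2 f.
Proof.
have ex j : exists S : {linear V -> V}, rank_lt S (2 ^ j) /\
    forall f, hn2 (IgV hB f - S f) <= x j ^+ 2 * hn2 f.
  have [S [rS hS]] := singular_value_approx hg (x0 j) (hx j); exists S; split=> // f.
  apply: hn2_le => N; apply: le_trans (hS f N).
  suff -> : coef (IgV hB f - S f) = fun m => coef (Ig f) m - coef (S f) m by [].
  rewrite -(coef_IgV hB) -scaleN1r addrC coefD coefZ.
  by apply/funext => m; rewrite mulN1r addrC.
have [S hS] := choice ex.
by exists S; split=> j; [exact: (hS j).1|exact: (hS j).2].
Qed.

End Lower.

Lemma tau_list k (lam : R) : 0 <= lam -> (lam%:E < tau g (2 ^ k))%E ->
  exists E : seq nat, [/\ uniq E, size E = (2 ^ k)%N &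
    forall N, N \in E -> (2 <= N)%N /\ lam / tc < wratio g N].
Proof.
move=> l0 hl; have k0 : (0 < 2 ^ k)%N by rewrite expn_gt0.
have [E [uE sE hE]] := tau_gt hgh gfin k0 l0 hl; exists E; split=> // N /hE[N2 h].
by split=> //; rewrite ltr_pdivrMr ?tau_const_gt0// mulrC.
Qed.

(** [hs_lower] is applied to 2^k arcs whose ratios exceed lam up to [tau_const]; division by 2^k
    leaves the kernel 2^((j-k)/2). *)
Lemma hs_ineq : exists2 K : R, 0 < K & forall x, (forall j, 0 < x j) ->
  (forall j, (s (2 ^ j) < (x j)%:E)%E) -> forall k (lam : R), 0 <= lam ->
  (lam%:E < tau g (2 ^ k))%E ->
  lam <= K * (\sum_(j < k.+1) (Num.sqrt 2)^-1 ^+ (k - j) * x j) ^+ 2.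
Proof.
have [_ A0] := dareaE R; have c0 := tau_const_gt0 R.
have k0 : 0 < 48 ^+ 2 * darea R * 9 ^+ 2 :> R.
  by apply: mulr_gt0; [apply: mulr_gt0 => //|]; apply: exprn_gt0; rewrite ltr0n.
exists (tc * (48 ^+ 2 * darea R * 9 ^+ 2)); first exact: mulr_gt0.
move=> x x0 hx k lam l0 hl; have [S [rS bS]] := approximants x0 hx.
have [E [uE sE hE]] := tau_list l0 hl.
have := @hs_lower R g hg (ig_bounded_of_singular hx) S x k E (fun j _ => rS j) (fun j f _ => bS j f)
  (fun j _ => x0 j) uE (fun N hN => (hE N hN).1) (eq_leq sE).
have : 2 ^+ k * (lam / tc) <= \sum_(N <- E) wratio g N.
  apply: le_trans (_ : \sum_(N <- E) lam / tc <= _).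
    by rewrite big_const_seq count_predT iter_addr addr0 sE -[_ *+ (2 ^ k)]mulr_natl natrX.
  by apply: ler_sum_seq => N /hE[_ /ltW].
move=> h1 h2; have {h1 h2} := le_trans h1 h2.
have s2 : 0 < Num.sqrt 2 :> R by rewrite sqrtr_gt0.
have -> : \sum_(j < k.+1) Num.sqrt 2 ^+ j * x j =
    Num.sqrt 2 ^+ k * \sum_(j < k.+1) (Num.sqrt 2)^-1 ^+ (k - j) * x j.
  rewrite mulr_sumr; apply: eq_bigr => -[j hj] _ /=.
  rewrite mulrA; congr (_ * _); rewrite exprVn -[in X in _ = X / _](subnK (hj : (j <= k)%N)) exprD.
  by rewrite mulrAC mulfV ?mul1r// expf_neq0// gt_eqF.
set Y := \sum_(j < _) _.
have E2 : (9 * (Num.sqrt 2 ^+ k * Y)) ^+ 2 = 9 ^+ 2 * (2 ^+ k * Y ^+ 2).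
  by rewrite !exprMn -exprM mulnC exprM sqr_sqrtr.
rewrite E2 => H; have p2 : 0 < 2 ^+ k :> R by rewrite exprn_gt0.
rewrite -(ler_pM2l p2); move: H; rewrite mulrA ler_pdivrMr// => /le_trans; apply.
by apply: le_of_eq; ring.
Qed.

(** The sum in [trace_lower] at scale i, divided by the number 2^i of arcs. *)
Definition half_average x i : R := \sum_(j < i.+1) 2^-1 ^+ (i - j) * x j.

Lemma half_sum x i : \sum_(j < i.+1) 2 ^+ j * x j = 2 ^+ i * half_average x i.
Proof.
rewrite mulr_sumr; apply: eq_bigr => -[j hj] _ /=.
rewrite mulrA; congr (_ * _); rewrite exprVn -[in X in _ = X / _](subnK (hj : (j <= i)%N)) exprD.
by rewrite mulrAC mulfV ?mul1r// expf_neq0.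
Qed.

Lemma half_average_ge0 x i : (forall j, 0 <= x j) -> 0 <= half_average x i.
Proof. by move=> x0; apply: sumr_ge0 => j _; rewrite mulr_ge0 ?exprn_ge0. Qed.

Lemma half_averageS x i : half_average x i.+1 = 2^-1 * half_average x i + x i.+1.
Proof.
rewrite /half_average big_ord_recr/= subnn expr0 mul1r; congr (_ + _).
rewrite mulr_sumr; apply: eq_bigr => -[j hj] _ /=.
by rewrite (subSn (hj : (j <= i)%N)) exprS mulrA.
Qed.

(** The truncated windows of 2^k heavy arcs are split into boxes by [tmass_powR]. Generation t has
    2^(k+t) boxes, to which the trace bound applies through [sorted_layers]. After division by 2^k,
    their number 2^t and the factor 2^(-r t) combine into 2^((1-r) t). *)
Lemma layer_ineq (r : R) : 0 < r <= 1 -> exists2 K : R, 0 < K & forall x, (forall j, 0 < x j) ->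
  (forall j, (s (2 ^ j) < (x j)%:E)%E) -> forall k (lam : R), 0 <= lam ->
  (lam%:E < tau g (2 ^ k))%E -> exists d,
  (lam / tc) `^ r <= 2 * \sum_(t < d) (2 `^ (1 - r)) ^+ t *
     half_average (fun i => (K * half_average x i) `^ (2 * r)) (k + t).
Proof.
move=> hr; have [r0 r1] := andP hr; have [_ A0] := dareaE R; have c0 := tau_const_gt0 R.
pose K : R := 48 * (9 * (1 + darea R)); have K0 : 0 < K.
  by apply: mulr_gt0; [rewrite ltr0n|apply: mulr_gt0; [rewrite ltr0n|rewrite addr_gt0]].
exists K => // x x0 hx k lam l0 hl; have [S [rS bS]] := approximants x0 hx.
have [E [uE sE hE]] := tau_list l0 hl.
have hE2 N : N \in E -> (2 <= N)%N by move=> /hE[].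
have [d hd] := wratio_tmass_seq hg hE; exists d.
pose v i := K * half_average x i; pose u N := Num.sqrt (bratio g N).
have v0 i : 0 <= v i by apply: mulr_ge0 (ltW K0) _; apply: half_average_ge0 => j; exact: ltW.
have trace F i : uniq F -> {subset F <= [pred N | (2 <= N)%N]} -> (size F <= 2 ^ i)%N ->
    \sum_(N <- F) u N <= 2 ^+ i * v i.
  move=> uF hF sF.
  have := @trace_lower R g hg (ig_bounded_of_singular hx) S x i F (fun j _ => rS j)
    (fun j f _ => bS j f) (fun j _ => x0 j) uF hF sF.
  by rewrite half_sum -/K mulrCA.
have q0 : 0 <= 2 * r by rewrite mulr_ge0// ltW.
have layers := @sorted_layers R u v (2 * r) _ q0 (fun N => sqrtr_ge0 _) trace.
pose z i := v i `^ (2 * r).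
have z0 i : 0 <= z i by exact: powR_ge0.
have hZ K' : z 0%N + \sum_(i < K') 2 ^+ i * z i <= 2 * (2 ^+ K' * half_average z K').
  rewrite -half_sum big_ord_recr/=; set s0 := \sum_(i < K') _.
  have s1 : 0 <= s0 by apply: sumr_ge0 => i _; rewrite mulr_ge0 ?exprn_ge0.
  have h1 : 0 <= 2 ^+ K' * z K' by rewrite mulr_ge0 ?exprn_ge0.
  suff : z 0%N <= s0 + 2 ^+ K' * z K' by lra.
  rewrite /s0; case: (K') => [|m]; first by rewrite big_ord0 expr0 mul1r add0r.
  rewrite big_ord_recl/= expr0 mul1r -addrA lerDl addr_ge0 ?mulr_ge0 ?exprn_ge0//.
  by apply: sumr_ge0 => i _; rewrite mulr_ge0 ?exprn_ge0.
have bu N : bratio g N `^ r = u N `^ (2 * r).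
  have b0 : 0 <= bratio g N by rewrite mulr_ge0 ?bmass_ge0 ?exprn_ge0.
  by rewrite powRrM powR_mulrn ?sqrtr_ge0// sqr_sqrtr.
have p2 : 0 < 2 ^+ k :> R by rewrite exprn_gt0.
rewrite -(ler_pM2l p2); apply: le_trans (_ : \sum_(N <- E) (2 ^+ lvl N * tmass g d N) `^ r <= _).
  apply: le_trans (_ : \sum_(N <- E) (lam / tc) `^ r <= _).
    by rewrite big_const_seq count_predT iter_addr addr0 sE -[_ *+ (2 ^ k)]mulr_natl natrX.
  have lt0 : 0 <= lam / tc by rewrite divr_ge0// ltW.
  apply: ler_sum_seq => N /hd /ltW h; apply: ge0_ler_powR; rewrite ?nnegrE//; first exact: ltW.
  exact: le_trans h.
apply: le_trans (tmass_powR g d hr hE2) _.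
rewrite !mulr_sumr; apply: ler_sum => -[t ht] _ /=.
have s0 : 0 <= (2 `^ (- r)) ^+ t :> R by rewrite exprn_ge0// powR_ge0.
have hl' : \sum_(M <- descendants E t) bratio g M `^ r <= 2 * (2 ^+ (k + t) * half_average z (k + t)).
  apply: le_trans (hZ _); under eq_bigr => M _ do rewrite bu.
  apply: layers; first exact: uniq_descendants.
    by move=> M hM; apply: descendants_ge2 hE2 hM.
  by rewrite size_allpairs size_iota sE expnD.
apply: le_trans (ler_wpM2l s0 hl') _.
have -> : 2 `^ (1 - r) = 2 * 2 `^ (- r) :> R.
  by rewrite powRD ?powRr1// pnatr_eq0 implybT.
rewrite exprMn exprD; apply: le_of_eq; ring.
Qed.

End OperatorInequalities.

(** * Transfer of asymptotics *)

Section DyadicTransfer.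
Variable R : realType.
Implicit Types (n k j M : nat) (a b T : R).

Lemma pow2_lt1 (e : R) : e < 0 -> 2 `^ e < 1.
Proof.
move=> e0; have l2 : 0 < ln 2 :> R by rewrite ln_gt0// ltr1n.
by rewrite /powR gt_eqF ?ltr0n// -[ltRHS]expR0 ltr_expR pmulr_llt0.
Qed.

Lemma powR_le_inv (q x y : R) : 0 < q -> 0 <= x -> 0 <= y -> x `^ q <= y `^ q -> x <= y.
Proof.
move=> q0 x0 y0 h; rewrite leNgt; apply/negP => yx.
by have := gt0_ltr_powR q0; move=> /(_ y x); rewrite !nnegrE => /(_ y0 x0 yx); rewrite ltNge h.
Qed.

Lemma prof_kernel a b (e kap : R) : 0 <= b -> kap = 2 `^ (- e) -> a < e ->
  exists th D : R, [/\ 0 <= th < 1, 0 < D & forall j k, (j <= k)%N ->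
    kap ^+ (k - j) * prof a b (2 ^ j) <= D * th ^+ (k - j) * prof a b (2 ^ k)].
Proof.
move=> b0 -> ae; have aa : a < (a + e) / 2 by lra.
have [D D0 hD] := prof_dyadic_growth b0 aa; exists (2 `^ (- e + (a + e) / 2)), D; split=> //.
  by rewrite powR_ge0 pow2_lt1//; lra.
move=> j k jk; have k0 : 0 <= (2 `^ (- e)) ^+ (k - j) :> R by rewrite exprn_ge0// powR_ge0.
apply: le_trans (ler_wpM2l k0 (hD j k jk)) _.
rewrite powRD; last by rewrite pnatr_eq0 implybT.
by rewrite exprMn; apply: le_of_eq; ring.
Qed.

Lemma prof_step a b : 0 <= b -> exists2 A : R, 0 < A &
  forall k, prof a b (2 ^ k) <= A * prof a b (2 ^ k.+1).
Proof.
move=> b0; have aa : a < a + 1 by rewrite ltrDl.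
have [D D0 hD] := prof_dyadic_growth b0 aa; exists (D * (2 `^ (a + 1)) ^+ 1).
  by rewrite mulr_gt0// exprn_gt0// powR_gt0.
by move=> k; have := hD k k.+1 (leqnSn k); rewrite subSnn.
Qed.

Lemma dyadic_bounds n : (1 <= n)%N -> (2 ^ trunc_log 2 n <= n < 2 ^ (trunc_log 2 n).+1)%N.
Proof. by move=> n1; have := @trunc_log_bounds 2 n isT n1. Qed.

(** M accommodates the rank constant of [singular_upper]. Indices below M are covered by F 1, which
    is why its finiteness is assumed. *)
Lemma dyadic_upper (F : nat -> \bar R) a b M T : 0 <= a -> 0 <= b -> (0 < M)%N -> 0 <= T ->
  (forall n m, (n <= m)%N -> (F m <= F n)%E) -> (F 1%N < +oo)%E -> (forall n, (0 <= F n)%E) ->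
  (forall k, (F (M * 2 ^ k)%N <= (T * prof a b (2 ^ k))%:E)%E) ->
  exists2 K : R, 0 < K & forall n, (1 <= n)%N -> (F n <= K%:E * (prof a b n)%:E)%E.
Proof.
move=> a0 b0 M0 T0 aF F1 F0 hF; have aa : a < a + 1 by rewrite ltrDl.
have [D D0 hD] := prof_dyadic_growth b0 aa.
have F1f : F 1%N = (fine (F 1%N))%:E by rewrite fineK// ge0_fin_numE.
have F1p : 0 <= fine (F 1%N) by exact: fine_ge0.
pose A := D * (2 `^ (a + 1)) ^+ M.+1; have A0 : 0 < A by rewrite mulr_gt0// exprn_gt0// powR_gt0.
have pM := @prof_gt0 R a b M M0.
exists (T * A + fine (F 1%N) / prof a b M + 1).
  rewrite ltr_wpDl// addr_ge0//; first by rewrite mulr_ge0// ltW.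
  by rewrite divr_ge0// ltW.
move=> n n1; have pn := @prof_gt0 R a b n n1; rewrite -EFinM.
have [nM|Mn] := ltnP n M.
  apply: le_trans (aF 1%N n n1) _; rewrite F1f lee_fin.
  apply: le_trans (_ : fine (F 1%N) / prof a b M * prof a b n <= _).
    rewrite -mulrA ler_peMr// mulrC ler_pdivlMr// mul1r; exact: prof_anti (ltnW nM).
  rewrite ler_wpM2r ?(ltW pn)//.
  by rewrite addrAC -[leLHS]add0r; apply: lerD => //; rewrite addr_ge0// mulr_ge0// ltW.
have q1 : (1 <= n %/ M)%N by rewrite divn_gt0.
have /andP[h1 h2] := dyadic_bounds q1; set k := trunc_log 2 _ in h1 h2.
have Mk : (M * 2 ^ k <= n)%N by rewrite mulnC -leq_divRL.
have nk : (n <= 2 ^ (k.+1 + M))%N.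
  rewrite expnD; apply: ltnW; apply: leq_trans (_ : 2 ^ k.+1 * M <= _)%N.
    by rewrite -ltn_divLR.
  by rewrite leq_mul2l ltnW ?orbT// ltn_expl.
apply: le_trans (aF _ _ Mk) _; apply: le_trans (hF k) _; rewrite lee_fin.
have h3 : prof a b (2 ^ k) <= A * prof a b n.
  have := hD k (k.+1 + M)%N (leq_trans (leqnSn k) (leq_addr _ _)).
  rewrite (_ : (k.+1 + M - k = M.+1)%N); last by lia.
  move/le_trans; apply; apply: ler_wpM2l; [exact: ltW|exact: prof_anti].
apply: le_trans (ler_wpM2l T0 h3) _; rewrite mulrA; apply: ler_wpM2r; first exact: ltW.
have : 0 <= fine (F 1%N) / prof a b M by rewrite divr_ge0// ltW.
lra.
Qed.

Lemma dyadic_lower (F : nat -> \bar R) a b (c : R) : 0 <= a -> 0 <= b -> 0 < c ->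
  (forall n m, (n <= m)%N -> (F m <= F n)%E) ->
  (forall k, ((c * prof a b (2 ^ k))%:E <= F (2 ^ k)%N)%E) ->
  exists2 c' : R, 0 < c' & forall n, (1 <= n)%N -> (c'%:E * (prof a b n)%:E <= F n)%E.
Proof.
move=> a0 b0 c0 aF hF; have [A A0 hA] := @prof_step a b b0.
exists (c / A); first exact: divr_gt0.
move=> n n1; have /andP[h1 h2] := dyadic_bounds n1; set k := trunc_log 2 n in h1 h2.
apply: le_trans (aF _ _ (ltnW h2)); apply: le_trans (hF k.+1); rewrite -EFinM lee_fin.
rewrite -mulrA ler_pM2l// mulrC ler_pdivrMr// mulrC; apply: le_trans (hA k).
by apply: prof_anti => //; rewrite expn_gt0.
Qed.

(* Dominating sequences have to be strict majorants of the singular values (or of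
   tau), so a slack [e * p k] is added and removed at the end. *)
Lemma remove_slack (X p : nat -> R) (c : R) : 0 < c -> (forall k, 0 < p k) ->
  (forall e : R, 0 < e <= 1 -> forall k, c * p k <= X k + e * p k) ->
  forall k, c / 2 * p k <= X k.
Proof.
move=> c0 p0 H k; pose e := Num.min 1 (c / 2).
have c2 : 0 < c / 2 by rewrite divr_gt0.
have e1 : 0 < e <= 1 by rewrite lt_min ltr01 c2 ge_min lexx.
have := H e e1 k; have : e * p k <= c / 2 * p k.
  by rewrite ler_pM2r// ge_min lexx orbT.
lra.
Qed.

(** Otherwise 2 B itself would be an admissible lam above B; the argument also rules out z = +oo. *)
Lemma lee_of_lt (z : \bar R) (B : R) : 0 < B ->
  (forall lam : R, 0 <= lam -> (lam%:E < z)%E -> lam <= B) -> (z <= (2 * B)%:E)%E.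
Proof.
move=> B0 H; rewrite leNgt; apply/negP => h.
have B2 : 0 <= 2 * B by rewrite mulr_ge0// ltW.
by have := H _ B2 h; lra.
Qed.

End DyadicTransfer.

(** * Transfer of the profile between the two sequences *)

Section Equivalence.
Variable R : realType.
Local Notation C := R[i].
Implicit Types (n k j : nat).

Variable g : C -> C.
Hypothesis hg : hardy2 g.
Local Notation s n := (singular_value (integration_op g) n).
Local Notation tc := (tau_const R).
Variables a b : R.
Hypotheses (a0 : 0 <= a) (a1 : a < 1) (b0 : 0 <= b).

Let p k := prof a b (2 ^ k).
Let p2 k := prof (2 * a) (2 * b) (2 ^ k).

Let e1 k : (1 <= 2 ^ k)%N. Proof. by rewrite expn_gt0. Qed.
Let p0 k : 0 < p k. Proof. exact: prof_gt0. Qed.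
Let p20 k : 0 < p2 k. Proof. exact: prof_gt0. Qed.
Let p2E k : p2 k = p k ^+ 2. Proof. by rewrite /p2 -prof_sqr. Qed.
Let aa0 : 0 <= 2 * a. Proof. by rewrite mulr_ge0. Qed.
Let bb0 : 0 <= 2 * b. Proof. by rewrite mulr_ge0. Qed.

Let p_anti j k : (j <= k)%N -> p k <= p j.
Proof. by move=> jk; apply: prof_anti => //; rewrite leq_exp2l. Qed.

Let p2_anti j k : (j <= k)%N -> p2 k <= p2 j.
Proof. by move=> jk; apply: prof_anti => //; rewrite leq_exp2l. Qed.

Let c0 : 0 < tc := tau_const_gt0 R.

Lemma kernel16 : exists th D : R, [/\ 0 <= th < 1, 0 < D & forall j k, (j <= k)%N ->
  16^-1 ^+ (k - j) * p2 j <= D * th ^+ (k - j) * p2 k].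
Proof.
have a4 : 2 * a < 4 by move: a1; lra.
apply: (prof_kernel bb0 _ a4).
by rewrite powRN (powR_mulrn 4 (ler0n R 2)) -natrX.
Qed.

(** Under the square root of [singular_upper] the kernel of ratio 1/16 preserves the profile p2 =
    p^2. *)
Lemma upper_s (T : R) : 0 < T ->
  (forall n, (1 <= n)%N -> (tau g n <= T%:E * (prof (2 * a) (2 * b) n)%:E)%E) ->
  exists2 K : R, 0 < K & forall n, (1 <= n)%N -> (s n <= K%:E * (prof a b n)%:E)%E.
Proof.
move=> T0 hT; have [rc rc0 [K K0 hK]] := singular_upper hg; have [th [D [th16 D0 hD]]] := kernel16.
have T1 : 0 < T + 1 by rewrite addr_gt0.
have tp j : 0 < (T + 1) * p2 j by exact: mulr_gt0.
have ht j : (tau g (2 ^ j) < ((T + 1) * p2 j)%:E)%E.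
  apply: le_lt_trans (hT _ (e1 j)) _; by rewrite -EFinM lte_fin (ltr_pM2r (p20 j)) ltrDl.
have q0 : (0 : R) <= 16^-1 by rewrite invr_ge0 ler0n.
pose T2 := (T + 1) * D / (1 - th).
have T20 : 0 <= T2 by have /andP[_ h] := th16; rewrite divr_ge0 ?mulr_ge0 ?ltW// subr_gt0.
have h1 : (s 1%N < +oo)%E.
  apply: (singular_fin hg); apply: le_lt_trans (hT 1%N isT) _; rewrite -EFinM; exact: ltry.
apply: (dyadic_upper a0 b0 rc0 (sqrtr_ge0 (K * T2))) => //.
- by move=> n m; exact: singular_value_anti.
- by move=> n; exact: singular_value_ge0.
move=> k; apply: le_trans (hK _ tp ht k _ (leqnn _)) _; rewrite lee_fin -/(p k).
rewrite -[p k]ger0_norm ?(ltW (p0 k))// -sqrtr_sqr -sqrtrM; last by rewrite mulr_ge0// ltW.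
apply: ler_wsqrtr; rewrite -mulrA; apply: ler_wpM2l; first exact: ltW.
rewrite -p2E; exact: (kernel_fwd q0 th16 (ltW D0) p20 hD k (ltW T1) (fun j => lexx _)).
Qed.

Lemma lower_tau (T c : R) : 0 < T -> 0 < c ->
  (forall n, (1 <= n)%N -> (tau g n <= T%:E * (prof (2 * a) (2 * b) n)%:E)%E) ->
  (forall n, (1 <= n)%N -> (c%:E * (prof a b n)%:E <= s n)%E) ->
  exists2 c' : R, 0 < c' &
    forall n, (1 <= n)%N -> (c'%:E * (prof (2 * a) (2 * b) n)%:E <= tau g n)%E.
Proof.
move=> T0 cp hT hc; have [rc rc0 [K K0 hK]] := singular_upper hg; have [th [D [th16 D0 hD]]] := kernel16.
have q0 : (0 : R) <= 16^-1 by rewrite invr_ge0 ler0n.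
have q1 : (16^-1 : R) <= 1 by rewrite invf_le1 ?ltr0n// ler1n.
pose X k := fine (tau g (2 ^ k)).
have XE k : tau g (2 ^ k) = (X k)%:E.
  rewrite fineK// ge0_fin_numE ?tau_ge0//; apply: le_lt_trans (hT _ (e1 k)) _.
  by rewrite -EFinM ltry.
have X0 k : 0 <= X k by apply: fine_ge0; exact: tau_ge0.
have XT k : X k <= T * p2 k by rewrite -lee_fin -XE EFinM; exact: hT.
have aX j k : (j <= k)%N -> X k <= X j.
  by move=> jk; rewrite -lee_fin -!XE; apply: tau_anti; rewrite leq_exp2l.
have aa : a < a + 1 by rewrite ltrDl.
have [D1 D10 hD1] := prof_dyadic_growth b0 aa.
pose A := D1 * (2 `^ (a + 1)) ^+ rc.
have A0 : 0 < A by rewrite mulr_gt0// exprn_gt0// powR_gt0.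
(* The lower bound on s is used at rc 2^k, the index appearing in [singular_upper]; since rc <=
   2^rc, the profile there is comparable to p k. *)
have pA k : p k <= A * prof a b (rc * 2 ^ k).
  have := hD1 k (k + rc)%N (leq_addr _ _); rewrite addKn => /le_trans; apply.
  apply: ler_wpM2l; first exact: ltW.
  apply: prof_anti => //; first by rewrite muln_gt0 rc0 e1.
  by rewrite expnD mulnC leq_mul2l ltnW ?orbT// ltn_expl.
pose c1 := (c / A) ^+ 2 / K; have c10 : 0 < c1 by rewrite divr_gt0// exprn_gt0// divr_gt0.
have T1 : 0 <= T + 1 by rewrite addr_ge0// ltW.
have [c' c'0 hc'] := kernel_rev_anti q0 q1 th16 (ltW D0) p20 hD 0%N T1 c10 (@prof_step R _ _ bb0).
have H : forall k, c' / 2 * p2 k <= X k.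
  apply: (remove_slack c'0 p20) => e /andP[ep e1'].
  apply: (hc' (fun k => X k + e * p2 k)).
  - by move=> j; rewrite addr_ge0// mulr_ge0// ltW.
  - move=> j; rewrite mulrDl mul1r; apply: lerD (XT j) _; rewrite ler_piMl// ltW//.
  - by move=> j k jk; apply: lerD (aX _ _ jk) _; rewrite ler_pM2l// p2_anti.
  move=> k _; have tp j : 0 < X j + e * p2 j by rewrite ltr_wpDl// mulr_gt0.
  have ht j : (tau g (2 ^ j) < (X j + e * p2 j)%:E)%E by rewrite XE lte_fin ltrDl mulr_gt0.
  have n1 : (1 <= rc * 2 ^ k)%N by rewrite muln_gt0 rc0 e1.
  have := le_trans (hc _ n1) (hK _ tp ht k _ (leqnn _)); rewrite -EFinM lee_fin.
  set Y := \sum_(j < _) _ => h.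
  have Y0 : 0 <= Y by apply: sumr_ge0 => j _; rewrite mulr_ge0 ?exprn_ge0// ltW.
  have : c / A * p k <= Num.sqrt (K * Y).
    apply: le_trans h; rewrite -mulrA ler_pM2l// mulrC ler_pdivrMr// mulrC; exact: pA.
  have cp0 : 0 <= c / A * p k by rewrite mulr_ge0 ?ltW// divr_gt0.
  rewrite -(@ler_pXn2r _ 2)// ?nnegrE ?sqrtr_ge0// sqr_sqrtr ?mulr_ge0 ?(ltW K0)//.
  by move=> H; rewrite /c1 mulrAC ler_pdivrMr// [Y * K]mulrC p2E -exprMn.
apply: (dyadic_lower aa0 bb0 (divr_gt0 c'0 (ltr0n _ 2))).
  by move=> n m; exact: tau_anti.
by move=> k; rewrite XE lee_fin; exact: H.
Qed.

Definition dominates (x : nat -> R) := (forall j, 0 < x j) /\ forall j, (s (2 ^ j) < (x j)%:E)%E.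

Section SmallExponent.
Hypothesis ha : a < 2^-1.

Let kap : R := (Num.sqrt 2)^-1.
Let kap0 : 0 <= kap. Proof. by rewrite invr_ge0 sqrtr_ge0. Qed.
Let kap1 : kap <= 1.
Proof. by rewrite invf_le1 ?sqrtr_gt0// -[leLHS]sqrtr1 ler_wsqrtr// ler1n. Qed.

Let kern : exists th D : R, [/\ 0 <= th < 1, 0 < D & forall j k, (j <= k)%N ->
  kap ^+ (k - j) * p j <= D * th ^+ (k - j) * p k].
Proof. by apply: (@prof_kernel _ _ _ 2^-1) => //; rewrite powRN powR12_sqrt. Qed.

Lemma upper_small (T : R) : 0 < T -> exists2 B, 0 < B & forall x, dominates x ->
  (forall j, x j <= T * p j) -> forall k (lam : R), 0 <= lam -> (lam%:E < tau g (2 ^ k))%E ->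
  lam <= B * p2 k.
Proof.
move=> T0; have [K K0 hK] := hs_ineq hg; have [th [D [th01 D0 hD]]] := kern.
pose T1 := T * D / (1 - th).
have T10 : 0 < T1 by have /andP[_ h] := th01; rewrite divr_gt0 ?mulr_gt0// subr_gt0.
exists (K * T1 ^+ 2); first by rewrite mulr_gt0// exprn_gt0.
move=> x [x0 hx] xT k lam l0 hl; apply: le_trans (hK x x0 hx k lam l0 hl) _.
rewrite p2E -mulrA -exprMn; apply: ler_wpM2l; first exact: ltW.
have h := kernel_fwd kap0 th01 (ltW D0) p0 hD k (ltW T0) xT.
rewrite ler_pXn2r// nnegrE; last by rewrite mulr_ge0// ltW.
by apply: sumr_ge0 => j _; rewrite mulr_ge0 ?exprn_ge0// ltW.
Qed.

Lemma lower_small (T c : R) : 0 < T -> 0 < c ->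
  (forall k, ((c * p2 k)%:E < tau g (2 ^ k))%E) ->
  exists2 c', 0 < c' & forall x, dominates x -> (forall j, x j <= T * p j) ->
  (forall j k, (j <= k)%N -> x k <= x j) -> forall k, c' * p k <= x k.
Proof.
move=> T0 cp hc; have [K K0 hK] := hs_ineq hg; have [th [D [th01 D0 hD]]] := kern.
pose c1 := Num.sqrt (c / K); have c10 : 0 < c1 by rewrite sqrtr_gt0 divr_gt0.
have [c' c'0 hc'] := kernel_rev_anti kap0 kap1 th01 (ltW D0) p0 hD 0%N (ltW T0) c10
  (@prof_step R a b b0).
exists c' => // x [x0 hx] xT ax; apply: hc' => // [j|k _]; first exact: ltW.
have l0 : 0 <= c * p2 k by rewrite mulr_ge0// ltW.
have := hK x x0 hx k _ l0 (hc k); rewrite -/kap; set Y := \sum_(j < _) _ => h.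
have Y0 : 0 <= Y by apply: sumr_ge0 => j _; rewrite mulr_ge0 ?exprn_ge0// ltW.
have cp0 : 0 <= c1 * p k by apply: mulr_ge0; exact: ltW.
rewrite -(@ler_pXn2r _ 2)// exprMn sqr_sqrtr; last by rewrite divr_ge0// ltW.
by rewrite -p2E mulrAC ler_pdivrMr// [Y ^+ 2 * _]mulrC.
Qed.

End SmallExponent.

Section LargeExponent.
Hypothesis ha : 2^-1 <= a.

(* This choice makes both [a * (2 * r) < 1] (half averages preserve the profile)
   and [1 - r - a * (2 * r) < 0] (the sums over descendants converge). *)
Let r : R := (2 * a + 2^-1)^-1.
Let q : R := 2 * r.
Let P k := prof (a * q) (b * q) (2 ^ k).
Let w0 : 0 < 2 * a + 2^-1. Proof. by rewrite ltr_wpDl// invr_gt0. Qed.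
Let r0 : 0 < r. Proof. by rewrite invr_gt0. Qed.
Let r1 : r <= 1. Proof. rewrite invf_le1//; move: ha; lra. Qed.
Let q0 : 0 < q. Proof. exact: mulr_gt0. Qed.
Let rw : r * (2 * a + 2^-1) = 1. Proof. by rewrite mulVf// gt_eqF. Qed.
Let aq1 : a * q < 1. Proof. move: rw r0; rewrite /q; lra. Qed.
Let neg : 1 - r - a * q < 0. Proof. move: rw r0; rewrite /q; lra. Qed.
Let bq0 : 0 <= b * q. Proof. by rewrite mulr_ge0// ltW. Qed.
Let aq0 : 0 <= a * q. Proof. by rewrite mulr_ge0// ltW. Qed.
Let P0 k : 0 < P k. Proof. exact: prof_gt0. Qed.
Let PE k : P k = p k `^ q. Proof. by rewrite /p prof_powR. Qed.
Let P2E k : P k = p2 k `^ r.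
Proof. by rewrite /p2 prof_powR// /P /q; congr (prof _ _ _); ring. Qed.
Let P_anti j k : (j <= k)%N -> P k <= P j.
Proof. by move=> jk; apply: prof_anti => //; rewrite leq_exp2l. Qed.

Let h0 : (0 : R) <= 2^-1. Proof. by rewrite invr_ge0. Qed.
Let h1 : (2^-1 : R) <= 1. Proof. by rewrite invf_le1// ler1n. Qed.
Let kern1 : exists th D : R, [/\ 0 <= th < 1, 0 < D & forall j k, (j <= k)%N ->
  2^-1 ^+ (k - j) * p j <= D * th ^+ (k - j) * p k].
Proof. by apply: (@prof_kernel _ _ _ 1) => //; rewrite powRN powRr1. Qed.
Let kernq : exists th D : R, [/\ 0 <= th < 1, 0 < D & forall j k, (j <= k)%N ->
  2^-1 ^+ (k - j) * P j <= D * th ^+ (k - j) * P k].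
Proof. by apply: (@prof_kernel _ _ _ 1) => //; rewrite powRN powRr1. Qed.

Let rho : R := 2 `^ (1 - r).
Let phi : R := 2 `^ (1 - r - a * q).
Let rho1 : 1 <= rho.
Proof. by rewrite -[leLHS](powRr0 2) ler_powR ?ler1n// subr_ge0. Qed.
Let phi01 : 0 <= phi < 1. Proof. by rewrite powR_ge0 pow2_lt1. Qed.
Let hP k t : rho ^+ t * P (k + t)%N <= phi ^+ t * P k.
Proof.
have t0 : 0 <= rho ^+ t by rewrite exprn_ge0// powR_ge0.
apply: le_trans (ler_wpM2l t0 (prof_dyadic_decay (a * q) k t bq0)) _.
rewrite mulrA -exprMn /phi powRD//; by rewrite pnatr_eq0 implybT.
Qed.

Let z (K : R) (x : nat -> R) i : R := (K * half_average x i) `^ q.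

Let z_ge0 K x i : 0 <= z K x i. Proof. exact: powR_ge0. Qed.

(** Half averages preserve p because a < 1, the power q turns p into P, and half averages preserve P
    because a q < 1. *)
Let averages (K T : R) : 0 < K -> 0 < T -> exists T1 T2 T3 : R, [/\ 0 < T1, 0 < T2, 0 < T3 &
  forall x, (forall j, 0 <= x j) -> (forall j, x j <= T * p j) ->
  [/\ forall j, half_average x j <= T1 * p j, forall j, z K x j <= T2 * P j &
      forall j, half_average (z K x) j <= T3 * P j]].
Proof.
move=> K0 T0; have [th [D [th01 D0 hD]]] := kern1; have [th' [D' [th01' D0' hD']]] := kernq.
pose T1 := T * D / (1 - th).
have T10 : 0 < T1 by have /andP[_ h] := th01; rewrite divr_gt0 ?mulr_gt0// subr_gt0.
pose T2 := (K * T1) `^ q; have T20 : 0 < T2 by rewrite powR_gt0// mulr_gt0.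
pose T3 := T2 * D' / (1 - th').
have T30 : 0 < T3 by have /andP[_ h] := th01'; rewrite divr_gt0 ?mulr_gt0// subr_gt0.
exists T1, T2, T3; split=> // x x0 xT.
have H1 j : half_average x j <= T1 * p j.
  exact: (kernel_fwd h0 th01 (ltW D0) p0 hD j (ltW T0) xT).
have H2 j : z K x j <= T2 * P j.
  rewrite PE -powRM ?(ltW (p0 j))//; last by rewrite mulr_ge0// ltW.
  have y0 := half_average_ge0 j x0; have k0 := ltW K0.
  apply: ge0_ler_powR; rewrite ?nnegrE ?(ltW q0)//; first exact: mulr_ge0.
    apply: mulr_ge0 (ltW (p0 j)); exact: mulr_ge0 k0 (ltW T10).
  by rewrite -mulrA; apply: ler_wpM2l.
by split=> // j; exact: (kernel_fwd h0 th01' (ltW D0') P0 hD' j (ltW T20) H2).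
Qed.

Let r01 : 0 < r <= 1. Proof. by rewrite r0. Qed.

(** [tail_fwd] bounds the r-th power of lam / tc by a multiple of P = p2^r; the root of order r is
    taken at the end. *)
Lemma upper_large (T : R) : 0 < T -> exists2 B, 0 < B & forall x, dominates x ->
  (forall j, x j <= T * p j) -> forall k (lam : R), 0 <= lam -> (lam%:E < tau g (2 ^ k))%E ->
  lam <= B * p2 k.
Proof.
move=> T0; have [K K0 hK] := layer_ineq hg r01.
have [T1 [T2 [T3 [T10 T20 T30 hT]]]] := averages K0 T0.
pose T4 := 2 * (T3 / (1 - phi)).
have T40 : 0 < T4 by have /andP[_ h] := phi01; rewrite mulr_gt0// divr_gt0// subr_gt0.
exists (tc * T4 `^ r^-1); first by rewrite mulr_gt0// powR_gt0.
move=> x [x0 hx] xT k lam l0 hl; have [d hd] := hK x x0 hx k lam l0 hl.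
have [_ _ H3] := hT x (fun j => ltW (x0 j)) xT.
have h := tail_fwd rho1 phi01 P0 hP k d (ltW T30) H3.
rewrite -mulrA -ler_pdivrMl// mulrC; apply: (powR_le_inv r0).
- by rewrite divr_ge0// ltW.
- by rewrite mulr_ge0 ?powR_ge0// ltW.
apply: le_trans hd _; rewrite powRM ?powR_ge0 ?(ltW (p20 k))// -powRrM mulVf ?gt_eqF//.
by rewrite powRr1 ?(ltW T40)// -P2E -mulrA; apply: ler_wpM2l.
Qed.

(** The operations of [layer_ineq] are undone from the outside: [tail_rev] for the sum over
    generations, [kernel_rev_slow] for the outer half average, and, after the root of order q,
    [kernel_rev_anti] for the inner one. *)
Lemma lower_large (T c : R) : 0 < T -> 0 < c ->
  (forall k, ((c * p2 k)%:E < tau g (2 ^ k))%E) ->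
  exists2 c', 0 < c' & forall x, dominates x -> (forall j, x j <= T * p j) ->
  (forall j k, (j <= k)%N -> x k <= x j) -> forall k, c' * p k <= x k.
Proof.
move=> T0 cp hc; have [K K0 hK] := layer_ineq hg r01.
have [T1 [T2 [T3 [T10 T20 T30 hT]]]] := averages K0 T0.
have [th [D [th01 D0 hD]]] := kern1; have [th' [D' [th01' D0' hD']]] := kernq.
pose c1 := (c / tc) `^ r / 2; have c10 : 0 < c1 by rewrite divr_gt0// powR_gt0// divr_gt0.
have [L [c2 c20 hc2]] := tail_rev rho1 phi01 P0 hP (ltW T30) c10 P_anti.
have A1 : 1 <= 2 `^ q :> R by rewrite -[leLHS](powRr0 2) ler_powR ?ler1n// ltW.
have [M [c3 c30 hc3]] := kernel_rev_slow h0 h1 th01' (ltW D0') P0 hD' L (ltW T20) c20 A1.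
pose c4 := c3 `^ q^-1 / K; have c40 : 0 < c4 by rewrite divr_gt0// powR_gt0.
have [c' c'0 hc'] := kernel_rev_anti h0 h1 th01 (ltW D0) p0 hD M (ltW T0) c40
  (@prof_step R a b b0).
exists c' => // x [x0 hx] xT ax; have x0' j := ltW (x0 j); have [H1 H2 H3] := hT x x0' xT.
have y0 j : 0 <= half_average x j by exact: half_average_ge0.
have y2 j : half_average x j <= 2 * half_average x j.+1.
  by rewrite half_averageS; have := x0 j.+1; lra.
have Z2 j : half_average (z K x) j <= 2 * half_average (z K x) j.+1.
  by rewrite half_averageS; have := z_ge0 K x j.+1; lra.
have z2 j : z K x j <= 2 `^ q * z K x j.+1.
  have k0 := ltW K0; rewrite /z -powRM//; last exact: mulr_ge0.
  apply: ge0_ler_powR; rewrite ?nnegrE ?(ltW q0)//; [exact: mulr_ge0|by rewrite !mulr_ge0|].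
  by rewrite mulrCA; apply: ler_wpM2l.
have tail k : exists d, c1 * P k <= \sum_(t < d) rho ^+ t * half_average (z K x) (k + t)%N.
  have l0 : 0 <= c * p2 k by rewrite mulr_ge0// ltW.
  have [d hd] := hK x x0 hx k _ l0 (hc k); exists d.
  move: hd; rewrite mulrAC powRM ?(ltW (p20 k))//; last by rewrite divr_ge0// ltW.
  by rewrite -P2E /c1 mulrAC ler_pdivrMr// [_ * 2]mulrC.
have HZ := hc2 _ (fun j => half_average_ge0 j (z_ge0 K x)) H3 Z2 tail.
have Hz := hc3 _ (z_ge0 K x) H2 z2 HZ.
apply: hc' => // k Mk; have := Hz k Mk; rewrite PE => h.
rewrite /c4 mulrAC ler_pdivrMr// [leRHS]mulrC; apply: (powR_le_inv q0).
- exact: mulr_ge0 (powR_ge0 _ _) (ltW (p0 k)).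
- exact: mulr_ge0 (ltW K0) (y0 k).
by rewrite powRM ?powR_ge0 ?(ltW (p0 k))// -powRrM mulVf ?gt_eqF// powRr1 ?(ltW c30).
Qed.

End LargeExponent.

Lemma upper_tau (T : R) : 0 < T ->
  (forall n, (1 <= n)%N -> (s n <= T%:E * (prof a b n)%:E)%E) ->
  exists2 K : R, 0 < K & forall n, (1 <= n)%N -> (tau g n <= K%:E * (prof (2 * a) (2 * b) n)%:E)%E.
Proof.
move=> T0 hT; have T1 : 0 < T + 1 by rewrite addr_gt0.
have hx : dominates (fun j => (T + 1) * p j).
  split=> j; first exact: mulr_gt0.
  by apply: le_lt_trans (hT _ (e1 j)) _; rewrite -EFinM lte_fin (ltr_pM2r (p0 j)) ltrDl.
have [B B0 hB] : exists2 B, 0 < B & forall k (lam : R), 0 <= lam ->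
    (lam%:E < tau g (2 ^ k))%E -> lam <= B * p2 k.
  have [ha|ha] := ltP a 2^-1.
    have [B B0 hB] := upper_small ha T1; exists B => //; exact: (hB _ hx).
  have [B B0 hB] := upper_large ha T1; exists B => //; exact: (hB _ hx).
have H k : (tau g (2 ^ k) <= (2 * (B * p2 k))%:E)%E.
  by apply: lee_of_lt; [exact: mulr_gt0|exact: hB].
have B2 : 0 <= 2 * B by rewrite mulr_ge0// ltW.
apply: (dyadic_upper aa0 bb0 (ltn0Sn 0) B2).
- by move=> n m; exact: tau_anti.
- by apply: le_lt_trans (H 0%N) _; exact: ltry.
- by move=> n; exact: tau_ge0.
- by move=> k; rewrite mul1n -mulrA; exact: H.
Qed.

Lemma lower_s (T c : R) : 0 < T -> 0 < c ->
  (forall n, (1 <= n)%N -> (s n <= T%:E * (prof a b n)%:E)%E) ->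
  (forall n, (1 <= n)%N -> (c%:E * (prof (2 * a) (2 * b) n)%:E <= tau g n)%E) ->
  exists2 c' : R, 0 < c' & forall n, (1 <= n)%N -> (c'%:E * (prof a b n)%:E <= s n)%E.
Proof.
move=> T0 cp hT hc; have T1 : 0 < T + 1 by rewrite addr_gt0.
pose X k := fine (s (2 ^ k)).
have XE k : s (2 ^ k) = (X k)%:E.
  rewrite fineK// ge0_fin_numE ?singular_value_ge0//; apply: le_lt_trans (hT _ (e1 k)) _.
  by rewrite -EFinM ltry.
have X0 k : 0 <= X k by apply: fine_ge0; exact: singular_value_ge0.
have XT k : X k <= T * p k by rewrite -lee_fin -XE EFinM; exact: hT.
have aX j k : (j <= k)%N -> X k <= X j.
  by move=> jk; rewrite -lee_fin -!XE; apply: singular_value_anti; rewrite leq_exp2l.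
have c2 : 0 < c / 2 by rewrite divr_gt0.
have hc2 k : (((c / 2) * p2 k)%:E < tau g (2 ^ k))%E.
  apply: lt_le_trans (hc _ (e1 k)); rewrite -EFinM lte_fin (ltr_pM2r (p20 k)); lra.
have [c' c'0 hc'] : exists2 c', 0 < c' & forall x, dominates x ->
    (forall j, x j <= (T + 1) * p j) ->
    (forall j k, (j <= k)%N -> x k <= x j) -> forall k, c' * p k <= x k.
  by have [ha|ha] := ltP a 2^-1; [exact: lower_small hc2|exact: lower_large hc2].
have H : forall k, c' / 2 * p k <= X k.
  apply: (remove_slack c'0 p0) => e /andP[ep e1'].
  apply: (hc' (fun k => X k + e * p k)).
  - split=> j; first by rewrite ltr_wpDl// mulr_gt0.
    by rewrite XE lte_fin ltrDl mulr_gt0.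
  - move=> j; rewrite mulrDl mul1r; apply: lerD (XT j) _.
    by rewrite ler_piMl// ltW.
  - by move=> j k jk; apply: lerD (aX _ _ jk) _; rewrite ler_pM2l// p_anti.
apply: (dyadic_lower a0 b0 (divr_gt0 c'0 (ltr0n _ 2))).
  by move=> n m; exact: singular_value_anti.
by move=> k; rewrite XE lee_fin; exact: H.
Qed.

End Equivalence.

Theorem corollary1p2 (R : realType) (g : R[i] -> R[i]) (hg : vmoa g)
  (alpha beta : R) (halpha : 0 <= alpha < 1) (hbeta : 0 <= beta)
  (hab : 0 < alpha \/ 0 < beta) :
  asymp (singular_value (integration_op g))
        (fun n : nat => (1 / (n%:R `^ alpha * ln (n.+1%:R) `^ beta))%:E)
  <->
  asymp (tau g)
        (fun n : nat =>
           (1 / (n%:R `^ (2 * alpha) * ln (n.+1%:R) `^ (2 * beta)))%:E).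
Proof.
have [a0 a1] := andP halpha; have hh := hg.1.
split=> -[c [K [c0 K0 h]]].
- have [K' K'0 hK'] := upper_tau hh a0 a1 hbeta K0 (fun n n1 => (h n n1).2).
  have [c' c'0 hc'] := lower_tau hh a0 a1 hbeta K'0 c0 hK' (fun n n1 => (h n n1).1).
  by exists c', K'; split=> // n n1; split; [exact: hc'|exact: hK'].
- have [K' K'0 hK'] := upper_s hh a0 a1 hbeta K0 (fun n n1 => (h n n1).2).
  have [c' c'0 hc'] := lower_s hh a0 a1 hbeta K'0 c0 hK' (fun n n1 => (h n n1).1).
  by exists c', K'; split=> // n n1; split; [exact: hc'|exact: hK'].
Qed.
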